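(* Let $M$ be an even positive integer and let $f:\mathbb{Z}\to\mathbb{C}$ be an $M$-periodic function with $f(0)=0$. Assume that either $\nu=0$ and $f$ is odd, or $\nu=1$ and $f$ is even. Let $\Gamma$ be the congruence subgroup defined in the context, let $\overline{\mathscr{Q}}_{f,M}=\{\alpha\in\mathbb{Q}\mid\langle f_{\alpha/M}\rangle=0\}$, and let $\Theta^{\mathrm{nt}}=\Theta^{\mathrm{nt}}(\cdot\,;\nu,f,M):\overline{\mathscr{Q}}_{f,M}\cup\{i\infty\}\to\mathbb{C}$ be the boundary function of the partial theta series $\Theta(\tau;\nu,f,M)=\sum_{n\ge1}n^\nu f(n)e^{i\pi n^2\tau/M}$. If $f$ is even, then the domain of definition $\overline{\mathscr{Q}}_{f,M}\cup\{i\infty\}$ of $\Theta^{\mathrm{nt}}$ is stable under $\Gamma$: it is a union of cusps of $\Gamma$, which contains at least the cusp at infinity, and also the cusp at $0$ if $\langle f\rangle=0$. If $f$ is odd, then $\overline{\mathscr{Q}}_{f,M}=\mathbb{Q}$. In all cases, the function $\Theta^{\mathrm{nt}}:\overline{\mathscr{Q}}_{f,M}\cup\{i\infty\}\to\mathbb{C}$ is a quantum modular form with respect to $\Gamma$, of weight $\frac12$ if $\nu=0$ and $f$ is odd, of weight $\frac32$ if $\nu=1$ and $f$ is even.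
   Context: The mean value $\langle g\rangle$ of a periodic function $g$ on $\mathbb{Z}$ is its average over a period, and $f_\beta(n):=f(n)e^{i\pi n^2\beta}$ for $\beta\in\mathbb{Q}$ (a periodic function). Boundary function: for $\alpha\in\overline{\mathscr{Q}}_{f,M}$, $\Theta^{\mathrm{nt}}(\alpha)$ is the limit of $\Theta(\tau;\nu,f,M)$ as $\tau\to\alpha$ non-tangentially in the upper half-plane $\mathbb{H}$ (i.e. uniformly in every sector $\varepsilon<\arg(\tau-\alpha)<\pi-\varepsilon$); it exists and equals $L(-\nu,f_{\alpha/M})$, where $L(s,g)$ is the analytic continuation of $\sum_{n\ge1}g(n)n^{-s}$. Moreover $\Theta^{\mathrm{nt}}(i\infty)=\lim_{\operatorname{Im}\tau\to+\infty}\Theta(\tau;\nu,f,M)=0$. The subgroup $\Gamma\subset\mathrm{SL}(2,\mathbb{Z})$, with elements $\gamma=\begin{pmatrix}a&b\\c&d\end{pmatrix}$, is any of the following: - $\Gamma:=\Gamma(2M)=\{a\equiv d\equiv1,\ b\equiv c\equiv0\bmod 2M\}$ (always allowed); - $\Gamma:=\Gamma_1(2M)=\{a\equiv d\equiv1,\ c\equiv0\bmod 2M\}$, if there exists $n_0\in\mathbb{Z}$ such that for all $n\in\mathbb{Z}$, $f(n)\ne0\Rightarrow n^2\equiv n_0^2\bmod 2M$; - $\Gamma:=\Gamma_0^0(2M)=\{b\equiv c\equiv0\bmod 2M\}$, if $f$ is a Dirichlet character modulo $M$. $\Gamma$ acts on $\mathbb{Q}\cup\{i\infty\}$ by $\gamma(\alpha)=\frac{a\alpha+b}{c\alpha+d}$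 with the usual conventions; a cusp of $\Gamma$ means a $\Gamma$-orbit in $\mathbb{Q}\cup\{i\infty\}$; the cusp at infinity (resp. at $0$) is the orbit of $i\infty$ (resp. of $0$). Quantum modular form (in the sense of Zagier, with multiplier): a function $\Phi:\mathcal{D}\to\mathbb{C}$ on a $\Gamma$-stable subset $\mathcal{D}\subset\mathbb{Q}\cup\{i\infty\}$ is a quantum modular form of weight $k\in\frac12\mathbb{Z}$ with respect to $\Gamma$ if for every $\gamma\in\Gamma$, written up to replacing $\gamma$ by $-\gamma$ with $c>0$, or with $c=0$ and $d=1$, there is a complex number $\chi(\gamma)$ of modulus $1$ such that the function $$\alpha\in\mathcal{D}\cap\mathbb{Q},\ c\alpha+d\ne0\ \longmapsto\ \Phi(\alpha)-\chi(\gamma)\,(c\alpha+d)^{-k}\,\Phi\big(\gamma(\alpha)\big)$$ (with $\arg(c\alpha+d)\in\{0,-\pi\}$) is the restriction of a function that is real-analytic on $\mathbb{R}\setminus\{\gamma^{-1}(i\infty)\}$ if $c>0$, and is identically $0$ if $c=0$. *)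

(* Defs.v *)
(* Stdlib reals and Coquelicot's complex numbers. *)
From Stdlib Require Import Reals ZArith QArith Qcanon Qreals.
From Coquelicot Require Import Coquelicot.

Local Open Scope C_scope.

(** * Complex analysis *)

Definition Cexp (z : C) : C :=
  (exp (Re z) * cos (Im z), exp (Re z) * sin (Im z))%R.

(* Sum of a convergent complex series; unspecified when the series diverges. *)
Definition CSeries (a : nat -> C) : C :=
  (Series (fun n => Re (a n)), Series (fun n => Im (a n))).

(* Limit of [h] along the filter [F]; unspecified when there is none. *)
Definition Clim (F : (C -> Prop) -> Prop) (h : C -> C) : C :=
  iota (T := C_CompleteNormedModule)
    (fun l : C => filterlim h F (locally (T := C_UniformSpace) l)).

Definition sector (eps : R) (a tau : C) : Prop :=
  exists r theta : R,
    (0 < r)%R /\ (eps < theta < PI - eps)%R /\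
    tau - a = RtoC r * Cexp (Ci * RtoC theta).

(* [P] holds eventually in each sector at [a], so that convergence along this
   filter is convergence uniformly in every sector. *)
Definition nontangential (a : C) (P : C -> Prop) : Prop :=
  forall eps : R, (0 < eps)%R ->
    within (sector eps a) (locally (T := C_UniformSpace) a) P.

Definition at_i_infinity (P : C -> Prop) : Prop :=
  exists B : R, forall tau : C, (B < Im tau)%R -> P tau.

(* [U] is meant to be open. *)
Definition real_analytic_on (U : R -> Prop) (F : R -> C) : Prop :=
  forall x0 : R, U x0 ->
    exists (a : nat -> C) (r : R), (0 < r)%R /\
      forall x : R, (Rabs (x - x0) < r)%R ->
        is_pseries (K := R_AbsRing) (V := C_R_NormedModule)
          a (x - x0)%R (F x).

(** * Periodic functions on Z *)

Definition periodic (N : Z) (g : Z -> C) : Prop :=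
  forall n : Z, g (n + N)%Z = g n.

Definition is_even (g : Z -> C) : Prop := forall n : Z, g (- n)%Z = g n.

Definition is_odd (g : Z -> C) : Prop := forall n : Z, g (- n)%Z = - g n.

(* [m] is the average of [g] over a period; it does not depend on the period
   chosen. *)
Definition is_mean (g : Z -> C) (m : C) : Prop :=
  exists N : nat, (0 < N)%nat /\ periodic (Z.of_nat N) g /\
    m = sum_n_m (G := C_AbelianMonoid) (fun k => g (Z.of_nat k)) 1 N
        / RtoC (INR N).

Definition twist (g : Z -> C) (beta : R) (n : Z) : C :=
  g n * Cexp (Ci * RtoC (PI * IZR n ^ 2 * beta)).

Definition dirichlet_character (M : Z) (g : Z -> C) : Prop :=
  periodic M g /\ g 1%Z = RtoC 1 /\
  (forall m n : Z, g (m * n)%Z = g m * g n) /\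
  (forall n : Z, g n <> RtoC 0 <-> Z.gcd n M = 1%Z).

(** * SL(2,Z) and its action on the cusps *)

Record SL2Z := mkSL2Z {
  ga : Z; gb : Z; gc : Z; gd : Z;
  gdet : (ga * gd - gb * gc = 1)%Z
}.

Lemma SL2Z_opp_det (g : SL2Z) :
  (- ga g * - gd g - - gb g * - gc g = 1)%Z.
Proof. now rewrite !Z.mul_opp_opp, gdet. Qed.

Definition SL2Z_opp (g : SL2Z) : SL2Z :=
  mkSL2Z (- ga g) (- gb g) (- gc g) (- gd g) (SL2Z_opp_det g).

Definition congr (N x y : Z) : Prop := (N | x - y)%Z.

Definition Gamma_principal (N : Z) (g : SL2Z) : Prop :=
  congr N (ga g) 1 /\ congr N (gd g) 1 /\
  congr N (gb g) 0 /\ congr N (gc g) 0.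

Definition Gamma_1 (N : Z) (g : SL2Z) : Prop :=
  congr N (ga g) 1 /\ congr N (gd g) 1 /\ congr N (gc g) 0.

Definition Gamma_0_0 (N : Z) (g : SL2Z) : Prop :=
  congr N (gb g) 0 /\ congr N (gc g) 0.

Inductive allowed_group (M : Z) (f : Z -> C) : (SL2Z -> Prop) -> Prop :=
| allowed_principal : allowed_group M f (Gamma_principal (2 * M))
| allowed_Gamma_1 :
    (exists n0 : Z, forall n : Z,
       f n <> RtoC 0 -> congr (2 * M) (n ^ 2) (n0 ^ 2)) ->
    allowed_group M f (Gamma_1 (2 * M))
| allowed_Gamma_0_0 :
    dirichlet_character M f -> allowed_group M f (Gamma_0_0 (2 * M)).

(* The set of all rational numbers together with [None], the point i*oo. *)
Definition P1Q : Type := option Qc.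

Definition Z2Qc (n : Z) : Qc := Q2Qc (inject_Z n).

Definition Qc2R (q : Qc) : R := Q2R (this q).

Definition act (g : SL2Z) (x : P1Q) : P1Q :=
  match x with
  | None =>
      if Z.eq_dec (gc g) 0 then None
      else Some (Z2Qc (ga g) / Z2Qc (gc g))%Qc
  | Some q =>
      let den := (Z2Qc (gc g) * q + Z2Qc (gd g))%Qc in
      if Qc_eq_dec den (Z2Qc 0) then None
      else Some ((Z2Qc (ga g) * q + Z2Qc (gb g)) / den)%Qc
  end.

Definition orbit (G : SL2Z -> Prop) (x y : P1Q) : Prop :=
  exists g : SL2Z, G g /\ act g x = y.

Definition is_cusp (G : SL2Z -> Prop) (o : P1Q -> Prop) : Prop :=
  exists x : P1Q, forall y : P1Q, o y <-> orbit G x y.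

Definition union_of_cusps (G : SL2Z -> Prop) (D : P1Q -> Prop) : Prop :=
  exists S : (P1Q -> Prop) -> Prop,
    (forall o, S o -> is_cusp G o) /\
    (forall x, D x <-> exists o, S o /\ o x).

Definition stable (G : SL2Z -> Prop) (D : P1Q -> Prop) : Prop :=
  forall (g : SL2Z) (x : P1Q), G g -> D x -> D (act g x).

(** * Quantum modular forms *)

(* x ^ s for real x <> 0, with arg x = - PI when x < 0. *)
Definition real_cpow (x s : R) : C :=
  let arg := if Rlt_dec x 0 then (- PI)%R else 0%R in
  RtoC (Rpower (Rabs x) s) * Cexp (Ci * RtoC (s * arg)).

Definition automorphy (g : SL2Z) (x : R) : R :=
  (IZR (gc g) * x + IZR (gd g))%R.

Definition modular_defect (k : R) (chi : C) (Phi : P1Q -> C) (g : SL2Z)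
    (q : Qc) : C :=
  Phi (Some q)
  - chi * real_cpow (automorphy g (Qc2R q)) (- k) * Phi (act g (Some q)).

(* Only the values of [Phi] on [D] matter. The normalised [g] below is plus or
   minus an element of [G], and - gd g / gc g is the point g^-1(i*oo). *)
Definition quantum_modular_form (G : SL2Z -> Prop) (k : R)
    (D : P1Q -> Prop) (Phi : P1Q -> C) : Prop :=
  (exists m : Z, k = (IZR m / 2)%R) /\
  stable G D /\
  forall g : SL2Z,
    G g \/ G (SL2Z_opp g) ->
    (0 < gc g)%Z \/ (gc g = 0%Z /\ gd g = 1%Z) ->
    exists chi : C, Cmod chi = 1%R /\
      ((0 < gc g)%Z ->
        exists F : R -> C,
          real_analytic_on
            (fun x => x <> (- IZR (gd g) / IZR (gc g))%R) F /\
          forall q : Qc, D (Some q) -> automorphy g (Qc2R q) <> 0%R ->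
            modular_defect k chi Phi g q = F (Qc2R q)) /\
      (gc g = 0%Z ->
        forall q : Qc, D (Some q) -> automorphy g (Qc2R q) <> 0%R ->
          modular_defect k chi Phi g q = RtoC 0).

(** * Partial theta series *)

Definition Theta (nu : nat) (f : Z -> C) (M : Z) (tau : C) : C :=
  CSeries (fun j =>
    let n := S j in
    RtoC (INR n ^ nu) * f (Z.of_nat n)
    * Cexp (Ci * RtoC (PI * INR n ^ 2) * tau / RtoC (IZR M))).

Definition Qbar (f : Z -> C) (M : Z) (alpha : Qc) : Prop :=
  is_mean (twist f (Qc2R alpha / IZR M)) (RtoC 0).

Definition Theta_nt_domain (f : Z -> C) (M : Z) (x : P1Q) : Prop :=
  match x with
  | None => True
  | Some alpha => Qbar f M alpha
  end.

Definition Theta_nt (nu : nat) (f : Z -> C) (M : Z) (x : P1Q) : C :=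
  match x with
  | None => Clim at_i_infinity (Theta nu f M)
  | Some alpha => Clim (nontangential (RtoC (Qc2R alpha))) (Theta nu f M)
  end.

(* Main.v *)
(** Write [N = c M], [w = c tau + d] and [g(n) = f(n) exp(- i pi d n^2 / N)], so that
    [Theta(tau; f, M) = Theta(w; g, N)]. Completing the square in a Gauss sum shows that the discrete
    Fourier transform of [g] is a unimodular multiple of [f(n) exp(i pi a n^2 / N)], and hence
    [Theta(- 1 / w; dft g, N)] the same multiple of [Theta(gamma tau; f, M)]. Poisson summation on the
    half-line turns [Theta(w; g, N)] into a multiple of [w^(- nu - 1/2) Theta(- 1 / w; dft g, N)] plus
    the integral over [y > 0] of [y^nu exp(- pi w y^2 / N)] against a bounded kernel, obtained by
    rotating the contour by [pi / 4] away from the poles. For [Re w > 0] this integral is analytic up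
    to and across the real axis; for [Re w < 0] one conjugates. Letting [tau] tend vertically to a
    rational number gives the transformation law of the boundary values. When [f] is even, stability
    of the domain follows from the same formula, because the theta series is unbounded on the vertical
    line over a rational at which the mean does not vanish. *)
Require Import Defs.
From Stdlib Require Import Reals ZArith QArith Qcanon Qreals Lra Lia Psatz ssreflect.
From Coquelicot Require Import Coquelicot.
Unset SsrRewrite.
Local Open Scope C_scope.

(** Only one sign of the frequency survives the rotation: on the rotated ray [exp (i b z)] decays
    for [b > 0] and grows for [b < 0], while the weight [exp (- s z^2)] becomes [exp (- i s y^2)],
    which still decays when [w] is a positive real number. Parity therefore trades each negative
    frequency for the opposite positive one and a Gaussian integral over the whole line; these
    Gaussians assemble into the theta series at [- 1 / w], and the rotated terms into the kernel
    integral. Two zeros make this work. [g 0 = 0] gives the transform mean zero, which removes the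
    pole of the kernel at the origin; [dft N g 0 = 0] removes frequency zero, and it holds because
    the transform is a multiple of a twist of [f] with [f 0 = 0]. The formula yields a limit over
    [q] from the mere existence of the boundary value at [gamma q]. Hence the domain is first seen
    to be closed under taking preimages, and stability follows by using the inverse matrix.
    Existence of the boundary values is a separate matter: three Abel summations are made, because
    for [nu = 1] the second differences of the terms have absolute sums that stay bounded without
    tending to zero. *)

Lemma exp_le (x y : R) : (x <= y)%R -> (exp x <= exp y)%R.
Proof. intros [H| ->]; [left; now apply exp_increasing|lra]. Qed.

Lemma exp_mult_INR (n : nat) (x : R) : (exp (x * INR n) = exp x ^ n)%R.
Proof.
  induction n as [|n IH]; [simpl; rewrite Rmult_0_r; apply exp_0|].
  rewrite S_INR, Rmult_plus_distr_l, exp_plus, IH, Rmult_1_r. simpl. ring.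
Qed.

(** * The complex exponential and roots of unity *)

Lemma C_ext (z w : C) : Re z = Re w -> Im z = Im w -> z = w.
Proof. destruct z, w; simpl; intros; subst; reflexivity. Qed.

Lemma Cexp_plus (z w : C) : Cexp (z + w) = Cexp z * Cexp w.
Proof.
  apply C_ext; destruct z as [a b], w as [c d]; unfold Cexp, Re, Im; simpl.
  - rewrite exp_plus, cos_plus; ring.
  - rewrite exp_plus, sin_plus; ring.
Qed.

Lemma Cexp_0 : Cexp 0 = 1.
Proof. unfold Cexp; simpl. rewrite exp_0, cos_0, sin_0. apply C_ext; simpl; ring. Qed.

Lemma Cmod_Cexp (z : C) : Cmod (Cexp z) = exp (Re z).
Proof.
  unfold Cmod, Cexp; simpl.
  replace (_ + _)%R with (Rsqr (exp (Re z))).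
  - apply sqrt_Rsqr. left; apply exp_pos.
  - generalize (sin2_cos2 (Im z)). unfold Rsqr. intros H.
    transitivity (exp (Re z) * exp (Re z) * (sin (Im z) * sin (Im z) + cos (Im z) * cos (Im z)))%R;
    [rewrite H|]; ring.
Qed.

Lemma Cexp_neq_0 (z : C) : Cexp z <> 0.
Proof.
  intros H. generalize (Cmod_Cexp z). rewrite H, Cmod_0.
  generalize (exp_pos (Re z)). lra.
Qed.

Lemma Cexp_opp (z : C) : Cexp (- z) = / Cexp z.
Proof.
  assert (H : Cexp (- z) * Cexp z = 1).
  { rewrite <- Cexp_plus, Cplus_comm, Cplus_opp_r. apply Cexp_0. }
  rewrite <- (Cmult_1_l (/ Cexp z)), <- H. field. apply Cexp_neq_0.
Qed.

Lemma Cexp_pow (z : C) (n : nat) : (Cexp z ^ n)%C = Cexp (RtoC (INR n) * z).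
Proof.
  induction n as [|n IH].
  - simpl. replace (0 * z)%C with (RtoC 0) by ring. now rewrite Cexp_0.
  - rewrite S_INR, RtoC_plus. simpl. rewrite IH, <- Cexp_plus. f_equal. ring.
Qed.

Lemma Cexp_RtoC (x : R) : Cexp (RtoC x) = RtoC (exp x).
Proof. unfold Cexp, RtoC; simpl. rewrite cos_0, sin_0. apply C_ext; simpl; ring. Qed.

Lemma Cexp_Ci (x : R) : Cexp (Ci * RtoC x) = (cos x, sin x).
Proof.
  unfold Cexp, Ci, RtoC, Re, Im; simpl.
  replace (0 * x - 1 * 0)%R with 0%R by ring.
  replace (0 * 0 + 1 * x)%R with x by ring. rewrite exp_0. apply C_ext; simpl; ring.
Qed.

Lemma Cmod_Cexp_Ci (x : R) : Cmod (Cexp (Ci * RtoC x)) = 1%R.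
Proof.
  rewrite Cmod_Cexp. unfold Ci, RtoC, Re; simpl.
  replace (0 * x - 1 * 0)%R with 0%R by ring. apply exp_0.
Qed.

Lemma cos_2kPI (k : Z) : cos (2 * PI * IZR k) = 1%R.
Proof.
  assert (P : forall n : nat, cos (2 * PI * INR n) = 1%R).
  { intros n. replace (2 * PI * INR n)%R with (0 + 2 * INR n * PI)%R by ring.
    rewrite cos_period. apply cos_0. }
  destruct (Z_le_gt_dec 0 k) as [H|H].
  - rewrite <- (Z2Nat.id k H), <- INR_IZR_INZ. apply P.
  - replace k with (- Z.of_nat (Z.to_nat (- k)))%Z by lia.
    rewrite opp_IZR, <- INR_IZR_INZ.
    replace (2 * PI * - INR (Z.to_nat (- k)))%R with (- (2 * PI * INR (Z.to_nat (- k))))%R by ring.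
    rewrite cos_neg. apply P.
Qed.

Lemma sin_2kPI (k : Z) : sin (2 * PI * IZR k) = 0%R.
Proof.
  assert (P : forall n : nat, sin (2 * PI * INR n) = 0%R).
  { intros n. replace (2 * PI * INR n)%R with (0 + 2 * INR n * PI)%R by ring.
    rewrite sin_period. apply sin_0. }
  destruct (Z_le_gt_dec 0 k) as [H|H].
  - rewrite <- (Z2Nat.id k H), <- INR_IZR_INZ. apply P.
  - replace k with (- Z.of_nat (Z.to_nat (- k)))%Z by lia.
    rewrite opp_IZR, <- INR_IZR_INZ.
    replace (2 * PI * - INR (Z.to_nat (- k)))%R with (- (2 * PI * INR (Z.to_nat (- k))))%R by ring.
    rewrite sin_neg, P. ring.
Qed.

Lemma Cexp_2kPI (k : Z) : Cexp (Ci * RtoC (2 * PI * IZR k)) = 1.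
Proof. rewrite Cexp_Ci, cos_2kPI, sin_2kPI. reflexivity. Qed.

Definition Cunit (t : R) : C := Cexp (Ci * RtoC (2 * PI * t)).

Lemma Cunit_plus (s t : R) : Cunit (s + t) = Cunit s * Cunit t.
Proof.
  unfold Cunit. rewrite <- Cexp_plus. f_equal.
  rewrite <- Cmult_plus_distr_l, <- RtoC_plus. do 2 f_equal. ring.
Qed.

Lemma Cunit_Z (k : Z) : Cunit (IZR k) = 1.
Proof. apply Cexp_2kPI. Qed.

Lemma Cunit_0 : Cunit 0 = 1.
Proof. apply (Cunit_Z 0). Qed.

Lemma Cmod_Cunit (t : R) : Cmod (Cunit t) = 1%R.
Proof. apply Cmod_Cexp_Ci. Qed.

Lemma Cunit_neq_0 (t : R) : Cunit t <> 0.
Proof. apply Cexp_neq_0. Qed.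

Lemma Cunit_opp (t : R) : Cunit (- t) = / Cunit t.
Proof.
  unfold Cunit. rewrite <- Cexp_opp. f_equal.
  apply C_ext; simpl; ring.
Qed.

Lemma Cunit_mod1 (s t : R) (k : Z) : (s - t)%R = IZR k -> Cunit s = Cunit t.
Proof.
  intros H. replace s with (t + IZR k)%R by lra.
  rewrite Cunit_plus, Cunit_Z. ring.
Qed.

Lemma Cunit_eq_1 (t : R) : Cunit t = 1 -> exists k : Z, t = IZR k.
Proof.
  unfold Cunit. rewrite Cexp_Ci. intros H. injection H as Hc _.
  (* The double-angle formula turns [cos (2 PI t) = 1] into a zero of the sine at [PI t], and the
     zeros of the sine are the integer multiples of [PI]. *)
  assert (S : sin (PI * t) = 0%R).
  { assert (E : cos (2 * (PI * t)) = 1%R) by (rewrite <- Hc; f_equal; ring).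
    rewrite cos_2a_sin in E. nra. }
  apply sin_eq_0_0 in S. destruct S as [k Hk]. exists k.
  generalize PI_RGT_0; intros. nra.
Qed.

Lemma Cconj_Cexp (z : C) : Cconj (Cexp z) = Cexp (Cconj z).
Proof.
  destruct z as [a b]. unfold Cexp, Cconj; simpl. rewrite cos_neg, sin_neg.
  apply C_ext; simpl; ring.
Qed.

Lemma Cconj_RtoC (x : R) : Cconj (RtoC x) = RtoC x.
Proof. apply C_ext; simpl; ring. Qed.

Lemma Im_le_Cmod' (z : C) : (Rabs (Im z) <= Cmod z)%R.
Proof. apply Rle_trans with (2 := Rmax_Cmod z). apply Rmax_r. Qed.

Lemma Cmod_Ci : Cmod Ci = 1%R.
Proof.
  unfold Cmod, Ci; simpl. transitivity (sqrt 1); [f_equal; ring|apply sqrt_1].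
Qed.

Lemma Cmod_le_Re_Im (z : C) : (Cmod z <= Rabs (Re z) + Rabs (Im z))%R.
Proof.
  replace z with (RtoC (Re z) + Ci * RtoC (Im z)) at 1 by (apply C_ext; simpl; ring).
  eapply Rle_trans; [apply Cmod_triangle|].
  rewrite Cmod_mult, !Cmod_R, Cmod_Ci. lra.
Qed.

Lemma Cmod_Rpos (x : R) : (0 <= x)%R -> Cmod (RtoC x) = x.
Proof. intros. rewrite Cmod_R. now apply Rabs_pos_eq. Qed.

Lemma Cmod_minus_sym (z w : C) : Cmod (z - w) = Cmod (w - z).
Proof. rewrite <- Cmod_opp. f_equal. ring. Qed.

(** * Limits *)

(** [locally] on [C] comes from the product uniform structure, which measures each coordinate
    separately. Working with [Cmod] instead gives a multiplicative norm; [Ctends_filterlim] is the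
    bridge to the limits of the statement. *)
Definition Ctends {T : Type} (F : (T -> Prop) -> Prop) (f : T -> C) (l : C) : Prop :=
  forall eps : R, (0 < eps)%R -> F (fun x => (Cmod (f x - l) < eps)%R).

Lemma Ctends_filterlim {T : Type} (F : (T -> Prop) -> Prop) {FF : Filter F} (f : T -> C) (l : C) :
  Ctends F f l <-> filterlim f F (locally (T := C_UniformSpace) l).
Proof.
  split.
  - intros H P [eps HP]. unfold filtermap.
    generalize (H eps (cond_pos eps)). apply filter_imp. intros x Hx. apply HP.
    split; unfold ball; simpl; unfold AbsRing_ball, abs, minus, plus, opp; simpl.
    + eapply Rle_lt_trans; [|exact Hx]. apply (re_le_Cmod (f x - l)).
    + eapply Rle_lt_trans; [|exact Hx]. apply (Im_le_Cmod' (f x - l)).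
  - intros H eps He.
    assert (He2 : (0 < eps / 2)%R) by lra.
    specialize (H (fun z => (Cmod (z - l) < eps)%R)).
    apply H. exists (mkposreal _ He2). intros z [H1 H2].
    unfold ball in H1, H2; simpl in H1, H2.
    unfold AbsRing_ball, abs, minus, plus, opp in H1, H2; simpl in H1, H2.
    eapply Rle_lt_trans; [apply Cmod_le_Re_Im|].
    replace eps with (eps / 2 + eps / 2)%R by field.
    apply Rplus_lt_compat; [exact H1|exact H2].
Qed.

Section Ctends.
Context {T : Type} (F : (T -> Prop) -> Prop) {FF : Filter F}.

Lemma Ctends_const (c : C) : Ctends F (fun _ => c) c.
Proof.
  intros eps He. apply filter_forall. intros _.
  replace (c - c) with (RtoC 0) by ring. now rewrite Cmod_0.
Qed.

Lemma Ctends_near (f g : T -> C) (l : C) :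
  F (fun x => f x = g x) -> Ctends F f l -> Ctends F g l.
Proof.
  intros E H eps He. generalize (filter_and _ _ E (H eps He)).
  apply filter_imp. intros x [-> Hx]. exact Hx.
Qed.

Lemma Ctends_ext (f g : T -> C) (l : C) :
  (forall x, f x = g x) -> Ctends F f l -> Ctends F g l.
Proof. intros E. apply Ctends_near. now apply filter_forall. Qed.

Lemma Ctends_plus (f g : T -> C) (l m : C) :
  Ctends F f l -> Ctends F g m -> Ctends F (fun x => f x + g x) (l + m).
Proof.
  intros Hf Hg eps He. assert (He2 : (0 < eps / 2)%R) by lra.
  generalize (filter_and _ _ (Hf _ He2) (Hg _ He2)). apply filter_imp.
  intros x [H1 H2]. replace (f x + g x - (l + m)) with ((f x - l) + (g x - m)) by ring.
  eapply Rle_lt_trans; [apply Cmod_triangle|]. lra.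
Qed.

Lemma Ctends_mult (f g : T -> C) (l m : C) :
  Ctends F f l -> Ctends F g m -> Ctends F (fun x => f x * g x) (l * m).
Proof.
  intros Hf Hg eps He.
  assert (P1 := Cmod_ge_0 l). assert (P2 := Cmod_ge_0 m).
  set (d := Rmin 1 (eps / (2 + Cmod l + Cmod m))).
  assert (Hd : (0 < d)%R).
  { apply Rmin_glb_lt; [lra|]. apply Rdiv_lt_0_compat; lra. }
  assert (Hd1 : (d <= 1)%R) by apply Rmin_l.
  assert (Hd2 : (d * (2 + Cmod l + Cmod m) <= eps)%R).
  { replace eps with (eps / (2 + Cmod l + Cmod m) * (2 + Cmod l + Cmod m))%R by (field; lra).
    apply Rmult_le_compat_r; [lra|apply Rmin_r]. }
  generalize (filter_and _ _ (Hf _ Hd) (Hg _ Hd)). apply filter_imp.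
  intros x [H1 H2].
  replace (f x * g x - l * m) with ((f x - l) * (g x - m) + (l * (g x - m) + (f x - l) * m)) by ring.
  eapply Rle_lt_trans; [apply Cmod_triangle|].
  eapply Rle_lt_trans; [apply Rplus_le_compat_l, Cmod_triangle|].
  rewrite !Cmod_mult.
  assert (Q1 := Cmod_ge_0 (f x - l)). assert (Q2 := Cmod_ge_0 (g x - m)).
  nra.
Qed.

Lemma Ctends_opp (f : T -> C) (l : C) :
  Ctends F f l -> Ctends F (fun x => - f x) (- l).
Proof.
  intros Hf eps He. generalize (Hf _ He). apply filter_imp. intros x H.
  replace (- f x - - l) with (- (f x - l)) by ring. now rewrite Cmod_opp.
Qed.

Lemma Ctends_minus (f g : T -> C) (l m : C) :
  Ctends F f l -> Ctends F g m -> Ctends F (fun x => f x - g x) (l - m).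
Proof. intros Hf Hg. apply Ctends_plus; [exact Hf|now apply Ctends_opp]. Qed.

Lemma Ctends_conj (f : T -> C) (l : C) :
  Ctends F f l -> Ctends F (fun x => Cconj (f x)) (Cconj l).
Proof.
  intros Hf eps He. generalize (Hf _ He). apply filter_imp. intros x H.
  rewrite <- Cminus_conj, Cmod_conj. exact H.
Qed.

Lemma Ctends_inv (f : T -> C) (l : C) :
  l <> 0 -> Ctends F f l -> Ctends F (fun x => / f x) (/ l).
Proof.
  intros Hl Hf eps He.
  assert (P := proj1 (Cmod_gt_0 l) Hl).
  set (d := Rmin (Cmod l / 2) (eps * Cmod l * Cmod l / 2)).
  assert (Hd : (0 < d)%R).
  { apply Rmin_glb_lt; [lra|]. assert (0 < eps * Cmod l * Cmod l)%R; [|lra].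
    apply Rmult_lt_0_compat; [apply Rmult_lt_0_compat|]; lra. }
  generalize (Hf _ Hd). apply filter_imp. intros x H.
  assert (H1 : (Cmod l / 2 < Cmod (f x))%R).
  { assert (D1 : (d <= Cmod l / 2)%R) by apply Rmin_l.
    assert (Cmod l <= Cmod (f x) + Cmod (f x - l))%R; [|lra].
    rewrite (Cmod_minus_sym (f x)). replace l with (f x + (l - f x)) at 1 by ring. apply Cmod_triangle. }
  assert (Hx : f x <> 0) by (apply Cmod_gt_0; lra).
  replace (/ f x - / l) with (- (f x - l) * / (f x * l)) by (field; auto).
  rewrite Cmod_mult, Cmod_opp, Cmod_inv, Cmod_mult.
  2: now apply Cmult_neq_0.
  assert (D2 : (d <= eps * Cmod l * Cmod l / 2)%R) by apply Rmin_r.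
  assert (Q : (0 < Cmod (f x) * Cmod l)%R) by (apply Rmult_lt_0_compat; lra).
  apply Rmult_lt_reg_r with (Cmod (f x) * Cmod l)%R; [exact Q|].
  rewrite Rmult_assoc, Rinv_l, Rmult_1_r by lra.
  assert (0 < eps * Cmod l)%R by (apply Rmult_lt_0_compat; lra). nra.
Qed.

Lemma Ctends_squeeze (f : T -> C) (g : T -> R) (l : C) :
  F (fun x => Cmod (f x - l) <= g x)%R ->
  (forall eps : R, (0 < eps)%R -> F (fun x => (g x < eps)%R)) -> Ctends F f l.
Proof.
  intros H1 H2 eps He. generalize (filter_and _ _ H1 (H2 eps He)). apply filter_imp.
  intros x [P Q]. lra.
Qed.

Lemma Ctends_comp {U : Type} (G : (U -> Prop) -> Prop) (h : U -> T) (f : T -> C) (l : C) :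
  filterlim h G F -> Ctends F f l -> Ctends G (fun x => f (h x)) l.
Proof. intros Hh Hf eps He. exact (Hh _ (Hf eps He)). Qed.

End Ctends.

Lemma Ctends_unique {T : Type} (F : (T -> Prop) -> Prop) {FF : ProperFilter F} (f : T -> C) (l m : C) :
  Ctends F f l -> Ctends F f m -> l = m.
Proof.
  intros Hf Hg.
  destruct (Rlt_dec 0 (Cmod (l - m))) as [H|H].
  - exfalso. assert (He : (0 < Cmod (l - m) / 2)%R) by lra.
    destruct (filter_ex _ (filter_and _ _ (Hf _ He) (Hg _ He))) as [x [H1 H2]].
    assert (Cmod (l - m) <= Cmod (f x - l) + Cmod (f x - m))%R; [|lra].
    rewrite (Cmod_minus_sym (f x) l). replace (l - m) with ((l - f x) + (f x - m)) by ring.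
    apply Cmod_triangle.
  - assert (E : Cmod (l - m) = 0%R) by (generalize (Cmod_ge_0 (l - m)); lra).
    apply Cmod_eq_0 in E. replace l with (l - m + m) by ring. rewrite E. ring.
Qed.

Lemma Ctends_bound {T : Type} (F : (T -> Prop) -> Prop) {FF : ProperFilter F} (f : T -> C) (l : C) (M : R) :
  Ctends F f l -> F (fun x => Cmod (f x) <= M)%R -> (Cmod l <= M)%R.
Proof.
  intros Hf HM. apply le_epsilon. intros e He.
  destruct (filter_ex _ (filter_and _ _ (Hf e He) HM)) as [x [H1 H2]].
  replace l with (f x + - (f x - l)) by ring.
  eapply Rle_trans; [apply Cmod_triangle|]. rewrite Cmod_opp. lra.
Qed.

Lemma eventually_small (K : R) (eps : R) : (0 < eps)%R ->
  eventually (fun n => (K / INR (S n) < eps)%R).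
Proof.
  intros He. destruct (INR_unbounded (K / eps)) as [n Hn].
  exists n. intros m Hm. assert (P : (0 < INR (S m))%R) by (apply lt_0_INR; lia).
  apply Rmult_lt_reg_r with (INR (S m)); [exact P|].
  unfold Rdiv. rewrite Rmult_assoc, Rinv_l, Rmult_1_r by lra.
  assert (INR n <= INR m)%R by now apply le_INR.
  rewrite S_INR. assert (K < INR n * eps)%R.
  { apply Rmult_lt_reg_r with (/ eps)%R; [now apply Rinv_0_lt_compat|].
    rewrite Rmult_assoc, Rinv_r, Rmult_1_r by lra. exact Hn. }
  nra.
Qed.

(** * Finite sums and series *)

(** The upper bound is excluded and the empty sum is zero, so that splitting and regrouping have no
    boundary cases. *)
Fixpoint csum (F : nat -> C) (n : nat) : C :=
  match n with O => 0 | S k => csum F k + F k end.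

Lemma csum_ext (F G : nat -> C) (n : nat) :
  (forall k, (k < n)%nat -> F k = G k) -> csum F n = csum G n.
Proof.
  induction n as [|n IH]; intros H; [reflexivity|]. simpl.
  rewrite IH, H; [reflexivity|lia|]. intros; apply H; lia.
Qed.

Lemma csum_plus (F G : nat -> C) (n : nat) :
  csum (fun k => F k + G k) n = csum F n + csum G n.
Proof. induction n as [|n IH]; simpl; [ring|]. rewrite IH. ring. Qed.

Lemma csum_mult_l (c : C) (F : nat -> C) (n : nat) :
  csum (fun k => c * F k) n = c * csum F n.
Proof. induction n as [|n IH]; simpl; [ring|]. rewrite IH. ring. Qed.

Lemma csum_mult_r (c : C) (F : nat -> C) (n : nat) :
  csum (fun k => F k * c) n = csum F n * c.
Proof. induction n as [|n IH]; simpl; [ring|]. rewrite IH. ring. Qed.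

Lemma csum_zero (n : nat) : csum (fun _ => 0) n = 0.
Proof. induction n as [|n IH]; simpl; [ring|]. rewrite IH. ring. Qed.

Lemma csum_const (c : C) (n : nat) : csum (fun _ => c) n = RtoC (INR n) * c.
Proof.
  induction n as [|n IH]; [simpl; ring|]. rewrite S_INR, RtoC_plus. simpl csum. rewrite IH. ring.
Qed.

Lemma csum_opp (F : nat -> C) (n : nat) : csum (fun k => - F k) n = - csum F n.
Proof. induction n as [|n IH]; simpl; [ring|]. rewrite IH. ring. Qed.

Lemma csum_minus (F G : nat -> C) (n : nat) :
  csum (fun k => F k - G k) n = csum F n - csum G n.
Proof. induction n as [|n IH]; simpl; [ring|]. rewrite IH. ring. Qed.

Lemma csum_add (F : nat -> C) (n m : nat) :
  csum F (n + m) = csum F n + csum (fun k => F (n + k)%nat) m.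
Proof.
  induction m as [|m IH]; [rewrite Nat.add_0_r; simpl; ring|].
  rewrite Nat.add_succ_r. simpl. rewrite IH. ring.
Qed.

Lemma csum_first (F : nat -> C) (n : nat) :
  csum F (S n) = F O + csum (fun k => F (S k)) n.
Proof. replace (S n) with (1 + n)%nat by lia. rewrite csum_add. simpl. ring. Qed.

Lemma csum_rev (F : nat -> C) (n : nat) :
  csum F n = csum (fun k => F (n - 1 - k)%nat) n.
Proof.
  induction n as [|n IH]; [reflexivity|].
  rewrite (csum_first (fun k => F (S n - 1 - k)%nat)).
  change (csum F (S n)) with (csum F n + F n). rewrite IH, Cplus_comm. f_equal.
  - f_equal. lia.
  - apply csum_ext. intros k Hk. f_equal. lia.
Qed.

Lemma csum_swap (F : nat -> nat -> C) (n m : nat) :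
  csum (fun i => csum (F i) m) n = csum (fun j => csum (fun i => F i j) n) m.
Proof.
  induction n as [|n IH]; simpl; [now rewrite csum_zero|].
  rewrite IH, <- csum_plus. reflexivity.
Qed.

Lemma csum_mul (F : nat -> C) (n m : nat) :
  csum F (n * m) = csum (fun j => csum (fun i => F (j * m + i)%nat) m) n.
Proof.
  induction n as [|n IH]; [reflexivity|].
  simpl csum at 2. rewrite <- IH, Nat.mul_succ_l, csum_add. reflexivity.
Qed.

(** The indices are sorted by residue modulo [m]. Both the frequencies of the Poisson formula and
    the summands of the Gauss sums are regrouped in this way. *)
Lemma csum_mul' (F : nat -> C) (n m : nat) :
  csum F (n * m) = csum (fun i => csum (fun j => F (i + m * j)%nat) n) m.
Proof.
  rewrite csum_mul, csum_swap. apply csum_ext; intros i _. apply csum_ext; intros j _.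
  f_equal. lia.
Qed.

Lemma csum_conj (F : nat -> C) (n : nat) :
  Cconj (csum F n) = csum (fun k => Cconj (F k)) n.
Proof.
  induction n as [|n IH]; simpl; [apply Cconj_RtoC|]. now rewrite Cplus_conj, IH.
Qed.

Lemma Cmod_csum_const (F : nat -> C) (c : R) (n : nat) :
  (forall k, (k < n)%nat -> (Cmod (F k) <= c)%R) -> (Cmod (csum F n) <= INR n * c)%R.
Proof.
  induction n as [|n IH]; intros H.
  - simpl. rewrite Cmod_0. lra.
  - rewrite S_INR. simpl csum. eapply Rle_trans; [apply Cmod_triangle|].
    assert (Cmod (csum F n) <= INR n * c)%R by (apply IH; intros; apply H; lia).
    assert (Cmod (F n) <= c)%R by (apply H; lia). lra.
Qed.

Lemma Ctends_csum {T : Type} (F : (T -> Prop) -> Prop) {FF : Filter F}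
    (f : nat -> T -> C) (l : nat -> C) (n : nat) :
  (forall k, (k < n)%nat -> Ctends F (f k) (l k)) ->
  Ctends F (fun x => csum (fun k => f k x) n) (csum l n).
Proof.
  induction n as [|n IH]; intros H; simpl.
  - apply Ctends_const; assumption.
  - apply Ctends_plus; [assumption|apply IH; intros; apply H; lia|apply H; lia].
Qed.

(** A relation, because [CSeries] has some value even for a divergent series; convergence has to be
    carried along separately. *)
Definition Csums (a : nat -> C) (l : C) : Prop := Ctends eventually (csum a) l.

Lemma csum_sum_n (a : nat -> C) (n : nat) :
  csum a (S n) = (sum_n (fun k => Re (a k)) n, sum_n (fun k => Im (a k)) n).
Proof.
  induction n as [|n IH].
  - rewrite !sum_O. simpl. rewrite Cplus_0_l. now destruct (a O).
  - rewrite !sum_Sn. simpl csum in *. rewrite IH. apply C_ext; reflexivity.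
Qed.

Lemma Csums_S (a : nat -> C) (l : C) :
  Ctends eventually (fun n => csum a (S n)) l <-> Csums a l.
Proof.
  split; intros H eps He; destruct (H eps He) as [n Hn].
  - exists (S n). intros [|m] Hm; [lia|]. apply Hn. lia.
  - exists n. intros m Hm. apply Hn. lia.
Qed.

Lemma Csums_iff (a : nat -> C) (l : C) :
  Csums a l <-> is_series (fun n => Re (a n)) (Re l) /\ is_series (fun n => Im (a n)) (Im l).
Proof.
  rewrite <- Csums_S.
  split.
  - intros H. split.
    + apply filterlim_locally. intros eps. destruct (H eps (cond_pos eps)) as [n Hn].
      exists n. intros m Hm. specialize (Hn m Hm). rewrite csum_sum_n in Hn.
      unfold ball; simpl; unfold AbsRing_ball, abs, minus, plus, opp; simpl.
      eapply Rle_lt_trans; [|exact Hn]. exact (re_le_Cmod ((_, sum_n (fun k => Im (a k)) m) - l)).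
    + apply filterlim_locally. intros eps. destruct (H eps (cond_pos eps)) as [n Hn].
      exists n. intros m Hm. specialize (Hn m Hm). rewrite csum_sum_n in Hn.
      unfold ball; simpl; unfold AbsRing_ball, abs, minus, plus, opp; simpl.
      eapply Rle_lt_trans; [|exact Hn]. exact (Im_le_Cmod' ((sum_n (fun k => Re (a k)) m, _) - l)).
  - intros [H1 H2] eps He. assert (He2 : (0 < eps / 2)%R) by lra.
    destruct (proj1 (filterlim_locally _ _) H1 (mkposreal _ He2)) as [n1 Hn1].
    destruct (proj1 (filterlim_locally _ _) H2 (mkposreal _ He2)) as [n2 Hn2].
    exists (max n1 n2). intros m Hm. rewrite csum_sum_n.
    eapply Rle_lt_trans; [apply Cmod_le_Re_Im|].
    specialize (Hn1 m ltac:(lia)). specialize (Hn2 m ltac:(lia)).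
    unfold ball in Hn1, Hn2; simpl in Hn1, Hn2.
    unfold AbsRing_ball, abs, minus, plus, opp in Hn1, Hn2; simpl in Hn1, Hn2.
    replace eps with (eps / 2 + eps / 2)%R by field.
    apply Rplus_lt_compat; [exact Hn1|exact Hn2].
Qed.

Lemma Csums_CSeries (a : nat -> C) (l : C) : Csums a l -> CSeries a = l.
Proof.
  intros H. apply Csums_iff in H. destruct H as [H1 H2].
  unfold CSeries. rewrite (is_series_unique _ _ H1), (is_series_unique _ _ H2).
  now destruct l.
Qed.

Lemma Csums_dominated (a : nat -> C) (b : nat -> R) :
  (forall n, (Cmod (a n) <= b n)%R) -> ex_series b -> Csums a (CSeries a).
Proof.
  intros H Hb. apply Csums_iff. split; simpl.
  - apply Series_correct. apply (@ex_series_le R_AbsRing R_CompleteNormedModule) with b; [|exact Hb].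
    intros n. eapply Rle_trans; [apply re_le_Cmod|apply H].
  - apply Series_correct. apply (@ex_series_le R_AbsRing R_CompleteNormedModule) with b; [|exact Hb].
    intros n. eapply Rle_trans; [apply Im_le_Cmod'|apply H].
Qed.

Lemma Csums_unique (a : nat -> C) (l m : C) : Csums a l -> Csums a m -> l = m.
Proof. apply Ctends_unique. apply eventually_filter. Qed.

Lemma Csums_ext (a b : nat -> C) (l : C) :
  (forall n, a n = b n) -> Csums a l -> Csums b l.
Proof. intros E. apply Ctends_ext; [typeclasses eauto|]. intros n. now apply csum_ext. Qed.

Lemma Csums_mult_l (c : C) (a : nat -> C) (l : C) :
  Csums a l -> Csums (fun n => c * a n) (c * l).
Proof.
  intros H. apply Ctends_ext with (f := fun n => c * csum a n); [typeclasses eauto| |].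
  - intros n. now rewrite csum_mult_l.
  - apply Ctends_mult; [typeclasses eauto| |exact H]. apply Ctends_const; typeclasses eauto.
Qed.

Lemma Csums_plus (a b : nat -> C) (l m : C) :
  Csums a l -> Csums b m -> Csums (fun n => a n + b n) (l + m).
Proof.
  intros Ha Hb. apply Ctends_ext with (f := fun n => csum a n + csum b n); [typeclasses eauto| |].
  - intros n. now rewrite csum_plus.
  - apply Ctends_plus; [typeclasses eauto|exact Ha|exact Hb].
Qed.

Lemma CSeries_ext (a b : nat -> C) : (forall n, a n = b n) -> CSeries a = CSeries b.
Proof.
  intros H. unfold CSeries. f_equal; apply Series_ext; intros n; now rewrite H.
Qed.

Ltac Rring := match goal with |- @eq _ ?x ?y => change (@eq R x y) end; ring.

(** * Calculus of complex-valued functions of a real variable *)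

(** Derivatives, continuity and integrals are all taken coordinatewise, so that the real theorems on
    primitives and on integrals with a parameter transfer directly. *)
Definition CD (f : R -> C) (x : R) (l : C) : Prop :=
  is_derive (fun t => Re (f t)) x (Re l) /\ is_derive (fun t => Im (f t)) x (Im l).

Definition CCont (f : R -> C) (x : R) : Prop :=
  continuous (fun t => Re (f t)) x /\ continuous (fun t => Im (f t)) x.

Definition CCont2 (f : R -> R -> C) (x y : R) : Prop :=
  continuity_2d_pt (fun u v => Re (f u v)) x y /\
  continuity_2d_pt (fun u v => Im (f u v)) x y.

Definition CInt (f : R -> C) (a b : R) : C :=
  (RInt (fun t => Re (f t)) a b, RInt (fun t => Im (f t)) a b).

Lemma CD_ext (f g : R -> C) (x : R) (l : C) :
  (forall t, f t = g t) -> CD f x l -> CD g x l.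
Proof.
  intros E [H1 H2]. split; [eapply is_derive_ext; [|exact H1]|eapply is_derive_ext; [|exact H2]];
  intros t; simpl; now rewrite (E t).
Qed.

Lemma CD_eq (f : R -> C) (x : R) (l m : C) : CD f x l -> l = m -> CD f x m.
Proof. now intros H <-. Qed.

Lemma CD_const (c : C) (x : R) : CD (fun _ => c) x 0.
Proof. split; exact (is_derive_const (V := R_NormedModule) _ x). Qed.

Lemma CD_RtoC (f : R -> R) (x l : R) : is_derive f x l -> CD (fun t => RtoC (f t)) x (RtoC l).
Proof. intros H. split; [exact H|exact (is_derive_const (V := R_NormedModule) _ x)]. Qed.

Lemma CD_id (x : R) : CD (fun t => RtoC t) x 1.
Proof. apply CD_RtoC. exact (is_derive_id x). Qed.

Lemma CD_plus (f g : R -> C) (x : R) (l m : C) :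
  CD f x l -> CD g x m -> CD (fun t => f t + g t) x (l + m).
Proof. intros [H1 H2] [H3 H4]. split; now apply: is_derive_plus. Qed.

Lemma CD_minus (f g : R -> C) (x : R) (l m : C) :
  CD f x l -> CD g x m -> CD (fun t => f t - g t) x (l - m).
Proof. intros [H1 H2] [H3 H4]. split; now apply: is_derive_minus. Qed.

Lemma is_derive_Rmult (f g : R -> R) (x l m : R) :
  is_derive f x l -> is_derive g x m ->
  is_derive (fun t => f t * g t)%R x (l * g x + f x * m)%R.
Proof. intros Hf Hg. apply: is_derive_mult Hf Hg _. intros; apply Rmult_comm. Qed.

Lemma CD_mult (f g : R -> C) (x : R) (l m : C) :
  CD f x l -> CD g x m -> CD (fun t => f t * g t) x (l * g x + f x * m).
Proof.
  intros [H1 H2] [H3 H4]. split; simpl.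
  - evar_last.
    + apply: is_derive_minus; [exact (is_derive_Rmult _ _ _ _ _ H1 H3)|exact (is_derive_Rmult _ _ _ _ _ H2 H4)].
    + unfold minus, plus, opp; simpl; unfold Re, Im; simpl; Rring.
  - evar_last.
    + apply: is_derive_plus; [exact (is_derive_Rmult _ _ _ _ _ H1 H4)|exact (is_derive_Rmult _ _ _ _ _ H2 H3)].
    + unfold minus, plus, opp; simpl; unfold Re, Im; simpl; Rring.
Qed.

Lemma CD_scal (c : C) (f : R -> C) (x : R) (l : C) :
  CD f x l -> CD (fun t => c * f t) x (c * l).
Proof.
  intros H. eapply CD_eq; [exact (CD_mult (fun _ => c) f x 0 l (CD_const c x) H)|]. simpl; ring.
Qed.

Lemma CD_Cexp (f : R -> C) (x : R) (l : C) :
  CD f x l -> CD (fun t => Cexp (f t)) x (l * Cexp (f x)).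
Proof.
  intros [H1 H2].
  assert (E : is_derive (fun t => exp (Re (f t))) x (Re l * exp (Re (f x)))%R).
  { evar_last; [apply: is_derive_comp; [apply is_derive_exp|exact H1]|].
    reflexivity. }
  split; simpl.
  - evar_last.
    + apply is_derive_Rmult; [exact E|]. apply: is_derive_comp; [apply is_derive_cos|exact H2].
    + unfold scal; simpl; unfold mult, Re, Im; simpl; Rring.
  - evar_last.
    + apply is_derive_Rmult; [exact E|]. apply: is_derive_comp; [apply is_derive_sin|exact H2].
    + unfold scal; simpl; unfold mult, Re, Im; simpl; Rring.
Qed.

Lemma CD_CCont (f : R -> C) (x : R) (l : C) : CD f x l -> CCont f x.
Proof. intros [H1 H2]. split; apply: ex_derive_continuous; eexists; eassumption. Qed.

Lemma CCont_ext (f g : R -> C) (x : R) : (forall t, f t = g t) -> CCont f x -> CCont g x.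
Proof.
  intros E [H1 H2].
  split; [eapply continuous_ext; [|exact H1]|eapply continuous_ext; [|exact H2]];
  intros t; simpl; now rewrite (E t).
Qed.

Lemma CCont_const (c : C) (x : R) : CCont (fun _ => c) x.
Proof. split; apply continuous_const. Qed.

Lemma CCont_RtoC (f : R -> R) (x : R) : continuous f x -> CCont (fun t => RtoC (f t)) x.
Proof. intros H. split; [exact H|apply continuous_const]. Qed.

Lemma CCont_id (x : R) : CCont (fun t => RtoC t) x.
Proof. apply CCont_RtoC, continuous_id. Qed.

Lemma CCont_plus (f g : R -> C) (x : R) :
  CCont f x -> CCont g x -> CCont (fun t => f t + g t) x.
Proof. intros [H1 H2] [H3 H4]. split; now apply: continuous_plus. Qed.

Lemma CCont_minus (f g : R -> C) (x : R) :
  CCont f x -> CCont g x -> CCont (fun t => f t - g t) x.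
Proof. intros [H1 H2] [H3 H4]. split; now apply: continuous_minus. Qed.

Lemma CCont_mult (f g : R -> C) (x : R) :
  CCont f x -> CCont g x -> CCont (fun t => f t * g t) x.
Proof.
  intros [H1 H2] [H3 H4]. split; simpl.
  - apply: continuous_minus; now apply: continuous_mult.
  - apply: continuous_plus; now apply: continuous_mult.
Qed.

Lemma CCont_Cexp (f : R -> C) (x : R) : CCont f x -> CCont (fun t => Cexp (f t)) x.
Proof.
  intros [H1 H2]. split; simpl; apply: continuous_mult.
  - apply: continuous_comp; [exact H1|apply continuous_exp].
  - apply: continuous_comp; [exact H2|apply continuous_cos].
  - apply: continuous_comp; [exact H1|apply continuous_exp].
  - apply: continuous_comp; [exact H2|apply continuous_sin].
Qed.

Lemma CCont_pow (f : R -> C) (n : nat) (x : R) :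
  CCont f x -> CCont (fun t => (f t ^ n)%C) x.
Proof.
  intros H. induction n as [|n IH]; simpl; [apply CCont_const|]. now apply CCont_mult.
Qed.

Lemma CCont_csum (f : nat -> R -> C) (n : nat) (x : R) :
  (forall k, (k < n)%nat -> CCont (f k) x) -> CCont (fun t => csum (fun k => f k t) n) x.
Proof.
  induction n as [|n IH]; intros H; simpl; [apply CCont_const|].
  apply CCont_plus; [apply IH; intros; apply H; lia|apply H; lia].
Qed.

Lemma CCont_tends (f : R -> C) (x : R) :
  CCont f x <-> Ctends (locally x) f (f x).
Proof.
  split.
  - intros [H1 H2] eps He. assert (He2 : (0 < eps / 2)%R) by lra.
    assert (A1 := proj1 (filterlim_locally _ _) H1 (mkposreal _ He2)).
    assert (A2 := proj1 (filterlim_locally _ _) H2 (mkposreal _ He2)).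
    generalize (filter_and _ _ A1 A2). apply filter_imp. intros t [B1 B2].
    eapply Rle_lt_trans; [apply Cmod_le_Re_Im|].
    replace eps with (eps / 2 + eps / 2)%R by field.
    apply Rplus_lt_compat; [exact B1|exact B2].
  - intros H. split; apply filterlim_locally; intros eps;
    generalize (H eps (cond_pos eps)); apply filter_imp; intros t Ht.
    + eapply Rle_lt_trans; [|exact Ht]. exact (re_le_Cmod (f t - f x)).
    + eapply Rle_lt_trans; [|exact Ht]. exact (Im_le_Cmod' (f t - f x)).
Qed.

Lemma CCont_inv (f : R -> C) (x : R) :
  f x <> 0 -> CCont f x -> CCont (fun t => / f t) x.
Proof.
  intros Hx H. apply CCont_tends. apply CCont_tends in H.
  apply (Ctends_inv _ f); assumption.
Qed.

Section CInt.
Variables (a b : R).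

Definition CContI (f : R -> C) : Prop :=
  forall t, (Rmin a b <= t <= Rmax a b)%R -> CCont f t.

Lemma ex_RInt_Re (f : R -> C) : CContI f -> ex_RInt (fun t => Re (f t)) a b.
Proof. intros H. apply: ex_RInt_continuous. intros t Ht. now apply H. Qed.

Lemma ex_RInt_Im (f : R -> C) : CContI f -> ex_RInt (fun t => Im (f t)) a b.
Proof. intros H. apply: ex_RInt_continuous. intros t Ht. now apply H. Qed.

Lemma CInt_ext (f g : R -> C) :
  (forall t, (Rmin a b < t < Rmax a b)%R -> f t = g t) -> CInt f a b = CInt g a b.
Proof.
  intros H. unfold CInt. f_equal; apply RInt_ext; intros t Ht; simpl; now rewrite (H t Ht).
Qed.

Lemma CInt_plus (f g : R -> C) : CContI f -> CContI g ->
  CInt (fun t => f t + g t) a b = CInt f a b + CInt g a b.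
Proof.
  intros Hf Hg. apply C_ext; simpl; apply: RInt_plus; auto using ex_RInt_Re, ex_RInt_Im.
Qed.

Lemma CInt_scal (c : C) (f : R -> C) : CContI f ->
  CInt (fun t => c * f t) a b = c * CInt f a b.
Proof.
  intros Hf. assert (H1 := ex_RInt_Re f Hf). assert (H2 := ex_RInt_Im f Hf).
  apply C_ext; simpl.
  - apply is_RInt_unique.
    apply (is_RInt_minus (V := R_NormedModule) (fun t => (Re c * Re (f t))%R) (fun t => (Im c * Im (f t))%R));
    apply (is_RInt_scal (V := R_NormedModule)); apply (RInt_correct (V := R_CompleteNormedModule)); assumption.
  - apply is_RInt_unique.
    apply (is_RInt_plus (V := R_NormedModule) (fun t => (Re c * Im (f t))%R) (fun t => (Im c * Re (f t))%R));
    apply (is_RInt_scal (V := R_NormedModule)); apply (RInt_correct (V := R_CompleteNormedModule)); assumption.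
Qed.

Lemma CInt_FTC (f df : R -> C) :
  (forall t, (Rmin a b <= t <= Rmax a b)%R -> CD f t (df t)) -> CContI df ->
  CInt df a b = f b - f a.
Proof.
  intros Hd Hc. apply C_ext; simpl; apply is_RInt_unique.
  - apply (is_RInt_derive (V := R_CompleteNormedModule) (fun t => Re (f t)) (fun t => Re (df t)));
    intros t Ht; [apply Hd|apply Hc]; exact Ht.
  - apply (is_RInt_derive (V := R_CompleteNormedModule) (fun t => Im (f t)) (fun t => Im (df t)));
    intros t Ht; [apply Hd|apply Hc]; exact Ht.
Qed.

Lemma CInt_bound (f : R -> C) (g : R -> R) : (a <= b)%R -> CContI f ->
  (forall t, (a <= t <= b)%R -> (Cmod (f t) <= g t)%R) -> ex_RInt g a b ->
  (Cmod (CInt f a b) <= RInt g a b)%R.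
Proof.
  intros Hab Hf Hg Hi.
  (* Bounding the coordinates separately would lose a constant. The integral is read instead in
     [C_R_NormedModule], whose norm is exactly [Cmod]. *)
  assert (I : is_RInt (V := C_R_NormedModule) f a b (CInt f a b)).
  { apply (is_RInt_fct_extend_pair (U := R_NormedModule) (V := R_NormedModule));
    apply: RInt_correct; [now apply ex_RInt_Re|now apply ex_RInt_Im]. }
  assert (N : forall z : C, norm (V := C_R_NormedModule) z = Cmod z).
  { intros z. change (sqrt (Rabs (fst z) ^ 2 + Rabs (snd z) ^ 2) = Cmod z).
    now rewrite !pow2_abs. }
  rewrite <- N.
  apply (norm_RInt_le f g a b); [exact Hab| |exact I|apply: RInt_correct; exact Hi].
  intros t Ht. rewrite N. now apply Hg.
Qed.

End CInt.

Lemma CInt_Chasles (f : R -> C) (a b c : R) :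
  CContI a b f -> CContI b c f -> CInt f a b + CInt f b c = CInt f a c.
Proof.
  intros H1 H2. apply C_ext; simpl; apply: RInt_Chasles; auto using ex_RInt_Re, ex_RInt_Im.
Qed.

Lemma CInt_param (f f1 : R -> R -> C) (a b u : R) :
  (forall u t, CD (fun u => f u t) u (f1 u t)) ->
  (forall t, CCont2 f1 u t) ->
  (forall u t, CCont (f u) t) ->
  CD (fun u => CInt (f u) a b) u (CInt (f1 u) a b).
Proof.
  intros Hd Hc Hf.
  assert (D1 : forall v t, Derive (fun v => Re (f v t)) v = Re (f1 v t))
    by (intros v t; exact (is_derive_unique _ _ _ (proj1 (Hd v t)))).
  assert (D2 : forall v t, Derive (fun v => Im (f v t)) v = Im (f1 v t))
    by (intros v t; exact (is_derive_unique _ _ _ (proj2 (Hd v t)))).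
  split; simpl.
  - rewrite <- (RInt_ext (fun t => Derive (fun v => Re (f v t)) u)) by (intros t _; apply D1).
    apply (is_derive_RInt_param (fun u t => Re (f u t))).
    + apply filter_forall. intros v t _. exists (Re (f1 v t)). exact (proj1 (Hd v t)).
    + intros t _. apply (continuity_2d_pt_ext (fun v t => Re (f1 v t))); [intros; now rewrite D1|].
      exact (proj1 (Hc t)).
    + apply filter_forall. intros v. apply ex_RInt_Re. intros t _. apply Hf.
  - rewrite <- (RInt_ext (fun t => Derive (fun v => Im (f v t)) u)) by (intros t _; apply D2).
    apply (is_derive_RInt_param (fun u t => Im (f u t))).
    + apply filter_forall. intros v t _. exists (Im (f1 v t)). exact (proj2 (Hd v t)).
    + intros t _. apply (continuity_2d_pt_ext (fun v t => Im (f1 v t))); [intros; now rewrite D2|].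
      exact (proj2 (Hc t)).
    + apply filter_forall. intros v. apply ex_RInt_Im. intros t _. apply Hf.
Qed.

Lemma CCont2_const (c : C) (x y : R) : CCont2 (fun _ _ => c) x y.
Proof. split; apply continuity_2d_pt_const. Qed.

Lemma CCont2_plus (f g : R -> R -> C) (x y : R) :
  CCont2 f x y -> CCont2 g x y -> CCont2 (fun u v => f u v + g u v) x y.
Proof. intros [H1 H2] [H3 H4]. split; simpl; now apply continuity_2d_pt_plus. Qed.

Lemma CCont2_mult (f g : R -> R -> C) (x y : R) :
  CCont2 f x y -> CCont2 g x y -> CCont2 (fun u v => f u v * g u v) x y.
Proof.
  intros [H1 H2] [H3 H4]. split; simpl.
  - apply continuity_2d_pt_minus; now apply continuity_2d_pt_mult.
  - apply continuity_2d_pt_plus; now apply continuity_2d_pt_mult.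
Qed.

Lemma CCont2_Cexp (f : R -> R -> C) (x y : R) :
  CCont2 f x y -> CCont2 (fun u v => Cexp (f u v)) x y.
Proof.
  intros [H1 H2]. split; simpl; apply continuity_2d_pt_mult.
  - apply (continuity_1d_2d_pt_comp exp); [|exact H1]. apply derivable_continuous_pt, derivable_pt_exp.
  - apply (continuity_1d_2d_pt_comp cos); [|exact H2]. apply continuity_cos.
  - apply (continuity_1d_2d_pt_comp exp); [|exact H1]. apply derivable_continuous_pt, derivable_pt_exp.
  - apply (continuity_1d_2d_pt_comp sin); [|exact H2]. apply continuity_sin.
Qed.

Lemma CCont2_l (f : R -> C) (x y : R) : CCont f x -> CCont2 (fun u _ => f u) x y.
Proof.
  intros [H1 H2].
  split; (apply (continuity_1d_2d_pt_comp _ (fun u _ => u)); [|apply continuity_2d_pt_id1]);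
  now apply continuity_pt_filterlim.
Qed.

Lemma CCont2_r (f : R -> C) (x y : R) : CCont f y -> CCont2 (fun _ v => f v) x y.
Proof.
  intros [H1 H2].
  split; (apply (continuity_1d_2d_pt_comp _ (fun _ v => v)); [|apply continuity_2d_pt_id2]);
  now apply continuity_pt_filterlim.
Qed.

(* [P dy + Q dt] is a closed form on the strip, so its integral along the
   boundary of a rectangle vanishes. *)
Lemma closed_form_rectangle (P Q W : R -> R -> C) (a b c d : R) :
  (forall t y, CD (fun t => P t y) t (W t y)) ->
  (forall t y, CD (fun y => Q t y) y (W t y)) ->
  (forall t y, CCont2 W t y) ->
  (forall t y, CCont (P t) y) ->
  (forall t y, CCont (W t) y) ->
  (forall t y, CCont (fun t => Q t y) t) ->
  CInt (P d) a b - CInt (P c) a b = CInt (fun t => Q t b - Q t a) c d.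
Proof.
  intros HP HQ HW cP cW cQ. symmetry.
  apply (CInt_FTC c d (fun t => CInt (P t) a b)).
  - intros t _. apply (CD_eq _ _ (CInt (W t) a b)).
    + apply CInt_param; auto.
    + apply CInt_FTC; [intros; apply HQ|]. intros y _. apply cW.
  - intros t _. apply CCont_minus; apply cQ.
Qed.

Lemma CInt_bound_const (f : R -> C) (a b M : R) : (a <= b)%R -> CContI a b f ->
  (forall t, (a <= t <= b)%R -> (Cmod (f t) <= M)%R) ->
  (Cmod (CInt f a b) <= (b - a) * M)%R.
Proof.
  intros Hab Hf HM. eapply Rle_trans.
  - apply (CInt_bound a b f (fun _ => M)); auto. apply ex_RInt_const.
  - rewrite RInt_const. unfold scal; simpl; unfold mult; simpl. lra.
Qed.

Lemma is_RInt_exp_decay (c k a b : R) : (0 < k)%R ->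
  is_RInt (fun y => c * exp (- k * y))%R a b (c / k * (exp (- k * a) - exp (- k * b)))%R.
Proof.
  intros Hk.
  evar_last.
  - apply (is_RInt_derive (fun y => - (c / k) * exp (- k * y))%R).
    + intros x _. auto_derive; [trivial|]. field. lra.
    + intros x _. apply: ex_derive_continuous. auto_derive. trivial.
  - unfold minus, plus, opp; simpl. Rring.
Qed.

Lemma CInt_exp_bound (f : R -> C) (c k a b : R) :
  (0 < k)%R -> (a <= b)%R -> (forall y, (a <= y)%R -> CCont f y) ->
  (forall y, (a <= y)%R -> (Cmod (f y) <= c * exp (- k * y))%R) ->
  (Cmod (CInt f a b) <= c / k * (exp (- k * a) - exp (- k * b)))%R.
Proof.
  intros Hk Hab Hc Hb.
  rewrite <- (is_RInt_unique _ _ _ _ (is_RInt_exp_decay c k a b Hk)).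
  apply CInt_bound; [exact Hab| | |eexists; now apply is_RInt_exp_decay].
  - intros t Ht. apply Hc. rewrite Rmin_left in Ht; lra.
  - intros t Ht. apply Hb. lra.
Qed.

(** * Improper integrals *)

(** The improper integral over the half-line, cut at the integers. For an [exp_dominated] integrand
    the pieces are dominated by a geometric series. *)
Definition Cinf (f : R -> C) : C := CSeries (fun n => CInt f (INR n) (INR (S n))).

Definition exp_dominated (f : R -> C) (c k : R) : Prop :=
  (forall y, (0 <= y)%R -> CCont f y) /\
  (forall y, (0 <= y)%R -> (Cmod (f y) <= c * exp (- k * y))%R).

Lemma exp_dominated_pos (f : R -> C) (c k : R) : exp_dominated f c k -> (0 <= c)%R.
Proof.
  intros [_ H]. specialize (H 0%R (Rle_refl _)). rewrite Rmult_0_r, exp_0 in H.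
  generalize (Cmod_ge_0 (f 0%R)). lra.
Qed.

Lemma csum_CInt (f : R -> C) (n : nat) : (forall y, (0 <= y)%R -> CCont f y) ->
  csum (fun n => CInt f (INR n) (INR (S n))) n = CInt f 0 (INR n).
Proof.
  intros H. induction n as [|n IH].
  - simpl. unfold CInt. rewrite !RInt_point. reflexivity.
  - change (csum (fun n => CInt f (INR n) (INR (S n))) n + CInt f (INR n) (INR (S n)) = CInt f 0 (INR (S n))).
    rewrite IH. assert (P := pos_INR n). assert (Q : (INR n <= INR (S n))%R) by (apply le_INR; lia).
    apply CInt_Chasles; intros t Ht; apply H; rewrite Rmin_left in Ht; lra.
Qed.

Lemma Cinf_correct (f : R -> C) (c k : R) : (0 < k)%R -> exp_dominated f c k ->
  Ctends eventually (fun n => CInt f 0 (INR n)) (Cinf f).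
Proof.
  intros Hk H. assert (Hc := exp_dominated_pos f c k H). destruct H as [H1 H2].
  apply (Ctends_ext _ (csum (fun n => CInt f (INR n) (INR (S n))))).
  - intros n. now apply csum_CInt.
  - apply (Csums_dominated _ (fun n => c / k * exp (- k) ^ n)%R).
    + intros n. assert (P := pos_INR n). eapply Rle_trans.
      * apply (CInt_exp_bound f c k); [exact Hk|apply le_INR; lia| |]; intros; [apply H1|apply H2]; lra.
      * apply Rmult_le_compat_l; [apply Rdiv_le_0_compat; lra|].
        assert (E : exp (- k * INR n) = (exp (- k) ^ n)%R).
        { clear. induction n as [|n IH]; [simpl; rewrite Rmult_0_r; apply exp_0|].
          rewrite S_INR, Rmult_plus_distr_l, exp_plus, IH, Rmult_1_r. simpl. ring. }
        rewrite E. generalize (exp_pos (- k * INR (S n))). lra.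
    + apply: ex_series_scal_l. apply ex_series_geom. rewrite Rabs_pos_eq; [|left; apply exp_pos].
      rewrite <- exp_0. apply exp_increasing. lra.
Qed.

Lemma Cinf_bound (f : R -> C) (c k : R) : (0 < k)%R -> exp_dominated f c k ->
  (Cmod (Cinf f) <= c / k)%R.
Proof.
  intros Hk H. assert (Hc := exp_dominated_pos f c k H).
  apply (Ctends_bound _ _ _ _ (Cinf_correct f c k Hk H)).
  exists O. intros n _. destruct H as [H1 H2]. eapply Rle_trans.
  - apply (CInt_exp_bound f c k); [exact Hk|apply pos_INR|exact H1|exact H2].
  - rewrite <- (Rmult_1_r (c / k)) at 2. apply Rmult_le_compat_l; [apply Rdiv_le_0_compat; lra|].
    rewrite Rmult_0_r, exp_0. generalize (exp_pos (- k * INR n)). lra.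
Qed.

Lemma CInt_ext_pos (f g : R -> C) (n : nat) :
  (forall y, (0 <= y)%R -> f y = g y) -> CInt f 0 (INR n) = CInt g 0 (INR n).
Proof.
  intros H. apply CInt_ext. intros t Ht. apply H. rewrite Rmin_left in Ht by apply pos_INR. lra.
Qed.

Lemma Cinf_ext (f g : R -> C) :
  (forall y, (0 <= y)%R -> f y = g y) -> Cinf f = Cinf g.
Proof.
  intros H. apply CSeries_ext. intros n. apply CInt_ext. intros t Ht. apply H.
  assert (P := pos_INR n). rewrite Rmin_left in Ht by (apply le_INR; lia). lra.
Qed.

(** * Integrals against a Gaussian weight *)

(** A class closed under sums and products that contains powers, exponentials and the kernel, and
    whose members become integrable against any Gaussian weight with positive real part. *)
Definition exp_bounded (f : R -> C) : Prop :=
  (forall y, (0 <= y)%R -> CCont f y) /\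
  exists c k : R, (0 <= c)%R /\ (0 <= k)%R /\
    forall y, (0 <= y)%R -> (Cmod (f y) <= c * exp (k * y))%R.

Definition gw (z : C) (y : R) : C := Cexp (- (z * RtoC (y ^ 2))).

Definition GI (f : R -> C) (z : C) : C := Cinf (fun y => f y * gw z y).

Lemma CCont_gw (z : C) (y : R) : CCont (gw z) y.
Proof.
  unfold gw. apply CCont_Cexp.
  apply (CCont_ext (fun y => (- z) * RtoC (y ^ 2))); [intros; ring|].
  apply CCont_mult; [apply CCont_const|]. apply CCont_RtoC.
  apply: ex_derive_continuous. auto_derive. trivial.
Qed.

Lemma Cmod_gw (z : C) (y : R) : Cmod (gw z y) = exp (- (Re z * y ^ 2)).
Proof. unfold gw. rewrite Cmod_Cexp. f_equal. destruct z as [a b]; simpl. ring. Qed.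

(** The maximum over [y] of [exp ((k + 1) y - d y^2)], found by completing the square. The extra [1]
    in [k + 1] pays for the factor [exp (- y)] that is kept in [gauss_decay]. *)
Definition gauss_const (k d : R) : R := exp ((k + 1) ^ 2 / (4 * d)).

Lemma gauss_const_pos (k d : R) : (0 < gauss_const k d)%R.
Proof. apply exp_pos. Qed.

Lemma gauss_decay (k d y : R) : (0 < d)%R ->
  (exp (k * y) * exp (- (d * y ^ 2)) <= gauss_const k d * exp (- 1 * y))%R.
Proof.
  intros Hd. unfold gauss_const. rewrite <- !exp_plus. apply exp_le.
  replace ((k + 1) ^ 2 / (4 * d) + -1 * y)%R with
    (k * y + - (d * y ^ 2) + d * (y - (k + 1) / (2 * d)) ^ 2)%R by (field; lra).
  assert (0 <= d * (y - (k + 1) / (2 * d)) ^ 2)%R; [|lra].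
  apply Rmult_le_pos; [lra|]. apply pow2_ge_0.
Qed.

Lemma gw_dominated (f : R -> C) (c k d : R) (z : C) :
  (0 < d)%R -> (d <= Re z)%R -> (forall y, (0 <= y)%R -> CCont f y) ->
  (forall y, (0 <= y)%R -> (Cmod (f y) <= c * exp (k * y))%R) -> (0 <= c)%R ->
  exp_dominated (fun y => f y * gw z y) (c * gauss_const k d) 1.
Proof.
  intros Hd Hz Hc Hb Hc0. split.
  - intros y Hy. apply CCont_mult; [now apply Hc|apply CCont_gw].
  - intros y Hy. rewrite Cmod_mult, Cmod_gw.
    apply Rle_trans with (c * exp (k * y) * exp (- (d * y ^ 2)))%R.
    + apply Rmult_le_compat; [apply Cmod_ge_0|left; apply exp_pos|now apply Hb|].
      apply exp_le. assert (0 <= y ^ 2)%R by apply pow2_ge_0. nra.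
    + rewrite !Rmult_assoc. apply Rmult_le_compat_l; [exact Hc0|]. now apply gauss_decay.
Qed.

Lemma GI_correct (f : R -> C) (z : C) : exp_bounded f -> (0 < Re z)%R ->
  Ctends eventually (fun n => CInt (fun y => f y * gw z y) 0 (INR n)) (GI f z).
Proof.
  intros [Hc [c [k [Hc0 [Hk Hb]]]]] Hz. eapply Cinf_correct with (k := 1%R); [lra|].
  apply (gw_dominated f c k (Re z)); auto; lra.
Qed.

Lemma GI_ext (f g : R -> C) (z : C) :
  (forall y, (0 <= y)%R -> f y = g y) -> GI f z = GI g z.
Proof. intros H. apply Cinf_ext. intros y Hy. now rewrite H. Qed.

Lemma exp_bounded_const (c : C) : exp_bounded (fun _ => c).
Proof.
  split; [intros; apply CCont_const|]. exists (Cmod c), 0%R.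
  repeat split; [apply Cmod_ge_0|lra|]. intros y _. rewrite Rmult_0_l, exp_0. lra.
Qed.

Lemma exp_bounded_plus (f g : R -> C) :
  exp_bounded f -> exp_bounded g -> exp_bounded (fun y => f y + g y).
Proof.
  intros [F1 [c [k [Hc [Hk Hf]]]]] [G1 [c' [k' [Hc' [Hk' Hg]]]]]. split.
  - intros; apply CCont_plus; auto.
  - exists (c + c')%R, (k + k')%R. repeat split; [lra|lra|]. intros y Hy.
    eapply Rle_trans; [apply Cmod_triangle|].
    assert (A := Hf y Hy). assert (B := Hg y Hy).
    assert (A' : (exp (k * y) <= exp ((k + k') * y))%R) by (apply exp_le; nra).
    assert (B' : (exp (k' * y) <= exp ((k + k') * y))%R) by (apply exp_le; nra).
    nra.
Qed.

Lemma exp_bounded_mult (f g : R -> C) :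
  exp_bounded f -> exp_bounded g -> exp_bounded (fun y => f y * g y).
Proof.
  intros [F1 [c [k [Hc [Hk Hf]]]]] [G1 [c' [k' [Hc' [Hk' Hg]]]]]. split.
  - intros; apply CCont_mult; auto.
  - exists (c * c')%R, (k + k')%R. repeat split; [nra|lra|]. intros y Hy.
    rewrite Cmod_mult, Rmult_plus_distr_r, exp_plus.
    replace (c * c' * (exp (k * y) * exp (k' * y)))%R
      with ((c * exp (k * y)) * (c' * exp (k' * y)))%R by ring.
    apply Rmult_le_compat; auto using Cmod_ge_0.
Qed.

Lemma exp_bounded_bounded (f : R -> C) (c : R) :
  (forall y, (0 <= y)%R -> CCont f y) ->
  (forall y, (0 <= y)%R -> (Cmod (f y) <= c)%R) -> exp_bounded f.
Proof.
  intros Hc Hb. split; [exact Hc|]. exists c, 0%R. repeat split.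
  - eapply Rle_trans; [apply Cmod_ge_0|apply (Hb 0%R); lra].
  - lra.
  - intros y Hy. rewrite Rmult_0_l, exp_0, Rmult_1_r. auto.
Qed.

Lemma exp_bounded_id : exp_bounded (fun y => RtoC y).
Proof.
  split; [intros; apply CCont_id|]. exists 1%R, 1%R. repeat split; [lra|lra|].
  intros y Hy. rewrite Cmod_Rpos by exact Hy. rewrite !Rmult_1_l.
  generalize (exp_ineq1_le y). lra.
Qed.

Lemma exp_bounded_pow (n : nat) : exp_bounded (fun y => RtoC (y ^ n)).
Proof.
  induction n as [|n IH]; [exact (exp_bounded_const 1)|]. simpl.
  assert (E := exp_bounded_mult _ _ exp_bounded_id IH).
  destruct E as [E1 E2]. split.
  - intros y Hy. eapply CCont_ext; [|exact (E1 y Hy)]. intros t; simpl. now rewrite RtoC_mult.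
  - destruct E2 as [c [k [H1 [H2 H3]]]]. exists c, k. repeat split; auto.
    intros y Hy. rewrite RtoC_mult. now apply H3.
Qed.

Lemma exp_bounded_csum (f : nat -> R -> C) (n : nat) :
  (forall k, (k < n)%nat -> exp_bounded (f k)) -> exp_bounded (fun y => csum (fun k => f k y) n).
Proof.
  induction n as [|n IH]; intros H; simpl; [apply exp_bounded_const|].
  apply exp_bounded_plus; [apply IH; intros; apply H; lia|apply H; lia].
Qed.

Lemma exp_bounded_Cexp (w : C) : exp_bounded (fun y => Cexp (w * RtoC y)).
Proof.
  split.
  - intros y _. apply CCont_Cexp, CCont_mult; [apply CCont_const|apply CCont_id].
  - exists 1%R, (Cmod w). repeat split; [lra|apply Cmod_ge_0|]. intros y Hy.
    rewrite Rmult_1_l, Cmod_Cexp. apply exp_le.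
    replace (Re (w * RtoC y)) with (Re w * y)%R by (destruct w; simpl; ring).
    apply Rmult_le_compat_r; [exact Hy|].
    generalize (re_le_Cmod w) (Rle_abs (Re w)). lra.
Qed.

Ltac ebound := lazymatch goal with
  | |- exp_bounded (fun _ => ?c) => exact (exp_bounded_const c)
  | |- exp_bounded (fun y => Cplus (@?f y) (@?g y)) => apply (exp_bounded_plus f g); ebound
  | |- exp_bounded (fun y => Cmult (@?f y) (@?g y)) => apply (exp_bounded_mult f g); ebound
  | |- exp_bounded (fun y => RtoC y) => exact exp_bounded_id
  | |- _ => auto
  end.

Lemma CContI_gw (f : R -> C) (z : C) (n : nat) : exp_bounded f ->
  CContI 0 (INR n) (fun y => f y * gw z y).
Proof.
  intros [H _] t Ht. rewrite Rmin_left in Ht by apply pos_INR.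
  apply CCont_mult; [apply H; lra|apply CCont_gw].
Qed.

Lemma GI_plus (f g : R -> C) (z : C) : exp_bounded f -> exp_bounded g -> (0 < Re z)%R ->
  GI (fun y => f y + g y) z = GI f z + GI g z.
Proof.
  intros Hf Hg Hz. eapply (Ctends_unique eventually).
  - apply GI_correct; [now apply exp_bounded_plus|exact Hz].
  - apply (Ctends_ext eventually (fun n => CInt (fun y => f y * gw z y) 0 (INR n) +
                                           CInt (fun y => g y * gw z y) 0 (INR n))).
    + intros n. rewrite <- CInt_plus by now apply CContI_gw.
      apply CInt_ext_pos. intros; ring.
    + apply (Ctends_plus eventually); now apply GI_correct.
Qed.

Lemma GI_scal (c : C) (f : R -> C) (z : C) : exp_bounded f -> (0 < Re z)%R ->
  GI (fun y => c * f y) z = c * GI f z.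
Proof.
  intros Hf Hz. eapply (Ctends_unique eventually).
  - apply GI_correct; [|exact Hz]. apply exp_bounded_mult; [apply exp_bounded_const|exact Hf].
  - apply (Ctends_ext eventually (fun n => c * CInt (fun y => f y * gw z y) 0 (INR n))).
    + intros n. rewrite <- CInt_scal by now apply CContI_gw.
      apply CInt_ext_pos. intros; ring.
    + apply (Ctends_mult eventually); [apply (Ctends_const eventually)|now apply GI_correct].
Qed.

Lemma GI_minus (f g : R -> C) (z : C) : exp_bounded f -> exp_bounded g -> (0 < Re z)%R ->
  GI (fun y => f y - g y) z = GI f z - GI g z.
Proof.
  intros Hf Hg Hz. transitivity (GI f z + (- (1)) * GI g z); [|ring].
  rewrite <- GI_scal by assumption.
  rewrite <- GI_plus; [apply GI_ext; intros; ring|exact Hf| |exact Hz].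
  apply exp_bounded_mult; [apply exp_bounded_const|exact Hg].
Qed.

Lemma GI_csum (f : nat -> R -> C) (n : nat) (z : C) :
  (forall k, exp_bounded (f k)) -> (0 < Re z)%R ->
  GI (fun y => csum (fun k => f k y) n) z = csum (fun k => GI (f k) z) n.
Proof.
  intros Hf Hz. induction n as [|n IH]; simpl.
  - transitivity (0 * GI (fun _ => 0) z); [|ring].
    rewrite <- GI_scal by (auto using exp_bounded_const). apply GI_ext; intros; ring.
  - rewrite GI_plus, IH; auto. apply exp_bounded_csum; auto.
Qed.

(** The derivative is integrated along the segment from [b] to [a], on which the real part stays
    below [m] by convexity. *)
Lemma Cexp_lipschitz (a b : C) (m : R) : (Re a <= m)%R -> (Re b <= m)%R ->
  (Cmod (Cexp a - Cexp b) <= Cmod (a - b) * exp m)%R.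
Proof.
  intros Ha Hb.
  assert (H : forall t, CD (fun t => Cexp (b + (a - b) * RtoC t)) t ((a - b) * Cexp (b + (a - b) * RtoC t))).
  { intros t. apply CD_Cexp. eapply CD_eq.
    - apply CD_plus; [apply CD_const|]. apply CD_scal, CD_id.
    - ring. }
  assert (E : CInt (fun t => (a - b) * Cexp (b + (a - b) * RtoC t)) 0 1 = Cexp a - Cexp b).
  { rewrite (CInt_FTC 0 1 (fun t => Cexp (b + (a - b) * RtoC t))).
    - f_equal; [f_equal; ring|]. do 2 f_equal. ring.
    - intros t _. apply H.
    - intros t _. apply CCont_mult; [apply CCont_const|]. eapply CD_CCont, H. }
  rewrite <- E. replace (Cmod (a - b) * exp m)%R with ((1 - 0) * (Cmod (a - b) * exp m))%R by ring.
  apply CInt_bound_const; [lra| |].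
  - intros t _. apply CCont_mult; [apply CCont_const|]. eapply CD_CCont, H.
  - intros t Ht. rewrite Cmod_mult, Cmod_Cexp. apply Rmult_le_compat_l; [apply Cmod_ge_0|].
    apply exp_le. destruct a as [a1 a2], b as [b1 b2]; simpl in *. nra.
Qed.

Lemma Cinf_minus (f g : R -> C) (c c' k : R) : (0 < k)%R ->
  exp_dominated f c k -> exp_dominated g c' k ->
  Cinf (fun y => f y - g y) = Cinf f - Cinf g.
Proof.
  intros Hk [F1 F2] [G1 G2].
  assert (D : exp_dominated (fun y => f y - g y) (c + c') k).
  { split; [intros; apply CCont_minus; auto|]. intros y Hy.
    unfold Cminus. eapply Rle_trans; [apply Cmod_triangle|]. rewrite Cmod_opp.
    specialize (F2 y Hy). specialize (G2 y Hy). lra. }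
  eapply (Ctends_unique eventually); [exact (Cinf_correct _ _ _ Hk D)|].
  apply (Ctends_ext eventually (fun n => CInt f 0 (INR n) - CInt g 0 (INR n))).
  - intros n.
    assert (A : CContI 0 (INR n) f) by (intros t Ht; rewrite Rmin_left in Ht by apply pos_INR; apply F1; lra).
    assert (B : CContI 0 (INR n) g) by (intros t Ht; rewrite Rmin_left in Ht by apply pos_INR; apply G1; lra).
    transitivity (CInt f 0 (INR n) + (- (1)) * CInt g 0 (INR n)); [ring|].
    rewrite <- CInt_scal by exact B. rewrite <- CInt_plus.
    + apply CInt_ext. intros; ring.
    + exact A.
    + intros t Ht. apply CCont_mult; [apply CCont_const|now apply B].
  - apply (Ctends_minus eventually); eapply Cinf_correct; try exact Hk; split; eassumption.
Qed.

Lemma GI_dominated (f : R -> C) (z : C) : exp_bounded f -> (0 < Re z)%R ->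
  exists c : R, exp_dominated (fun y => f y * gw z y) c 1.
Proof.
  intros [H1 [c [k [Hc [Hk H2]]]]] Hz. eexists.
  apply (gw_dominated f c k (Re z)); auto; lra.
Qed.

(** Moving the parameter changes the weight by at most [|z - w| y^2 exp (- d y^2)], and [y^2 f]
    still belongs to the class [exp_bounded]. The constant depends only on [f] and [d]. *)
Lemma GI_lipschitz (f : R -> C) (d : R) : (0 < d)%R -> exp_bounded f ->
  exists M : R, (0 <= M)%R /\ forall z w : C, (d <= Re z)%R -> (d <= Re w)%R ->
    (Cmod (GI f z - GI f w) <= M * Cmod (z - w))%R.
Proof.
  intros Hd Hf. destruct (exp_bounded_mult _ _ Hf (exp_bounded_pow 2)) as [H1 [c [k [Hc [Hk H2]]]]].
  exists (c * gauss_const k d)%R. split; [generalize (gauss_const_pos k d); nra|].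
  intros z w Hz Hw.
  destruct (GI_dominated f z Hf) as [cz Dz]; [lra|].
  destruct (GI_dominated f w Hf) as [cw Dw]; [lra|].
  unfold GI. rewrite <- (Cinf_minus _ _ cz cw 1 Rlt_0_1 Dz Dw).
  replace (c * gauss_const k d * Cmod (z - w))%R with (Cmod (z - w) * c * gauss_const k d / 1)%R by field.
  apply Cinf_bound; [lra|]. split.
  - intros y Hy. apply CCont_minus; [now apply Dz|now apply Dw].
  - intros y Hy. replace (f y * gw z y - f y * gw w y) with (f y * (gw z y - gw w y)) by ring.
    rewrite Cmod_mult.
    assert (Y2 : (0 <= y ^ 2)%R) by apply pow2_ge_0.
    assert (L : (Cmod (gw z y - gw w y) <= Cmod (z - w) * y ^ 2 * exp (- (d * y ^ 2)))%R).
    { eapply Rle_trans; [apply (Cexp_lipschitz _ _ (- (d * y ^ 2)))|].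
      - replace (Re (- (z * RtoC (y ^ 2)))) with (- (Re z * y ^ 2))%R by (destruct z; simpl; ring). nra.
      - replace (Re (- (w * RtoC (y ^ 2)))) with (- (Re w * y ^ 2))%R by (destruct w; simpl; ring). nra.
      - apply Rmult_le_compat_r; [left; apply exp_pos|].
        replace (- (z * RtoC (y ^ 2)) - - (w * RtoC (y ^ 2))) with (- ((z - w) * RtoC (y ^ 2))) by ring.
        rewrite Cmod_opp, Cmod_mult, Cmod_Rpos by exact Y2. lra. }
    specialize (H2 y Hy). rewrite Cmod_mult, Cmod_Rpos in H2 by exact Y2.
    assert (G := gauss_decay k d y Hd).
    assert (E0 := exp_pos (- (d * y ^ 2))). assert (M0 := Cmod_ge_0 (z - w)). assert (F0 := Cmod_ge_0 (f y)).
    apply Rle_trans with (Cmod (z - w) * ((Cmod (f y) * y ^ 2) * exp (- (d * y ^ 2))))%R.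
    { replace (Cmod (z - w) * (Cmod (f y) * y ^ 2 * exp (- (d * y ^ 2))))%R
        with (Cmod (f y) * (Cmod (z - w) * y ^ 2 * exp (- (d * y ^ 2))))%R by ring.
      now apply Rmult_le_compat_l. }
    rewrite !Rmult_assoc. apply Rmult_le_compat_l; [exact M0|].
    apply Rle_trans with (c * exp (k * y) * exp (- (d * y ^ 2)))%R.
    + rewrite <- (Rmult_assoc (Cmod (f y))). apply Rmult_le_compat_r; lra.
    + rewrite Rmult_assoc. apply Rmult_le_compat_l; [exact Hc|exact G].
Qed.

(** Used with [z] a positive real number, which is where the rotated parameter goes when [w] reaches
    the positive real axis. *)
Lemma GI_continuous {T : Type} (F : (T -> Prop) -> Prop) {FF : Filter F}
    (f : R -> C) (h : T -> C) (z : C) : exp_bounded f -> (0 < Re z)%R ->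
  Ctends F h z -> Ctends F (fun x => GI f (h x)) (GI f z).
Proof.
  intros Hf Hz Hh. destruct (GI_lipschitz f (Re z / 2)) as [M [HM H]]; [lra|exact Hf|].
  intros eps He. set (r := Rmin (Re z / 2) (eps / (M + 1))).
  assert (Hr : (0 < r)%R).
  { apply Rmin_glb_lt; [lra|]. apply Rdiv_lt_0_compat; lra. }
  generalize (Hh r Hr). apply filter_imp. intros x Hx.
  assert (R1 : (r <= Re z / 2)%R) by apply Rmin_l.
  assert (R2 : (r <= eps / (M + 1))%R) by apply Rmin_r.
  eapply Rle_lt_trans; [apply H; [|lra]|].
  - assert (A := re_le_Cmod (h x - z)). simpl in A. apply Rabs_le_between in A.
    unfold Re in *. lra.
  - apply Rle_lt_trans with (M * r)%R; [apply Rmult_le_compat_l; lra|].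
    assert (r * (M + 1) <= eps)%R; [|nra].
    replace eps with (eps / (M + 1) * (M + 1))%R by (field; lra).
    apply Rmult_le_compat_r; lra.
Qed.

(** * Taylor expansion and real-analyticity in the Gaussian parameter *)

Fixpoint exp_partial (u : R) (n : nat) : R :=
  match n with O => 0 | S k => exp_partial u k + u ^ k / INR (fact k) end.

Lemma exp_partial_0 (n : nat) : exp_partial 0 (S n) = 1%R.
Proof.
  induction n as [|n IH]; [simpl; field|].
  change (exp_partial 0 (S n) + 0 ^ S n / INR (fact (S n)) = 1)%R.
  rewrite IH, pow_i by lia. unfold Rdiv. ring.
Qed.

Lemma is_derive_exp_partial (c u : R) (n : nat) :
  is_derive (fun u => exp_partial (c * u) (S n)) u (c * exp_partial (c * u) n)%R.
Proof.
  induction n as [|n IH].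
  - apply (is_derive_ext (fun _ => 1%R)); [intros; simpl; field|].
    simpl. rewrite Rmult_0_r. exact (is_derive_const (V := R_NormedModule) _ u).
  - change (is_derive (fun u => exp_partial (c * u) (S n) + (c * u) ^ (S n) / INR (fact (S n)))%R u
       (c * (exp_partial (c * u) n + (c * u) ^ n / INR (fact n)))%R).
    rewrite Rmult_plus_distr_l.
    apply: is_derive_plus; [exact IH|].
    auto_derive; [trivial|].
    change (c * 1 * (INR (S n) * (c * u) ^ n) * / INR (S n * fact n) = c * ((c * u) ^ n / INR (fact n)))%R.
    rewrite mult_INR.
    field. split; [apply INR_fact_neq_0|apply not_0_INR; lia].
Qed.

(* The weight [exp (2u)] doubles under differentiation, which produces the
   geometric factor [2^-n] by induction. *)
Lemma exp_partial_bound (n : nat) : forall (e : R), (e = 1 \/ e = -1)%R ->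
  forall u, (0 <= u)%R ->
  (Rabs (exp (e * u) - exp_partial (e * u) n) <= (/ 2) ^ n * exp (2 * u))%R.
Proof.
  induction n as [|n IH]; intros e He u Hu.
  - simpl. rewrite Rminus_0_r, Rmult_1_l, Rabs_pos_eq by (left; apply exp_pos).
    apply exp_le. destruct He; subst; lra.
  - assert (H : forall s, (s = 1 \/ s = -1)%R ->
        (s * (exp (e * u) - exp_partial (e * u) (S n)) <= (/ 2) ^ (S n) * exp (2 * u))%R).
    { intros s Hs.
      set (D := fun u => ((/ 2) ^ (S n) * exp (2 * u) - s * (exp (e * u) - exp_partial (e * u) (S n)))%R).
      assert (Dd : forall v, is_derive D v ((/ 2) ^ n * exp (2 * v) - s * e * (exp (e * v) - exp_partial (e * v) n))%R).
      { intros v. unfold D.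
        assert (A1 : is_derive (fun u => (/ 2) ^ (S n) * exp (2 * u))%R v ((/ 2) ^ n * exp (2 * v))%R)
          by (auto_derive; [trivial|simpl; field]).
        assert (A2 : is_derive (fun u => exp (e * u)) v (e * exp (e * v))%R)
          by (auto_derive; [trivial|ring]).
        assert (A3 := is_derive_minus _ _ _ _ _ A2 (is_derive_exp_partial e v n)).
        assert (A4 := is_derive_scal _ v s _ A3).
        assert (A5 := is_derive_minus _ _ _ _ _ A1 A4).
        evar_last; [exact A5|]. unfold minus, plus, opp; simpl. Rring. }
      assert (D0 : (0 <= D 0)%R).
      { unfold D. rewrite !Rmult_0_r, exp_0, exp_partial_0, Rminus_diag, Rmult_0_r, Rminus_0_r, Rmult_1_r.
        apply pow_le. lra. }
      assert (Du : (D 0 <= D u)%R).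
      { destruct (MVT_gen D 0 u (fun v => ((/ 2) ^ n * exp (2 * v) - s * e * (exp (e * v) - exp_partial (e * v) n))%R)) as [c [Hc Ec]].
        - intros v _. apply Dd.
        - intros v _. apply continuity_pt_filterlim. apply: ex_derive_continuous. eexists; apply Dd.
        - rewrite Rmin_left, Rmax_right in Hc by lra.
          assert (B := IH e He c (proj1 Hc)). apply Rabs_le_between in B.
          assert (0 <= (/ 2) ^ n * exp (2 * c) - s * e * (exp (e * c) - exp_partial (e * c) n))%R.
          { destruct He, Hs; subst; lra. }
          nra. }
      unfold D in Du, D0. unfold D in *. lra. }
    apply Rabs_le. split; [generalize (H (-1)%R (or_intror eq_refl))|generalize (H 1%R (or_introl eq_refl))]; lra.
Qed.

Lemma exp_partial_error (u : R) (n : nat) :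
  (Rabs (exp u - exp_partial u n) <= (/ 2) ^ n * exp (2 * Rabs u))%R.
Proof.
  destruct (Rle_dec 0 u) as [H|H].
  - rewrite (Rabs_pos_eq u H). generalize (exp_partial_bound n 1 (or_introl eq_refl) u H).
    now rewrite Rmult_1_l.
  - rewrite (Rabs_left u) by lra. generalize (exp_partial_bound n (-1) (or_intror eq_refl) (- u)).
    replace (-1 * - u)%R with u by ring. intros A. apply A. lra.
Qed.

Lemma Csums_is_series (a : nat -> C) (l : C) :
  Csums a l -> is_series (K := R_AbsRing) (V := C_R_NormedModule) a l.
Proof.
  intros H. apply (Ctends_filterlim eventually).
  apply Csums_S in H. revert H. apply (Ctends_ext eventually). intros n.
  induction n as [|n IH].
  - rewrite sum_O. simpl. ring.
  - rewrite sum_Sn, <- IH. reflexivity.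
Qed.

Definition analytic_at (G : R -> C) (x0 : R) : Prop :=
  exists (a : nat -> C) (r : R), (0 < r)%R /\
    forall x : R, (Rabs (x - x0) < r)%R -> Csums (fun k => RtoC ((x - x0) ^ k) * a k) (G x).

Lemma Csums_is_pseries (a : nat -> C) (h : R) (l : C) :
  Csums (fun k => RtoC (h ^ k) * a k) l ->
  is_pseries (K := R_AbsRing) (V := C_R_NormedModule) a h l.
Proof.
  intros S. apply Csums_is_series in S. revert S. apply is_series_ext. intros n.
  transitivity (scal (V := C_R_ModuleSpace) (h ^ n)%R (a n)); [symmetry; apply scal_R_Cmult|].
  reflexivity.
Qed.

Lemma CCont_exp_partial (h y : R) (n : nat) :
  CCont (fun y => RtoC (exp_partial (- h * y ^ 2) n)) y.
Proof.
  apply CCont_RtoC. induction n as [|n IH]; [apply continuous_const|].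
  simpl. apply: (continuous_plus (V := R_NormedModule)); [exact IH|].
  apply: ex_derive_continuous. auto_derive. trivial.
Qed.

Lemma exp_partial_csum (h y : R) (n : nat) :
  RtoC (exp_partial (- h * y ^ 2) n) =
  csum (fun k => RtoC (h ^ k) * RtoC ((- y ^ 2) ^ k / INR (fact k))) n.
Proof.
  induction n as [|n IH]; [reflexivity|].
  change (RtoC (exp_partial (- h * y ^ 2) n + (- h * y ^ 2) ^ n / INR (fact n)) =
    csum (fun k => RtoC (h ^ k) * RtoC ((- y ^ 2) ^ k / INR (fact k))) n +
    RtoC (h ^ n) * RtoC ((- y ^ 2) ^ n / INR (fact n))).
  rewrite <- IH, RtoC_plus, <- RtoC_mult. do 2 f_equal.
  replace (- h * y ^ 2)%R with (h * (- y ^ 2))%R by ring. rewrite Rpow_mult_distr. unfold Rdiv. ring.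
Qed.

Lemma exp_bounded_monomial (k : nat) : exp_bounded (fun y => RtoC ((- y ^ 2) ^ k / INR (fact k))).
Proof.
  assert (E := exp_bounded_mult _ _ (exp_bounded_const (RtoC ((-1) ^ k / INR (fact k)))) (exp_bounded_pow (2 * k))).
  assert (Q : forall y, RtoC ((-1) ^ k / INR (fact k)) * RtoC (y ^ (2 * k)) = RtoC ((- y ^ 2) ^ k / INR (fact k))).
  { intros y. rewrite <- RtoC_mult. f_equal. rewrite pow_mult.
    replace (- y ^ 2)%R with (-1 * y ^ 2)%R by ring. rewrite Rpow_mult_distr. unfold Rdiv. ring. }
  destruct E as [E1 [c [l [E2 [E3 E4]]]]]. split.
  - intros y Hy. eapply CCont_ext; [|exact (E1 y Hy)]. intros t; apply Q.
  - exists c, l. repeat split; auto. intros y Hy. rewrite <- Q. auto.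
Qed.

(** With [h = x - x0], expanding [exp (- h y^2)] under the integral gives the coefficients. The
    Taylor remainder is at most [2^-n exp (2 |h| y^2)], so the partial sums converge geometrically
    as soon as the Gaussian at [x0] absorbs the growing factor. *)
Lemma GI_real_analytic (f : R -> C) (x0 : R) : exp_bounded f -> (0 < x0)%R ->
  analytic_at (fun x => GI f (RtoC x)) x0.
Proof.
  intros Hf Hx0.
  set (a := fun k => GI (fun y => RtoC ((- y ^ 2) ^ k / INR (fact k)) * f y) (RtoC x0)).
  (* For [|h| < x0 / 4] the remainder grows at most like [exp (x0 / 2 y^2)], which leaves half of
     the decay [exp (- x0 y^2)]. *)
  exists a, (x0 / 4)%R. split; [lra|]. intros x Hx. set (h := (x - x0)%R) in *.
  assert (Hx' : (0 < x)%R) by (apply Rabs_lt_between in Hx; unfold h in Hx; lra).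
  destruct Hf as [Hc [c [k [Hc0 [Hk Hb]]]]].
    assert (Hf : exp_bounded f) by (split; [exact Hc|now exists c, k]).
    set (M := (c * gauss_const k (x0 / 2))%R).
    assert (E : forall n, csum (fun k => RtoC (h ^ k) * a k) n =
              GI (fun y => RtoC (exp_partial (- h * y ^ 2) n) * f y) (RtoC x0)).
    { intros n. transitivity (GI (fun y => csum (fun k => RtoC (h ^ k) * (RtoC ((- y ^ 2) ^ k / INR (fact k)) * f y)) n) (RtoC x0)).
      - rewrite GI_csum; [| |exact Hx0].
        + apply csum_ext. intros j _. symmetry. apply GI_scal; [|exact Hx0].
          apply exp_bounded_mult; [apply exp_bounded_monomial|exact Hf].
        + intros j. apply exp_bounded_mult; [apply exp_bounded_const|].
          apply exp_bounded_mult; [apply exp_bounded_monomial|exact Hf].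
      - apply GI_ext. intros y _. rewrite exp_partial_csum, <- csum_mult_r.
        apply csum_ext. intros; ring. }
    intros eps He.
    assert (L : is_lim_seq (fun n => M * (/ 2) ^ n)%R 0).
    { replace (Finite 0) with (Rbar_mult M 0) by (simpl; f_equal; ring).
      apply is_lim_seq_scal_l. apply is_lim_seq_geom. rewrite Rabs_pos_eq; lra. }
    apply is_lim_seq_spec in L. destruct (L (mkposreal _ He)) as [n0 Hn0].
    exists n0. intros n Hn. specialize (Hn0 n Hn). simpl in Hn0.
    rewrite Rminus_0_r in Hn0. eapply Rle_lt_trans; [|eapply Rle_lt_trans; [apply Rle_abs|exact Hn0]].
    rewrite E. destruct (GI_dominated f (RtoC x) Hf Hx') as [c1 D1].
    destruct (GI_dominated (fun y => RtoC (exp_partial (- h * y ^ 2) n) * f y) (RtoC x0)) as [c2 D2].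
    { assert (Q : exp_bounded (fun y => csum (fun k => RtoC (h ^ k) * (RtoC ((- y ^ 2) ^ k / INR (fact k)))) n)).
      { apply exp_bounded_csum. intros j _. apply exp_bounded_mult; [apply exp_bounded_const|apply exp_bounded_monomial]. }
      apply exp_bounded_mult; [|exact Hf]. destruct Q as [Q1 [cq [kq [Q2 [Q3 Q4]]]]].
      split; [intros; apply CCont_exp_partial|]. exists cq, kq. repeat split; auto.
      intros y Hy. rewrite exp_partial_csum. auto. }
    { exact Hx0. }
    rewrite Cmod_minus_sym. unfold GI. rewrite <- (Cinf_minus _ _ c1 c2 1 Rlt_0_1 D1 D2).
    replace (M * (/ 2) ^ n)%R with (M * (/ 2) ^ n / 1)%R by field.
    apply Cinf_bound; [lra|]. split.
    - intros y Hy. apply CCont_minus; [now apply D1|now apply D2].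
    - intros y Hy.
      assert (G : gw (RtoC x) y = gw (RtoC x0) y * RtoC (exp (- h * y ^ 2))).
      { rewrite <- Cexp_RtoC. unfold gw. rewrite <- Cexp_plus. f_equal.
        rewrite <- !RtoC_mult, <- !RtoC_opp, <- RtoC_plus. f_equal. unfold h. ring. }
      rewrite G.
      replace (f y * (gw (RtoC x0) y * RtoC (exp (- h * y ^ 2))) -
               RtoC (exp_partial (- h * y ^ 2) n) * f y * gw (RtoC x0) y)
        with (f y * gw (RtoC x0) y * RtoC (exp (- h * y ^ 2) - exp_partial (- h * y ^ 2) n))
        by (rewrite RtoC_minus; ring).
      rewrite !Cmod_mult, Cmod_gw, Cmod_R. change (Re (RtoC x0)) with x0.
      assert (B := exp_partial_error (- h * y ^ 2) n).
      assert (Y2 : (0 <= y ^ 2)%R) by apply pow2_ge_0.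
      assert (B' : (exp (2 * Rabs (- h * y ^ 2)) <= exp (x0 / 2 * y ^ 2))%R).
      { apply exp_le. rewrite Rabs_mult, Rabs_Ropp, (Rabs_pos_eq (y ^ 2)) by exact Y2. nra. }
      assert (P2 : (0 <= (/ 2) ^ n)%R) by (apply pow_le; lra).
      apply Rle_trans with (c * exp (k * y) * exp (- (x0 * y ^ 2)) * ((/ 2) ^ n * exp (x0 / 2 * y ^ 2)))%R.
      { apply Rmult_le_compat.
        - apply Rmult_le_pos; [apply Cmod_ge_0|left; apply exp_pos].
        - apply Rabs_pos.
        - apply Rmult_le_compat_r; [left; apply exp_pos|auto].
        - eapply Rle_trans; [exact B|]. now apply Rmult_le_compat_l. }
      assert (X : (exp (- (x0 * y ^ 2)) * exp (x0 / 2 * y ^ 2) = exp (- (x0 / 2 * y ^ 2)))%R).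
      { rewrite <- exp_plus. f_equal. field. }
      replace (c * exp (k * y) * exp (- (x0 * y ^ 2)) * ((/ 2) ^ n * exp (x0 / 2 * y ^ 2)))%R
        with (c * (/ 2) ^ n * (exp (k * y) * (exp (- (x0 * y ^ 2)) * exp (x0 / 2 * y ^ 2))))%R by ring.
      rewrite X.
      replace (M * (/ 2) ^ n * exp (- (1) * y))%R with
        (c * (/ 2) ^ n * (gauss_const k (x0 / 2) * exp (- (1) * y)))%R by (unfold M; ring).
      apply Rmult_le_compat_l; [now apply Rmult_le_pos|]. apply gauss_decay. lra.
Qed.

(** * Rotation of the contour and Gaussian integrals *)

Lemma Cmod_tends_0 (u : nat -> C) (g : nat -> R) :
  (forall n, (Cmod (u n) <= g n)%R) -> is_lim_seq g 0 -> Ctends eventually u 0.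
Proof.
  intros H L eps He. apply is_lim_seq_spec in L. destruct (L (mkposreal _ He)) as [N HN].
  exists N. intros n Hn. specialize (HN n Hn). simpl in HN. specialize (H n).
  replace (u n - 0) with (u n) by ring. rewrite Rminus_0_r in HN.
  generalize (Rle_abs (g n)). lra.
Qed.

Lemma is_lim_seq_exp_neg (c : R) : is_lim_seq (fun n => c * exp (- 1 * INR n))%R 0.
Proof.
  replace (Finite 0) with (Rbar_mult c 0) by (simpl; f_equal; ring).
  apply is_lim_seq_scal_l.
  apply (is_lim_seq_ext (fun n => (exp (-1)) ^ n)%R).
  - intros n. induction n as [|n IH]; [simpl; rewrite Rmult_0_r, exp_0; reflexivity|].
    rewrite S_INR, Rmult_plus_distr_l, exp_plus, <- IH, Rmult_1_r. simpl. ring.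
  - apply is_lim_seq_geom. rewrite Rabs_pos_eq by (left; apply exp_pos).
    rewrite <- exp_0. apply exp_increasing. lra.
Qed.

Definition omega : C := Cexp (Ci * RtoC (PI / 4)).

Lemma Cmod_omega : Cmod omega = 1%R.
Proof. apply Cmod_Cexp_Ci. Qed.

(** The half-line Fourier integral of [y^nu exp (- s y^2)] at frequency [b]. *)
Definition hint (nu : nat) (b : R) (s : C) : C :=
  GI (fun y => RtoC (y ^ nu) * Cexp (Ci * RtoC b * RtoC y)) s.

(** On the ray of angle [t] the weight has parameter [s exp (2 i t)], with [exp (2 i t)] on the
    quarter circle from [1] to [i]. Since [cos + sin >= 1] there, its real part is at least the
    smaller of its two extreme values. The frequency [b >= 0] only helps. *)
Lemma rotation_phase (b : R) (s : C) (t y : R) :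
  (0 <= b)%R -> (0 <= y)%R -> (0 <= t <= PI / 4)%R ->
  (0 < Re s)%R -> (0 < Re (Ci * s))%R ->
  (Re (Ci * RtoC b * RtoC y * Cexp (Ci * RtoC t) - s * RtoC (y ^ 2) * Cexp (Ci * RtoC (2 * t)))
   <= - (Rmin (Re s) (Re (Ci * s)) * y ^ 2))%R.
Proof.
  intros Hb Hy Ht H1 H2. rewrite !Cexp_Ci. set (d := Rmin _ _).
  destruct s as [s1 s2].
  replace (Re _) with (- (b * y * sin t) - (y ^ 2) * (s1 * cos (2 * t) - s2 * sin (2 * t)))%R
    by (unfold Re, Im, Ci, RtoC; simpl; ring).
  assert (d1 : (d <= s1)%R) by apply Rmin_l.
  assert (d2 : (d <= - s2)%R).
  { eapply Rle_trans; [apply Rmin_r|]. simpl. lra. }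
  assert (d0 : (0 < d)%R).
  { apply Rmin_glb_lt; assumption. }
  assert (HP := PI_RGT_0).
  assert (S0 : (0 <= sin t)%R) by (apply sin_ge_0; lra).
  assert (S2 : (0 <= sin (2 * t))%R) by (apply sin_ge_0; lra).
  assert (C2 : (0 <= cos (2 * t))%R) by (apply cos_ge_0; lra).
  assert (X : (1 <= cos (2 * t) + sin (2 * t))%R).
  { generalize (sin2_cos2 (2 * t)). unfold Rsqr. intros. nra. }
  assert (Y2 : (0 <= y ^ 2)%R) by apply pow2_ge_0.
  assert (0 <= b * y * sin t)%R by (apply Rmult_le_pos; [now apply Rmult_le_pos|exact S0]).
  assert (d <= s1 * cos (2 * t) - s2 * sin (2 * t))%R by nra.
  nra.
Qed.

Ltac ccont := lazymatch goal with
  | |- CCont (fun _ => ?c) _ => exact (CCont_const c _)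
  | |- CCont (fun t => Cplus (@?f t) (@?g t)) _ => apply (CCont_plus f g); ccont
  | |- CCont (fun t => Cminus (@?f t) (@?g t)) _ => apply (CCont_minus f g); ccont
  | |- CCont (fun t => Cmult (@?f t) (@?g t)) _ => apply (CCont_mult f g); ccont
  | |- CCont (fun t => Cexp (@?f t)) _ => apply (CCont_Cexp f); ccont
  | |- CCont (fun t => RtoC (@?f t)) _ =>
      apply (CCont_RtoC f); apply: ex_derive_continuous; auto_derive; trivial
  | |- _ => auto
  end.

Ltac ccont2 := lazymatch goal with
  | |- CCont2 (fun _ _ => ?c) _ _ => exact (CCont2_const c _ _)
  | |- CCont2 (fun t y => Cplus (@?f t y) (@?g t y)) _ _ => apply (CCont2_plus f g); ccont2
  | |- CCont2 (fun t y => Cmult (@?f t y) (@?g t y)) _ _ => apply (CCont2_mult f g); ccont2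
  | |- CCont2 (fun t y => Cexp (@?f t y)) _ _ => apply (CCont2_Cexp f); ccont2
  | |- CCont2 (fun t _ => @?f t) _ _ => apply (CCont2_l f); ccont
  | |- CCont2 (fun _ y => @?f y) _ _ => apply (CCont2_r f); ccont
  | |- _ => auto
  end.

(** Cauchy's theorem on a circular sector of angle [pi / 4], written in polar coordinates
    [z = y exp (i t)] so that it becomes the vanishing of a closed form around a rectangle. At angle
    [pi / 4] the parameter [s] has become [i s]. *)
Lemma hint_rotation (nu : nat) (b : R) (s : C) :
  (0 <= b)%R -> (0 < Re s)%R -> (0 < Re (Ci * s))%R ->
  hint nu b s = (omega ^ (S nu))%C *
    GI (fun y => RtoC (y ^ nu) * Cexp (Ci * RtoC b * omega * RtoC y)) (Ci * s).
Proof.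
  intros Hb Hs1 Hs2.
  (* The phase [exp (i (nu + 1) t)] collects [nu] factors from [z^nu] and one from [dz] along the
     ray. *)
  remember (INR (S nu)) as kk eqn:Ekk.
  set (E := fun t y : R => Cexp (Ci * RtoC (kk * t) +
     (Ci * RtoC b * RtoC y * Cexp (Ci * RtoC t) + (- s) * RtoC (y ^ 2) * Cexp (Ci * RtoC (2 * t))))).
  set (P := fun t y : R => RtoC (y ^ nu) * E t y).
  set (Q := fun t y : R => Ci * RtoC (y ^ S nu) * E t y).
  set (W := fun t y : R => (Ci * RtoC (kk) + (Ci * RtoC b * RtoC y * (Ci * Cexp (Ci * RtoC t)) +
     (- s) * RtoC (y ^ 2) * (2 * Ci * Cexp (Ci * RtoC (2 * t))))) * (RtoC (y ^ nu) * E t y)).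
  assert (cE : forall t y, CCont (E t) y) by (intros; unfold E; ccont).
  assert (cE' : forall t y, CCont (fun t => E t y) t) by (intros; unfold E; ccont).
  assert (cE2 : forall t y, CCont2 E t y) by (intros; unfold E; ccont2).
  assert (dEt : forall t y, CD (fun t => E t y) t ((Ci * RtoC (kk) + (Ci * RtoC b * RtoC y * (Ci * Cexp (Ci * RtoC t)) +
     (- s) * RtoC (y ^ 2) * (2 * Ci * Cexp (Ci * RtoC (2 * t))))) * E t y)).
  { intros t y. unfold E. apply CD_Cexp. apply CD_plus.
    - apply CD_scal, CD_RtoC. auto_derive; [trivial|ring].
    - apply CD_plus; apply CD_scal.
      + eapply CD_eq; [apply CD_Cexp, CD_scal, CD_id|]. cbv beta; ring.
      + eapply CD_eq; [apply CD_Cexp, CD_scal, (CD_RtoC _ _ 2%R)|].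
        * auto_derive; [trivial|ring].
        * cbv beta; ring. }
  assert (dEy : forall t y, CD (E t) y ((Ci * RtoC b * Cexp (Ci * RtoC t) +
     (- s) * RtoC (2 * y) * Cexp (Ci * RtoC (2 * t))) * E t y)).
  { intros t y. unfold E. apply CD_Cexp.
    eapply CD_eq; [apply CD_plus; [apply CD_const|apply CD_plus]|].
    - apply CD_mult; [apply CD_scal, CD_id|apply CD_const].
    - apply CD_mult; [apply CD_scal, (CD_RtoC _ _ (2 * y)%R)|apply CD_const].
      auto_derive; [trivial|ring].
    - cbv beta; ring. }
  assert (Hcf : forall n : nat, CInt (P (PI / 4)%R) 0 (INR n) - CInt (P 0) 0 (INR n) =
      CInt (fun t => Q t (INR n) - Q t 0) 0 (PI / 4)).
  { intros n. apply (closed_form_rectangle P Q W).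
    - intros t y. unfold P, W. eapply CD_eq; [apply CD_scal, dEt|]. cbv beta; ring.
    - intros t y. unfold Q, W. eapply CD_eq.
      + apply CD_mult; [apply CD_scal, (CD_RtoC _ _ (kk * y ^ nu)%R)|apply dEy].
        evar_last; [apply: is_derive_pow; apply: is_derive_id|].
        rewrite Ekk. change (Init.Nat.pred (S nu)) with nu. unfold one; simpl. Rring.
      + rewrite <- tech_pow_Rmult, !RtoC_mult, !RtoC_pow. simpl. ring.
    - intros t y. unfold W. ccont2.
    - intros t y. unfold P. ccont.
    - intros t y. unfold W. ccont.
    - intros t y. unfold Q. ccont. }
  set (d := Rmin (Re s) (Re (Ci * s))).
  assert (Hd : (0 < d)%R) by (now apply Rmin_glb_lt).
  destruct (exp_bounded_pow (S nu)) as [_ [c [k [Hc [Hk Hpow]]]]].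
  assert (HQ : forall t y, (0 <= t <= PI / 4)%R -> (0 <= y)%R -> (Cmod (Q t y) <= c * gauss_const k d * exp (- 1 * y))%R).
  { intros t y Ht Hy. unfold Q, E. rewrite !Cmod_mult, Cmod_Ci, Rmult_1_l, Cmod_Cexp.
    specialize (Hpow y Hy).
    assert (B := rotation_phase b s t y Hb Hy Ht Hs1 Hs2). fold d in B.
    assert (X : (exp (Re (Ci * RtoC (kk * t) + (Ci * RtoC b * RtoC y * Cexp (Ci * RtoC t) +
      (- s) * RtoC (y ^ 2) * Cexp (Ci * RtoC (2 * t))))) <= exp (- (d * y ^ 2)))%R).
    { apply exp_le. eapply Rle_trans; [|exact B]. right.
      replace ((- s) * RtoC (y ^ 2) * Cexp (Ci * RtoC (2 * t))) with (- (s * RtoC (y ^ 2) * Cexp (Ci * RtoC (2 * t)))) by ring.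
      unfold Cminus. set (u := _ + - _). simpl Re. unfold Re; simpl. ring. }
    assert (G := gauss_decay k d y Hd). assert (E0 := exp_pos (- (d * y ^ 2))).
    apply Rle_trans with (c * exp (k * y) * exp (- (d * y ^ 2)))%R.
    - apply Rmult_le_compat; [apply Cmod_ge_0|left; apply exp_pos|exact Hpow|exact X].
    - rewrite !Rmult_assoc. now apply Rmult_le_compat_l. }
  assert (HPI := PI_RGT_0).
  (* The difference between the two rays is the integral over the arc of radius [n], small by
     [rotation_phase]. The arc of radius [0] contributes nothing, owing to the factor [y^(nu + 1)]
     in [Q]. *)
  assert (L0 : Ctends eventually (fun n => CInt (P (PI / 4)%R) 0 (INR n) - CInt (P 0) 0 (INR n)) 0).
  { apply (Cmod_tends_0 _ (fun n => PI / 4 * (c * gauss_const k d) * exp (- 1 * INR n))%R); [|apply is_lim_seq_exp_neg].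
    intros n. rewrite Hcf. replace (PI / 4 * (c * gauss_const k d) * exp (-1 * INR n))%R
      with ((PI / 4 - 0) * (c * gauss_const k d * exp (-1 * INR n)))%R by ring.
    apply CInt_bound_const; [lra| |].
    - intros t _. unfold Q. ccont.
    - intros t Ht. assert (Z0 : Q t 0 = 0) by (unfold Q; rewrite pow_i by lia; ring).
      rewrite Z0. replace (Q t (INR n) - 0) with (Q t (INR n)) by ring. apply HQ; [lra|apply pos_INR]. }
  assert (eb : forall w, exp_bounded (fun y => RtoC (y ^ nu) * Cexp (w * RtoC y)))
    by (intros w; apply exp_bounded_mult; [apply exp_bounded_pow|apply exp_bounded_Cexp]).
  assert (L1 : Ctends eventually (fun n => CInt (P (PI / 4)%R) 0 (INR n))
     ((omega ^ (S nu))%C * GI (fun y => RtoC (y ^ nu) * Cexp (Ci * RtoC b * omega * RtoC y)) (Ci * s))).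
  { rewrite <- GI_scal by auto.
    eapply (Ctends_ext eventually); [|apply GI_correct; [|exact Hs2]].
    - intros n. apply CInt_ext_pos. intros y _. unfold P, E, gw.
      replace (Cexp (Ci * RtoC (2 * (PI / 4)))) with Ci
        by (replace (2 * (PI / 4))%R with (PI / 2)%R by field; rewrite Cexp_Ci, cos_PI2, sin_PI2; reflexivity).
      rewrite !Cexp_plus. fold omega. unfold omega at 1. rewrite Cexp_pow, <- Ekk.
      replace (RtoC (kk) * (Ci * RtoC (PI / 4))) with (Ci * RtoC (kk * (PI / 4))) by (rewrite RtoC_mult; ring).
      replace (Ci * RtoC b * omega * RtoC y) with (Ci * RtoC b * RtoC y * omega) by ring.
      replace (- (Ci * s * RtoC (y ^ 2))) with ((- s) * RtoC (y ^ 2) * Ci) by ring. ring.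
    - apply exp_bounded_mult; [apply exp_bounded_const|apply eb]. }
  assert (L2 : Ctends eventually (fun n => CInt (P 0) 0 (INR n)) (hint nu b s)).
  { eapply (Ctends_ext eventually); [|apply GI_correct; [apply eb|exact Hs1]].
    intros n. apply CInt_ext_pos. intros y _. unfold P, E, gw.
    rewrite !Rmult_0_r. replace (Ci * RtoC 0) with (RtoC 0) by ring. rewrite Cexp_0.
    rewrite <- Cmult_assoc, <- Cexp_plus. do 2 f_equal. ring. }
  assert (U := Ctends_unique _ _ _ _ L0 (Ctends_minus _ _ _ _ _ L1 L2)).
  apply Ceq_minus.
  transitivity (- ((omega ^ S nu)%C * GI (fun y => RtoC (y ^ nu) * Cexp (Ci * RtoC b * omega * RtoC y)) (Ci * s) - hint nu b s)); [ring|].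
  rewrite <- U. ring.
Qed.

Lemma exp_bounded_hint (nu : nat) (w : C) : exp_bounded (fun y => RtoC (y ^ nu) * Cexp (w * RtoC y)).
Proof. apply exp_bounded_mult; [apply exp_bounded_pow|apply exp_bounded_Cexp]. Qed.

(* The shifted Gaussians at [y + t c] and [y - t c], [c = - i b / (2 s)], are
   added so that the boundary term at [y = 0] vanishes. *)
Lemma hint_Gauss_0 (b : R) (s : C) : (0 < Re s)%R ->
  hint 0 b s + hint 0 (- b) s = 2 * GI (fun _ => 1) s * Cexp (- (RtoC (b ^ 2) / (4 * s))).
Proof.
  intros Hs. assert (Hs0 : s <> 0) by (intros H; rewrite H in Hs; simpl in Hs; lra).
  set (c := - (Ci * RtoC b / (2 * s))). set (kap := RtoC (b ^ 2) / (4 * s)).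
  set (E := fun (e t y : R) => Cexp ((- s) * RtoC (y ^ 2) + (Ci * RtoC (e * b) * RtoC y * RtoC t + kap * RtoC (t ^ 2)))).
  set (P := fun t y : R => E 1%R t y + E (-1)%R t y).
  set (Q := fun t y : R => c * (E 1%R t y - E (-1)%R t y)).
  set (W := fun t y : R => (Ci * RtoC (1 * b) * RtoC y + 2 * kap * RtoC t) * E 1%R t y +
     (Ci * RtoC (-1 * b) * RtoC y + 2 * kap * RtoC t) * E (-1)%R t y).
  assert (cE : forall e t y, CCont (E e t) y) by (intros; unfold E; ccont).
  assert (cE' : forall e t y, CCont (fun t => E e t y) t) by (intros; unfold E; ccont).
  assert (cE2 : forall e t y, CCont2 (E e) t y) by (intros; unfold E; ccont2).
  assert (dEt : forall e t y, CD (fun t => E e t y) t ((Ci * RtoC (e * b) * RtoC y + 2 * kap * RtoC t) * E e t y)).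
  { intros e t y. unfold E. apply CD_Cexp. eapply CD_eq.
    - apply CD_plus; [apply CD_const|apply CD_plus]; [apply CD_scal, CD_id|].
      apply CD_scal, (CD_RtoC _ _ (2 * t)%R). auto_derive; [trivial|ring].
    - rewrite (RtoC_mult 2 t). cbv beta; ring. }
  assert (dEy : forall e t y, CD (E e t) y (((- s) * RtoC (2 * y) + Ci * RtoC (e * b) * RtoC t) * E e t y)).
  { intros e t y. unfold E. apply CD_Cexp. eapply CD_eq.
    - apply CD_plus; [apply CD_scal, (CD_RtoC _ _ (2 * y)%R)|apply CD_plus; [|apply CD_const]].
      + auto_derive; [trivial|ring].
      + apply CD_mult; [apply CD_scal, CD_id|apply CD_const].
    - cbv beta; ring. }
  assert (Hcf : forall n : nat, CInt (P 1%R) 0 (INR n) - CInt (P 0%R) 0 (INR n) =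
      CInt (fun t => Q t (INR n) - Q t 0%R) 0 1).
  { intros n. apply (closed_form_rectangle P Q W).
    - intros t y. unfold P, W. apply CD_plus; apply dEt.
    - intros t y. unfold Q, W. eapply CD_eq; [apply CD_scal, CD_minus; apply dEy|].
      set (e1 := E 1%R t y). set (e2 := E (-1)%R t y). unfold c, kap.
      replace (-1 * b)%R with (- b)%R by ring. rewrite Rmult_1_l, RtoC_opp, (RtoC_mult 2 y), RtoC_pow. simpl.
      assert (I2 : Ci * Ci = - (1)) by (apply C_ext; simpl; ring).
      transitivity (Ci * RtoC b * RtoC y * (e1 - e2) - (Ci * Ci) * (RtoC b * RtoC b * RtoC t / (2 * s)) * (e1 + e2)).
      + field. exact Hs0.
      + rewrite I2. field. exact Hs0.
    - intros t y. unfold W. ccont2.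
    - intros t y. unfold P. ccont.
    - intros t y. unfold W. ccont.
    - intros t y. unfold Q. ccont. }
  assert (HE : forall e t y, (0 <= t <= 1)%R -> (Cmod (E e t y) <= exp (Cmod kap) * exp (- (Re s * y ^ 2)))%R).
  { intros e t y Ht. unfold E. rewrite Cmod_Cexp, <- exp_plus. apply exp_le.
    assert (A := re_le_Cmod kap). apply Rabs_le_between in A.
    replace (Re _) with (- (Re s * y ^ 2) + Re kap * t ^ 2)%R
      by (unfold Re, Im, Ci, RtoC; destruct s, kap; simpl; ring).
    assert (0 <= t ^ 2 <= 1)%R by (split; [apply pow2_ge_0|nra]).
    assert (0 <= Cmod kap)%R by apply Cmod_ge_0. nra. }
  set (M := (Cmod c * (2 * (exp (Cmod kap) * gauss_const 0 (Re s))))%R).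
  assert (L0 : Ctends eventually (fun n => CInt (P 1%R) 0 (INR n) - CInt (P 0%R) 0 (INR n)) 0).
  { apply (Cmod_tends_0 _ (fun n => M * exp (- 1 * INR n))%R); [|apply is_lim_seq_exp_neg].
    intros n. rewrite Hcf. replace (M * exp (-1 * INR n))%R
      with ((1 - 0) * (M * exp (-1 * INR n)))%R by ring.
    apply CInt_bound_const; [lra| |].
    - intros t _. unfold Q. ccont.
    - intros t Ht. assert (Z0 : Q t 0%R = 0).
      { unfold Q, E. replace (RtoC 0) with (RtoC 0 * 0) by ring.
        replace (Ci * RtoC (1 * b) * (RtoC 0 * 0) * RtoC t) with (Ci * RtoC (-1 * b) * (RtoC 0 * 0) * RtoC t) by ring. ring. }
      rewrite Z0. replace (Q t (INR n) - 0) with (Q t (INR n)) by ring.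
      unfold Q. rewrite Cmod_mult. unfold M. rewrite (Rmult_assoc (Cmod c)). apply Rmult_le_compat_l; [apply Cmod_ge_0|].
      unfold Cminus. eapply Rle_trans; [apply Cmod_triangle|]. rewrite Cmod_opp.
      assert (B1 := HE 1%R t (INR n) Ht). assert (B2 := HE (-1)%R t (INR n) Ht).
      assert (G := gauss_decay 0 (Re s) (INR n) Hs). rewrite Rmult_0_l, exp_0, Rmult_1_l in G.
      assert (E0 := exp_pos (Cmod kap)). nra. }
  assert (L1 : Ctends eventually (fun n => CInt (P 1%R) 0 (INR n)) (Cexp kap * (hint 0 b s + hint 0 (- b) s))).
  { unfold hint. rewrite <- GI_plus, <- GI_scal; auto using exp_bounded_hint, exp_bounded_plus.
    eapply (Ctends_ext eventually); [|apply GI_correct; [|exact Hs]].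
    - intros n. apply CInt_ext_pos. intros y _. unfold P, E, gw. simpl pow.
      rewrite !Rmult_1_r, !Cmult_1_l, !Cmult_1_r, !Cexp_plus. rewrite !Rmult_1_l.
      replace (-1 * b)%R with (- b)%R by ring.
      replace (- (s * RtoC (y * y))) with ((- s) * RtoC (y * y)) by ring. ring.
    - apply exp_bounded_mult; [apply exp_bounded_const|].
      apply exp_bounded_plus; apply exp_bounded_hint. }
  assert (L2 : Ctends eventually (fun n => CInt (P 0%R) 0 (INR n)) (2 * GI (fun _ => 1) s)).
  { rewrite <- GI_scal by (auto using exp_bounded_const).
    eapply (Ctends_ext eventually); [|apply GI_correct; [|exact Hs]].
    - intros n. apply CInt_ext_pos. intros y _. unfold P, E, gw.
      rewrite pow_i by lia. rewrite !Cmult_0_r, !Cplus_0_r.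
      replace (- (s * RtoC (y ^ 2))) with ((- s) * RtoC (y ^ 2)) by ring. ring.
    - apply exp_bounded_const. }
  assert (U := Ctends_unique _ _ _ _ L0 (Ctends_minus _ _ _ _ _ L1 L2)).
  symmetry in U. apply Ceq_minus in U. rewrite <- U, Cexp_opp. field. apply Cexp_neq_0.
Qed.

(** The function [(exp (i b y) - exp (- i b y)) exp (- s y^2)] vanishes at both ends of the
    half-line, so the integral of its derivative is zero; expanding that derivative gives the
    relation. *)
Lemma hint_Gauss_1 (b : R) (s : C) : (0 < Re s)%R ->
  hint 1 b s - hint 1 (- b) s = Ci * RtoC b / (2 * s) * (hint 0 b s + hint 0 (- b) s).
Proof.
  intros Hs. assert (Hs0 : s <> 0) by (intros H; rewrite H in Hs; simpl in Hs; lra).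
  set (e := fun b y => Cexp (Ci * RtoC b * RtoC y)).
  set (F := fun y : R => (e b y - e (- b)%R y) * gw s y).
  set (dF := fun y : R => Ci * RtoC b * (e b y + e (- b)%R y) * gw s y - 2 * s * (RtoC y * (e b y - e (- b)%R y)) * gw s y).
  assert (dgw : forall y, CD (gw s) y ((- s) * RtoC (2 * y) * gw s y)).
  { intros y. apply CD_ext with (f := fun y => Cexp ((- s) * RtoC (y ^ 2))).
    - intros t. unfold gw. f_equal. ring.
    - replace (gw s y) with (Cexp ((- s) * RtoC (y ^ 2))) by (unfold gw; f_equal; ring).
      apply CD_Cexp. apply CD_scal, CD_RtoC. auto_derive; [trivial|ring]. }
  assert (de : forall b y, CD (e b) y (Ci * RtoC b * e b y)).
  { intros b' y. unfold e. apply CD_Cexp. eapply CD_eq; [apply CD_scal, CD_id|]. cbv beta; ring. }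
  assert (H : forall n, CInt dF 0 (INR n) = F (INR n) - F 0%R).
  { intros n. apply CInt_FTC.
    - intros t _. unfold F, dF. eapply CD_eq.
      + apply CD_mult; [apply CD_minus; apply de|apply dgw].
      + rewrite RtoC_opp, (RtoC_mult 2 t). cbv beta; ring.
    - intros t _. assert (A := fun b => CD_CCont _ _ _ (de b t)). assert (B := CCont_gw s t).
      unfold dF. ccont. }
  assert (eb := exp_bounded_hint). assert (e0 : forall b, exp_bounded (e b)) by (intros; apply exp_bounded_Cexp).
  set (G := fun y => Ci * RtoC b * (e b y + e (- b)%R y) + (- (2 * s)) * (RtoC y * e b y - RtoC y * e (- b)%R y)).
  assert (ey : forall b, exp_bounded (fun y => RtoC y * e b y)).
  { intros; apply exp_bounded_mult; [apply exp_bounded_id|apply e0]. }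
  assert (em : exp_bounded (fun y => RtoC y * e b y - RtoC y * e (- b)%R y)).
  { destruct (exp_bounded_plus _ _ (ey b) (exp_bounded_mult _ _ (exp_bounded_const (- (1))) (ey (- b)%R))) as [A1 [c [k [A2 [A3 A4]]]]].
    split.
    - intros y Hy. eapply CCont_ext; [|exact (A1 y Hy)]. intros; simpl; ring.
    - exists c, k. repeat split; auto. intros y Hy. specialize (A4 y Hy). simpl in A4.
      replace (RtoC y * e b y - RtoC y * e (- b)%R y) with (RtoC y * e b y + - (1) * (RtoC y * e (- b)%R y)) by ring. exact A4. }
  assert (eG : exp_bounded G).
  { apply exp_bounded_plus; apply exp_bounded_mult; auto using exp_bounded_const, exp_bounded_plus. }
  assert (L0 : GI G s = 0).
  { eapply (Ctends_unique eventually); [apply GI_correct; [exact eG|exact Hs]|].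
    apply (Ctends_ext eventually (fun n => F (INR n))).
    - intros n. transitivity (CInt dF 0 (INR n)).
      + rewrite H. unfold F, e. replace (RtoC 0) with (0 * 0) at 2 3 by ring.
        replace (Ci * RtoC b * RtoC 0) with (RtoC 0) by ring.
        replace (Ci * RtoC (- b) * RtoC 0) with (RtoC 0) by ring. ring.
      + apply CInt_ext_pos. intros y _. unfold G, dF. ring.
    - apply (Cmod_tends_0 _ (fun n => 2 * gauss_const 0 (Re s) * exp (- 1 * INR n))%R); [|apply is_lim_seq_exp_neg].
      intros n. unfold F. rewrite Cmod_mult, Cmod_gw.
      assert (X := gauss_decay 0 (Re s) (INR n) Hs). rewrite Rmult_0_l, exp_0, Rmult_1_l in X.
      assert (Y : (Cmod (e b (INR n) - e (- b)%R (INR n)) <= 2)%R).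
      { unfold Cminus. eapply Rle_trans; [apply Cmod_triangle|]. rewrite Cmod_opp.
        unfold e. rewrite <- !Cmult_assoc, <- !RtoC_mult, !Cmod_Cexp_Ci. lra. }
      assert (E0 := exp_pos (- (Re s * INR n ^ 2))). assert (Y0 := Cmod_ge_0 (e b (INR n) - e (- b)%R (INR n))).
      assert (E1 := exp_pos (-1 * INR n)). assert (G0 := gauss_const_pos 0 (Re s)). nra. }
  unfold G in L0.
  rewrite GI_plus, !GI_scal, GI_plus, GI_minus in L0; auto using exp_bounded_const, exp_bounded_plus, exp_bounded_mult.
  assert (Q0 : forall b, hint 0 b s = GI (e b) s) by (intros; apply GI_ext; intros; simpl; unfold e; ring).
  assert (Q1 : forall b, hint 1 b s = GI (fun y => RtoC y * e b y) s).
  { intros; apply GI_ext; intros; simpl; rewrite Rmult_1_r; reflexivity. }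
  rewrite !Q0, !Q1.
  set (u := GI (fun y => RtoC y * e b y) s) in *. set (v := GI (fun y => RtoC y * e (- b)%R y) s) in *.
  set (p := GI (e b) s + GI (e (- b)%R) s) in *.
  transitivity ((Ci * RtoC b * p - (Ci * RtoC b * p + - (2 * s) * (u - v))) / (2 * s)).
  - field. exact Hs0.
  - rewrite L0. field. exact Hs0.
Qed.

(** With [ph t] the integral of the Gaussian from [0] to [t], the quantity [x ph(t)^2 + int_0^1 exp
    (- x t^2 (1 + v^2)) / (1 + v^2) dv] does not depend on [t]. At [t = 0] it equals
    [atan 1 = pi / 4], and at infinity its second term disappears. *)
Lemma GI_1_real (x : R) : (0 < x)%R ->
  GI (fun _ => 1) (RtoC x) = RtoC (sqrt (PI / x) / 2).
Proof.
  intros Hx. pose (ph := (fun u : R => RInt (fun v => exp (- (x * v ^ 2))) 0 u) : R -> R).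
  assert (cg : forall v, continuous (fun v => exp (- (x * v ^ 2))) v).
  { intros v. apply: ex_derive_continuous. auto_derive. trivial. }
  assert (dph : forall u, is_derive ph u (exp (- (x * u ^ 2)))).
  { intros u. apply (is_derive_RInt (V := R_NormedModule) (fun v => exp (- (x * v ^ 2))) ph 0 u); [|apply cg]. apply filter_forall. intros w.
    apply (RInt_correct (V := R_CompleteNormedModule)). apply: ex_RInt_continuous. intros; apply cg. }
  assert (cph : forall u, continuous ph u) by (intros u; apply: ex_derive_continuous; eexists; apply dph).
  assert (Hv : forall v : R, (0 < 1 + v ^ 2)%R) by (intros v; generalize (pow2_ge_0 v); lra).
  set (P := fun t v : R => RtoC (exp (- (x * t ^ 2 * (1 + v ^ 2))) / (1 + v ^ 2))).
  set (Q := fun t v : R => RtoC (-2 * x * exp (- (x * t ^ 2)) * ph (t * v)%R)).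
  set (W := fun t v : R => RtoC (-2 * x * t) * Cexp (RtoC (- x * t ^ 2) * RtoC (1 + v ^ 2))).
  assert (eW : forall t v, W t v = RtoC (-2 * x * t * exp (- (x * t ^ 2 * (1 + v ^ 2))))).
  { intros t v. unfold W. rewrite <- RtoC_mult, Cexp_RtoC, <- RtoC_mult. do 3 f_equal. ring. }
  assert (cQ : forall t v, CCont (fun t => Q t v) t).
  { intros t v. unfold Q. apply CCont_RtoC. apply: continuous_mult.
    - apply: ex_derive_continuous. auto_derive. trivial.
    - apply: continuous_comp; [|apply cph]. apply: ex_derive_continuous. auto_derive. trivial. }
  assert (Hcf : forall n : nat, CInt (P (INR n)) 0 1 - CInt (P 0%R) 0 1 =
      CInt (fun t => Q t 1%R - Q t 0%R) 0 (INR n)).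
  { intros n. apply (closed_form_rectangle P Q W).
    - intros t v. rewrite eW. apply CD_RtoC. specialize (Hv v). auto_derive; [lra|]. simpl in *. field. lra.
    - intros t v. rewrite eW. apply CD_RtoC.
      evar_last.
      + apply: is_derive_scal. apply: is_derive_comp; [apply dph|]. auto_derive; [trivial|reflexivity].
      + unfold scal; simpl; unfold mult; simpl.
        replace (exp (- (x * (t * (t * 1)) * (1 + v * (v * 1))))) with
          (exp (- (x * (t * (t * 1)))) * exp (- (x * (t * v * (t * v * 1)))))%R
          by (rewrite <- exp_plus; f_equal; ring).
        Rring.
    - intros t v. unfold W. ccont2.
    - intros t v. unfold P. specialize (Hv v). apply CCont_RtoC. apply: ex_derive_continuous. auto_derive. lra.
    - intros t v. unfold W. ccont.
    - intros t v. apply cQ. }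
  assert (H0 : CInt (P 0%R) 0 1 = RtoC (PI / 4)).
  { transitivity (RtoC (atan 1) - RtoC (atan 0)).
    - apply (CInt_FTC 0 1 (fun v => RtoC (atan v))).
      + intros v _. apply CD_RtoC. unfold P.
        replace (x * 0 ^ 2 * (1 + v ^ 2))%R with 0%R by ring. rewrite Ropp_0, exp_0.
        auto_derive; [trivial|]. specialize (Hv v). unfold Rsqr. field. nra.
      + intros v _. unfold P. specialize (Hv v). apply CCont_RtoC. apply: ex_derive_continuous. auto_derive. lra.
    - rewrite atan_0, atan_1. ring. }
  assert (HQ : forall n, CInt (fun t => Q t 1%R - Q t 0%R) 0 (INR n) = RtoC (- x * ph (INR n) ^ 2)).
  { intros n. assert (p0 : ph 0%R = 0%R) by (unfold ph; apply: RInt_point).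
    transitivity (RtoC (- x * ph (INR n) ^ 2) - RtoC (- x * ph 0%R ^ 2)).
    - apply (CInt_FTC 0 (INR n) (fun t => RtoC (- x * ph t ^ 2))).
      + intros t _. unfold Q. rewrite <- RtoC_minus. apply CD_RtoC.
        rewrite Rmult_1_r, Rmult_0_r, p0.
        evar_last; [apply: is_derive_scal; apply: is_derive_pow; apply dph|]. simpl. Rring.
      + intros t _. apply CCont_minus; apply cQ.
    - rewrite p0. replace (- x * 0 ^ 2)%R with 0%R by ring. ring. }
  assert (LP : Ctends eventually (fun n => CInt (P (INR n)) 0 1) 0).
  { apply (Cmod_tends_0 _ (fun n => gauss_const 0 x * exp (- 1 * INR n))%R); [|apply is_lim_seq_exp_neg].
    intros n. replace (gauss_const 0 x * exp (-1 * INR n))%R with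
      ((1 - 0) * (gauss_const 0 x * exp (-1 * INR n)))%R by ring.
    apply CInt_bound_const; [lra| |].
    - intros v _. unfold P. specialize (Hv v). apply CCont_RtoC. apply: ex_derive_continuous. auto_derive. lra.
    - intros v _. unfold P. specialize (Hv v). assert (V2 := pow2_ge_0 v). assert (N2 := pow2_ge_0 (INR n)).
      rewrite Cmod_Rpos by (apply Rdiv_le_0_compat; [left; apply exp_pos|lra]).
      assert (G := gauss_decay 0 x (INR n) Hx). rewrite Rmult_0_l, exp_0, Rmult_1_l in G.
      eapply Rle_trans; [|exact G].
      apply Rle_trans with (exp (- (x * INR n ^ 2 * (1 + v ^ 2))) / 1)%R.
      + apply Rmult_le_compat_l; [left; apply exp_pos|]. apply Rinv_le_contravar; lra.
      + rewrite Rdiv_1_r. apply exp_le.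
        assert (0 <= x * INR n ^ 2)%R by (apply Rmult_le_pos; lra). nra. }
  assert (Hg : forall n, CInt (fun y => 1 * gw (RtoC x) y) 0 (INR n) = RtoC (ph (INR n))).
  { intros n. assert (X : forall y, 1 * gw (RtoC x) y = RtoC (exp (- (x * y ^ 2)))).
    { intros y. unfold gw. rewrite <- RtoC_mult, <- RtoC_opp, Cexp_RtoC. ring. }
    rewrite (CInt_ext _ _ _ (fun y => RtoC (exp (- (x * y ^ 2))))) by (intros; apply X).
    unfold CInt, ph, RtoC; simpl. f_equal. rewrite RInt_const. unfold scal; simpl; unfold mult; simpl. ring. }
  assert (LG : Ctends eventually (fun n => RtoC (ph (INR n))) (GI (fun _ => 1) (RtoC x))).
  { eapply (Ctends_ext eventually); [exact Hg|]. apply GI_correct; [apply exp_bounded_const|exact Hx]. }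
  set (g := GI (fun _ => 1) (RtoC x)) in *.
  assert (E : RtoC x * (g * g) = RtoC (PI / 4)).
  { eapply (Ctends_unique eventually (fun n => RtoC x * (RtoC (ph (INR n)) * RtoC (ph (INR n))))).
    - apply (Ctends_mult eventually); [apply (Ctends_const eventually)|]. now apply (Ctends_mult eventually).
    - apply (Ctends_ext eventually (fun n => - (CInt (P (INR n)) 0 1 - CInt (P 0%R) 0 1) + 0)).
      + intros n. rewrite Hcf, HQ. rewrite <- !RtoC_mult, <- RtoC_opp. rewrite Cplus_0_r. f_equal. ring.
      + replace (RtoC (PI / 4)) with (- (0 - RtoC (PI / 4)) + 0) by ring.
        apply (Ctends_plus eventually); [|apply (Ctends_const eventually)].
        apply (Ctends_opp eventually), (Ctends_minus eventually); [exact LP|]. rewrite H0. apply (Ctends_const eventually). }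
  (* Only the square of [g] is known so far. That [g] is real and nonnegative, as a limit of such
     numbers, selects the square root. *)
  assert (Im0 : Im g = 0%R).
  { assert (A : Cconj g = g).
    { eapply (Ctends_unique eventually); [apply (Ctends_conj eventually), LG|].
      eapply (Ctends_ext eventually); [|exact LG]. intros n. now rewrite Cconj_RtoC. }
    assert (B : Im (Cconj g) = Im g) by now rewrite A. rewrite im_conj in B. lra. }
  assert (Re0 : (0 <= Re g)%R).
  { destruct (Rle_dec 0 (Re g)) as [H|H]; [exact H|exfalso].
    assert (He : (0 < - Re g)%R) by lra. destruct (LG _ He) as [n Hn]. specialize (Hn n (le_n n)).
    assert (A : (Rabs (ph (INR n) - Re g) <= Cmod (RtoC (ph (INR n)) - g))%R) by exact (re_le_Cmod (RtoC (ph (INR n)) - g)).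
    assert (B : (0 <= ph (INR n))%R).
    { apply RInt_ge_0; [apply pos_INR| |intros; left; apply exp_pos].
      apply: ex_RInt_continuous. intros; apply cg. }
    rewrite Rabs_pos_eq in A by lra. lra. }
  assert (g1 : g = RtoC (Re g)) by (apply C_ext; [reflexivity|exact Im0]).
  rewrite g1 in E |- *. rewrite <- !RtoC_mult in E. apply RtoC_inj in E.
  f_equal. symmetry. replace (PI / x)%R with ((2 * Re g) * (2 * Re g))%R.
  - change (2 * Re g * (2 * Re g))%R with (Rsqr (2 * Re g)). rewrite sqrt_Rsqr; [field|lra].
  - apply Rmult_eq_reg_l with x; [|lra]. field_simplify; [|lra]. lra.
Qed.

(** * Sums of roots of unity *)

Lemma Cunit_pow (t : R) (n : nat) : (Cunit t ^ n)%C = Cunit (INR n * t).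
Proof.
  unfold Cunit. rewrite Cexp_pow. f_equal.
  rewrite !RtoC_mult. ring.
Qed.

Lemma csum_geom (q : C) (n : nat) : (1 - q) * csum (fun k => (q ^ k)%C) n = 1 - (q ^ n)%C.
Proof. induction n as [|n IH]; simpl; [ring|]. rewrite Cmult_plus_distr_l, IH. ring. Qed.

Lemma csum_Cunit_0 (n : nat) (t : Z) : (0 < n)%nat -> ~ (Z.of_nat n | t)%Z ->
  csum (fun k => Cunit (INR k * (IZR t / INR n))) n = 0.
Proof.
  intros Hn Ht. assert (P : (0 < INR n)%R) by (now apply lt_0_INR).
  set (q := Cunit (IZR t / INR n)).
  assert (Hq : q <> 1).
  { intros H. apply Cunit_eq_1 in H. destruct H as [k Hk]. apply Ht. exists k.
    apply eq_IZR. rewrite mult_IZR, <- INR_IZR_INZ, <- Hk. field. lra. }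
  assert (E : (1 - q) * csum (fun k => (q ^ k)%C) n = 0).
  { rewrite csum_geom. unfold q. rewrite Cunit_pow.
    replace (INR n * (IZR t / INR n))%R with (IZR t) by (field; lra). rewrite Cunit_Z. ring. }
  rewrite (csum_ext _ (fun k => (q ^ k)%C)) by (intros; unfold q; now rewrite Cunit_pow).
  destruct (Ceq_dec (csum (fun k => (q ^ k)%C) n) 0) as [H|H]; [exact H|exfalso].
  apply (Cmult_neq_0 (1 - q) (csum (fun k => (q ^ k)%C) n)); [|exact H|exact E].
  intros H'. apply Hq. symmetry. now apply Ceq_minus.
Qed.

Lemma csum_Cunit_1 (n : nat) (t : Z) : (0 < n)%nat -> (Z.of_nat n | t)%Z ->
  csum (fun k => Cunit (INR k * (IZR t / INR n))) n = RtoC (INR n).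
Proof.
  intros Hn [k Hk]. assert (P : (0 < INR n)%R) by (now apply lt_0_INR).
  rewrite (csum_ext _ (fun _ => 1)).
  - rewrite csum_const. ring.
  - intros j _. replace (INR j * (IZR t / INR n))%R with (IZR (Z.of_nat j * k)).
    + apply Cunit_Z.
    + rewrite Hk, !mult_IZR, <- !INR_IZR_INZ. field. lra.
Qed.

Fixpoint rsum (F : nat -> R) (n : nat) : R :=
  match n with O => 0 | S k => rsum F k + F k end.

Lemma rsum_csum (F : nat -> R) (n : nat) : RtoC (rsum F n) = csum (fun k => RtoC (F k)) n.
Proof. induction n as [|n IH]; simpl; [reflexivity|]. now rewrite RtoC_plus, IH. Qed.

Lemma Re_csum (F : nat -> C) (n : nat) : Re (csum F n) = rsum (fun k => Re (F k)) n.
Proof. induction n as [|n IH]; simpl; [reflexivity|]. now rewrite <- IH. Qed.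

Lemma rsum_ext (F G : nat -> R) (n : nat) :
  (forall k, (k < n)%nat -> F k = G k) -> rsum F n = rsum G n.
Proof.
  induction n as [|n IH]; intros H; [reflexivity|]. simpl.
  rewrite IH, H; [reflexivity|lia|]. intros; apply H; lia.
Qed.

Lemma rsum_plus (F G : nat -> R) (n : nat) :
  rsum (fun k => F k + G k)%R n = (rsum F n + rsum G n)%R.
Proof. induction n as [|n IH]; simpl; [ring|]. rewrite IH. ring. Qed.

Lemma rsum_scal (c : R) (F : nat -> R) (n : nat) :
  rsum (fun k => c * F k)%R n = (c * rsum F n)%R.
Proof. induction n as [|n IH]; simpl; [ring|]. rewrite IH. ring. Qed.

Lemma rsum_minus (F G : nat -> R) (n : nat) :
  rsum (fun k => F k - G k)%R n = (rsum F n - rsum G n)%R.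
Proof. induction n as [|n IH]; simpl; [ring|]. rewrite IH. ring. Qed.

Lemma rsum_add (F : nat -> R) (n m : nat) :
  rsum F (n + m) = (rsum F n + rsum (fun k => F (n + k)%nat) m)%R.
Proof.
  induction m as [|m IH]; [rewrite Nat.add_0_r; simpl; ring|].
  rewrite Nat.add_succ_r. simpl. rewrite IH. ring.
Qed.

Lemma rsum_rev (F : nat -> R) (n : nat) : rsum F n = rsum (fun k => F (n - 1 - k)%nat) n.
Proof. apply RtoC_inj. rewrite !rsum_csum. apply csum_rev. Qed.

Lemma rsum_first (F : nat -> R) (n : nat) :
  rsum F (S n) = (F O + rsum (fun k => F (S k)) n)%R.
Proof. replace (S n) with (1 + n)%nat by lia. rewrite rsum_add. simpl. ring. Qed.

Lemma rsum_le (F G : nat -> R) (n : nat) :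
  (forall k, (k < n)%nat -> (F k <= G k)%R) -> (rsum F n <= rsum G n)%R.
Proof.
  induction n as [|n IH]; intros H; simpl; [lra|].
  apply Rplus_le_compat; [apply IH; intros; apply H; lia|apply H; lia].
Qed.

Lemma rsum_Rabs (F : nat -> R) (n : nat) :
  (Rabs (rsum F n) <= rsum (fun k => Rabs (F k)) n)%R.
Proof.
  induction n as [|n IH]; simpl; [rewrite Rabs_R0; lra|].
  eapply Rle_trans; [apply Rabs_triang|]. lra.
Qed.

Lemma rsum_const (c : R) (n : nat) : rsum (fun _ => c) n = (INR n * c)%R.
Proof. induction n as [|n IH]; [simpl; ring|]. rewrite S_INR. simpl rsum. rewrite IH. ring. Qed.

(** * The Fourier series of [x (1 - x) / 2] *)

(** A nontrivial character sums to zero over all residues modulo [n]; the value [-1] compensates the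
    missing residue zero. *)
Lemma rsum_cos (n j : nat) : (0 < j < n)%nat ->
  rsum (fun k => cos (2 * (INR j * (PI * INR (S k) / INR n)))) (n - 1) = (-1)%R.
Proof.
  intros Hj. assert (P : (0 < INR n)%R) by (apply lt_0_INR; lia).
  assert (H : csum (fun k => Cunit (INR k * (IZR (Z.of_nat j) / INR n))) n = 0).
  { apply csum_Cunit_0; [lia|]. intros H. apply Z.divide_pos_le in H; lia. }
  apply (f_equal Re) in H. rewrite Re_csum in H.
  set (G := fun k => Re (Cunit (INR k * (IZR (Z.of_nat j) / INR n)))) in H.
  replace n with (S (n - 1)) in H by lia. rewrite rsum_first in H. unfold G in H. replace (INR 0 * (IZR (Z.of_nat j) / INR n))%R with 0%R in H by (simpl; ring).
  rewrite Cunit_0 in H. change (Re 1) with 1%R in H. change (Re 0) with 0%R in H.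
  transitivity (rsum (fun k => Re (Cunit (INR (S k) * (IZR (Z.of_nat j) / INR n)))) (n - 1)); [|lra].
  apply rsum_ext. intros k _. unfold Cunit. rewrite Cexp_Ci.
  match goal with |- _ = Re (?c, _) => change (Re (c, _)) with c end. f_equal.
  rewrite <- INR_IZR_INZ. field. lra.
Qed.

Lemma sin_angle_pos (n k : nat) : (S k < n)%nat -> (0 < sin (PI * INR (S k) / INR n))%R.
Proof.
  intros H. assert (P := PI_RGT_0).
  assert (A : (0 < INR (S k))%R) by (apply lt_0_INR; lia).
  assert (B : (INR (S k) < INR n)%R) by (now apply lt_INR).
  apply sin_gt_0.
  - apply Rdiv_lt_0_compat; [apply Rmult_lt_0_compat|]; lra.
  - apply Rmult_lt_reg_r with (INR n); [lra|]. unfold Rdiv.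
    rewrite Rmult_assoc, Rinv_l, Rmult_1_r by lra. now apply Rmult_lt_compat_l.
Qed.

(** After division by [sin t ^ 2] the second difference in [j] is a pure cosine, which [rsum_cos]
    can sum over the angles. *)
Lemma sin_sqr_step (j t : R) :
  (sin ((j + 2) * t) ^ 2 + sin (j * t) ^ 2 - 2 * sin ((j + 1) * t) ^ 2 =
   2 * sin t ^ 2 * cos (2 * ((j + 1) * t)))%R.
Proof.
  replace ((j + 2) * t)%R with ((j + 1) * t + t)%R by ring.
  replace (j * t)%R with ((j + 1) * t - t)%R by ring.
  set (a := ((j + 1) * t)%R). rewrite sin_plus, sin_minus, cos_2a.
  generalize (sin2_cos2 a) (sin2_cos2 t). unfold Rsqr. intros H1 H2.
  replace (cos t * cos t)%R with (1 - sin t * sin t)%R by lra.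
  set (p := sin t) in *. set (q := cos t) in *.
  assert (q * q = 1 - p * p)%R by lra.
  transitivity (2 * (sin a * sin a) * (q * q) + 2 * (cos a * cos a) * (p * p) - 2 * (sin a * sin a))%R; [ring|].
  rewrite H. ring.
Qed.

(** As functions of [j] both sides have second difference [-2] and agree at [j = 0] and [j = 1]. The
    point is that [j (n - j)] is, up to scaling, [x (1 - x)] at [x = j / n]. *)
Lemma fejer_sum (n j : nat) : (0 < n)%nat -> (j <= n)%nat ->
  rsum (fun k => sin (INR j * (PI * INR (S k) / INR n)) ^ 2 / sin (PI * INR (S k) / INR n) ^ 2)%R (n - 1)
  = (INR j * (INR n - INR j))%R.
Proof.
  intros Hn.
  set (U := fun j => rsum (fun k => sin (INR j * (PI * INR (S k) / INR n)) ^ 2 /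
     sin (PI * INR (S k) / INR n) ^ 2)%R (n - 1)).
  assert (U0 : U O = 0%R).
  { unfold U. rewrite (rsum_ext _ (fun _ => 0%R)).
    - rewrite rsum_const. ring.
    - intros k _. change (INR 0) with 0%R. rewrite Rmult_0_l, sin_0. unfold Rdiv. ring. }
  assert (U1 : U 1%nat = (INR n - 1)%R).
  { unfold U. rewrite (rsum_ext _ (fun _ => 1%R)).
    - rewrite rsum_const, minus_INR by lia. simpl INR. ring.
    - intros k Hk. assert (S0 := sin_angle_pos n k ltac:(lia)). change (INR 1) with 1%R.
      rewrite Rmult_1_l. field. lra. }
  assert (US : forall j, (S (S j) <= n)%nat -> U (S (S j)) = (2 * U (S j) - U j - 2)%R).
  { intros i Hi. assert (C := rsum_cos n (S i) ltac:(lia)).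
    unfold U. transitivity (rsum (fun k =>
       (2 * (sin (INR (S i) * (PI * INR (S k) / INR n)) ^ 2 / sin (PI * INR (S k) / INR n) ^ 2)
       + (-1 * (sin (INR i * (PI * INR (S k) / INR n)) ^ 2 / sin (PI * INR (S k) / INR n) ^ 2)
       + 2 * cos (2 * (INR (S i) * (PI * INR (S k) / INR n)))))%R) (n - 1)).
    - apply rsum_ext. intros k Hk. assert (S0 := sin_angle_pos n k ltac:(lia)).
      set (t := (PI * INR (S k) / INR n)%R) in *.
      assert (E := sin_sqr_step (INR i) t). rewrite !S_INR.
      replace (INR i + 1 + 1)%R with (INR i + 2)%R by ring.
      replace (sin ((INR i + 2) * t) ^ 2)%R with
        (2 * sin t ^ 2 * cos (2 * ((INR i + 1) * t)) - sin (INR i * t) ^ 2 + 2 * sin ((INR i + 1) * t) ^ 2)%R by lra.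
      field. lra.
    - rewrite !rsum_plus, !rsum_scal, C. ring. }
  assert (H : forall i, ((i <= n)%nat -> U i = (INR i * (INR n - INR i))%R) /\
                        ((S i <= n)%nat -> U (S i) = (INR (S i) * (INR n - INR (S i)))%R)).
  { induction i as [|i [IH1 IH2]].
    - split; intros _; [rewrite U0|rewrite U1]; simpl; ring.
    - split; [exact IH2|]. intros Hi. rewrite US by exact Hi. rewrite IH1, IH2 by lia.
      rewrite !S_INR. ring. }
  intros Hj. now apply (proj1 (H j)).
Qed.

Lemma sin_sqr_PI_minus (j : nat) (x : R) : (sin (INR j * PI - x) ^ 2 = sin x ^ 2)%R.
Proof.
  assert (H : forall y, (sin y ^ 2 = (1 - cos (2 * y)) / 2)%R).
  { intros y. rewrite cos_2a_sin. field. }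
  rewrite !H. do 2 f_equal.
  replace (2 * (INR j * PI - x))%R with (- (2 * x) + 2 * INR j * PI)%R by ring.
  rewrite cos_period. apply cos_neg.
Qed.

(** The summand is invariant under [k -> n - k], and an odd [n] leaves no middle term. The remaining
    angles are below [pi / 2], where sine and angle are comparable. *)
Lemma fejer_half_sum (p j : nat) : (j <= 2 * p + 1)%nat -> let n := (2 * p + 1)%nat in
  (2 * rsum (fun k => sin (INR j * (PI * INR (S k) / INR n)) ^ 2 / sin (PI * INR (S k) / INR n) ^ 2)%R p
  = INR j * (INR n - INR j))%R.
Proof.
  intros Hj n. rewrite <- (fejer_sum n j) by (unfold n; lia).
  set (F := fun k => (sin (INR j * (PI * INR (S k) / INR n)) ^ 2 / sin (PI * INR (S k) / INR n) ^ 2)%R).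
  replace (n - 1)%nat with (p + p)%nat by (unfold n; lia).
  rewrite rsum_add. rewrite (rsum_rev (fun k => F (p + k)%nat)).
  assert (P : (0 < INR n)%R) by (apply lt_0_INR; unfold n; lia).
  replace (rsum (fun k => F (p + (p - 1 - k))%nat) p) with (rsum F p); [ring|].
  apply rsum_ext. intros k Hk. unfold F.
  replace (INR (S (p + (p - 1 - k)))) with (INR n - INR (S k))%R
    by (rewrite <- minus_INR by (unfold n; lia); f_equal; unfold n; lia).
  replace (PI * (INR n - INR (S k)) / INR n)%R with (PI - PI * INR (S k) / INR n)%R by (field; lra).
  set (t := (PI * INR (S k) / INR n)%R).
  replace (INR j * (PI - t))%R with (INR j * PI - INR j * t)%R by ring.
  rewrite sin_sqr_PI_minus. replace (PI - t)%R with (INR 1 * PI - t)%R by (simpl; ring).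
  now rewrite sin_sqr_PI_minus.
Qed.

(** From [t cos t <= sin t] one gets [t^2 (1 - sin^2 t) <= sin^2 t], that is
    [t^2 <= sin^2 t (1 + t^2)]; division gives the upper bound. *)
Lemma inv_sin_sqr_bound (t : R) : (0 < t < PI / 2)%R ->
  (0 <= / sin t ^ 2 - / t ^ 2 <= 1)%R.
Proof.
  intros Ht. assert (HP := PI_RGT_0).
  assert (S0 : (0 < sin t)%R) by (apply sin_gt_0; lra).
  assert (C0 : (0 < cos t)%R) by (apply cos_gt_0; lra).
  assert (S1 : (sin t < t)%R) by (apply sin_lt_x; lra).
  assert (T : (t * cos t <= sin t)%R).
  { destruct (MVT_gen (fun u => sin u - u * cos u)%R 0 t (fun u => u * sin u)%R) as [c [Hc E]].
    - intros u _. auto_derive; [trivial|ring].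
    - intros u _. apply continuity_pt_filterlim. apply (ex_derive_continuous (fun u => sin u - u * cos u)%R). auto_derive. trivial.
    - rewrite Rmin_left, Rmax_right in Hc by lra. rewrite sin_0 in E.
      assert (0 <= sin c)%R by (apply sin_ge_0; lra).
      assert (0 <= c * sin c * (t - 0))%R by (apply Rmult_le_pos; [apply Rmult_le_pos|]; lra). lra. }
  assert (A : (t ^ 2 <= sin t ^ 2 * (1 + t ^ 2))%R).
  { generalize (sin2_cos2 t). unfold Rsqr. intros.
    assert (t * cos t * (t * cos t) <= sin t * sin t)%R by (apply Rmult_le_compat; nra). nra. }
  assert (T2 : (0 < t ^ 2)%R) by (apply pow_lt; lra).
  assert (S2 : (0 < sin t ^ 2)%R) by (apply pow_lt; lra).
  split.
  - assert (/ t ^ 2 <= / sin t ^ 2)%R; [|lra]. apply Rinv_le_contravar; [exact S2|]. apply pow_incr. lra.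
  - assert (/ sin t ^ 2 <= / t ^ 2 * (1 + t ^ 2))%R; [|rewrite Rmult_plus_distr_l, Rmult_1_r, Rinv_l in H by lra; lra].
    apply Rmult_le_reg_l with (sin t ^ 2)%R; [exact S2|]. rewrite Rinv_r by lra.
    apply Rmult_le_reg_l with (t ^ 2)%R; [exact T2|].
    replace (t ^ 2 * (sin t ^ 2 * (/ t ^ 2 * (1 + t ^ 2))))%R with (sin t ^ 2 * (1 + t ^ 2) * (t ^ 2 * / t ^ 2))%R by ring.
    rewrite Rinv_r by lra. lra.
Qed.

(** The Fourier partial sums of [x (1 - x) / 2] on [[0, 1]], with constant terms distributed so that
    every partial sum vanishes at the integers. *)
Definition zser (K : nat) (x : R) : R :=
  rsum (fun k => (1 - cos (2 * PI * INR (S k) * x)) / (2 * (PI * INR (S k)) ^ 2))%R K.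

Lemma zser_sin (K : nat) (x : R) :
  zser K x = rsum (fun k => sin (PI * INR (S k) * x) ^ 2 / (PI * INR (S k)) ^ 2)%R K.
Proof.
  apply rsum_ext. intros k _. assert (HP := PI_RGT_0). assert (0 < INR (S k))%R by (apply lt_0_INR; lia).
  replace (2 * PI * INR (S k) * x)%R with (2 * (PI * INR (S k) * x))%R by ring. rewrite cos_2a_sin. field. lra.
Qed.

(** [fejer_half_sum] expresses [x (1 - x) / 2] at [x = j / n] as the same sum with
    [n sin (pi k / n)] in place of [pi k]. Each of the [p] terms changes by at most [1 / n^2]. *)
Lemma zser_rational (p j : nat) : (j <= 2 * p + 1)%nat -> let n := INR (2 * p + 1) in
  (Rabs (zser p (INR j / n) - (INR j / n) * (1 - INR j / n) / 2) <= / n)%R.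
Proof.
  intros Hj n. assert (H := fejer_half_sum p j Hj). cbv zeta in H. fold n in H.
  assert (Hn : (INR p <= n)%R) by (apply le_INR; lia).
  assert (P : (0 < n)%R) by (apply lt_0_INR; lia). assert (HP := PI_RGT_0).
  replace ((INR j / n) * (1 - INR j / n) / 2)%R with
    (/ (2 * n ^ 2) * (INR j * (n - INR j)))%R by (field; lra).
  rewrite <- H, zser_sin.
  set (F := fun k => (sin (INR j * (PI * INR (S k) / n)) ^ 2 / sin (PI * INR (S k) / n) ^ 2)%R).
  replace (/ (2 * n ^ 2) * (2 * rsum F p))%R with (/ n ^ 2 * rsum F p)%R by (field; lra).
  rewrite Rabs_minus_sym, <- rsum_scal.
  rewrite <- rsum_minus. eapply Rle_trans; [apply rsum_Rabs|].
  apply Rle_trans with (rsum (fun _ => / n ^ 2)%R p).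
  - apply rsum_le. intros k Hk. unfold F. set (t := (PI * INR (S k) / n)%R).
    assert (Kp : (0 < INR (S k))%R) by (apply lt_0_INR; lia).
    assert (Ht : (0 < t < PI / 2)%R).
    { unfold t. split; [apply Rdiv_lt_0_compat; [apply Rmult_lt_0_compat|]; lra|].
      apply Rmult_lt_reg_r with n; [lra|]. unfold Rdiv. rewrite Rmult_assoc, Rinv_l, Rmult_1_r by lra.
      assert (INR (S k) * 2 < n)%R; [|nra]. change 2%R with (INR 2). rewrite <- mult_INR. apply lt_INR. lia. }
    replace (PI * INR (S k) * (INR j / n))%R with (INR j * t)%R by (unfold t; field; lra).
    assert (B := inv_sin_sqr_bound t Ht).
    replace ((PI * INR (S k)) ^ 2)%R with (n ^ 2 * t ^ 2)%R by (unfold t; field; lra).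
    assert (S0 : (0 < sin t)%R) by (apply sin_gt_0; lra).
    replace (/ n ^ 2 * (sin (INR j * t) ^ 2 / sin t ^ 2) - sin (INR j * t) ^ 2 / (n ^ 2 * t ^ 2))%R
      with (/ n ^ 2 * (sin (INR j * t) ^ 2 * (/ sin t ^ 2 - / t ^ 2)))%R by (field; lra).
    assert (N2 : (0 < / n ^ 2)%R) by (apply Rinv_0_lt_compat, pow_lt; lra).
    assert (Q : (0 <= sin (INR j * t) ^ 2 <= 1)%R).
    { split; [apply pow2_ge_0|]. generalize (SIN_bound (INR j * t)). nra. }
    rewrite Rabs_pos_eq; [|apply Rmult_le_pos; [lra|apply Rmult_le_pos; lra]].
    rewrite <- (Rmult_1_r (/ n ^ 2)) at 2. apply Rmult_le_compat_l; [lra|]. nra.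
  - rewrite rsum_const. replace (/ n)%R with (n * / n ^ 2)%R by (field; lra).
    apply Rmult_le_compat_r; [left; apply Rinv_0_lt_compat, pow_lt; lra|exact Hn].
Qed.

(** The terms are nonnegative and at most [1 / (pi k)^2]. With [pi >= 3] this is below
    [(1 / (k - 1) - 1 / k) / 9], which telescopes. *)
Lemma zser_tail (K m : nat) (x : R) : (0 < K)%nat ->
  (0 <= zser (K + m) x - zser K x <= / 9 * (/ INR K - / INR (K + m)))%R.
Proof.
  intros HK. assert (HP := PI2_3_2). induction m as [|m IH].
  - rewrite Nat.add_0_r. lra.
  - rewrite Nat.add_succ_r. rewrite !zser_sin in *.
    set (F := fun k => (sin (PI * INR (S k) * x) ^ 2 / (PI * INR (S k)) ^ 2)%R) in *.
    change (rsum F (S (K + m))) with (rsum F (K + m) + F (K + m)%nat)%R.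
    assert (EF : F (K + m)%nat = (sin (PI * INR (S (K + m)) * x) ^ 2 / (PI * INR (S (K + m))) ^ 2)%R) by reflexivity.
    set (a := INR (K + m)) in *. assert (Ha : (0 < a)%R) by (apply lt_0_INR; lia).
    assert (E : INR (S (K + m)) = (a + 1)%R) by apply S_INR.
    rewrite E in *.
    assert (Q : (0 <= sin (PI * (a + 1) * x) ^ 2 <= 1)%R).
    { split; [apply pow2_ge_0|]. generalize (SIN_bound (PI * (a + 1) * x)). nra. }
    assert (D : (9 * (a * (a + 1)) <= (PI * (a + 1)) ^ 2)%R).
    { assert (9 <= PI ^ 2)%R by nra. nra. }
    assert (D0 : (0 < 9 * (a * (a + 1)))%R) by nra.
    assert (T : (0 <= sin (PI * (a + 1) * x) ^ 2 / (PI * (a + 1)) ^ 2 <= / 9 * (/ a - / (a + 1)))%R).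
    { split; [apply Rdiv_le_0_compat; lra|].
      replace (/ 9 * (/ a - / (a + 1)))%R with (1 / (9 * (a * (a + 1))))%R by (field; lra).
      unfold Rdiv. apply Rmult_le_compat; try lra.
      - left; apply Rinv_0_lt_compat; lra.
      - now apply Rinv_le_contravar. }
    lra.
Qed.

(** The term of index [k] has derivative at most [1 / (pi k) <= 1]. This crude bound suffices, as
    [K] stays fixed while a rational point approaches [x]. *)
Lemma zser_lipschitz (K : nat) (x y : R) : (Rabs (zser K x - zser K y) <= INR K * Rabs (x - y))%R.
Proof.
  unfold zser. rewrite <- rsum_minus.
  eapply Rle_trans; [apply rsum_Rabs|]. rewrite <- rsum_const. apply rsum_le.
  intros k _. assert (HP := PI2_3_2). assert (Hk : (1 <= INR (S k))%R) by (rewrite S_INR; generalize (pos_INR k); lra).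
  set (m := INR (S k)) in *. assert (Pm : (3 <= PI * m)%R) by nra.
  replace ((1 - cos (2 * PI * m * x)) / (2 * (PI * m) ^ 2) - (1 - cos (2 * PI * m * y)) / (2 * (PI * m) ^ 2))%R
    with ((cos (2 * PI * m * y) - cos (2 * PI * m * x)) / (2 * (PI * m) ^ 2))%R by (field; nra).
  assert (L : (Rabs (cos (2 * PI * m * y) - cos (2 * PI * m * x)) <= 2 * PI * m * Rabs (x - y))%R).
  { eapply Rle_trans; [apply (bounded_variation (fun u => cos (2 * PI * m * u)) (fun u => - (2 * PI * m) * sin (2 * PI * m * u))%R (2 * PI * m))|].
    - intros t _. split; [auto_derive; [trivial|ring]|].
      rewrite Rabs_mult, Rabs_Ropp, Rabs_pos_eq by nra.
      assert (Rabs (sin (2 * PI * m * t)) <= 1)%R by (apply Rabs_le; generalize (SIN_bound (2 * PI * m * t)); lra). nra.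
    - rewrite Rabs_minus_sym. lra. }
  rewrite Rabs_div by (apply Rgt_not_eq; nra). rewrite (Rabs_pos_eq (2 * (PI * m) ^ 2)) by nra.
  apply Rmult_le_reg_r with (2 * (PI * m) ^ 2)%R; [nra|].
  unfold Rdiv. rewrite Rmult_assoc, Rinv_l, Rmult_1_r by (apply Rgt_not_eq; nra).
  eapply Rle_trans; [exact L|]. replace (2 * PI * m * Rabs (x - y))%R with (Rabs (x - y) * (2 * (PI * m)))%R by ring.
  apply Rmult_le_compat_l; [apply Rabs_pos|]. nra.
Qed.

(** Four comparisons: move from [x] to a nearby fraction [y = j / n], pass from [K] to many more
    terms at [y], use the estimate at fractions, and move back. Only the second costs a quantity
    that does not tend to zero with [1 / n], and it is below [1 / K]. *)
Lemma zser_error (K : nat) (x : R) : (0 < K)%nat -> (0 <= x <= 1)%R ->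
  (Rabs (zser K x - x * (1 - x) / 2) <= / INR K)%R.
Proof.
  intros HK Hx. assert (PK : (0 < INR K)%R) by (now apply lt_0_INR).
  apply le_epsilon. intros e He.
  (* The share [K / n] comes from the Lipschitz bound, and one [1 / n] each from [zser_rational] and
     from moving [x (1 - x) / 2]. *)
  destruct (INR_unbounded ((INR K + 2) / e)) as [m Hm].
  set (p := (K + m)%nat). set (n := INR (2 * p + 1)).
  assert (Hnm : (INR m <= n)%R) by (apply le_INR; unfold p; lia).
  assert (Hn0 : (0 < n)%R) by (apply lt_0_INR; lia).
  destruct (nfloor_ex (n * x)) as [j [J1 J2]]; [nra|].
  assert (Hj : (j <= 2 * p + 1)%nat).
  { apply INR_le. fold n. nra. }
  set (y := (INR j / n)%R).
  assert (Hy : (Rabs (x - y) <= / n)%R).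
  { replace (x - y)%R with ((n * x - INR j) * / n)%R by (unfold y; field; lra).
    rewrite Rabs_pos_eq; [|apply Rmult_le_pos; [lra|left; now apply Rinv_0_lt_compat]].
    rewrite <- (Rmult_1_l (/ n)) at 2. apply Rmult_le_compat_r; [left; now apply Rinv_0_lt_compat|lra]. }
  assert (Hy01 : (0 <= y <= 1)%R).
  { unfold y. split; [apply Rdiv_le_0_compat; [apply pos_INR|lra]|].
    apply Rmult_le_reg_r with n; [lra|]. unfold Rdiv. rewrite Rmult_assoc, Rinv_l, Rmult_1_r by lra. nra. }
  assert (A := zser_lipschitz K x y).
  assert (B := zser_tail K m y HK). fold p in B.
  assert (Cq := zser_rational p j Hj). cbv zeta in Cq. fold n in Cq. fold y in Cq.
  assert (D : (Rabs (y * (1 - y) / 2 - x * (1 - x) / 2) <= / n)%R).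
  { replace (y * (1 - y) / 2 - x * (1 - x) / 2)%R with ((x - y) * ((x + y - 1) / 2))%R by field.
    rewrite Rabs_mult. assert (Rabs ((x + y - 1) / 2) <= 1)%R by (apply Rabs_le; lra).
    assert (0 <= Rabs (x - y))%R by apply Rabs_pos. nra. }
  assert (E : ((INR K + 2) * / n <= e)%R).
  { apply Rmult_le_reg_r with n; [lra|]. rewrite Rmult_assoc, Rinv_l, Rmult_1_r by lra.
    apply Rmult_lt_compat_r with (r := e) in Hm; [|lra]. unfold Rdiv in Hm.
    rewrite Rmult_assoc, Rinv_l, Rmult_1_r in Hm by lra. nra. }
  assert (Kn : (INR K * Rabs (x - y) <= INR K * / n)%R) by (apply Rmult_le_compat_l; lra).
  assert (P1 : (0 < INR (K + m))%R) by (apply lt_0_INR; lia). fold p in P1.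
  assert (IP : (0 < / INR p)%R) by now apply Rinv_0_lt_compat.
  assert (IK : (0 < / INR K)%R) by now apply Rinv_0_lt_compat.
  apply Rabs_le_between in A. apply Rabs_le_between in Cq. apply Rabs_le_between in D.
  apply Rabs_le. lra.
Qed.

(** * Poisson summation on the half-line *)

Definition dirichlet (K : nat) (x : R) : R :=
  (1 + rsum (fun k => 2 * cos (2 * PI * INR (S k) * x)) K)%R.

Lemma dirichlet_csum (K : nat) (x : R) :
  RtoC (dirichlet K x) = csum (fun k => Cunit ((INR k - INR K) * x)) (K + S K).
Proof.
  rewrite csum_add, csum_first, csum_rev.
  rewrite (csum_ext (fun k => Cunit ((INR (K - 1 - k) - INR K) * x)) (fun k => Cunit (- (INR (S k) * x)))).
  2: { intros k Hk. f_equal. rewrite !minus_INR by lia. rewrite !S_INR. simpl INR. ring. }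
  rewrite (csum_ext (fun k => Cunit ((INR (K + S k) - INR K) * x)) (fun k => Cunit (INR (S k) * x))).
  2: { intros k Hk. f_equal. rewrite plus_INR. ring. }
  rewrite Nat.add_0_r, Rminus_diag, Rmult_0_l, Cunit_0.
  unfold dirichlet. rewrite RtoC_plus, rsum_csum.
  rewrite (csum_ext _ (fun k => Cunit (- (INR (S k) * x)) + Cunit (INR (S k) * x))).
  - rewrite csum_plus. ring.
  - intros k _. unfold Cunit. rewrite !Cexp_Ci.
    replace (2 * PI * - (INR (S k) * x))%R with (- (2 * PI * INR (S k) * x))%R by ring.
    replace (2 * PI * (INR (S k) * x))%R with (2 * PI * INR (S k) * x)%R by ring.
    rewrite cos_neg, sin_neg. apply C_ext; unfold Re, Im; simpl fst; simpl snd; ring.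
Qed.

Definition zser' (K : nat) (x : R) : R :=
  rsum (fun k => sin (2 * PI * INR (S k) * x) / (PI * INR (S k)))%R K.

Lemma is_derive_zser (K : nat) (x : R) : is_derive (zser K) x (zser' K x).
Proof.
  assert (HP := PI_RGT_0). unfold zser, zser'. induction K as [|K IH]; cbn [rsum].
  - exact (is_derive_const (V := R_NormedModule) _ x).
  - apply: is_derive_plus; [exact IH|].
    assert (Hm : (0 < INR (S K))%R) by (apply lt_0_INR; lia).
    generalize dependent (INR (S K)). intros m Hm.
    auto_derive; [trivial|]. field. split; nra.
Qed.

Lemma is_derive_zser' (K : nat) (x : R) : is_derive (zser' K) x (dirichlet K x - 1)%R.
Proof.
  assert (HP := PI_RGT_0). unfold dirichlet, zser'.
  replace (1 + rsum (fun k => 2 * cos (2 * PI * INR (S k) * x)) K - 1)%R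
    with (rsum (fun k => 2 * cos (2 * PI * INR (S k) * x))%R K) by ring.
  induction K as [|K IH]; cbn [rsum].
  - exact (is_derive_const (V := R_NormedModule) _ x).
  - apply: is_derive_plus; [exact IH|].
    assert (Hm : (0 < INR (S K))%R) by (apply lt_0_INR; lia).
    generalize dependent (INR (S K)). intros m Hm.
    auto_derive; [trivial|]. field. split; nra.
Qed.

Lemma continuous_dirichlet (K : nat) (x : R) : continuous (dirichlet K) x.
Proof.
  unfold dirichlet. apply: continuous_plus; [apply continuous_const|].
  induction K as [|K IH]; cbn [rsum]; [apply continuous_const|].
  apply: continuous_plus; [exact IH|]. apply: ex_derive_continuous. auto_derive. trivial.
Qed.

Lemma zser_shift (K j : nat) (x : R) : zser K x = zser K (x - INR j).
Proof.
  apply rsum_ext. intros k _. do 2 f_equal.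
  replace (2 * PI * INR (S k) * x)%R with (2 * PI * INR (S k) * (x - INR j) + 2 * INR (S k * j) * PI)%R
    by (rewrite mult_INR; ring).
  apply cos_period.
Qed.

Lemma zser_0 (K : nat) : zser K 0 = 0%R.
Proof.
  unfold zser. rewrite (rsum_ext _ (fun _ => 0%R)); [rewrite rsum_const; ring|].
  intros k _. rewrite Rmult_0_r, cos_0. unfold Rdiv. ring.
Qed.

Lemma zser'_INR (K j : nat) : zser' K (INR j) = 0%R.
Proof.
  unfold zser'. rewrite (rsum_ext _ (fun _ => 0%R)); [rewrite rsum_const; ring|].
  intros k _. replace (2 * PI * INR (S k) * INR j)%R with (2 * PI * IZR (Z.of_nat (S k * j)))%R.
  - rewrite sin_2kPI. unfold Rdiv. ring.
  - rewrite <- INR_IZR_INZ, mult_INR. ring.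
Qed.

Section Trapezoid.
Context (F F1 F2 : R -> C) (c : R).
Context (dF : forall x, CD F x (F1 x)) (dF1 : forall x, CD F1 x (F2 x)) (cF2 : forall x, CCont F2 x).
Context (bF2 : forall x, (0 <= x)%R -> (Cmod (F2 x) <= c * exp (- 1 * x))%R).

(** On a unit cell the Dirichlet kernel is the second derivative of [u], the difference between
    [zser K] and the parabola [x (1 - x) / 2]. Two integrations by parts apply: [u] vanishes at both
    ends, its derivative is [-1/2] and [1/2] there and produces the trapezoid, and the integral of
    [u F''] is controlled by [zser_error]. *)
Lemma trapezoid_cell (K j : nat) : (0 < K)%nat ->
  (Cmod (CInt (fun x => RtoC (dirichlet K x) * F x)%C (INR j) (INR (S j)) -
     / 2 * (F (INR j) + F (INR (S j)))) <=
   c / INR K * (exp (- 1 * INR j) - exp (- 1 * INR (S j))))%R.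
Proof.
  intros HK. assert (PK : (0 < INR K)%R) by (now apply lt_0_INR). assert (Pj := pos_INR j).
  assert (c0 : (0 <= c)%R).
  { specialize (bF2 0%R (Rle_refl _)). rewrite Rmult_0_r, exp_0 in bF2.
    generalize (Cmod_ge_0 (F2 0%R)). lra. }
  set (a := INR j). assert (ES : INR (S j) = (a + 1)%R) by apply S_INR.
  set (u := fun x => (zser K x - (x - a) * (1 - (x - a)) / 2)%R).
  set (u1 := fun x => (zser' K x - (1 - 2 * (x - a)) / 2)%R).
  assert (du : forall x, is_derive u x (u1 x)).
  { intros x. apply: is_derive_minus; [apply is_derive_zser|]. auto_derive; [trivial|field]. }
  assert (du1 : forall x, is_derive u1 x (dirichlet K x)).
  { intros x. evar_last; [apply: is_derive_minus; [apply is_derive_zser'|]|].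
    - auto_derive; [trivial|reflexivity].
    - unfold minus, plus, opp; simpl. match goal with |- @eq _ ?x ?y => change (@eq R x y) end. field. }
  assert (cD : forall x, CCont (fun x => RtoC (dirichlet K x)) x) by (intros; apply CCont_RtoC, continuous_dirichlet).
  assert (cu : forall x, CCont (fun x => RtoC (u x)) x).
  { intros; apply CCont_RtoC. apply: ex_derive_continuous. eexists; apply du. }
  assert (cF : forall x, CCont F x) by (intros; eapply CD_CCont, dF).
  assert (Ib : CInt (fun x => RtoC (dirichlet K x) * F x - RtoC (u x) * F2 x) a (a + 1) =
     / 2 * (F a + F (a + 1)%R)).
  { rewrite (CInt_FTC a (a + 1) (fun x => RtoC (u1 x) * F x - RtoC (u x) * F1 x)).
    - assert (u0 : u a = 0%R).
      { unfold u. rewrite (zser_shift K j). fold a. rewrite Rminus_diag, zser_0. field. }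
      assert (u0' : u (a + 1)%R = 0%R).
      { unfold u. rewrite (zser_shift K (S j)), ES. rewrite Rminus_diag, zser_0. field. }
      assert (v0 : u1 a = (- / 2)%R).
      { unfold u1. unfold a at 1. rewrite zser'_INR. field. }
      assert (v0' : u1 (a + 1)%R = (/ 2)%R).
      { unfold u1. rewrite <- ES at 1. rewrite zser'_INR. field. }
      rewrite u0, u0', v0, v0'. rewrite RtoC_opp, RtoC_inv by lra. field.
    - intros x _. eapply CD_eq.
      + apply CD_minus; (apply CD_mult; [apply CD_RtoC|]); [apply du1|apply dF|apply du|apply dF1].
      + cbv beta; ring.
    - intros x _. apply CCont_minus; apply CCont_mult; auto. }
  rewrite ES. rewrite <- Ib.
  replace (CInt (fun x => RtoC (dirichlet K x) * F x) a (a + 1) -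
    CInt (fun x => RtoC (dirichlet K x) * F x - RtoC (u x) * F2 x) a (a + 1))
    with (CInt (fun x => RtoC (u x) * F2 x) a (a + 1)).
  - apply Rle_trans with (c / INR K / 1 * (exp (- (1) * a) - exp (- (1) * (a + 1))))%R.
    2: { replace (- (1))%R with (-1)%R by ring. rewrite Rdiv_1_r. lra. }
    rewrite <- (is_RInt_unique _ _ _ _ (is_RInt_exp_decay (c / INR K) 1 a (a + 1) Rlt_0_1)).
    apply CInt_bound; [lra| | |eexists; apply is_RInt_exp_decay; lra].
    + intros t _. apply CCont_mult; auto.
    + intros t Ht. rewrite Cmod_mult, Cmod_R.
      assert (E : (Rabs (u t) <= / INR K)%R).
      { unfold u. rewrite (zser_shift K j). fold a. apply zser_error; [exact HK|lra]. }
      assert (B := bF2 t ltac:(unfold a in *; lra)). replace (- (1) * t)%R with (-1 * t)%R by ring.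
      replace (c / INR K * exp (-1 * t))%R with (/ INR K * (c * exp (-1 * t)))%R by (unfold Rdiv; ring).
      apply Rmult_le_compat; [apply Rabs_pos|apply Cmod_ge_0|exact E|exact B].
  - transitivity (CInt (fun x => RtoC (dirichlet K x) * F x + (- (1)) * (RtoC (dirichlet K x) * F x - RtoC (u x) * F2 x)) a (a + 1)).
    + apply CInt_ext. intros; ring.
    + rewrite CInt_plus, CInt_scal.
      * ring.
      * intros t _. apply CCont_minus; apply CCont_mult; auto.
      * intros t _. apply CCont_mult; auto.
      * intros t _. apply CCont_mult; [apply CCont_const|]. apply CCont_minus; apply CCont_mult; auto.
Qed.

Lemma trapezoid (K n : nat) : (0 < K)%nat ->
  (Cmod (CInt (fun x => RtoC (dirichlet K x) * F x)%C 0 (INR n) -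
     (/ 2 * F 0%R + csum (fun j => F (INR (S j))) n - / 2 * F (INR n))) <=
   c / INR K * (1 - exp (- 1 * INR n)))%R.
Proof.
  intros HK.
  assert (cDF : forall x, CCont (fun x => RtoC (dirichlet K x) * F x) x).
  { intros; apply CCont_mult; [apply CCont_RtoC, continuous_dirichlet|eapply CD_CCont, dF]. }
  induction n as [|n IH].
  - simpl INR. simpl csum. rewrite Rmult_0_r, exp_0.
    replace (CInt _ 0 0) with (RtoC 0) by (unfold CInt; rewrite !RInt_point; reflexivity).
    replace (0 - (/ 2 * F 0%R + 0 - / 2 * F 0%R)) with (RtoC 0) by ring. rewrite Cmod_0. lra.
  - assert (T := trapezoid_cell K n HK).
    rewrite <- (CInt_Chasles _ 0 (INR n)) by (intros t _; apply cDF).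
    set (e := exp (-1 * INR (S n))) in *. set (e' := exp (-1 * INR n)) in *.
    change (csum (fun j => F (INR (S j))) (S n)) with (csum (fun j => F (INR (S j))) n + F (INR (S n))).
    set (I1 := CInt _ _ (INR n)) in *. set (I2 := CInt _ (INR n) _) in *.
    set (S1 := csum _ n) in *.
    replace (I1 + I2 - (/ 2 * F 0%R + (S1 + F (INR (S n))) - / 2 * F (INR (S n))))
      with ((I1 - (/ 2 * F 0%R + S1 - / 2 * F (INR n))) + (I2 - / 2 * (F (INR n) + F (INR (S n))))).
    + eapply Rle_trans; [apply Cmod_triangle|]. lra.
    + field.
Qed.

(** The cell errors add up to a bound [c / K] over the whole half-line, with [c] independent of [K].
    This is Poisson summation with a rate, and with the value at the endpoint counted by half. The
    bound on [F] itself ensures that the integral converges and that the boundary term at infinity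
    disappears. *)
Lemma Poisson_half_line (K : nat) (c' : R) (S0 : C) : (0 < K)%nat ->
  (forall x, (0 <= x)%R -> (Cmod (F x) <= c' * exp (- 1 * x))%R) ->
  Csums (fun j => F (INR (S j))) S0 ->
  (Cmod (Cinf (fun x => RtoC (dirichlet K x) * F x)%C - (/ 2 * F 0%R + S0)) <= c / INR K)%R.
Proof.
  intros HK bF HS. assert (PK : (0 < INR K)%R) by (now apply lt_0_INR).
  assert (D : exp_dominated (fun x => RtoC (dirichlet K x) * F x) ((1 + 2 * INR K) * c') 1).
  { split.
    - intros; apply CCont_mult; [apply CCont_RtoC, continuous_dirichlet|eapply CD_CCont, dF].
    - intros y Hy. rewrite Cmod_mult, Cmod_R, Rmult_assoc.
      apply Rmult_le_compat; [apply Rabs_pos|apply Cmod_ge_0| |].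
      + unfold dirichlet. eapply Rle_trans; [apply Rabs_triang|]. rewrite Rabs_R1.
        apply Rplus_le_compat_l. eapply Rle_trans; [apply rsum_Rabs|].
        replace (2 * INR K)%R with (rsum (fun _ => 2%R) K) by (rewrite rsum_const; ring). apply rsum_le. intros k _.
        apply Rabs_le. generalize (COS_bound (2 * PI * INR (S k) * y)). lra.
      + replace (- (1))%R with (-1)%R by ring. now apply bF. }
  assert (L := Cinf_correct _ _ 1 Rlt_0_1 D).
  assert (c0 : (0 <= c)%R).
  { assert (B := bF2 0%R (Rle_refl _)). rewrite Rmult_0_r, exp_0 in B.
    generalize (Cmod_ge_0 (F2 0%R)). lra. }
  assert (LF : Ctends eventually (fun n => F (INR n)) 0).
  { apply (Cmod_tends_0 _ (fun n => c' * exp (- 1 * INR n))%R); [|apply is_lim_seq_exp_neg].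
    intros n. apply bF, pos_INR. }
  assert (L2 : Ctends eventually (fun n => CInt (fun x => RtoC (dirichlet K x) * F x) 0 (INR n) -
     (/ 2 * F 0%R + csum (fun j => F (INR (S j))) n - / 2 * F (INR n)))
     (Cinf (fun x => RtoC (dirichlet K x) * F x) - (/ 2 * F 0%R + S0 - / 2 * 0))).
  { apply (Ctends_minus eventually); [exact L|].
    apply (Ctends_minus eventually).
    - apply (Ctends_plus eventually); [apply (Ctends_const eventually)|exact HS].
    - apply (Ctends_mult eventually); [apply (Ctends_const eventually)|exact LF]. }
  replace (/ 2 * F 0%R + S0) with (/ 2 * F 0%R + S0 - / 2 * 0) by ring.
  apply (Ctends_bound _ _ _ _ L2). exists O. intros n _.
  eapply Rle_trans; [now apply trapezoid|].
  rewrite <- (Rmult_1_r (c / INR K)) at 2. apply Rmult_le_compat_l; [apply Rdiv_le_0_compat; lra|].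
  generalize (exp_pos (-1 * INR n)). lra.
Qed.
End Trapezoid.

(** * Periodic functions and the discrete Fourier transform *)

Lemma periodic_mult (N : Z) (g : Z -> C) : periodic N g -> forall k n, g (n + N * k)%Z = g n.
Proof.
  intros H.
  assert (P : forall (k : nat) n, g (n + N * Z.of_nat k)%Z = g n).
  { induction k as [|k IH]; intros n.
    - f_equal. rewrite Z.mul_0_r. ring.
    - rewrite Nat2Z.inj_succ, Z.mul_succ_r, Z.add_assoc, H. apply IH. }
  intros k n. destruct (Z_le_gt_dec 0 k) as [Hk|Hk].
  - rewrite <- (Z2Nat.id k Hk). apply P.
  - rewrite <- (P (Z.to_nat (- k)) (n + N * k)%Z). f_equal. rewrite Z2Nat.id by lia. ring.
Qed.

Lemma periodic_congr (N : Z) (g : Z -> C) (m n : Z) : periodic N g -> (N | m - n)%Z -> g m = g n.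
Proof.
  intros H [k Hk]. rewrite <- (periodic_mult N g H k n). f_equal. lia.
Qed.

Lemma csum_shift1 (n : nat) (G : Z -> C) : periodic (Z.of_nat n) G ->
  csum (fun k => G (Z.of_nat k + 1)%Z) n = csum (fun k => G (Z.of_nat k)) n.
Proof.
  intros H. destruct n as [|n]; [reflexivity|].
  rewrite (csum_first (fun k => G (Z.of_nat k))). simpl csum at 1.
  rewrite Cplus_comm. f_equal.
  - rewrite <- (H (Z.of_nat 0)). f_equal. lia.
  - apply csum_ext. intros k _. f_equal. lia.
Qed.

Lemma csum_shift (n : nat) (G : Z -> C) (t : Z) : periodic (Z.of_nat n) G ->
  csum (fun k => G (Z.of_nat k + t)%Z) n = csum (fun k => G (Z.of_nat k)) n.
Proof.
  intros H.
  assert (P : forall (t : nat), csum (fun k => G (Z.of_nat k + Z.of_nat t)%Z) n = csum (fun k => G (Z.of_nat k)) n).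
  { induction t0 as [|t0 IH].
    - apply csum_ext. intros; f_equal; lia.
    - rewrite <- IH. rewrite <- (csum_shift1 n (fun k => G (k + Z.of_nat t0)%Z)).
      + apply csum_ext. intros; f_equal; lia.
      + intros k. rewrite <- (H (k + Z.of_nat t0)%Z). f_equal. lia. }
  destruct n as [|n]; [reflexivity|].
  (* Adding a multiple of the period makes the shift nonnegative, which reduces it to the case done
     by induction. *)
  rewrite <- (P (Z.to_nat (t + Z.of_nat (S n) * Z.abs t))).
  apply csum_ext. intros k _. rewrite <- (periodic_mult _ G H (Z.abs t) (Z.of_nat k + t)). f_equal. nia.
Qed.

Lemma csum_negate (n : nat) (G : Z -> C) : periodic (Z.of_nat n) G ->
  csum (fun k => G (- Z.of_nat k)%Z) n = csum (fun k => G (Z.of_nat k)) n.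
Proof.
  intros H. rewrite csum_rev. rewrite <- (csum_shift n G 1 H).
  apply csum_ext. intros k Hk. rewrite <- (H (- _)%Z). f_equal. lia.
Qed.

Lemma csum_single (F : nat -> C) (n k0 : nat) : (k0 < n)%nat ->
  (forall k, (k < n)%nat -> k <> k0 -> F k = 0) -> csum F n = F k0.
Proof.
  intros Hk H. induction n as [|n IH]; [lia|]. simpl.
  destruct (Nat.eq_dec k0 n) as [->|Hne].
  - rewrite (csum_ext _ (fun _ => 0)), csum_zero; [ring|]. intros; apply H; lia.
  - rewrite IH, (H n); [ring|lia|lia|lia|]. intros; apply H; lia.
Qed.

Lemma periodic_bounded (n : nat) (G : Z -> C) : (0 < n)%nat -> periodic (Z.of_nat n) G ->
  exists b : R, (0 <= b)%R /\ forall k, (Cmod (G k) <= b)%R.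
Proof.
  intros Hn H. exists (rsum (fun k => Cmod (G (Z.of_nat k))) n).
  assert (P : forall m k, (k < m)%nat -> (0 <= Cmod (G (Z.of_nat k)) <= rsum (fun k => Cmod (G (Z.of_nat k))) m)%R).
  { induction m as [|m IH]; intros k Hk; [lia|]. cbn [rsum].
    assert (Q := Cmod_ge_0 (G (Z.of_nat m))).
    assert (Q' : (0 <= rsum (fun k => Cmod (G (Z.of_nat k))) m)%R).
    { destruct m as [|m]; [simpl; lra|]. generalize (IH O ltac:(lia)). lra. }
    destruct (Nat.eq_dec k m) as [->|Hne]; [lra|]. generalize (IH k ltac:(lia)). lra. }
  split; [generalize (P n O Hn); lra|].
  intros k. assert (B := Z.mod_pos_bound k (Z.of_nat n) ltac:(lia)).
  replace (G k) with (G (Z.of_nat (Z.to_nat (k mod Z.of_nat n)))).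
  - apply P. lia.
  - apply (periodic_congr _ _ _ _ H). exists (- (k / Z.of_nat n))%Z.
    rewrite Z2Nat.id by lia. rewrite (Z.div_mod k (Z.of_nat n)) at 2 by lia. ring.
Qed.

(** The symmetric normalisation makes the transform unitary, so that a Gaussian twist of [f] can be
    sent to another twist with a factor of modulus one. *)
Definition dft (N : nat) (g : Z -> C) (m : Z) : C :=
  RtoC (/ sqrt (INR N)) * csum (fun n => g (Z.of_nat n) * Cunit (- (IZR m * INR n / INR N))) N.

Section DFT.
Context (N : nat) (g : Z -> C) (HN : (0 < N)%nat) (Hg : periodic (Z.of_nat N) g).

Let PN : (0 < INR N)%R := lt_0_INR N HN.

Lemma dft_periodic : periodic (Z.of_nat N) (dft N g).
Proof.
  intros m. unfold dft. f_equal. apply csum_ext. intros n _. f_equal.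
  apply (Cunit_mod1 _ _ (- Z.of_nat n)). rewrite plus_IZR, opp_IZR, <- !INR_IZR_INZ. field. lra.
Qed.

Lemma sqrt_INR_sqr : (sqrt (INR N) * sqrt (INR N) = INR N)%R.
Proof. apply sqrt_sqrt. lra. Qed.

Lemma sqrt_INR_pos : (0 < sqrt (INR N))%R.
Proof. now apply sqrt_lt_R0. Qed.

Lemma dft_inversion (n : Z) :
  g n = RtoC (/ sqrt (INR N)) * csum (fun m => dft N g (Z.of_nat m) * Cunit (IZR n * INR m / INR N)) N.
Proof.
  assert (S1 := sqrt_INR_sqr). assert (S2 := sqrt_INR_pos).
  assert (E : csum (fun m => dft N g (Z.of_nat m) * Cunit (IZR n * INR m / INR N)) N =
     RtoC (/ sqrt (INR N)) * csum (fun k => g (Z.of_nat k) *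
       csum (fun m => Cunit (INR m * (IZR (n - Z.of_nat k) / INR N))) N) N).
  { transitivity (RtoC (/ sqrt (INR N)) * csum (fun m => csum (fun k => g (Z.of_nat k) *
       Cunit (INR m * (IZR (n - Z.of_nat k) / INR N))) N) N).
    - rewrite <- csum_mult_l. apply csum_ext. intros m _. unfold dft.
      rewrite <- Cmult_assoc. f_equal. rewrite <- csum_mult_r. apply csum_ext. intros k _.
      rewrite <- Cmult_assoc. f_equal. rewrite <- Cunit_plus. f_equal.
      rewrite minus_IZR, <- !INR_IZR_INZ. field. lra.
    - f_equal. rewrite csum_swap. apply csum_ext. intros k _. now rewrite csum_mult_l. }
  assert (B := Z.mod_pos_bound n (Z.of_nat N) ltac:(lia)).
  assert (Em := Z.div_mod n (Z.of_nat N) ltac:(lia)).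
  set (k0 := Z.to_nat (n mod Z.of_nat N)).
  rewrite E, (csum_single _ N k0).
  - rewrite csum_Cunit_1; [|exact HN|exists (n / Z.of_nat N)%Z; unfold k0; lia].
    rewrite (periodic_congr _ _ n (Z.of_nat k0) Hg) by (exists (n / Z.of_nat N)%Z; unfold k0; lia).
    transitivity (RtoC (/ sqrt (INR N) * / sqrt (INR N) * INR N) * g (Z.of_nat k0)).
    + replace (/ sqrt (INR N) * / sqrt (INR N) * INR N)%R with 1%R; [ring|].
      rewrite <- Rinv_mult, S1. field. lra.
    + rewrite !RtoC_mult. ring.
  - unfold k0; lia.
  - intros k Hk Hne. rewrite csum_Cunit_0; [ring|exact HN|].
    intros [q Hq]. apply Hne. unfold k0.
    apply Nat2Z.inj. rewrite Z2Nat.id by lia.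
    assert (n / Z.of_nat N = q)%Z; [|nia].
    symmetry. apply (Z.div_unique_pos n (Z.of_nat N) q (Z.of_nat k)); lia.
Qed.

Lemma dft_neg (e : C) : (forall n, g (- n)%Z = e * g n) -> forall m, dft N g (- m)%Z = e * dft N g m.
Proof.
  intros He m. unfold dft.
  set (G := fun n : Z => g n * Cunit (- (IZR (- m) * IZR n / INR N))).
  assert (PG : periodic (Z.of_nat N) G).
  { intros n. unfold G. rewrite Hg. f_equal. apply (Cunit_mod1 _ _ m).
    rewrite plus_IZR, opp_IZR, <- !INR_IZR_INZ. field. lra. }
  rewrite (csum_ext _ (fun k => G (Z.of_nat k))) by (intros; unfold G; now rewrite <- INR_IZR_INZ).
  rewrite <- (csum_negate N G PG).
  rewrite (csum_ext _ (fun n => e * (g (Z.of_nat n) * Cunit (- (IZR m * INR n / INR N))))).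
  - rewrite csum_mult_l. ring.
  - intros n _. unfold G. rewrite He, !opp_IZR, <- INR_IZR_INZ.
    replace (- (- IZR m * - INR n / INR N))%R with (- (IZR m * INR n / INR N))%R by (field; lra). ring.
Qed.

(** Inversion at [0]. It is applied with [g 0 = 0], where it says that the transform has mean zero,
    as the kernel requires. *)
Lemma csum_dft : csum (fun m => dft N g (Z.of_nat m)) N = RtoC (sqrt (INR N)) * g 0%Z.
Proof.
  assert (S2 := sqrt_INR_pos). rewrite (dft_inversion 0).
  rewrite Cmult_assoc, <- RtoC_mult, Rinv_r by lra. rewrite Cmult_1_l. apply csum_ext. intros m _.
  replace (0 * INR m / INR N)%R with 0%R by (field; lra). rewrite Cunit_0. ring.
Qed.

End DFT.

Lemma dft_conj (N : nat) (g : Z -> C) (m : Z) :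
  dft N (fun n => Cconj (g n)) m = Cconj (dft N g (- m)%Z).
Proof.
  unfold dft. rewrite Cmult_conj, Cconj_RtoC, csum_conj. f_equal. apply csum_ext. intros n _.
  rewrite Cmult_conj. f_equal. unfold Cunit. rewrite Cconj_Cexp. f_equal.
  rewrite opp_IZR. unfold Rdiv. apply C_ext; simpl; ring.
Qed.

(** * The kernel *)

Definition gsum (q : C) (n : nat) : C := csum (fun k => (q ^ k)%C) n.

Lemma gsum_geom (q : C) (n : nat) : (1 - q) * gsum q n = 1 - (q ^ n)%C.
Proof. apply csum_geom. Qed.

(** The value of [exp (2 pi i z / N)] at the point [z = omega y] of the rotated ray. For [y > 0] its
    modulus is below one, so the poles of [1 / (1 - q^N)] are avoided except at the origin. *)
Definition qexp (N : nat) (y : R) : C := Cexp (Ci * RtoC (2 * PI / INR N) * omega * RtoC y).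

(* [sum_m h(m) q^m / (1 - q^N)] with [q = qexp N y] and [m] from [1] to [N]; as [sum_m h(m) = 0],
   the factor [1 - q] cancels, which removes the singularity at [y = 0]. *)
Definition kernel (N : nat) (h : Z -> C) (y : R) : C :=
  - csum (fun k => h (Z.of_nat (S k)) * gsum (qexp N y) (S k)) N * / gsum (qexp N y) N.

(** Grouping the exponents by periods gives a geometric series in [q^N], and mean zero lets a factor
    [1 - q] be pulled out of one period. The identity is free of division so that it also covers
    [q = 1]. *)
Lemma kernel_identity (N K : nat) (h : Z -> C) (q : C) :
  periodic (Z.of_nat N) h -> csum (fun k => h (Z.of_nat k)) N = 0 ->
  csum (fun k => h (Z.of_nat (S k)) * (q ^ (S k))%C) (K * N) * gsum q N =
  - csum (fun k => h (Z.of_nat (S k)) * gsum q (S k)) N * (1 - (q ^ (K * N))%C).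
Proof.
  intros Hh H0. set (P := csum (fun k => h (Z.of_nat (S k)) * (q ^ (S k))%C) N).
  assert (E1 : csum (fun k => h (Z.of_nat (S k)) * (q ^ (S k))%C) (K * N) = gsum (q ^ N)%C K * P).
  { rewrite csum_mul. unfold gsum. rewrite <- csum_mult_r. apply csum_ext. intros j _.
    unfold P. rewrite <- csum_mult_l. apply csum_ext. intros i _.
    replace (h (Z.of_nat (S (j * N + i)))) with (h (Z.of_nat (S i))).
    - replace (S (j * N + i)) with (N * j + S i)%nat by lia. rewrite Cpow_add_r, Cpow_mult_r. ring.
    - rewrite <- (periodic_mult _ h Hh (Z.of_nat j)). f_equal. lia. }
  assert (E2 : P = (1 - q) * - csum (fun k => h (Z.of_nat (S k)) * gsum q (S k)) N).
  { assert (H1 : csum (fun k => h (Z.of_nat (S k))) N = 0).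
    { rewrite <- H0, <- (csum_shift1 N h Hh). apply csum_ext. intros; f_equal; lia. }
    transitivity (P - csum (fun k => h (Z.of_nat (S k))) N); [rewrite H1; ring|].
    unfold P. rewrite <- csum_minus, <- csum_opp, <- csum_mult_l. apply csum_ext. intros k _.
    transitivity (- (h (Z.of_nat (S k)) * ((1 - q) * gsum q (S k)))); [|ring].
    rewrite gsum_geom. ring. }
  rewrite E1, E2. set (Rn := csum _ N).
  transitivity (gsum (q ^ N)%C K * ((1 - q) * gsum q N) * - Rn); [ring|].
  rewrite gsum_geom. rewrite (Cmult_comm (gsum _ K)), gsum_geom, <- Cpow_mult_r, (Nat.mul_comm N). ring.
Qed.

Section Kernel.
Context (N : nat) (h : Z -> C) (HN : (0 < N)%nat) (Hh : periodic (Z.of_nat N) h).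

Let PN : (0 < INR N)%R := lt_0_INR N HN.

Lemma Cmod_qexp (y : R) : Cmod (qexp N y) = exp (- (2 * PI / INR N * sin (PI / 4) * y)).
Proof.
  unfold qexp. rewrite Cmod_Cexp. f_equal. unfold omega. rewrite Cexp_Ci.
  unfold Re, Ci, RtoC. cbn [fst snd Cmult]. ring.
Qed.

Lemma sin_PI4_bounds : (7 / 10 <= sin (PI / 4) <= 1)%R.
Proof.
  split; [|apply SIN_bound].
  assert (E : (sin (PI / 4) * sin (PI / 4) = / 2)%R).
  { assert (H := sin2_cos2 (PI / 4)). unfold Rsqr in H. rewrite sin_cos_PI4 in *. lra. }
  assert (0 <= sin (PI / 4))%R by (apply sin_ge_0; generalize PI_RGT_0; lra). nra.
Qed.

Lemma Cmod_qexp_le_1 (y : R) : (0 <= y)%R -> (Cmod (qexp N y) <= 1)%R.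
Proof.
  intros Hy. rewrite Cmod_qexp, <- exp_0. apply exp_le. assert (HP := PI_RGT_0). assert (S := sin_PI4_bounds).
  assert (0 <= 2 * PI / INR N)%R by (apply Rdiv_le_0_compat; lra).
  assert (0 <= 2 * PI / INR N * sin (PI / 4) * y)%R by (apply Rmult_le_pos; [apply Rmult_le_pos|]; lra). lra.
Qed.

Lemma exp_neg_bound (v : R) : (0 <= v)%R -> (v / (1 + v) <= 1 - exp (- v))%R.
Proof.
  intros Hv. assert (exp (- v) <= / (1 + v))%R.
  { rewrite exp_Ropp. apply Rinv_le_contravar; [lra|]. apply exp_ineq1_le. }
  replace (v / (1 + v))%R with (1 - / (1 + v))%R by (field; lra). lra.
Qed.

(* [(1 - q) gsum q N = 1 - q^N] with [|1 - q^N| >= 1 - e^{-u}] and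
   [|1 - q| <= min (2, 2u)], where [u] is minus the real part of the exponent. *)
Lemma gsum_lower (y : R) : (0 <= y)%R -> (/ 4 <= Cmod (gsum (qexp N y) N))%R.
Proof.
  intros Hy. assert (HP := PI_RGT_0). assert (Sn := sin_PI4_bounds).
  destruct (Req_dec y 0) as [->|Hy0].
  - assert (E : qexp N 0 = 1) by (unfold qexp; rewrite Cmult_0_r; apply Cexp_0).
    rewrite E. unfold gsum. rewrite (csum_ext _ (fun _ => 1)) by (intros; apply Cpow_1_l).
    rewrite csum_const, Cmult_1_r, Cmod_Rpos by lra.
    assert (1 <= INR N)%R by (apply (le_INR 1); lia). lra.
  - set (a := (2 * PI / INR N * y)%R).
    assert (Ha : (0 < a)%R) by (apply Rmult_lt_0_compat; [apply Rdiv_lt_0_compat|]; lra).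
    set (u := (a * sin (PI / 4))%R). assert (Hu : (0 < u)%R) by (apply Rmult_lt_0_compat; lra).
    assert (Eq : Cmod (qexp N y) = exp (- u)) by (rewrite Cmod_qexp; f_equal; unfold u, a; ring).
    assert (G := f_equal Cmod (gsum_geom (qexp N y) N)). rewrite Cmod_mult in G.
    assert (L1 : (1 - exp (- u) <= Cmod (1 - (qexp N y ^ N)%C))%R).
    { assert (T : (1 <= Cmod (1 - (qexp N y ^ N)%C) + Cmod ((qexp N y ^ N)%C))%R).
      { rewrite <- Cmod_1 at 1. replace (RtoC 1) with ((1 - (qexp N y ^ N)%C) + (qexp N y ^ N)%C) at 1 by ring. apply Cmod_triangle. }
      rewrite Cmod_pow, Eq in T.
      assert (exp (- u) ^ N <= exp (- u) ^ 1)%R.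
      { assert (E1 : (exp (- u) <= 1)%R) by (rewrite <- exp_0; apply exp_le; lra).
        assert (E0 := exp_pos (- u)). destruct N as [|k]; [lia|]. simpl.
        assert (exp (- u) ^ k <= 1)%R by (rewrite <- (pow1 k); apply pow_incr; lra). nra. }
      simpl in H. lra. }
    assert (L2 : (Cmod (1 - qexp N y) <= 2)%R).
    { eapply Rle_trans; [apply Cmod_triangle|]. rewrite Cmod_1, Cmod_opp. generalize (Cmod_qexp_le_1 y Hy). lra. }
    assert (L3 : (Cmod (1 - qexp N y) <= 2 * u)%R).
    { rewrite Cmod_minus_sym. unfold qexp. rewrite <- Cexp_0.
      eapply Rle_trans; [apply (Cexp_lipschitz _ _ 0)|].
      - apply Rnot_lt_le. intros H. assert (Q := Cmod_qexp_le_1 y Hy). unfold qexp in Q. rewrite Cmod_Cexp in Q.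
        rewrite <- exp_0 in Q. apply exp_increasing in H. lra.
      - simpl. lra.
      - rewrite exp_0, Rmult_1_r.
        replace (Ci * RtoC (2 * PI / INR N) * omega * RtoC y - 0) with (Ci * omega * RtoC a) by (unfold a; rewrite RtoC_mult; ring).
        rewrite !Cmod_mult, Cmod_Ci, Cmod_omega, Cmod_Rpos by lra. unfold u. nra. }
    assert (B := exp_neg_bound u (Rlt_le _ _ Hu)).
    assert (B2 : (u / 2 <= 1 - exp (- u) \/ 1 / 2 <= 1 - exp (- u))%R).
    { destruct (Rle_dec u 1) as [H1|H1]; [left|right]; (eapply Rle_trans; [|exact B]).
      - apply Rmult_le_compat_l; [lra|]. apply Rinv_le_contravar; lra.
      - apply Rmult_le_reg_r with (1 + u)%R; [lra|]. field_simplify; lra. }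
    assert (C0 := Cmod_ge_0 (1 - qexp N y)). assert (C1 := Cmod_ge_0 (gsum (qexp N y) N)).
    apply Rnot_lt_le. intros H. nra.
Qed.

Lemma CCont_qexp (y : R) : CCont (qexp N) y.
Proof. unfold qexp. apply CCont_Cexp, CCont_mult; [apply CCont_const|apply CCont_id]. Qed.

Lemma CCont_gsum (n : nat) (y : R) : CCont (fun y => gsum (qexp N y) n) y.
Proof. unfold gsum. apply CCont_csum. intros k _. apply CCont_pow, CCont_qexp. Qed.

Lemma exp_bounded_kernel : exp_bounded (kernel N h).
Proof.
  destruct (periodic_bounded N h HN Hh) as [b [Hb Hbd]].
  apply (exp_bounded_bounded _ (INR N * (b * INR N) * 4)%R).
  - intros y Hy. unfold kernel. apply CCont_mult.
    + apply (CCont_ext (fun y => - (1) * csum (fun k => h (Z.of_nat (S k)) * gsum (qexp N y) (S k)) N)); [intros; ring|].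
      apply CCont_mult; [apply CCont_const|]. apply CCont_csum. intros k _.
      apply CCont_mult; [apply CCont_const|apply CCont_gsum].
    + apply CCont_inv; [|apply CCont_gsum]. apply Cmod_gt_0. generalize (gsum_lower y Hy). lra.
  - intros y Hy. assert (G := gsum_lower y Hy). unfold kernel. rewrite Cmod_mult, Cmod_opp.
    rewrite Cmod_inv by (apply Cmod_gt_0; lra).
    apply Rmult_le_compat; [apply Cmod_ge_0|left; apply Rinv_0_lt_compat; lra| |].
    + apply Cmod_csum_const. intros k Hk. rewrite Cmod_mult.
      apply Rmult_le_compat; [apply Cmod_ge_0|apply Cmod_ge_0|apply Hbd|].
      eapply Rle_trans; [apply (Cmod_csum_const _ 1%R)|].
      * intros j _. rewrite Cmod_pow. rewrite <- (pow1 j). apply pow_incr.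
        split; [apply Cmod_ge_0|now apply Cmod_qexp_le_1].
      * rewrite Rmult_1_r. apply le_INR. lia.
    + replace 4%R with (/ / 4)%R by field. apply Rinv_le_contravar; lra.
Qed.

(** On the ray, [K] full periods of positive frequencies already sum to the kernel, up to the factor
    [1 - q^(K N)], which tends to [1] for [y > 0]. *)
Lemma kernel_partial_sum (K : nat) (y : R) : (0 <= y)%R ->
  csum (fun k => h (Z.of_nat k)) N = 0 ->
  csum (fun k => h (Z.of_nat (S k)) * Cexp (Ci * RtoC (2 * PI / INR N * INR (S k)) * omega * RtoC y)) (K * N) =
  kernel N h y * (1 - (qexp N y ^ (K * N))%C).
Proof.
  intros Hy H0.
  assert (G : gsum (qexp N y) N <> 0) by (apply Cmod_gt_0; generalize (gsum_lower y Hy); lra).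
  rewrite (csum_ext _ (fun k => h (Z.of_nat (S k)) * (qexp N y ^ (S k))%C)).
  - assert (E := kernel_identity N K h (qexp N y) Hh H0). unfold kernel.
    set (X := csum _ (K * N)) in *. set (Y := csum _ N) in *.
    transitivity (X * gsum (qexp N y) N / gsum (qexp N y) N); [field; exact G|].
    rewrite E. field. exact G.
  - intros k _. f_equal. unfold qexp. rewrite Cexp_pow. f_equal. rewrite RtoC_mult. ring.
Qed.

End Kernel.

(** * Convergence of the partial theta series *)

Lemma ex_series_exp_neg (c : R) : ex_series (fun n => c * exp (- 1 * INR n))%R.
Proof.
  apply: ex_series_scal_l. apply (ex_series_ext (fun n => exp (-1) ^ n)%R).
  - intros n. symmetry. apply exp_mult_INR.
  - apply ex_series_geom. rewrite Rabs_pos_eq by (left; apply exp_pos).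
    rewrite <- exp_0. apply exp_increasing. lra.
Qed.

Lemma Csums_exp_dominated (u : nat -> C) (c : R) :
  (forall n, (Cmod (u n) <= c * exp (- 1 * INR (S n)))%R) -> Csums u (CSeries u).
Proof.
  intros H. apply (Csums_dominated _ (fun n => c * exp (- 1 * INR (S n)))%R); [exact H|].
  apply (ex_series_incr_1 (fun n => c * exp (- 1 * INR n))%R). apply ex_series_exp_neg.
Qed.

(** The [s] for which [exp (i pi n^2 tau / N)] is the Gaussian weight at [n]. Rotating the contour
    replaces it by [i s = pi tau / N], a positive number when [tau] is a positive real: this is why
    the rotated integrals survive at the boundary. *)
Definition theta_param (N : Z) (tau : C) : C := - Ci * RtoC (PI / IZR N) * tau.

Lemma Re_theta_param (N : Z) (tau : C) : Re (theta_param N tau) = (PI / IZR N * Im tau)%R.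
Proof. unfold theta_param. destruct tau. simpl. ring. Qed.

Lemma Re_Ci_theta_param (N : Z) (tau : C) : Re (Ci * theta_param N tau) = (PI / IZR N * Re tau)%R.
Proof. unfold theta_param. destruct tau. simpl. ring. Qed.

Lemma Ci_theta_param (N : Z) (tau : C) : Ci * theta_param N tau = RtoC (PI / IZR N) * tau.
Proof. unfold theta_param. destruct tau. apply C_ext; simpl; ring. Qed.

Lemma theta_term_gw (nu : nat) (g : Z -> C) (N : Z) (tau : C) (j : nat) : (0 < N)%Z ->
  RtoC (INR (S j) ^ nu) * g (Z.of_nat (S j)) * Cexp (Ci * RtoC (PI * INR (S j) ^ 2) * tau / RtoC (IZR N)) =
  RtoC (INR (S j) ^ nu) * g (Z.of_nat (S j)) * gw (theta_param N tau) (INR (S j)).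
Proof.
  intros HN. assert (P : (0 < IZR N)%R) by (now apply IZR_lt). f_equal. unfold gw, theta_param. f_equal.
  unfold Rdiv. rewrite !RtoC_mult, RtoC_inv by lra. field. intros H. apply RtoC_inj in H. lra.
Qed.

Lemma gauss_terms_bound (nu : nat) (s : C) : (0 < Re s)%R ->
  exists c : R, (0 <= c)%R /\ forall y, (0 <= y)%R ->
    (Cmod (RtoC (y ^ nu) * gw s y) <= c * exp (- 1 * y))%R.
Proof.
  intros Hs. destruct (GI_dominated _ s (exp_bounded_pow nu) Hs) as [c [D1 D2]].
  exists c. split; [exact (exp_dominated_pos _ _ _ (conj D1 D2))|].
  intros y Hy. specialize (D2 y Hy). replace (- (1) * y)%R with (-1 * y)%R in D2 by ring. exact D2.
Qed.

Lemma Theta_Csums (nu : nat) (g : Z -> C) (N : Z) (tau : C) (b : R) : (0 < N)%Z -> (0 < Im tau)%R ->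
  (forall n, (Cmod (g n) <= b)%R) ->
  Csums (fun j => RtoC (INR (S j) ^ nu) * g (Z.of_nat (S j)) * gw (theta_param N tau) (INR (S j))) (Theta nu g N tau).
Proof.
  intros HN Ht Hb.
  assert (P : (0 < IZR N)%R) by (now apply IZR_lt).
  destruct (gauss_terms_bound nu (theta_param N tau)) as [c [Hc B]].
  { rewrite Re_theta_param. apply Rmult_lt_0_compat; [apply Rdiv_lt_0_compat; [apply PI_RGT_0|exact P]|exact Ht]. }
  unfold Theta. rewrite (CSeries_ext _ (fun j => RtoC (INR (S j) ^ nu) * g (Z.of_nat (S j)) * gw (theta_param N tau) (INR (S j))))
    by (intros; now apply theta_term_gw).
  apply (Csums_exp_dominated _ (b * c)). intros n.
  replace (RtoC (INR (S n) ^ nu) * g (Z.of_nat (S n)) * gw (theta_param N tau) (INR (S n)))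
    with (g (Z.of_nat (S n)) * (RtoC (INR (S n) ^ nu) * gw (theta_param N tau) (INR (S n)))) by ring.
  rewrite Cmod_mult, Rmult_assoc. apply Rmult_le_compat; auto using Cmod_ge_0. apply B, pos_INR.
Qed.

(** * The theta transformation in the quadrant [Re tau > 0] *)

Definition hfun (nu : nat) (b : R) (s : C) (x : R) : C :=
  RtoC (x ^ nu) * Cexp (Ci * RtoC b * RtoC x) * gw s x.

(** The Dirichlet kernel is a sum of exponentials of frequencies [2 pi (k - K)], so weighting [hfun]
    by it only shifts the frequency [b]; each term of the integral is again a [hint]. *)
Lemma Poisson_hint (nu : nat) (b : R) (s : C) : (nu <= 1)%nat -> (0 < Re s)%R ->
  exists c : R, forall (K : nat) (S0 : C), (0 < K)%nat ->
    Csums (fun j => hfun nu b s (INR (S j))) S0 ->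
    (Cmod (csum (fun k => hint nu (b + 2 * PI * (INR k - INR K)) s) (K + S K) -
      (/ 2 * hfun nu b s 0%R + S0)) <= c / INR K)%R.
Proof.
  intros Hnu Hs.
  set (e := fun x => Cexp (Ci * RtoC b * RtoC x)).
  set (L := fun x : R => Ci * RtoC b + (- (2 * s)) * RtoC x).
  (* [p1] and [p2] are the polynomial factors that one and two differentiations put in front of the
     exponential. *)
  set (p1 := fun x : R => match nu with O => L x | _ => 1 + RtoC x * L x end).
  set (p2 := fun x : R => match nu with
     | O => - (2 * s) + L x * L x
     | _ => L x + RtoC x * (- (2 * s)) + (1 + RtoC x * L x) * L x end).
  assert (dE : forall x, CD (fun x => e x * gw s x) x (L x * (e x * gw s x))).
  { intros x. apply (CD_ext (fun x => Cexp (Ci * RtoC b * RtoC x + (- s) * RtoC (x ^ 2)))).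
    - intros t. rewrite Cexp_plus. unfold e, gw. do 2 f_equal. ring.
    - replace (e x * gw s x) with (Cexp (Ci * RtoC b * RtoC x + (- s) * RtoC (x ^ 2)))
        by (rewrite Cexp_plus; unfold e, gw; do 2 f_equal; ring).
      apply CD_Cexp. eapply CD_eq.
      + apply CD_plus; [apply CD_scal, CD_id|apply CD_scal, (CD_RtoC _ _ (2 * x)%R)].
        auto_derive; [trivial|ring].
      + unfold L. rewrite (RtoC_mult 2 x). cbv beta; ring. }
  assert (dL : forall x, CD L x (- (2 * s))).
  { intros x. unfold L. eapply CD_eq; [apply CD_plus; [apply CD_const|apply CD_scal, CD_id]|]. cbv beta; ring. }
  assert (d1 : forall x, CD (hfun nu b s) x (p1 x * (e x * gw s x))).
  { intros x. apply (CD_ext (fun x => match nu with O => 1 | _ => RtoC x end * (e x * gw s x))).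
    - intros t. unfold hfun, e. destruct nu as [|[|n]]; [simpl; ring| |lia].
      simpl. rewrite Rmult_1_r. ring.
    - unfold p1. destruct nu as [|n].
      + eapply CD_eq; [apply CD_scal, dE|]. ring.
      + eapply CD_eq; [apply CD_mult; [apply CD_id|apply dE]|]. cbv beta; ring. }
  assert (d2 : forall x, CD (fun x => p1 x * (e x * gw s x)) x (p2 x * (e x * gw s x))).
  { intros x. unfold p1, p2. destruct nu as [|n].
    - eapply CD_eq; [apply CD_mult; [apply dL|apply dE]|]. cbv beta; ring.
    - eapply CD_eq; [apply CD_mult; [|apply dE]|].
      + apply CD_plus; [apply CD_const|apply CD_mult; [apply CD_id|apply dL]].
      + cbv beta; ring. }
  assert (bL : exp_bounded L).
  { apply exp_bounded_plus; [apply exp_bounded_const|].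
    apply exp_bounded_mult; [apply exp_bounded_const|apply exp_bounded_id]. }
  assert (bp2 : exp_bounded p2).
  { unfold p2. destruct nu as [|n]; ebound. }
  assert (be : exp_bounded e) by apply exp_bounded_Cexp.
  destruct (GI_dominated _ s (exp_bounded_mult _ _ bp2 be) Hs) as [c [D1 D2]].
  destruct (GI_dominated _ s (exp_bounded_hint nu (Ci * RtoC b)) Hs) as [c' [D1' D2']].
  exists c. intros K S0 HK HS.
  assert (cL : forall x, CCont L x) by (intros; eapply CD_CCont, dL).
  assert (X := Poisson_half_line (hfun nu b s) (fun x => p1 x * (e x * gw s x)) (fun x => p2 x * (e x * gw s x)) c d1 d2).
  unfold hint. rewrite <- (GI_csum (fun k y => RtoC (y ^ nu) * Cexp (Ci * RtoC (b + 2 * PI * (INR k - INR K)) * RtoC y)))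
    by (auto; intros; apply exp_bounded_hint).
  unfold GI.
  rewrite (Cinf_ext _ (fun x => RtoC (dirichlet K x) * hfun nu b s x)).
  - apply (X) with (c' := c'); [| |exact HK| |exact HS].
    + intros x. apply CCont_mult; [|eapply CD_CCont, dE].
      unfold p2. destruct nu; ccont; apply cL.
    + intros x Hx. specialize (D2 x Hx). replace (- (1) * x)%R with (-1 * x)%R in D2 by ring.
      rewrite Cmult_assoc. exact D2.
    + intros x Hx. specialize (D2' x Hx). replace (- (1) * x)%R with (-1 * x)%R in D2' by ring. exact D2'.
  - intros y _. rewrite dirichlet_csum. unfold hfun. rewrite <- !csum_mult_r. apply csum_ext. intros k _.
    unfold Cunit. replace (Ci * RtoC (b + 2 * PI * (INR k - INR K)) * RtoC y) with
      (Ci * RtoC (2 * PI * ((INR k - INR K) * y)) + Ci * RtoC b * RtoC y)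
      by (apply C_ext; simpl; ring).
    rewrite Cexp_plus. ring.
Qed.

(** The Fourier transform of [y^nu exp (- s y^2)] over the whole line, as the sum of the two
    half-line integrals at [b] and, with sign [(-1)^nu], at [- b]. *)
Definition hint_Gauss_value (nu : nat) (b : R) (s : C) : C :=
  (Ci * RtoC b / (2 * s)) ^ nu * (2 * GI (fun _ => 1) s * Cexp (- (RtoC (b ^ 2) / (4 * s)))).

(** The device for negative frequencies, which cannot be rotated: they are replaced by positive ones
    at the price of a full-line Gaussian. *)
Lemma hint_opp (nu : nat) (b : R) (s : C) : (nu <= 1)%nat -> (0 < Re s)%R ->
  (- (1)) ^ nu * hint nu (- b) s = hint_Gauss_value nu b s - hint nu b s.
Proof.
  intros Hnu Hs. unfold hint_Gauss_value. rewrite <- hint_Gauss_0 by exact Hs.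
  destruct nu as [|[|n]]; [simpl; ring| |lia].
  rewrite !Cpow_1_r, <- hint_Gauss_1 by exact Hs. ring.
Qed.

Lemma eventually_mult (N : nat) : (0 < N)%nat -> filterlim (fun K => (K * N)%nat) eventually eventually.
Proof. intros HN P [n Hn]. exists n. intros m Hm. apply Hn. nia. Qed.

Lemma eventually_S : filterlim S eventually eventually.
Proof. intros P [n Hn]. exists n. intros m Hm. apply Hn. lia. Qed.

(** One formula for both cases: odd for [nu = 0], even for [nu = 1]. *)
Definition parity (nu : nat) (g : Z -> C) : Prop := forall n : Z, g (- n)%Z = - (- (1)) ^ nu * g n.

Section ThetaStep.
Context (N : nat) (g : Z -> C) (nu : nat) (HN : (0 < N)%nat) (Hg : periodic (Z.of_nat N) g) (Hnu : (nu <= 1)%nat).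
Context (Hpar : parity nu g) (g0 : g 0%Z = 0) (gh0 : dft N g 0 = 0).
Context (tau : C) (Ht : (0 < Im tau)%R) (Hre : (0 < Re tau)%R).

Let gh := dft N g.
Let s := theta_param (Z.of_nat N) tau.
Let PN : (0 < INR N)%R := lt_0_INR N HN.
Let bm (m : Z) : R := (2 * PI / INR N * IZR m)%R.
Let H (m : Z) : C := gh m * hint nu (bm m) s.

Lemma step_Re_s : (0 < Re s)%R.
Proof.
  unfold s. rewrite Re_theta_param, <- INR_IZR_INZ.
  apply Rmult_lt_0_compat; [apply Rdiv_lt_0_compat; [apply PI_RGT_0|exact PN]|exact Ht].
Qed.

Lemma step_Re_Cis : (0 < Re (Ci * s))%R.
Proof.
  unfold s. rewrite Re_Ci_theta_param, <- INR_IZR_INZ.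
  apply Rmult_lt_0_compat; [apply Rdiv_lt_0_compat; [apply PI_RGT_0|exact PN]|exact Hre].
Qed.

Lemma step_tau_neq_0 : tau <> 0.
Proof. intros E. rewrite E in Ht. simpl in Ht. lra. Qed.

(** The frequencies run through [2 pi / N] times the integers from [- K N] to [(K + 1) N - 1]. Since
    [gh] vanishes at all multiples of [N], the term at [0] may be exchanged for the one at
    [(K + 1) N], so that both remaining sums start at [1]. *)
Lemma step_split (K : nat) :
  csum (fun m => gh (Z.of_nat m) * csum (fun k => hint nu (bm (Z.of_nat m) + 2 * PI * (INR k - INR K)) s) (K + S K)) N
  = csum (fun i => H (- Z.of_nat (S i))%Z) (K * N) + csum (fun i => H (Z.of_nat (S i))) (S K * N).
Proof.
  set (F := fun i : nat => H (Z.of_nat i - Z.of_nat (K * N))%Z).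
  transitivity (csum F ((K + S K) * N)).
  - rewrite csum_mul'. apply csum_ext. intros m _. rewrite <- csum_mult_l. apply csum_ext. intros k _.
    unfold F, H. f_equal.
    + apply (periodic_congr _ _ _ _ (dft_periodic N g HN)). exists (Z.of_nat K - Z.of_nat k)%Z. lia.
    + f_equal. unfold bm. rewrite minus_IZR, <- !INR_IZR_INZ, plus_INR, !mult_INR. field. lra.
  - rewrite Nat.mul_add_distr_r, csum_add. f_equal.
    + rewrite csum_rev. apply csum_ext. intros k Hk. unfold F. f_equal. lia.
    + assert (E : csum (fun i => H (Z.of_nat i)) (S K * N) + H (Z.of_nat (S K * N)) =
        H (Z.of_nat 0) + csum (fun i => H (Z.of_nat (S i))) (S K * N))
        by exact (csum_first (fun i => H (Z.of_nat i)) (S K * N)).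
      assert (H0 : H (Z.of_nat 0) = 0) by (unfold H; change (Z.of_nat 0) with 0%Z; unfold gh; rewrite gh0; ring).
      assert (H1 : H (Z.of_nat (S K * N)) = 0).
      { unfold H. replace (gh (Z.of_nat (S K * N))) with (dft N g 0); [rewrite gh0; ring|].
        apply (periodic_congr _ _ _ _ (dft_periodic N g HN)). exists (- Z.of_nat (S K))%Z. lia. }
      rewrite H0, H1, Cplus_0_l, Cplus_0_r in E. rewrite <- E.
      apply csum_ext. intros k _. unfold F. f_equal. lia.
Qed.

Lemma step_negative (i : nat) : H (- Z.of_nat (S i))%Z =
  H (Z.of_nat (S i)) - gh (Z.of_nat (S i)) * hint_Gauss_value nu (bm (Z.of_nat (S i))) s.
Proof.
  unfold H. set (m := Z.of_nat (S i)).
  replace (bm (- m)) with (- bm m)%R by (unfold bm; rewrite opp_IZR; ring).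
  unfold gh. rewrite (dft_neg N g HN Hg (- (- (1)) ^ nu)) by exact Hpar.
  assert (E := hint_opp nu (bm m) s Hnu step_Re_s).
  transitivity (- (dft N g m * ((- (1)) ^ nu * hint nu (- bm m) s))); [ring|]. rewrite E. ring.
Qed.

Definition step_kernel_value : C :=
  omega ^ (S nu) * GI (fun y => RtoC (y ^ nu) * kernel N gh y) (Ci * s).

Lemma step_kernel_csum0 : csum (fun k => gh (Z.of_nat k)) N = 0.
Proof. unfold gh. rewrite csum_dft, g0 by assumption. ring. Qed.

Lemma exp_bounded_pow_kernel : exp_bounded (fun y => RtoC (y ^ nu) * kernel N gh y).
Proof.
  apply exp_bounded_mult; [apply exp_bounded_pow|].
  apply exp_bounded_kernel; [exact HN|now apply dft_periodic].
Qed.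

(** Rotation is done term by term, before summing; afterwards the finite sum under the integral is
    the kernel times [1 - q^(K N)], and the second part tends to zero. *)
Lemma step_positive_limit :
  Ctends eventually (fun K => csum (fun i => H (Z.of_nat (S i))) (K * N)) step_kernel_value.
Proof.
  assert (Hs := step_Re_s). assert (Hcs := step_Re_Cis). assert (HP := PI_RGT_0).
  set (B := fun y => RtoC (y ^ nu) * kernel N gh y).
  assert (EB : exp_bounded B) by apply exp_bounded_pow_kernel.
  assert (E : forall K, csum (fun i => H (Z.of_nat (S i))) (K * N) =
    omega ^ (S nu) * GI (fun y => B y - B y * (qexp N y ^ (K * N))%C) (Ci * s)).
  { intros K. set (T := fun (i : nat) (y : R) => gh (Z.of_nat (S i)) * (RtoC (y ^ nu) *
      Cexp (Ci * RtoC (bm (Z.of_nat (S i))) * omega * RtoC y))).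
    assert (ET : forall i, exp_bounded (T i)).
    { intros i. apply exp_bounded_mult; [apply exp_bounded_const|apply exp_bounded_hint]. }
    transitivity (omega ^ (S nu) * GI (fun y => csum (fun i => T i y) (K * N)) (Ci * s)).
    - rewrite GI_csum by auto. rewrite <- csum_mult_l. apply csum_ext. intros i _.
      unfold T, H. rewrite GI_scal by (auto; apply exp_bounded_hint).
      rewrite hint_rotation; [ring| |exact Hs|exact Hcs].
      unfold bm. apply Rmult_le_pos; [apply Rdiv_le_0_compat; lra|]. apply IZR_le. lia.
    - f_equal. apply GI_ext. intros y Hy.
      transitivity (RtoC (y ^ nu) * (kernel N gh y * (1 - (qexp N y ^ (K * N))%C))); [|unfold B; ring].
      rewrite <- kernel_partial_sum; [|exact HN|now apply dft_periodic|exact Hy|apply step_kernel_csum0].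
      rewrite <- csum_mult_l. apply csum_ext. intros i _. unfold T, bm. rewrite <- INR_IZR_INZ. ring. }
  destruct (GI_dominated B (Ci * s) EB Hcs) as [c D].
  assert (Eq : forall K, exp_bounded (fun y => B y * (qexp N y ^ (K * N))%C)).
  { intros K. apply exp_bounded_mult; [exact EB|].
    apply (exp_bounded_bounded _ 1%R).
    - intros y _. apply CCont_pow, CCont_qexp.
    - intros y Hy. rewrite Cmod_pow. rewrite <- (pow1 (K * N)). apply pow_incr.
      split; [apply Cmod_ge_0|now apply Cmod_qexp_le_1]. }
  assert (c0 := exp_dominated_pos _ _ _ D). destruct D as [_ D].
  (* Without any decay from the Gaussian, the integrand is at most [c |q|^(K N)], and
     [2 pi sin (pi / 4) >= 1] bounds this by [c exp (- K y)]; integration gives [c / K]. *)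
  assert (L : Ctends eventually (fun K => GI (fun y => B y * (qexp N y ^ (K * N))%C) (Ci * s)) 0).
  { intros eps He. destruct (INR_unbounded (c / eps)) as [K0 HK0]. exists (S K0). intros K HK.
    assert (PK : (0 < INR K)%R) by (apply lt_0_INR; lia).
    replace (GI (fun y => B y * (qexp N y ^ (K * N))%C) (Ci * s) - 0) with
      (GI (fun y => B y * (qexp N y ^ (K * N))%C) (Ci * s)) by ring.
    apply Rle_lt_trans with (c / INR K)%R.
    - apply Cinf_bound; [exact PK|]. split.
      + intros y Hy. apply CCont_mult; [now apply Eq|apply CCont_gw].
      + intros y Hy. specialize (D y Hy).
        replace (B y * (qexp N y ^ (K * N))%C * gw (Ci * s) y) with ((B y * gw (Ci * s) y) * (qexp N y ^ (K * N))%C) by ring.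
        rewrite Cmod_mult. apply Rmult_le_compat; [apply Cmod_ge_0|apply Cmod_ge_0| |].
        * eapply Rle_trans; [exact D|]. rewrite <- (Rmult_1_r c) at 2. apply Rmult_le_compat_l; [exact c0|].
          apply Rle_trans with (exp 0); [apply exp_le; lra|rewrite exp_0; lra].
        * rewrite Cmod_pow, Cmod_qexp, <- exp_mult_INR, mult_INR by exact HN. apply exp_le.
          replace (- (2 * PI / INR N * sin (PI / 4) * y) * (INR K * INR N))%R
            with (- (2 * PI * sin (PI / 4)) * (INR K * y))%R by (field; lra).
          assert (S4 := sin_PI4_bounds). assert (P4 := PI2_3_2).
          assert (Z : (0 <= INR K * y)%R) by (apply Rmult_le_pos; [left; exact PK|exact Hy]).
          replace (- INR K * y)%R with (- (INR K * y))%R by ring.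
          revert S4 P4 Z. clear. generalize (INR K * y)%R (sin (PI / 4)). intros z w S4 P4 Z.
          assert (1 <= 2 * PI * w)%R by nra. nra.
    - apply Rmult_lt_reg_r with (INR K); [exact PK|].
      unfold Rdiv. rewrite Rmult_assoc, Rinv_l, Rmult_1_r by lra.
      apply Rmult_lt_compat_r with (r := eps) in HK0; [|exact He]. unfold Rdiv in HK0.
      rewrite Rmult_assoc, Rinv_l, Rmult_1_r in HK0 by lra.
      assert (INR K0 <= INR K)%R by (apply le_INR; lia). nra. }
  apply (Ctends_ext eventually (fun K => omega ^ (S nu) * (GI B (Ci * s) -
     GI (fun y => B y * (qexp N y ^ (K * N))%C) (Ci * s)))).
  - intros K. rewrite E, GI_minus by auto. reflexivity.
  - unfold step_kernel_value. fold B.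
    replace (omega ^ S nu * GI B (Ci * s)) with (omega ^ S nu * (GI B (Ci * s) - 0)) by ring.
    apply (Ctends_mult eventually); [apply (Ctends_const eventually)|].
    exact (Ctends_minus eventually _ _ _ _ (Ctends_const eventually (GI B (Ci * s))) L).
Qed.

(** For [s = - i pi tau / N] and [b = 2 pi m / N] one has [i b / (2 s) = - m / tau], and
    [exp (- b^2 / (4 s))] is the exponential of index [m] in the theta series at [- 1 / tau]. *)
Lemma step_Gauss_limit :
  Ctends eventually (fun K => csum (fun i => gh (Z.of_nat (S i)) * hint_Gauss_value nu (bm (Z.of_nat (S i))) s) (K * N))
    ((- / tau) ^ nu * (2 * GI (fun _ => 1) s) * Theta nu gh (Z.of_nat N) (- / tau)).
Proof.
  assert (T0 := step_tau_neq_0). assert (HP := PI_RGT_0).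
  destruct (periodic_bounded N gh HN (dft_periodic N g HN)) as [b [Hb Hbd]].
  assert (Ht' : (0 < Im (- / tau))%R).
  { clear - Ht. destruct tau as [x y]. simpl in *.
    replace (- (- y / (x * (x * 1) + y * (y * 1))))%R with (y / (x * x + y * y))%R by (field; nra).
    apply Rdiv_lt_0_compat; [exact Ht|nra]. }
  assert (TS := Theta_Csums nu gh (Z.of_nat N) (- / tau) b ltac:(lia) Ht' Hbd).
  refine (Ctends_comp eventually eventually (fun K => (K * N)%nat)
    (csum (fun i => gh (Z.of_nat (S i)) * hint_Gauss_value nu (bm (Z.of_nat (S i))) s)) _ (eventually_mult N HN) _).
  eapply Csums_ext; [|apply Csums_mult_l; exact TS].
  intros j. cbv beta. unfold hint_Gauss_value.
  set (m := INR (S j)). assert (Em : IZR (Z.of_nat (S j)) = m) by (unfold m; now rewrite INR_IZR_INZ).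
  assert (Pn0 : RtoC (INR N) <> 0) by (intros X; apply RtoC_inj in X; lra).
  assert (PI0 : RtoC PI <> 0) by (intros X; apply RtoC_inj in X; lra).
  assert (Es : s = - Ci * RtoC PI / RtoC (INR N) * tau).
  { unfold s, theta_param. rewrite <- INR_IZR_INZ. unfold Rdiv. rewrite RtoC_mult, RtoC_inv by lra. field. exact Pn0. }
  assert (Eb : RtoC (bm (Z.of_nat (S j))) = 2 * RtoC PI / RtoC (INR N) * RtoC m).
  { unfold bm. rewrite Em. unfold Rdiv. rewrite !RtoC_mult, RtoC_inv by lra. field. exact Pn0. }
  assert (I2 : Ci * Ci = - (1)) by (apply C_ext; simpl; ring).
  assert (E1 : Ci * RtoC (bm (Z.of_nat (S j))) / (2 * s) = - / tau * RtoC m).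
  { rewrite Eb, Es. field. repeat split; auto. apply Ci_nz. }
  assert (E2 : Cexp (- (RtoC (bm (Z.of_nat (S j)) ^ 2) / (4 * s))) = gw (theta_param (Z.of_nat N) (- / tau)) m).
  { unfold gw. f_equal. f_equal. rewrite RtoC_pow, Eb, Es. unfold theta_param. rewrite <- INR_IZR_INZ, RtoC_pow.
    unfold Rdiv. rewrite RtoC_mult, RtoC_inv by lra.
    transitivity (- (Ci * Ci) * RtoC PI * RtoC m * RtoC m / (- Ci * RtoC (INR N) * tau)).
    - rewrite I2. field. repeat split; auto. apply Ci_nz.
    - field. repeat split; auto. apply Ci_nz. }
  rewrite E1, E2, Cpow_mult_l, RtoC_pow. ring.
Qed.

(** Poisson summation is applied to each exponential of the inverse Fourier expansion of [g]. Summed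
    against [gh], the exponentials give back [sqrt N g], and the half terms at the endpoint cancel
    because [gh] has mean zero. *)
Lemma step_Poisson_limit :
  Ctends eventually (fun K => csum (fun m => gh (Z.of_nat m) *
      csum (fun k => hint nu (bm (Z.of_nat m) + 2 * PI * (INR k - INR K)) s) (K + S K)) N)
    (RtoC (sqrt (INR N)) * Theta nu g (Z.of_nat N) tau).
Proof.
  assert (Hs := step_Re_s). assert (S2 := sqrt_INR_pos N HN).
  destruct (gauss_terms_bound nu s Hs) as [c [Hc Bc]].
  assert (bdd : forall b y, (0 <= y)%R -> (Cmod (hfun nu b s y) <= c * exp (-1 * y))%R).
  { intros b y Hy. unfold hfun.
    replace (Ci * RtoC b * RtoC y) with (Ci * RtoC (b * y)) by (rewrite RtoC_mult; ring).
    replace (RtoC (y ^ nu) * Cexp (Ci * RtoC (b * y)) * gw s y) with (Cexp (Ci * RtoC (b * y)) * (RtoC (y ^ nu) * gw s y)) by ring.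
    rewrite Cmod_mult, Cmod_Cexp_Ci, Rmult_1_l. now apply Bc. }
  set (S0 := fun m : nat => CSeries (fun j => hfun nu (bm (Z.of_nat m)) s (INR (S j)))).
  assert (HS0 : forall m, Csums (fun j => hfun nu (bm (Z.of_nat m)) s (INR (S j))) (S0 m)).
  { intros m. apply (Csums_exp_dominated _ c). intros n. apply bdd, pos_INR. }
  assert (HT : csum (fun m => gh (Z.of_nat m) * (/ 2 * hfun nu (bm (Z.of_nat m)) s 0%R + S0 m)) N =
      RtoC (sqrt (INR N)) * Theta nu g (Z.of_nat N) tau).
  { transitivity (csum (fun m => gh (Z.of_nat m) * S0 m) N).
    - transitivity (csum (fun m => gh (Z.of_nat m)) N * (/ 2 * hfun nu 0 s 0%R) + csum (fun m => gh (Z.of_nat m) * S0 m) N).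
      + rewrite <- csum_mult_r, <- csum_plus. apply csum_ext. intros m _. unfold hfun.
        rewrite !Cmult_0_r. ring.
      + rewrite step_kernel_csum0. ring.
    - destruct (periodic_bounded N g HN Hg) as [b [Hb Hbd]].
      assert (TS := Theta_Csums nu g (Z.of_nat N) tau b ltac:(lia) Ht Hbd). fold s in TS.
      eapply Csums_unique; [|apply Csums_mult_l; exact TS].
      apply (Csums_ext (fun j => csum (fun m => gh (Z.of_nat m) * hfun nu (bm (Z.of_nat m)) s (INR (S j))) N)).
      + intros j. cbv beta. rewrite (dft_inversion N g HN Hg (Z.of_nat (S j))).
        transitivity (RtoC (sqrt (INR N) * / sqrt (INR N)) * (csum (fun m => gh (Z.of_nat m) * Cunit (IZR (Z.of_nat (S j)) * INR m / INR N)) N *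
           (RtoC (INR (S j) ^ nu) * gw s (INR (S j))))).
        * rewrite Rinv_r, Cmult_1_l by lra. rewrite <- csum_mult_r. apply csum_ext. intros m _.
          unfold hfun, Cunit. rewrite <- INR_IZR_INZ.
          replace (Ci * RtoC (bm (Z.of_nat m)) * RtoC (INR (S j))) with (Ci * RtoC (2 * PI * (INR (S j) * INR m / INR N))); [ring|].
          rewrite <- Cmult_assoc, <- RtoC_mult. do 2 f_equal. unfold bm. rewrite <- INR_IZR_INZ. field. lra.
        * rewrite (RtoC_mult (sqrt (INR N))). fold gh. ring.
      + clear - HS0. generalize N at 1 2. intros n. induction n as [|n IH].
        * apply (Csums_ext (fun _ => 0)); [reflexivity|]. intros eps He. exists O. intros n _.
          rewrite csum_zero. simpl. replace (0 - 0) with (RtoC 0) by ring. now rewrite Cmod_0.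
        * simpl. apply Csums_plus; [exact IH|]. apply Csums_mult_l, HS0. }
  rewrite <- HT.
  apply (Ctends_csum eventually). intros m _.
  apply (Ctends_mult eventually); [apply (Ctends_const eventually)|].
  destruct (Poisson_hint nu (bm (Z.of_nat m)) s Hnu Hs) as [cm Hcm].
  intros eps He. destruct (eventually_small cm eps He) as [n0 Hn0].
  exists (S n0). intros [|K] HK; [lia|]. eapply Rle_lt_trans; [apply Hcm; [lia|apply HS0]|]. apply Hn0. lia.
Qed.

(** Positive and negative frequencies contribute the same kernel value, hence the [2]; the latter
    also contribute the Gaussian part. *)
Lemma theta_step :
  Theta nu g (Z.of_nat N) tau = RtoC (/ sqrt (INR N)) * (2 * step_kernel_value -
    (- / tau) ^ nu * (2 * GI (fun _ => 1) s) * Theta nu gh (Z.of_nat N) (- / tau)).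
Proof.
  assert (S2 := sqrt_INR_pos N HN).
  assert (E : RtoC (sqrt (INR N)) * Theta nu g (Z.of_nat N) tau = step_kernel_value + step_kernel_value -
    (- / tau) ^ nu * (2 * GI (fun _ => 1) s) * Theta nu gh (Z.of_nat N) (- / tau)).
  { eapply (Ctends_unique eventually); [exact step_Poisson_limit|].
    apply (Ctends_ext eventually (fun K => csum (fun i => H (Z.of_nat (S i))) (K * N) +
       csum (fun i => H (Z.of_nat (S i))) (S K * N) -
       csum (fun i => gh (Z.of_nat (S i)) * hint_Gauss_value nu (bm (Z.of_nat (S i))) s) (K * N))).
    - intros K. rewrite step_split.
      rewrite (csum_ext (fun i => H (- Z.of_nat (S i))%Z) _ (K * N) (fun i _ => step_negative i)).
      rewrite csum_minus. ring.
    - apply (Ctends_minus eventually); [|exact step_Gauss_limit].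
      apply (Ctends_plus eventually); [exact step_positive_limit|].
      exact (Ctends_comp eventually eventually S (fun K => csum (fun i => H (Z.of_nat (S i))) (K * N)) _ eventually_S step_positive_limit). }
  transitivity (RtoC (/ sqrt (INR N)) * (RtoC (sqrt (INR N)) * Theta nu g (Z.of_nat N) tau)).
  - rewrite Cmult_assoc, <- RtoC_mult, Rinv_l by lra. ring.
  - rewrite E. ring.
Qed.
End ThetaStep.

(** * Analyticity *)

Lemma analytic_at_scal (c : C) (G : R -> C) (x0 : R) :
  analytic_at G x0 -> analytic_at (fun x => c * G x) x0.
Proof.
  intros [a [r [Hr H]]]. exists (fun k => c * a k), r. split; [exact Hr|].
  intros x Hx. eapply Csums_ext; [|apply Csums_mult_l, H, Hx]. intros n. cbv beta. ring.
Qed.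

Lemma analytic_at_conj (G : R -> C) (x0 : R) :
  analytic_at G x0 -> analytic_at (fun x => Cconj (G x)) x0.
Proof.
  intros [a [r [Hr H]]]. exists (fun k => Cconj (a k)), r. split; [exact Hr|].
  intros x Hx. unfold Csums. eapply (Ctends_ext eventually); [|apply (Ctends_conj eventually), (H x Hx)].
  intros n. cbv beta. rewrite csum_conj. apply csum_ext. intros k _. now rewrite Cmult_conj, Cconj_RtoC.
Qed.

Lemma analytic_at_affine (G : R -> C) (u v x0 : R) :
  analytic_at G (u * x0 + v) -> analytic_at (fun x => G (u * x + v)%R) x0.
Proof.
  intros [a [r [Hr H]]]. exists (fun k => RtoC (u ^ k) * a k), (r / (Rabs u + 1))%R.
  assert (P := Rabs_pos u). split; [apply Rdiv_lt_0_compat; lra|].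
  intros x Hx. eapply Csums_ext; [|apply H].
  - intros n. cbv beta. replace (u * x + v - (u * x0 + v))%R with (u * (x - x0))%R by ring.
    rewrite Rpow_mult_distr, RtoC_mult. ring.
  - replace (u * x + v - (u * x0 + v))%R with (u * (x - x0))%R by ring. rewrite Rabs_mult.
    assert (Q := Rabs_pos (x - x0)). apply Rle_lt_trans with ((Rabs u + 1) * Rabs (x - x0))%R; [nra|].
    replace r with ((Rabs u + 1) * (r / (Rabs u + 1)))%R by (field; lra).
    apply Rmult_lt_compat_l; lra.
Qed.

Lemma analytic_at_locally_eq (G G' : R -> C) (x0 r : R) : (0 < r)%R ->
  (forall x, (Rabs (x - x0) < r)%R -> G' x = G x) -> analytic_at G x0 -> analytic_at G' x0.
Proof.
  intros Hr E [a [r' [Hr' H]]]. exists a, (Rmin r r'). split; [now apply Rmin_glb_lt|].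
  intros x Hx. rewrite E by (eapply Rlt_le_trans; [exact Hx|apply Rmin_l]).
  apply H. eapply Rlt_le_trans; [exact Hx|apply Rmin_r].
Qed.

(** * The obstruction function and boundary values *)

(** The kernel term of [theta_step] evaluated at a boundary point: there [i s] is the real number
    [pi x / N]. *)
Definition obstruction_pos (N nu : nat) (g : Z -> C) (x : R) : C :=
  RtoC (/ sqrt (INR N)) * (2 * (omega ^ (S nu) *
    GI (fun y => RtoC (y ^ nu) * kernel N (dft N g) y) (RtoC (PI / INR N * x)))).

(** Negative points are reached through [tau -> - conj tau], which exchanges the theta series of [g]
    with the conjugate of that of [conj g]. *)
Definition obstruction (N nu : nat) (g : Z -> C) (x : R) : C :=
  match Rlt_dec 0 x with
  | left _ => obstruction_pos N nu g x
  | right _ => Cconj (obstruction_pos N nu (fun n => Cconj (g n)) (- x))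
  end.

Lemma obstruction_pos_analytic (N nu : nat) (g : Z -> C) (x : R) :
  (0 < N)%nat -> periodic (Z.of_nat N) g -> (0 < x)%R -> analytic_at (obstruction_pos N nu g) x.
Proof.
  intros HN Hg Hx. unfold obstruction_pos. apply analytic_at_scal, analytic_at_scal, analytic_at_scal.
  assert (P : (0 < PI / INR N)%R) by (apply Rdiv_lt_0_compat; [apply PI_RGT_0|now apply lt_0_INR]).
  set (G := fun x : R => GI (fun y => RtoC (y ^ nu) * kernel N (dft N g) y) (RtoC x)).
  apply (analytic_at_locally_eq (fun x => G (PI / INR N * x + 0)%R) _ x 1 Rlt_0_1).
  - intros t _. unfold G. now rewrite Rplus_0_r.
  - apply analytic_at_affine. apply (GI_real_analytic (fun y => RtoC (y ^ nu) * kernel N (dft N g) y)); [now apply exp_bounded_pow_kernel|].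
    rewrite Rplus_0_r. now apply Rmult_lt_0_compat.
Qed.

Lemma periodic_conj (N : Z) (g : Z -> C) : periodic N g -> periodic N (fun n => Cconj (g n)).
Proof. intros H n. now rewrite H. Qed.

Lemma obstruction_analytic (N nu : nat) (g : Z -> C) (x : R) :
  (0 < N)%nat -> periodic (Z.of_nat N) g -> x <> 0%R -> analytic_at (obstruction N nu g) x.
Proof.
  intros HN Hg Hx. destruct (Rlt_dec 0 x) as [H|H].
  - apply (analytic_at_locally_eq (obstruction_pos N nu g) _ x x H); [|now apply obstruction_pos_analytic].
    intros t Ht. unfold obstruction. destruct (Rlt_dec 0 t) as [_|H']; [reflexivity|].
    apply Rabs_lt_between in Ht. lra.
  - set (G := fun x => Cconj (obstruction_pos N nu (fun n => Cconj (g n)) x)).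
    apply (analytic_at_locally_eq (fun x => G (-1 * x + 0)%R) _ x (- x)); [lra| |].
    + intros t Ht. unfold obstruction, G. destruct (Rlt_dec 0 t) as [H'|_].
      * apply Rabs_lt_between in Ht. lra.
      * do 2 f_equal. ring.
    + apply analytic_at_affine, analytic_at_conj, obstruction_pos_analytic; [exact HN|now apply periodic_conj|lra].
Qed.

(** As [tau] tends to a positive real, [s] runs into the imaginary axis while [i s] tends to a
    positive number; after rotation the Gaussian factor has the limit given by [GI_1_real]. *)
Lemma GI_1_rotation (s : C) : (0 < Re s)%R -> (0 < Re (Ci * s))%R ->
  GI (fun _ => 1) s = omega * GI (fun _ => 1) (Ci * s).
Proof.
  intros H1 H2. assert (E := hint_rotation 0 0 s (Rle_refl _) H1 H2). unfold hint in E.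
  rewrite Cpow_1_r in E.
  rewrite (GI_ext _ (fun _ => 1)) in E.
  - rewrite E. f_equal. apply GI_ext. intros y _. simpl.
    replace (Ci * 0 * omega * RtoC y) with (RtoC 0) by ring. rewrite Cexp_0. ring.
  - intros y _. simpl. replace (Ci * 0 * RtoC y) with (RtoC 0) by ring. rewrite Cexp_0. ring.
Qed.

(** The phase left over in the limit: the minus sign in [theta_step], [(-1)^nu] from
    [(- 1 / tau)^nu], and [omega] from the rotated Gaussian integral. *)
Definition theta_multiplier (nu : nat) : C := - (- (1)) ^ nu * omega.

Lemma Cmod_theta_multiplier (nu : nat) : Cmod (theta_multiplier nu) = 1%R.
Proof.
  unfold theta_multiplier. rewrite Cmod_mult, Cmod_omega, Cmod_opp, Cmod_pow, Cmod_opp, Cmod_1, pow1. ring.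
Qed.

Lemma Rpower_half_int (x : R) (nu : nat) : (0 < x)%R ->
  Rpower x (- (INR nu + / 2)) = (/ x ^ nu * / sqrt x)%R.
Proof.
  intros Hx. rewrite Rpower_Ropp, Rpower_plus, Rpower_pow, Rpower_sqrt by exact Hx. apply Rinv_mult.
Qed.

Section BoundaryLimit.
Context {T : Type} (F : (T -> Prop) -> Prop) {FF : Filter F}.
Context (N nu : nat) (HN : (0 < N)%nat) (Hnu : (nu <= 1)%nat).

Let PN : (0 < INR N)%R := lt_0_INR N HN.

(** All factors in [theta_step] are continuous at [x > 0] once written with [i s]. The factor
    [1 / sqrt N] cancels the [sqrt (N / x)] of the Gaussian integral down to [x^(- 1/2)]. *)
Lemma theta_limit_pos (g : Z -> C) (h : T -> C) (x : R) (l : C) :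
  periodic (Z.of_nat N) g -> parity nu g -> g 0%Z = 0 -> dft N g 0 = 0 -> (0 < x)%R ->
  Ctends F h (RtoC x) -> F (fun t => (0 < Im (h t))%R) ->
  Ctends F (fun t => Theta nu (dft N g) (Z.of_nat N) (- / h t)) l ->
  Ctends F (fun t => Theta nu g (Z.of_nat N) (h t))
    (obstruction_pos N nu g x + theta_multiplier nu * RtoC (Rpower x (- (INR nu + / 2))) * l).
Proof.
  intros Hg Hpar g0 gh0 Hx Hh HI Hl. assert (HP := PI_RGT_0).
  set (A := fun z : C => GI (fun y => RtoC (y ^ nu) * kernel N (dft N g) y) z).
  set (z := fun t => RtoC (PI / INR N) * h t).
  apply (Ctends_near F (fun t => RtoC (/ sqrt (INR N)) * (2 * (omega ^ (S nu) * A (z t)) -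
     (- / h t) ^ nu * (2 * (omega * GI (fun _ => 1) (z t))) * Theta nu (dft N g) (Z.of_nat N) (- / h t)))).
  - assert (HR : F (fun t => (0 < Re (h t))%R)).
    { generalize (Hh x Hx). apply filter_imp. intros t Ht.
      assert (B : (Rabs (Re (h t) - x) <= Cmod (h t - RtoC x))%R) by exact (re_le_Cmod (h t - RtoC x)).
      apply Rabs_le_between in B. lra. }
    generalize (filter_and _ _ HI HR). apply filter_imp. intros t [H1 H2].
    rewrite (theta_step N g nu HN Hg Hnu Hpar g0 gh0 (h t) H1 H2).
    unfold step_kernel_value. rewrite (GI_1_rotation (theta_param (Z.of_nat N) (h t))).
    + rewrite Ci_theta_param, <- INR_IZR_INZ. fold (z t). reflexivity.
    + apply step_Re_s; assumption.
    + apply step_Re_Cis; assumption.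
  - assert (Lz : Ctends F z (RtoC (PI / INR N * x))).
    { rewrite RtoC_mult. apply (Ctends_mult F); [apply (Ctends_const F)|exact Hh]. }
    assert (Pz : (0 < PI / INR N * x)%R) by (apply Rmult_lt_0_compat; [apply Rdiv_lt_0_compat; lra|exact Hx]).
    assert (LA : Ctends F (fun t => A (z t)) (A (RtoC (PI / INR N * x)))).
    { apply (GI_continuous F); [now apply exp_bounded_pow_kernel|exact Pz|exact Lz]. }
    assert (LK : Ctends F (fun t => GI (fun _ => 1) (z t)) (RtoC (sqrt (INR N / x) / 2))).
    { replace (INR N / x)%R with (PI / (PI / INR N * x))%R by (field; lra). rewrite <- GI_1_real by exact Pz.
      apply (GI_continuous F); [apply exp_bounded_const|exact Pz|exact Lz]. }
    assert (X0 : RtoC x <> 0) by (intros E; apply RtoC_inj in E; lra).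
    assert (Lp : Ctends F (fun t => (- / h t) ^ nu) ((- / RtoC x) ^ nu)).
    { clear - FF Hh X0. induction nu as [|n IH]; simpl; [apply (Ctends_const F)|].
      apply (Ctends_mult F); [|exact IH]. apply (Ctends_opp F), (Ctends_inv F); assumption. }
    replace (obstruction_pos N nu g x + theta_multiplier nu * RtoC (Rpower x (- (INR nu + / 2))) * l)
      with (RtoC (/ sqrt (INR N)) * (2 * (omega ^ (S nu) * A (RtoC (PI / INR N * x))) -
        (- / RtoC x) ^ nu * (2 * (omega * RtoC (sqrt (INR N / x) / 2))) * l)).
    + apply (Ctends_mult F); [apply (Ctends_const F)|].
      apply (Ctends_minus F).
      * apply (Ctends_mult F); [apply (Ctends_const F)|]. apply (Ctends_mult F); [apply (Ctends_const F)|exact LA].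
      * apply (Ctends_mult F); [|exact Hl]. apply (Ctends_mult F); [exact Lp|].
        apply (Ctends_mult F); [apply (Ctends_const F)|]. apply (Ctends_mult F); [apply (Ctends_const F)|exact LK].
    + unfold obstruction_pos. fold (A (RtoC (PI / INR N * x))).
      rewrite Rpower_half_int by exact Hx. unfold theta_multiplier.
      assert (S1 := sqrt_lt_R0 _ PN). assert (S2 := sqrt_lt_R0 _ Hx).
      rewrite sqrt_div by lra.
      assert (E : RtoC (/ sqrt (INR N)) * (2 * RtoC (sqrt (INR N) / sqrt x / 2)) = RtoC (/ sqrt x)).
      { rewrite <- !RtoC_mult. f_equal. field. lra. }
      assert (Ep : (- / RtoC x) ^ nu = (- (1)) ^ nu * RtoC (/ x ^ nu)).
      { rewrite RtoC_inv by (apply pow_nonzero; lra). rewrite RtoC_pow.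
        rewrite <- Cpow_inv by exact X0. rewrite <- Cpow_mult_l. f_equal. ring. }
      rewrite Ep, (RtoC_mult (/ x ^ nu)), <- E. ring.
Qed.

Lemma Theta_conj (g : Z -> C) (M : Z) (tau : C) : (0 < M)%Z ->
  Theta nu (fun n => Cconj (g n)) M (- Cconj tau) = Cconj (Theta nu g M tau).
Proof.
  intros HM. assert (PM : (0 < IZR M)%R) by (now apply IZR_lt).
  assert (C1 : forall a : nat -> C, CSeries (fun n => Cconj (a n)) = Cconj (CSeries a)).
  { intros a. unfold CSeries, Cconj. simpl. f_equal. apply Series_opp. }
  unfold Theta. rewrite <- C1. apply CSeries_ext. intros j.
  rewrite !Cmult_conj, Cconj_RtoC, Cconj_Cexp. f_equal. f_equal.
  rewrite Cdiv_conj by (intros E; apply RtoC_inj in E; lra). rewrite !Cmult_conj, !Cconj_RtoC.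
  f_equal. replace (Cconj Ci) with (- Ci) by (apply C_ext; simpl; ring). ring.
Qed.

Lemma Theta_scal (c : C) (g : Z -> C) (M : Z) (tau : C) (b : R) : (0 < M)%Z -> (0 < Im tau)%R ->
  (forall n, (Cmod (g n) <= b)%R) ->
  Theta nu (fun n => c * g n) M tau = c * Theta nu g M tau.
Proof.
  intros HM Ht Hb. apply Csums_CSeries. eapply Csums_ext; [|apply Csums_mult_l, (Theta_Csums nu g M tau b HM Ht Hb)].
  intros j. assert (E := theta_term_gw nu (fun n => c * g n) M tau j HM). cbv beta zeta in *. rewrite E. ring.
Qed.

Lemma Theta_ext (g g' : Z -> C) (M : Z) (tau : C) : (forall n, g n = g' n) -> Theta nu g M tau = Theta nu g' M tau.
Proof. intros H. apply CSeries_ext. intros j. cbv zeta. now rewrite H. Qed.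

(** For [x < 0] the positive case is applied to [conj g] at [- x] and the result is conjugated. What
    remains is to check that the conjugated phase agrees with the branch [arg x = - pi] of
    [real_cpow]. *)
Lemma theta_limit (g : Z -> C) (h : T -> C) (x : R) (l : C) :
  periodic (Z.of_nat N) g -> parity nu g -> g 0%Z = 0 -> dft N g 0 = 0 -> x <> 0%R ->
  Ctends F h (RtoC x) -> F (fun t => (0 < Im (h t))%R) ->
  Ctends F (fun t => Theta nu (dft N g) (Z.of_nat N) (- / h t)) l ->
  Ctends F (fun t => Theta nu g (Z.of_nat N) (h t))
    (obstruction N nu g x + theta_multiplier nu * real_cpow x (- (INR nu + / 2)) * l).
Proof.
  intros Hg Hpar g0 gh0 Hx Hh HI Hl. unfold obstruction, real_cpow.
  destruct (Rlt_dec 0 x) as [H|H]; destruct (Rlt_dec x 0) as [H'|H']; try lra.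
  - rewrite Rmult_0_r, Cmult_0_r, Cexp_0, Cmult_1_r, Rabs_pos_eq by lra.
    now apply theta_limit_pos.
  - set (g' := fun n => Cconj (g n)).
    assert (Hg' : periodic (Z.of_nat N) g') by (now apply periodic_conj).
    destruct (periodic_bounded N (dft N g) HN (dft_periodic N g HN)) as [b [Hb Hbd]].
    assert (e1 : Cconj ((- (1)) ^ nu) = (- (1)) ^ nu).
    { rewrite Cpow_conj, Copp_conj, Cconj_RtoC. reflexivity. }
    assert (Hgh : forall m, dft N g' m = Cconj (- (- (1)) ^ nu * dft N g m)).
    { intros m. unfold g'. rewrite dft_conj. f_equal. now apply dft_neg. }
    assert (L : Ctends F (fun t => Theta nu g' (Z.of_nat N) (- Cconj (h t)))
       (obstruction_pos N nu g' (- x) + theta_multiplier nu * RtoC (Rpower (- x) (- (INR nu + / 2))) *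
         Cconj (- (- (1)) ^ nu * l))).
    { apply theta_limit_pos; auto.
      - intros n. unfold g'. rewrite Hpar, Cmult_conj, Copp_conj, e1. reflexivity.
      - unfold g'. rewrite g0. apply Cconj_RtoC.
      - rewrite Hgh, gh0, Cmult_0_r. apply Cconj_RtoC.
      - lra.
      - replace (RtoC (- x)) with (- Cconj (RtoC x)) by (rewrite Cconj_RtoC; apply C_ext; simpl; ring).
        apply (Ctends_opp F), (Ctends_conj F), Hh.
      - revert HI. apply filter_imp. intros t. destruct (h t); simpl; lra.
      - apply (Ctends_near F (fun t => Cconj (- (- (1)) ^ nu * Theta nu (dft N g) (Z.of_nat N) (- / h t)))).
        + revert HI. apply filter_imp. intros t Ht.
          assert (h0 : h t <> 0) by (intros E; rewrite E in Ht; simpl in Ht; lra).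
          assert (Ht' : (0 < Im (- / h t))%R).
          { destruct (h t) as [u v]. simpl in *.
            replace (- (- v / (u * (u * 1) + v * (v * 1))))%R with (v / (u * u + v * v))%R by (field; nra).
            apply Rdiv_lt_0_compat; [exact Ht|nra]. }
          rewrite <- (Theta_scal _ _ _ _ b) by (auto; lia).
          rewrite <- Theta_conj by lia.
          rewrite (Theta_ext _ _ _ _ Hgh). f_equal.
          rewrite !Copp_conj, Cinv_conj by exact h0. field. intros E. apply h0.
          rewrite <- (Cconj_conj (h t)), E. apply Cconj_RtoC.
        + apply (Ctends_conj F). apply (Ctends_mult F); [apply (Ctends_const F)|exact Hl]. }
    apply (Ctends_conj F) in L.
    apply (Ctends_ext F _ (fun t => Theta nu g (Z.of_nat N) (h t))) in L.
    2: { intros t. unfold g'. rewrite Theta_conj by lia. apply Cconj_conj. }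
    replace (Cconj (obstruction_pos N nu g' (- x)) + theta_multiplier nu *
      (RtoC (Rpower (Rabs x) (- (INR nu + / 2))) * Cexp (Ci * RtoC (- (INR nu + / 2) * - PI))) * l)
      with (Cconj (obstruction_pos N nu g' (- x) + theta_multiplier nu * RtoC (Rpower (- x) (- (INR nu + / 2))) *
         Cconj (- (- (1)) ^ nu * l))); [exact L|].
    rewrite Cplus_conj. f_equal. rewrite Cmult_conj, Cconj_conj, Cmult_conj, Cconj_RtoC, Rabs_left by exact H'.
    unfold theta_multiplier. rewrite Cmult_conj, Copp_conj, e1.
    (* On the branch [arg = - pi] the power [- (nu + 1/2)] has phase
       [exp (i pi (nu + 1/2)) = i (-1)^nu]. Conjugating [omega] gives [- i omega], and the two
       phases match. *)
    assert (E1 : Cexp (Ci * RtoC (- (INR nu + / 2) * - PI)) = Ci * (- (1)) ^ nu).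
    { assert (EP : Cexp (Ci * RtoC PI) = - (1)) by (rewrite Cexp_Ci, cos_PI, sin_PI; apply C_ext; simpl; ring).
      assert (E2 : Cexp (Ci * RtoC (PI / 2)) = Ci) by (rewrite Cexp_Ci, cos_PI2, sin_PI2; reflexivity).
      transitivity (Cexp (Ci * RtoC (PI / 2)) * Cexp (RtoC (INR nu) * (Ci * RtoC PI))).
      - rewrite <- Cexp_plus. f_equal. apply C_ext; simpl; field.
      - rewrite E2, <- Cexp_pow, EP. reflexivity. }
    assert (E3 : Cconj omega = - Ci * omega).
    { unfold omega. rewrite Cexp_Ci, sin_cos_PI4 || rewrite Cexp_Ci.
      apply C_ext; simpl; rewrite ?cos_PI4, ?sin_PI4; field; apply Rgt_not_eq, sqrt_lt_R0; lra. }
    rewrite E1, E3. ring.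
Qed.
End BoundaryLimit.

(** * Non-tangential limits at rational points *)

Definition mean_zero_seq (N : nat) (u : nat -> C) : Prop :=
  (forall j, u (j + N)%nat = u j) /\ csum u N = 0.

Lemma mean_zero_primitive_periodic (N : nat) (u : nat -> C) (n : nat) :
  mean_zero_seq N u -> csum u (n + N) = csum u n.
Proof.
  intros [Hu H0]. rewrite Nat.add_comm, csum_add, H0.
  rewrite (csum_ext _ u) by (intros; rewrite Nat.add_comm; apply Hu). ring.
Qed.

Lemma periodic_seq_bounded (N : nat) (u : nat -> C) : (0 < N)%nat -> (forall j, u (j + N)%nat = u j) ->
  exists b : R, (0 <= b)%R /\ forall j, (Cmod (u j) <= b)%R.
Proof.
  intros HN Hu.
  assert (E : forall j k, u (j + k * N)%nat = u j).
  { intros j k. induction k as [|k IH]; [f_equal; simpl; lia|]. transitivity (u (j + k * N + N)%nat); [f_equal; simpl; lia|rewrite Hu; exact IH]. }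
  destruct (periodic_bounded N (fun z => u (Z.to_nat (z mod Z.of_nat N)))) as [b [Hb H]].
  - exact HN.
  - intros z. cbv beta. do 2 f_equal. replace (z + Z.of_nat N)%Z with (z + 1 * Z.of_nat N)%Z by ring.
    apply Z.mod_add. lia.
  - exists b. split; [exact Hb|]. intros j. specialize (H (Z.of_nat j)). cbv beta in H.
    replace (u j) with (u (Z.to_nat (Z.of_nat j mod Z.of_nat N))); [exact H|].
    rewrite <- (E _ (j / N)%nat). f_equal. rewrite <- Nat2Z.inj_mod, Nat2Z.id.
    rewrite (Nat.div_mod_eq j N) at 3. lia.
Qed.

(* Abel summation against the primitive of [u] whose mean vanishes, so that the
   step can be iterated. *)
Lemma abel_step (N : nat) (u : nat -> C) : (0 < N)%nat -> mean_zero_seq N u ->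
  exists (c : C) (u' : nat -> C), mean_zero_seq N u' /\
    forall (phi : nat -> C) (S0 : C), Ctends eventually phi 0 ->
      Csums (fun j => u j * phi j) S0 ->
      Csums (fun j => u' j * (phi j - phi (S j))) (S0 - c * phi O).
Proof.
  intros HN Hu. set (mu := csum (fun j => csum u (S j)) N * / RtoC (INR N)).
  set (P := fun n => csum u n - mu).
  assert (PN : RtoC (INR N) <> 0).
  { intros E. apply RtoC_inj in E. assert (0 < INR N)%R by (now apply lt_0_INR). lra. }
  assert (HP : mean_zero_seq N (fun j => P (S j))).
  { split.
    - intros j. unfold P. f_equal. replace (S (j + N)) with (S j + N)%nat by lia.
      now apply mean_zero_primitive_periodic.
    - unfold P. rewrite csum_minus, csum_const. unfold mu. field. exact PN. }
  exists (- P O), (fun j => P (S j)). split; [exact HP|].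
  intros phi S0 Hphi HS.
  destruct (periodic_seq_bounded N P HN) as [b [Hb Hbd]].
  { intros j. unfold P. f_equal. now apply mean_zero_primitive_periodic. }
  apply (Ctends_ext eventually (fun n => csum (fun j => u j * phi j) n - (P n * phi n - P O * phi O))).
  - intros n. induction n as [|n IH]; [simpl; ring|]. simpl csum at 2. rewrite <- IH. simpl csum at 1.
    replace (u n) with (P (S n) - P n) by (unfold P; simpl; ring). ring.
  - replace (S0 - - P O * phi O) with (S0 - (0 - P O * phi O)) by ring.
    apply (Ctends_minus eventually); [exact HS|].
    apply (Ctends_minus eventually); [|apply (Ctends_const eventually)].
    intros eps He. assert (He' : (0 < eps / (b + 1))%R) by (apply Rdiv_lt_0_compat; lra).
    generalize (Hphi _ He'). apply filter_imp. intros n Hn.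
    replace (phi n - 0) with (phi n) in Hn by ring. replace (P n * phi n - 0) with (P n * phi n) by ring.
    rewrite Cmod_mult. assert (Q := Cmod_ge_0 (phi n)). assert (Q' := Hbd n).
    apply Rle_lt_trans with (b * Cmod (phi n))%R; [now apply Rmult_le_compat_r|].
    replace eps with ((b + 1) * (eps / (b + 1)))%R by (field; lra).
    apply Rle_lt_trans with ((b + 1) * Cmod (phi n))%R; [nra|]. apply Rmult_lt_compat_l; lra.
Qed.

(** The sign is that of the differences [phi j - phi (S j)] left over by [abel_step]. *)
Definition Cdiff (f : R -> C) (x : R) : C := f x - f (x + 1)%R.

Lemma CD_shift (f : R -> C) (x : R) (l : C) : CD f (x + 1) l -> CD (fun x => f (x + 1)%R) x l.
Proof.
  intros [H1 H2]. split.
  - evar_last; [apply: (is_derive_comp (fun u => Re (f u)) (fun x => (x + 1)%R)); [exact H1|auto_derive; [trivial|reflexivity]]|].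
    unfold scal; simpl; unfold mult; simpl. Rring.
  - evar_last; [apply: (is_derive_comp (fun u => Im (f u)) (fun x => (x + 1)%R)); [exact H2|auto_derive; [trivial|reflexivity]]|].
    unfold scal; simpl; unfold mult; simpl. Rring.
Qed.

Lemma CD_Cdiff (f f1 : R -> C) : (forall x, CD f x (f1 x)) -> forall x, CD (Cdiff f) x (Cdiff f1 x).
Proof.
  intros H x. unfold Cdiff. apply CD_minus; [apply H|]. apply CD_shift, H.
Qed.

Lemma Cdiff_bound (f f1 : R -> C) (x M : R) :
  (forall x, CD f x (f1 x)) -> (forall x, CCont f1 x) ->
  (forall t, (x <= t)%R -> (Cmod (f1 t) <= M)%R) -> (Cmod (Cdiff f x) <= M)%R.
Proof.
  intros Hd Hc HM. unfold Cdiff. rewrite Cmod_minus_sym.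
  rewrite <- (CInt_FTC x (x + 1) f f1); [|intros; apply Hd|intros t _; apply Hc].
  replace M with ((x + 1 - x) * M)%R by ring. apply CInt_bound_const; [lra|intros t _; apply Hc|].
  intros t Ht. apply HM. lra.
Qed.

Lemma Cdiff3_bound (f f1 f2 f3 : R -> C) (x M : R) :
  (forall x, CD f x (f1 x)) -> (forall x, CD f1 x (f2 x)) -> (forall x, CD f2 x (f3 x)) ->
  (forall x, CCont f3 x) -> (forall t, (x <= t)%R -> (Cmod (f3 t) <= M)%R) ->
  (Cmod (Cdiff (Cdiff (Cdiff f)) x) <= M)%R.
Proof.
  intros H1 H2 H3 Hc HM.
  assert (D1 := CD_Cdiff _ _ H1). assert (D2 := CD_Cdiff _ _ H2). assert (D3 := CD_Cdiff _ _ H3).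
  assert (DD1 := CD_Cdiff _ _ D1). assert (DD2 := CD_Cdiff _ _ D2).
  apply (Cdiff_bound _ (Cdiff (Cdiff f1))); [exact DD1|intros; eapply CD_CCont, DD2|].
  intros t Ht. apply (Cdiff_bound _ (Cdiff f2)); [exact D2|intros; eapply CD_CCont, D3|].
  intros t' Ht'. apply (Cdiff_bound _ f3); [exact H3|exact Hc|].
  intros t'' Ht''. apply HM. lra.
Qed.

Definition gpow (nu : nat) (s : C) (x : R) : C := RtoC (x ^ nu) * gw s x.

Lemma CD_gw (s : C) (y : R) : CD (gw s) y (- (2 * s) * RtoC y * gw s y).
Proof.
  apply (CD_ext (fun y => Cexp ((- s) * RtoC (y ^ 2)))).
  - intros t. unfold gw. f_equal. ring.
  - replace (gw s y) with (Cexp ((- s) * RtoC (y ^ 2))) by (unfold gw; f_equal; ring).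
    eapply CD_eq; [apply CD_Cexp, CD_scal, (CD_RtoC _ _ (2 * y)%R)|].
    + auto_derive; [trivial|ring].
    + rewrite (RtoC_mult 2 y). cbv beta. ring.
Qed.

Lemma CD_poly_gw (p : R -> C) (s dp : C) (y : R) :
  CD p y dp -> CD (fun y => p y * gw s y) y ((dp - 2 * s * RtoC y * p y) * gw s y).
Proof.
  intros H. eapply CD_eq; [apply CD_mult; [exact H|apply CD_gw]|]. cbv beta; ring.
Qed.

(** The cube of the linear estimate [1 + u <= (1 + 3 / d) exp (d u / 3)]. *)
Lemma cube_exp_bound (d u : R) : (0 < d)%R -> (0 <= u)%R ->
  ((1 + u) ^ 3 * exp (- (d * u)) <= (1 + 3 / d) ^ 3)%R.
Proof.
  intros Hd Hu. assert (P3 : (0 < 3 / d)%R) by (apply Rdiv_lt_0_compat; lra).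
  assert (A : (1 + u <= (1 + 3 / d) * exp (d * u / 3))%R).
  { assert (B := exp_ineq1_le (d * u / 3)).
    apply Rle_trans with ((1 + 3 / d) * (1 + d * u / 3))%R; [|apply Rmult_le_compat_l; lra].
    replace ((1 + 3 / d) * (1 + d * u / 3))%R with (1 + u + (3 / d + d * u / 3))%R by (field; lra).
    assert (0 <= d * u / 3)%R by (apply Rmult_le_pos; nra). lra. }
  assert (E : exp (d * u) = (exp (d * u / 3) ^ 3)%R).
  { rewrite <- exp_mult_INR. f_equal. simpl. field. }
  assert (A3 : ((1 + u) ^ 3 <= (1 + 3 / d) ^ 3 * exp (d * u))%R).
  { rewrite E, <- Rpow_mult_distr. apply pow_incr. lra. }
  rewrite exp_Ropp. assert (Pe := exp_pos (d * u)).
  apply Rmult_le_reg_r with (exp (d * u)); [exact Pe|]. rewrite Rmult_assoc, Rinv_l by lra. lra.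
Qed.

(** The third derivative is bounded by [|s|] times a quadratic polynomial in [|s| t^2] times the
    weight. In the sector [Re s >= d |s|] the weight decays like [exp (- d |s| t^2)], which absorbs
    the polynomial and one more factor [1 + |s| t^2]. *)
Lemma gpow_third_diff (nu : nat) (s : C) (d x : R) : (nu <= 1)%nat -> (0 < d)%R -> (1 <= x)%R ->
  (d * Cmod s <= Re s)%R ->
  (Cmod (Cdiff (Cdiff (Cdiff (gpow nu s))) x) <= 24 * (1 + 3 / d) ^ 3 * (Cmod s / (1 + Cmod s * x ^ 2)))%R.
Proof.
  intros Hnu Hd Hx Hs. assert (S0 := Cmod_ge_0 s). set (a := Cmod s) in *.
  (* The coefficients [6], [24], [8] are those of the third derivative for [nu = 1]. For [nu = 0]
     the odd powers of [t] are raised to even ones, using [t >= 1]. *)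
  assert (B : forall t (w : C), (x <= t)%R ->
     (Cmod w <= a * (6 + 24 * (a * t ^ 2) + 8 * (a * t ^ 2) ^ 2))%R ->
     (Cmod (w * gw s t) <= 24 * (1 + 3 / d) ^ 3 * (a / (1 + a * x ^ 2)))%R).
  { intros t w Ht Hw. rewrite Cmod_mult, Cmod_gw. set (u := (a * t ^ 2)%R) in *.
    assert (T2 : (x ^ 2 <= t ^ 2)%R) by (apply pow_incr; lra).
    assert (X2 : (1 <= x ^ 2)%R) by nra.
    assert (Hu : (0 <= u)%R) by (apply Rmult_le_pos; lra).
    assert (E1 : (exp (- (Re s * t ^ 2)) <= exp (- (d * u)))%R) by (apply exp_le; unfold u; nra).
    assert (C3 := cube_exp_bound d u Hd Hu). assert (Pe := exp_pos (- (d * u))).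
    apply Rle_trans with (a * (24 * (1 + u) ^ 2) * exp (- (d * u)))%R.
    - apply Rmult_le_compat; [apply Cmod_ge_0|left; apply exp_pos| |exact E1].
      eapply Rle_trans; [exact Hw|]. apply Rmult_le_compat_l; [exact S0|]. nra.
    - replace (a * (24 * (1 + u) ^ 2) * exp (- (d * u)))%R
        with (24 * ((1 + u) ^ 3 * exp (- (d * u))) * (a / (1 + u)))%R by (field; lra).
      assert (Q : (0 <= a / (1 + u))%R) by (apply Rdiv_le_0_compat; lra).
      assert (Q' : (a / (1 + u) <= a / (1 + a * x ^ 2))%R).
      { apply Rmult_le_compat_l; [exact S0|]. apply Rinv_le_contravar; [nra|]. unfold u. nra. }
      assert (C0 : (0 <= (1 + 3 / d) ^ 3)%R) by (eapply Rle_trans; [|exact C3]; apply Rmult_le_pos; [apply pow_le; lra|lra]).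
      apply Rmult_le_compat; [|exact Q|lra|exact Q'].
      apply Rmult_le_pos; [lra|]. apply Rmult_le_pos; [apply pow_le; lra|lra]. }
  assert (Hsx : forall t : R, (0 <= t)%R -> Cmod (RtoC t) = t) by apply Cmod_Rpos.
  assert (nu = 0 \/ nu = 1)%nat as [-> | ->] by lia.
  - set (p1 := fun t : R => - (2 * s) * RtoC t).
    set (p2 := fun t : R => - (2 * s) + 4 * s * s * RtoC t * RtoC t).
    set (p3 := fun t : R => 12 * s * s * RtoC t - 8 * s * s * s * (RtoC t * RtoC t * RtoC t)).
    apply (Cdiff3_bound _ (fun t => p1 t * gw s t) (fun t => p2 t * gw s t) (fun t => p3 t * gw s t)).
    + intros t. apply (CD_ext (gw s)); [intros; unfold gpow; simpl; ring|]. apply CD_gw.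
    + intros t. eapply CD_eq; [apply CD_poly_gw|].
      * unfold p1. apply CD_scal, CD_id.
      * unfold p1, p2. ring.
    + intros t. eapply CD_eq; [apply CD_poly_gw|].
      * unfold p2. apply CD_plus; [apply CD_const|]. apply CD_mult; [apply CD_scal, CD_id|apply CD_id].
      * unfold p2, p3. cbv beta. ring.
    + intros t. unfold p3. assert (Q := CCont_gw s t). ccont.
    + intros t Ht. apply B; [exact Ht|]. unfold p3.
      replace (12 * s * s * RtoC t - 8 * s * s * s * (RtoC t * RtoC t * RtoC t)) with
        (RtoC 12 * (s * (s * RtoC t)) + - (RtoC 8 * (s * (s * (s * (RtoC t * (RtoC t * RtoC t))))))) by ring.
      eapply Rle_trans; [apply Cmod_triangle|]. rewrite Cmod_opp, !Cmod_mult, !Hsx by lra. fold a.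
      assert (t <= t ^ 2)%R by nra. assert (t * (t * t) <= t ^ 2 * t ^ 2)%R by nra.
      assert (0 <= a * a)%R by nra. assert (0 <= a * a * a)%R by (apply Rmult_le_pos; nra).
      assert (a * a * t <= a * a * t ^ 2)%R by (apply Rmult_le_compat_l; lra).
      assert (a * a * a * (t * (t * t)) <= a * a * a * (t ^ 2 * t ^ 2))%R by (apply Rmult_le_compat_l; lra).
      assert (0 <= a * a * t ^ 2)%R by nra. nra.
  - set (p1 := fun t : R => 1 - 2 * s * (RtoC t * RtoC t)).
    set (p2 := fun t : R => - (6 * s) * RtoC t + 4 * s * s * (RtoC t * RtoC t * RtoC t)).
    set (p3 := fun t : R => - (6 * s) + 24 * s * s * (RtoC t * RtoC t) - 8 * s * s * s * (RtoC t * RtoC t * RtoC t * RtoC t)).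
    apply (Cdiff3_bound _ (fun t => p1 t * gw s t) (fun t => p2 t * gw s t) (fun t => p3 t * gw s t)).
    + intros t. apply (CD_ext (fun t => RtoC t * gw s t)); [intros; unfold gpow; simpl; rewrite Rmult_1_r; reflexivity|].
      eapply CD_eq; [apply CD_poly_gw, CD_id|]. unfold p1. cbv beta. ring.
    + intros t. eapply CD_eq; [apply CD_poly_gw|].
      * unfold p1. apply CD_minus; [apply CD_const|]. apply CD_scal, CD_mult; apply CD_id.
      * unfold p1, p2. cbv beta. ring.
    + intros t. eapply CD_eq; [apply CD_poly_gw|].
      * unfold p2. apply CD_plus; apply CD_scal; [apply CD_id|]. apply CD_mult; [apply CD_mult; apply CD_id|apply CD_id].
      * unfold p2, p3. cbv beta. ring.
    + intros t. unfold p3. assert (Q := CCont_gw s t). ccont.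
    + intros t Ht. apply B; [exact Ht|]. unfold p3.
      replace (- (6 * s) + 24 * s * s * (RtoC t * RtoC t) - 8 * s * s * s * (RtoC t * RtoC t * RtoC t * RtoC t)) with
        (- (RtoC 6 * s) + (RtoC 24 * (s * (s * (RtoC t * RtoC t))) + - (RtoC 8 * (s * (s * (s * (RtoC t * (RtoC t * (RtoC t * RtoC t)))))))))
        by ring.
      eapply Rle_trans; [apply Cmod_triangle|]. rewrite Cmod_opp.
      eapply Rle_trans; [apply Rplus_le_compat_l, Cmod_triangle|]. rewrite Cmod_opp, !Cmod_mult, !Hsx by lra. fold a.
      right. ring.
Qed.

(** The first [K] terms are at most [a] each; a later one, of index [j], is at most
    [1 / (j (j + 1))], and these telescope. The free [K] is what lets the sum tend to zero with
    [a]. *)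
Lemma rsum_lorentz (a : R) (K n : nat) : (0 <= a)%R -> (0 < K)%nat ->
  (rsum (fun j => a / (1 + a * INR (S j) ^ 2)) n <= INR K * a + / INR K)%R.
Proof.
  intros Ha HK. assert (PK : (0 < INR K)%R) by (now apply lt_0_INR).
  assert (IK : (0 < / INR K)%R) by (now apply Rinv_0_lt_compat).
  assert (den : forall j, (1 <= 1 + a * INR (S j) ^ 2)%R).
  { intros j. assert (0 <= a * INR (S j) ^ 2)%R by (apply Rmult_le_pos; [exact Ha|apply pow2_ge_0]). lra. }
  assert (B1 : forall n, (rsum (fun j => a / (1 + a * INR (S j) ^ 2)) n <= INR n * a)%R).
  { intros m. rewrite <- rsum_const. apply rsum_le. intros j _. assert (D := den j).
    apply Rmult_le_reg_r with (1 + a * INR (S j) ^ 2)%R; [lra|]. unfold Rdiv.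
    rewrite Rmult_assoc, Rinv_l by lra. nra. }
  destruct (le_lt_dec n K) as [H|H].
  - eapply Rle_trans; [apply B1|]. apply le_INR in H. nra.
  - replace n with (K + (n - K))%nat by lia. generalize (n - K)%nat. intros m.
    assert (Q : (rsum (fun j => a / (1 + a * INR (S j) ^ 2)) (K + m) <= INR K * a + (/ INR K - / INR (K + m)))%R).
    { induction m as [|m IH].
      - rewrite Nat.add_0_r. generalize (B1 K). lra.
      - rewrite Nat.add_succ_r. cbn [rsum]. assert (Pm : (0 < INR (K + m))%R) by (apply lt_0_INR; lia).
        assert (D := den (K + m)%nat). set (x := INR (K + m)) in *.
        assert (Ex : INR (S (K + m)) = (x + 1)%R) by apply S_INR. rewrite Ex in *.
        assert (T : (a / (1 + a * (x + 1) ^ 2) <= / x - / (x + 1))%R).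
        { replace (/ x - / (x + 1))%R with (/ (x * (x + 1)))%R by (field; lra).
          apply Rmult_le_reg_r with (1 + a * (x + 1) ^ 2)%R; [lra|]. unfold Rdiv.
          rewrite Rmult_assoc, Rinv_l, Rmult_1_r by lra.
          apply Rmult_le_reg_l with (x * (x + 1))%R; [nra|]. rewrite <- Rmult_assoc, Rinv_r by nra. nra. }
        lra. }
    assert (0 < / INR (K + m))%R by (apply Rinv_0_lt_compat, lt_0_INR; lia). lra.
Qed.

Lemma Cmod_csum_rsum (F : nat -> C) (g : nat -> R) (n : nat) :
  (forall k, (Cmod (F k) <= g k)%R) -> (Cmod (csum F n) <= rsum g n)%R.
Proof.
  intros H. induction n as [|n IH]; simpl; [rewrite Cmod_0; lra|].
  eapply Rle_trans; [apply Cmod_triangle|]. generalize (H n). lra.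
Qed.

Lemma gpow_tends {T : Type} (F : (T -> Prop) -> Prop) {FF : Filter F} (s : T -> C) (nu : nat) (x : R) :
  Ctends F s 0 -> F (fun t => (0 < Re (s t))%R) -> Ctends F (fun t => gpow nu (s t) x) (gpow nu 0 x).
Proof.
  intros Hs HR. unfold gpow. apply (Ctends_mult F); [apply (Ctends_const F)|].
  apply (Ctends_squeeze F _ (fun t => (Cmod (s t) * x ^ 2)%R)).
  - revert HR. apply filter_imp. intros t Ht. unfold gw. assert (X2 := pow2_ge_0 x).
    eapply Rle_trans; [apply (Cexp_lipschitz _ _ 0)|].
    + replace (Re (- (s t * RtoC (x ^ 2)))) with (- (Re (s t) * x ^ 2))%R by (destruct (s t); simpl; ring). nra.
    + replace (- (0 * RtoC (x ^ 2))) with (RtoC 0) by ring. simpl. lra.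
    + replace (- (s t * RtoC (x ^ 2)) - - (0 * RtoC (x ^ 2))) with (- (s t * RtoC (x ^ 2))) by ring.
      rewrite Cmod_opp, Cmod_mult, Cmod_Rpos, exp_0 by exact X2. lra.
  - intros eps He. assert (X2 := pow2_ge_0 x).
    assert (He' : (0 < eps / (x ^ 2 + 1))%R) by (apply Rdiv_lt_0_compat; lra).
    generalize (Hs _ He'). apply filter_imp. intros t Ht. replace (s t - 0) with (s t) in Ht by ring.
    assert (C0 := Cmod_ge_0 (s t)).
    apply Rle_lt_trans with (Cmod (s t) * (x ^ 2 + 1))%R; [nra|].
    replace eps with (eps / (x ^ 2 + 1) * (x ^ 2 + 1))%R by (field; lra). apply Rmult_lt_compat_r; lra.
Qed.

(** Abel summation is iterated until the absolute sum of the differences tends to zero with [s];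
    what was split off is a combination of values at [1] that converges. The limit [l] is chosen
    before the filter and the opening [d], so it is common to all sectors and all paths. *)
Lemma theta_sector_limit (N nu : nat) (u : nat -> C) : (0 < N)%nat -> (nu <= 1)%nat -> mean_zero_seq N u ->
  exists l : C, forall (T : Type) (F : (T -> Prop) -> Prop) (FF : Filter F) (s S0 : T -> C) (d : R), (0 < d)%R ->
    Ctends F s 0 -> F (fun t => (0 < Re (s t))%R) -> F (fun t => (d * Cmod (s t) <= Re (s t))%R) ->
    F (fun t => Csums (fun j => u j * gpow nu (s t) (INR (S j))) (S0 t)) ->
    Ctends F S0 l.
Proof.
  intros HN Hnu Hu.
  destruct (abel_step N u HN Hu) as [c1 [u1 [Hu1 A1]]].
  destruct (abel_step N u1 HN Hu1) as [c2 [u2 [Hu2 A2]]].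
  destruct (abel_step N u2 HN Hu2) as [c3 [u3 [Hu3 A3]]].
  destruct (periodic_seq_bounded N u3 HN (proj1 Hu3)) as [b [Hb Hbd]].
  (* The boundary terms of the three summations. Their limit is [psi 0], and the remainder is shown
     to tend to [0]. *)
  set (psi := fun s : C => c1 * gpow nu s 1 + (c2 * Cdiff (gpow nu s) 1 + c3 * Cdiff (Cdiff (gpow nu s)) 1)).
  exists (psi 0 + 0). intros T F FF s S0 d Hd Hs HR Hsec HS.
  apply (Ctends_ext F (fun t => psi (s t) + (S0 t - psi (s t)))); [intros; ring|].
  apply (Ctends_plus F).
  - assert (G : forall x, Ctends F (fun t => gpow nu (s t) x) (gpow nu 0 x)) by (intros; now apply gpow_tends). unfold psi, Cdiff.
    repeat first [apply G | apply (Ctends_plus F) | apply (Ctends_opp F) | apply (Ctends_minus F) | apply (Ctends_mult F); [apply (Ctends_const F)|]].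
  - set (C1 := (b * (24 * (1 + 3 / d) ^ 3))%R).
    assert (C1p : (0 <= C1)%R).
    { unfold C1. apply Rmult_le_pos; [exact Hb|]. apply Rmult_le_pos; [lra|]. apply pow_le.
      assert (0 < 3 / d)%R by (apply Rdiv_lt_0_compat; lra). lra. }
    assert (Bd : forall K : nat, (0 < K)%nat -> F (fun t => (Cmod (S0 t - psi (s t)) <= C1 * (INR K * Cmod (s t) + / INR K))%R)).
    { intros K HK. generalize (filter_and (F := F) _ _ HR (filter_and (F := F) _ _ Hsec HS)). apply filter_imp.
      intros t [Ht [Hst HSt]].
      assert (L0 : Ctends eventually (fun j => gpow nu (s t) (INR (S j))) 0).
      { destruct (gauss_terms_bound nu (s t) Ht) as [c [Hc B]].
        apply (Ctends_comp eventually eventually S (fun j => gpow nu (s t) (INR j)) 0 eventually_S).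
        apply (Cmod_tends_0 _ (fun n => c * exp (- 1 * INR n))%R); [|apply is_lim_seq_exp_neg].
        intros n. apply B, pos_INR. }
      assert (Es : forall j, (INR (S j) + 1)%R = INR (S (S j))) by (intros; now rewrite (S_INR (S j))).
      assert (L1 : Ctends eventually (fun j => Cdiff (gpow nu (s t)) (INR (S j))) 0).
      { unfold Cdiff. replace (RtoC 0) with (0 - 0) by ring. apply (Ctends_minus eventually); [exact L0|].
        apply (Ctends_ext eventually (fun j => gpow nu (s t) (INR (S (S j))))); [intros; now rewrite Es|].
        exact (Ctends_comp eventually eventually S (fun j => gpow nu (s t) (INR (S j))) 0 eventually_S L0). }
      assert (L2 : Ctends eventually (fun j => Cdiff (Cdiff (gpow nu (s t))) (INR (S j))) 0).
      { unfold Cdiff at 1. replace (RtoC 0) with (0 - 0) by ring. apply (Ctends_minus eventually); [exact L1|].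
        apply (Ctends_ext eventually (fun j => Cdiff (gpow nu (s t)) (INR (S (S j))))); [intros; now rewrite Es|].
        exact (Ctends_comp eventually eventually S (fun j => Cdiff (gpow nu (s t)) (INR (S j))) 0 eventually_S L1). }
      assert (X1 := A1 _ _ L0 HSt).
      apply (Csums_ext _ (fun j => u1 j * Cdiff (gpow nu (s t)) (INR (S j)))) in X1;
        [|intros j; unfold Cdiff; now rewrite Es].
      assert (X2 := A2 _ _ L1 X1).
      apply (Csums_ext _ (fun j => u2 j * Cdiff (Cdiff (gpow nu (s t))) (INR (S j)))) in X2;
        [|intros j; unfold Cdiff at 3; now rewrite Es].
      assert (X3 := A3 _ _ L2 X2).
      apply (Csums_ext _ (fun j => u3 j * Cdiff (Cdiff (Cdiff (gpow nu (s t)))) (INR (S j)))) in X3;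
        [|intros j; unfold Cdiff at 5; now rewrite Es].
      replace (S0 t - psi (s t)) with (S0 t - c1 * gpow nu (s t) (INR 1) - c2 * Cdiff (gpow nu (s t)) (INR 1) -
        c3 * Cdiff (Cdiff (gpow nu (s t))) (INR 1)) by (unfold psi; simpl INR; ring).
      apply (Ctends_bound _ _ _ _ X3). exists O. intros n _.
      eapply Rle_trans; [apply (Cmod_csum_rsum _ (fun j => C1 * (Cmod (s t) / (1 + Cmod (s t) * INR (S j) ^ 2)))%R)|].
      - intros j. rewrite Cmod_mult. unfold C1. rewrite Rmult_assoc.
        apply Rmult_le_compat; [apply Cmod_ge_0|apply Cmod_ge_0|apply Hbd|].
        apply gpow_third_diff; [exact Hnu|exact Hd| |exact Hst].
        apply (le_INR 1). lia.
      - rewrite rsum_scal. apply Rmult_le_compat_l; [exact C1p|]. apply rsum_lorentz; [apply Cmod_ge_0|exact HK]. }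
    (* The order matters: [K] is fixed first so that [C1 / K] is at most [eps / 2], and only then is
       [s] made small against [C1 K]. *)
    intros eps He. destruct (INR_unbounded (2 * (C1 + 1) / eps)) as [K0 HK0].
    set (K := S K0). assert (PK : (0 < INR K)%R) by (apply lt_0_INR; unfold K; lia).
    assert (HKe : (C1 * / INR K <= eps / 2)%R).
    { apply Rmult_le_reg_r with (INR K); [exact PK|]. rewrite Rmult_assoc, Rinv_l, Rmult_1_r by lra.
      apply Rmult_lt_compat_r with (r := eps) in HK0; [|exact He]. unfold Rdiv in HK0.
      rewrite Rmult_assoc, Rinv_l, Rmult_1_r in HK0 by lra.
      assert (INR K0 <= INR K)%R by (apply le_INR; unfold K; lia). nra. }
    assert (He' : (0 < eps / (2 * (C1 * INR K + 1)))%R) by (apply Rdiv_lt_0_compat; nra).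
    generalize (filter_and (F := F) _ _ (Bd K ltac:(unfold K; lia)) (Hs _ He')). apply filter_imp. intros t [Ht Hst].
    replace (s t - 0) with (s t) in Hst by ring.
    replace (S0 t - psi (s t) - 0) with (S0 t - psi (s t)) by ring.
    eapply Rle_lt_trans; [exact Ht|].
    assert (Q : ((C1 * INR K + 1) * Cmod (s t) < eps / 2)%R).
    { replace (eps / 2)%R with ((C1 * INR K + 1) * (eps / (2 * (C1 * INR K + 1))))%R by (field; nra).
      apply Rmult_lt_compat_l; [nra|exact Hst]. }
    assert (C0 := Cmod_ge_0 (s t)). nra.
Qed.

(** * The boundary function *)

Lemma sum_n_m_csum (a : nat -> C) (n : nat) :
  sum_n_m (G := C_AbelianMonoid) a 1 n = csum (fun k => a (S k)) n.
Proof.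
  induction n as [|n IH].
  - rewrite sum_n_m_zero by lia. reflexivity.
  - rewrite sum_n_Sm by lia. rewrite IH. reflexivity.
Qed.

Lemma is_mean_0_iff (N : nat) (g : Z -> C) : (0 < N)%nat -> periodic (Z.of_nat N) g ->
  (csum (fun k => g (Z.of_nat (S k))) N = 0 <-> RtoC 0 = csum (fun k => g (Z.of_nat (S k))) N / RtoC (INR N)).
Proof.
  intros HN Hg. assert (P : RtoC (INR N) <> 0).
  { intros E. apply RtoC_inj in E. assert (0 < INR N)%R by (now apply lt_0_INR). lra. }
  split; intros H.
  - rewrite H. field. exact P.
  - transitivity (csum (fun k => g (Z.of_nat (S k))) N / RtoC (INR N) * RtoC (INR N)); [field; exact P|].
    rewrite <- H. ring.
Qed.

Lemma Qbar_inv (f : Z -> C) (M : Z) (q : Qc) : Qbar f M q ->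
  exists N : nat, (0 < N)%nat /\ periodic (Z.of_nat N) (twist f (Qc2R q / IZR M)) /\
    csum (fun k => twist f (Qc2R q / IZR M) (Z.of_nat (S k))) N = 0.
Proof.
  intros [N [HN [Hp E]]]. exists N. repeat split; auto. rewrite sum_n_m_csum in E.
  now apply is_mean_0_iff.
Qed.

Lemma Qbar_intro (f : Z -> C) (M : Z) (q : Qc) (N : nat) : (0 < N)%nat ->
  periodic (Z.of_nat N) (twist f (Qc2R q / IZR M)) ->
  csum (fun k => twist f (Qc2R q / IZR M) (Z.of_nat (S k))) N = 0 -> Qbar f M q.
Proof.
  intros HN Hp E. exists N. repeat split; auto. rewrite sum_n_m_csum. now apply is_mean_0_iff.
Qed.

(** The exponential is split at the rational point: its value there makes the coefficients a
    periodic twist of [f], and the difference [tau - q] enters through a Gaussian weight alone. *)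
Lemma Theta_twist_Csums (nu : nat) (f : Z -> C) (M : Z) (q : R) (tau : C) (b : R) : (0 < M)%Z -> (0 < Im tau)%R ->
  (forall n, (Cmod (f n) <= b)%R) ->
  Csums (fun j => twist f (q / IZR M) (Z.of_nat (S j)) * gpow nu (theta_param M (tau - RtoC q)) (INR (S j))) (Theta nu f M tau).
Proof.
  intros HM Ht Hb. assert (PM : (0 < IZR M)%R) by (now apply IZR_lt).
  eapply Csums_ext; [|exact (Theta_Csums nu f M tau b HM Ht Hb)].
  intros j. unfold gpow, twist. set (n := S j).
  assert (E : gw (theta_param M tau) (INR n) = Cexp (Ci * RtoC (PI * IZR (Z.of_nat n) ^ 2 * (q / IZR M))) * gw (theta_param M (tau - RtoC q)) (INR n)).
  { unfold gw. rewrite <- Cexp_plus. f_equal. rewrite <- INR_IZR_INZ. unfold theta_param.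
    destruct tau as [x y]. apply C_ext; simpl; field; lra. }
  rewrite E. ring.
Qed.

Global Instance nontangential_filter (a : C) : ProperFilter (nontangential a).
Proof.
  constructor.
  (* A sector is empty once [eps] reaches [pi / 2], so one fixed small [eps] is used; the point
     vertically above [a] lies in that sector. *)
  - intros P H. assert (HP := PI_RGT_0). assert (He : (0 < PI / 4)%R) by lra.
    destruct (H (PI / 4)%R He) as [e He0].
    assert (Hb : ball (M := C_UniformSpace) a e (a + Ci * RtoC (e / 2))).
    { destruct a as [x y]. assert (Pe := cond_pos e). split; unfold ball; simpl; unfold AbsRing_ball, abs, minus, plus, opp; simpl.
      - replace (x + (0 * (e / 2) - 1 * 0) + - x)%R with 0%R by ring. rewrite Rabs_R0. exact Pe.
      - replace (y + (0 * 0 + 1 * (e / 2)) + - y)%R with (e / 2)%R by ring. rewrite Rabs_pos_eq; lra. }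
    exists (a + Ci * RtoC (e / 2)). apply (He0 _ Hb).
    exists (e / 2)%R, (PI / 2)%R. assert (Pe := cond_pos e). split; [lra|]. split; [lra|].
    rewrite Cexp_Ci, cos_PI2, sin_PI2. apply C_ext; destruct a; simpl; ring.
  - constructor.
    + intros eps _. apply filter_forall. auto.
    + intros P Q HP HQ eps He. apply filter_and; [now apply HP|now apply HQ].
    + intros P Q HPQ HP eps He. specialize (HP eps He). revert HP. apply filter_imp. exact HPQ.
Qed.

(** * The Gauss sum *)

Definition gauss_sum (M c d : Z) : C :=
  csum (fun j => Cunit (- (IZR (d * M * Z.of_nat j ^ 2) / (2 * IZR c)))) (Z.to_nat c).

Lemma Cunit_IZR_div_mod (x y m : Z) : m <> 0%Z -> (m | x - y)%Z -> Cunit (IZR x / IZR m) = Cunit (IZR y / IZR m).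
Proof.
  intros Hm [k Hk]. apply (Cunit_mod1 _ _ k).
  assert (P : IZR m <> 0%R) by (now apply not_0_IZR).
  replace (IZR x / IZR m - IZR y / IZR m)%R with (IZR (x - y) / IZR m)%R by (rewrite minus_IZR; field; exact P).
  rewrite Hk, mult_IZR. field. exact P.
Qed.

Section Gauss.
Context (M a b c d k : Z) (HM : (0 < M)%Z) (HMe : Z.Even M) (Hk : (0 < k)%Z) (Hc : c = (2 * M * k)%Z).
Context (Hdet : (a * d - b * c = 1)%Z).

(** Modulo a divisor of [c] the determinant reads [a d = 1], so [d] can be cancelled. *)
Lemma gauss_coprime (l n : Z) : (n | c)%Z -> (n | d * l)%Z -> (n | l)%Z.
Proof.
  intros [u Hu] [v Hv]. exists (a * v - b * u * l)%Z.
  transitivity ((a * d - b * c) * l)%Z; [rewrite Hdet; ring|]. rewrite Hu.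
  transitivity (a * (d * l) - b * u * l * n)%Z; [ring|]. rewrite Hv. ring.
Qed.

Let Hc0 : (0 < c)%Z.
Proof. rewrite Hc. nia. Qed.

Lemma csum_Cunit_Z (n : Z) (t : Z) : (0 < n)%Z -> ~ (n | t)%Z ->
  csum (fun j => Cunit (IZR (t * Z.of_nat j) / IZR n)) (Z.to_nat n) = 0.
Proof.
  intros Hn Ht. rewrite <- (csum_Cunit_0 (Z.to_nat n) t); [|lia|now rewrite Z2Nat.id by lia].
  apply csum_ext. intros j _. f_equal. rewrite mult_IZR, !INR_IZR_INZ, Z2Nat.id by lia. unfold Rdiv. ring.
Qed.

(** The index is written [i + 2 k j]. Moving [j] changes the exponent, modulo integers, only by
    [- d r j / M], a character of order dividing [M]; it sums to zero unless [M] divides [d r], that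
    is [r]. *)
Lemma gauss_inner (r : Z) : ~ (M | r)%Z ->
  csum (fun j => Cunit (- (IZR (d * (r + M * Z.of_nat j) ^ 2) / (2 * IZR (c * M))))) (Z.to_nat c) = 0.
Proof.
  intros Hr. assert (PM : (0 < IZR M)%R) by (now apply IZR_lt). assert (Pk : (0 < IZR k)%R) by (now apply IZR_lt).
  replace (Z.to_nat c) with (Z.to_nat M * Z.to_nat (2 * k))%nat by (rewrite Hc, <- Z2Nat.inj_mul by lia; f_equal; ring).
  rewrite csum_mul'. rewrite (csum_ext _ (fun _ => 0)); [apply csum_zero|].
  intros i Hi.
  transitivity (Cunit (- (IZR (d * (r + M * Z.of_nat i) ^ 2) / (2 * IZR (c * M)))) *
    csum (fun j => Cunit (IZR ((- (d * r)) * Z.of_nat j) / IZR M)) (Z.to_nat M)).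
  - rewrite <- csum_mult_l. apply csum_ext. intros j _. rewrite <- Cunit_plus.
    apply (Cunit_mod1 _ _ (- (d * (Z.of_nat i * Z.of_nat j + k * Z.of_nat j ^ 2)))%Z).
    rewrite Nat2Z.inj_add, Nat2Z.inj_mul, Z2Nat.id by lia. rewrite Hc.
    repeat rewrite ?opp_IZR, ?mult_IZR, ?plus_IZR, ?Z.pow_2_r. field. lra.
  - rewrite csum_Cunit_Z; [ring|exact HM|]. intros [v Hv]. apply Hr. apply gauss_coprime.
    + exists (2 * k)%Z. rewrite Hc. ring.
    + exists (- v)%Z. lia.
Qed.

(** In the double sum, one index is shifted by the other. The inner sum is then over a character
    modulo [c] that is trivial only if [2 k] divides the remaining index [l]. *)
Lemma gauss_sum_sqr : gauss_sum M c d * Cconj (gauss_sum M c d) = RtoC (IZR (c * M)).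
Proof.
  assert (PM : (0 < IZR M)%R) by (now apply IZR_lt). assert (Pk : (0 < IZR k)%R) by (now apply IZR_lt).
  assert (Pc : (0 < IZR c)%R) by (now apply IZR_lt).
  set (W := fun n : Z => Cunit (- (IZR (d * M * n ^ 2) / (2 * IZR c)))).
  assert (PW : periodic (Z.of_nat (Z.to_nat c)) W).
  { intros n. unfold W. rewrite Z2Nat.id by lia. apply (Cunit_mod1 _ _ (- (d * M * n + d * M * M * k))%Z).
    rewrite Hc. repeat rewrite ?opp_IZR, ?mult_IZR, ?plus_IZR, ?Z.pow_2_r. field. lra. }
  assert (CW : forall n, Cconj (W n) = Cunit (IZR (d * M * n ^ 2) / (2 * IZR c))).
  { intros n. unfold W, Cunit. rewrite Cconj_Cexp. f_equal. apply C_ext; simpl; ring. }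
  transitivity (csum (fun l => W (Z.of_nat l) * csum (fun k0 => Cunit (IZR ((- (d * M * Z.of_nat l)) * Z.of_nat k0) / IZR c)) (Z.to_nat c)) (Z.to_nat c)).
  - transitivity (csum (fun k0 => csum (fun l => W (Z.of_nat l + Z.of_nat k0)%Z * Cconj (W (Z.of_nat k0))) (Z.to_nat c)) (Z.to_nat c)).
    + unfold gauss_sum. rewrite csum_conj. fold W. rewrite <- csum_mult_l. apply csum_ext. intros k0 _.
      rewrite csum_mult_r. f_equal. symmetry. exact (csum_shift _ W (Z.of_nat k0) PW).
    + rewrite csum_swap. apply csum_ext. intros l _. rewrite <- csum_mult_l. apply csum_ext. intros k0 _.
      rewrite CW. unfold W. rewrite <- !Cunit_plus. f_equal.
      repeat rewrite ?opp_IZR, ?mult_IZR, ?plus_IZR, ?Z.pow_2_r. field. lra.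
  - match goal with |- csum ?F _ = _ => set (Fl := F) end.
    (* The [M] multiples of [2 k] are the surviving indices. At each of them [W] equals [1] and the
       inner sum is [c], which gives [c M]. *)
    replace (Z.to_nat c) with (Z.to_nat M * Z.to_nat (2 * k))%nat by (rewrite Hc, <- Z2Nat.inj_mul by lia; f_equal; ring).
    rewrite csum_mul. unfold Fl.
    transitivity (csum (fun _ => RtoC (IZR c)) (Z.to_nat M)).
    + apply csum_ext. intros t Ht. rewrite (csum_single _ _ 0%nat); [|lia|].
      * rewrite Nat.add_0_r. set (l := Z.of_nat (t * Z.to_nat (2 * k))).
        assert (El : l = (Z.of_nat t * (2 * k))%Z) by (unfold l; rewrite Nat2Z.inj_mul, Z2Nat.id by lia; reflexivity).
        rewrite (csum_ext _ (fun _ => 1)).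
        { rewrite csum_const, INR_IZR_INZ, Z2Nat.id, Cmult_1_r by lia.
          replace (W l) with (RtoC 1); [ring|]. symmetry.
          transitivity (Cunit (IZR (- (d * k * Z.of_nat t ^ 2)))); [|apply Cunit_Z].
          unfold W. f_equal. rewrite El, Hc. repeat rewrite ?opp_IZR, ?mult_IZR, ?plus_IZR, ?Z.pow_2_r. field. lra. }
        intros k0 _. transitivity (Cunit (IZR (- (d * Z.of_nat t * Z.of_nat k0)))); [|apply Cunit_Z].
        f_equal. rewrite El, Hc. repeat rewrite ?opp_IZR, ?mult_IZR, ?plus_IZR, ?Z.pow_2_r. field. lra.
      * intros i Hi Hi0. rewrite csum_Cunit_Z; [ring|exact Hc0|].
        intros [v Hv]. set (l := Z.of_nat (t * Z.to_nat (2 * k) + i)) in *.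
        assert (D : (2 * k | l)%Z).
        { apply gauss_coprime; [exists M; rewrite Hc; ring|]. exists (- v)%Z.
          apply (Z.mul_reg_r _ _ M); [lia|]. rewrite Hc in Hv.
          replace (d * l * M)%Z with (- - (d * M * l))%Z by ring. rewrite Hv. ring. }
        destruct D as [v' Hv']. unfold l in Hv'. rewrite Nat2Z.inj_add, Nat2Z.inj_mul, Z2Nat.id in Hv' by lia.
        assert (Hi1 : (Z.of_nat i < 2 * k)%Z) by lia.
        assert (Z.of_nat i = (v' - Z.of_nat t) * (2 * k))%Z by (rewrite Z.mul_sub_distr_r; lia).
        assert (0 < Z.of_nat i)%Z by lia. destruct (Z_le_gt_dec (v' - Z.of_nat t) 0); nia.
    + rewrite csum_const, INR_IZR_INZ, Z2Nat.id by lia. rewrite <- RtoC_mult, mult_IZR. f_equal. ring.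
Qed.

Lemma Cmod_gauss_sum : Cmod (gauss_sum M c d) = sqrt (IZR (c * M)).
Proof.
  assert (E := Cmod2_conj (gauss_sum M c d)). rewrite gauss_sum_sqr in E. apply RtoC_inj in E.
  rewrite <- E. symmetry. apply sqrt_pow2. apply Cmod_ge_0.
Qed.

Context (f : Z -> C) (Hf : periodic M f).

Let N : nat := Z.to_nat (c * M).

Definition gauss_twist (n : Z) : C := f n * Cunit (- (IZR (d * n ^ 2) / (2 * IZR (c * M)))).

Let PN : (0 < IZR (c * M))%R.
Proof. apply IZR_lt. nia. Qed.

Lemma gauss_twist_periodic : periodic (Z.of_nat N) gauss_twist.
Proof.
  assert (PM : (0 < IZR M)%R) by (now apply IZR_lt). assert (Pc : (0 < IZR c)%R) by (now apply IZR_lt).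
  assert (Pk : (0 < IZR k)%R) by (now apply IZR_lt).
  intros n. unfold gauss_twist, N. rewrite Z2Nat.id by nia. f_equal.
  - rewrite (Z.mul_comm c M). now apply periodic_mult.
  - apply (Cunit_mod1 _ _ (- (d * n + d * M * k * M))%Z).
    repeat rewrite ?opp_IZR, ?mult_IZR, ?plus_IZR, ?Z.pow_2_r. rewrite Hc.
    repeat rewrite ?opp_IZR, ?mult_IZR, ?plus_IZR, ?Z.pow_2_r. field. lra.
Qed.

(** After the square is completed and the sum shifted by [- a m], the quadratic phase depends on [j]
    in [n = i + M j] through the sum of [gauss_inner], while [f] and the linear phase depend on [i]
    only. Every residue but [i = 0] drops out, and that one carries [f] at [- a m]. *)
Lemma dft_gauss_twist (m : Z) :
  dft N gauss_twist m = RtoC (/ sqrt (IZR (c * M))) * gauss_sum M c d *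
    (f (- (a * m))%Z * Cunit (- (IZR (a * b * m ^ 2) / (2 * IZR M)))) * Cunit (IZR (a * m ^ 2) / (2 * IZR (c * M))).
Proof.
  assert (PM : (0 < IZR M)%R) by (now apply IZR_lt). assert (Pc : (0 < IZR c)%R) by (now apply IZR_lt).
  assert (Pk : (0 < IZR k)%R) by (now apply IZR_lt).
  assert (EN : INR N = IZR (c * M)) by (unfold N; rewrite INR_IZR_INZ, Z2Nat.id by nia; reflexivity).
  unfold dft. rewrite EN.
  (* By [a d = 1 + b c], the phase [- d n^2 - 2 m n] over [2 c M] equals [- d (n + a m)^2] over
     [2 c M], plus the linear phase [b n m / M], plus terms free of [n], which form [K0]. *)
  set (K0 := Cunit (IZR (a * m ^ 2) / (2 * IZR (c * M))) * Cunit (IZR (a * b * m ^ 2) / (2 * IZR M))).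
  set (G := fun n : Z => f n * Cunit (IZR (b * n * m) / IZR M) * Cunit (- (IZR (d * (n + a * m) ^ 2) / (2 * IZR (c * M))))).
  assert (EdetR : (IZR a * IZR d = 1 + IZR b * IZR c)%R).
  { rewrite <- !mult_IZR, <- plus_IZR. f_equal. lia. }
  transitivity (RtoC (/ sqrt (IZR (c * M))) * (K0 * csum (fun n => G (Z.of_nat n)) N)).
  { f_equal. rewrite <- csum_mult_l. apply csum_ext. intros n _. unfold gauss_twist, K0, G.
    rewrite <- Cmult_assoc, <- Cunit_plus.
    transitivity (f (Z.of_nat n) * (Cunit (IZR (a * m ^ 2) / (2 * IZR (c * M))) * Cunit (IZR (a * b * m ^ 2) / (2 * IZR M)) *
      Cunit (IZR (b * Z.of_nat n * m) / IZR M) * Cunit (- (IZR (d * (Z.of_nat n + a * m) ^ 2) / (2 * IZR (c * M)))))); [|ring].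
    f_equal. rewrite <- !Cunit_plus. f_equal. rewrite INR_IZR_INZ. set (nn := Z.of_nat n).
    repeat rewrite ?opp_IZR, ?mult_IZR, ?plus_IZR, ?Z.pow_2_r.
    apply Rminus_diag_uniq.
    transitivity ((2 * IZR nn * IZR m + IZR a * (IZR m * IZR m)) * (IZR a * IZR d - (1 + IZR b * IZR c)) / (2 * (IZR c * IZR M)))%R.
    - field. lra.
    - rewrite EdetR. field. lra. }
  assert (PG : periodic (Z.of_nat N) G).
  { intros n. unfold G, N. rewrite Z2Nat.id by nia. f_equal; [f_equal|].
    - rewrite (Z.mul_comm c M). now apply periodic_mult.
    - apply Cunit_IZR_div_mod; [lia|]. exists (b * c * m)%Z. ring.
    - apply (Cunit_mod1 _ _ (- (d * (n + a * m) + d * M * k * M))%Z).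
      repeat rewrite ?opp_IZR, ?mult_IZR, ?plus_IZR, ?Z.pow_2_r. rewrite Hc.
      repeat rewrite ?opp_IZR, ?mult_IZR, ?plus_IZR, ?Z.pow_2_r. field. lra. }
  rewrite <- (csum_shift N G (- (a * m)) PG).
  replace N with (Z.to_nat c * Z.to_nat M)%nat at 1 by (unfold N; rewrite <- Z2Nat.inj_mul by lia; reflexivity).
  rewrite csum_mul'.
  assert (EG : forall i j : nat, G (Z.of_nat (i + Z.to_nat M * j) + - (a * m))%Z =
     f (Z.of_nat i - a * m)%Z * Cunit (IZR (b * (Z.of_nat i - a * m) * m) / IZR M) *
     Cunit (- (IZR (d * (Z.of_nat i + M * Z.of_nat j) ^ 2) / (2 * IZR (c * M))))).
  { intros i j. unfold G. rewrite Nat2Z.inj_add, Nat2Z.inj_mul, Z2Nat.id by lia.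
    replace (Z.of_nat i + M * Z.of_nat j + - (a * m) + a * m)%Z with (Z.of_nat i + M * Z.of_nat j)%Z by ring.
    f_equal. f_equal.
    - rewrite <- (periodic_mult M f Hf (Z.of_nat j) (Z.of_nat i - a * m)). f_equal. ring.
    - apply Cunit_IZR_div_mod; [lia|]. exists (b * Z.of_nat j * m)%Z. ring. }
  rewrite (csum_single _ (Z.to_nat M) 0%nat); [|lia|].
  - rewrite (csum_ext _ (fun j => f (- (a * m))%Z * Cunit (IZR (b * (- (a * m)) * m) / IZR M) *
       Cunit (- (IZR (d * M * Z.of_nat j ^ 2) / (2 * IZR c))))).
    + rewrite csum_mult_l. fold (gauss_sum M c d). unfold K0.
      transitivity (RtoC (/ sqrt (IZR (c * M))) * gauss_sum M c d * (f (- (a * m))%Z *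
        (Cunit (IZR (a * b * m ^ 2) / (2 * IZR M)) * Cunit (IZR (b * - (a * m) * m) / IZR M))) *
        Cunit (IZR (a * m ^ 2) / (2 * IZR (c * M)))); [ring|].
      rewrite <- Cunit_plus. do 4 f_equal.
      repeat rewrite ?opp_IZR, ?mult_IZR, ?plus_IZR, ?Z.pow_2_r. field. lra.
    + intros j _. rewrite EG. change (Z.of_nat 0) with 0%Z. rewrite !Z.sub_0_l, Z.add_0_l. do 2 f_equal.
      repeat rewrite ?opp_IZR, ?mult_IZR, ?plus_IZR, ?Z.pow_2_r. field. lra.
  - intros i Hi Hi0. rewrite (csum_ext _ _ _ (fun j _ => EG i j)). rewrite csum_mult_l, gauss_inner; [ring|].
    intros [v Hv]. assert (0 < Z.of_nat i < M)%Z by lia. destruct (Z_le_gt_dec v 0); nia.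
Qed.

End Gauss.

(** * Boundary values along paths *)

Lemma sin_ge_of_sector (e t : R) : (0 < e)%R -> (e <= PI / 4)%R -> (e < t < PI - e)%R -> (sin e <= sin t)%R.
Proof.
  intros H1 H2 H3. destruct (Rle_dec t (PI / 2)).
  - apply sin_incr_1; lra.
  - rewrite <- (sin_PI_x t). apply sin_incr_1; lra.
Qed.

(** A sector of opening [e] satisfies [Im >= sin e] times the modulus, which is the hypothesis of
    [theta_sector_limit] with [d = sin e]. As the limit there is common to all sectors, it is the
    one picked by [Clim]. *)
Lemma Theta_nontangential (nu : nat) (f : Z -> C) (M : Z) (q : Qc) (b : R) :
  (0 < M)%Z -> (nu <= 1)%nat -> (forall n, (Cmod (f n) <= b)%R) -> Qbar f M q ->
  Ctends (nontangential (RtoC (Qc2R q))) (Theta nu f M) (Theta_nt nu f M (Some q)).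
Proof.
  intros HM Hnu Hb Hq. assert (PM : (0 < IZR M)%R) by (now apply IZR_lt). assert (HP := PI_RGT_0).
  destruct (Qbar_inv f M q Hq) as [N [HN [Hper H0]]].
  set (u := fun j => twist f (Qc2R q / IZR M) (Z.of_nat (S j))).
  assert (Hu : mean_zero_seq N u).
  { split; [|exact H0]. intros j. unfold u. rewrite <- (Hper (Z.of_nat (S j))). f_equal. lia. }
  destruct (theta_sector_limit N nu u HN Hnu Hu) as [l Hl].
  assert (L : Ctends (nontangential (RtoC (Qc2R q))) (Theta nu f M) l).
  { intros eps He e0 He0.
    (* The given [e0] may be large; capping it at [pi / 4] enlarges the sector and keeps [sin e]
       positive and below the sine of every angle in it. *)
    set (e := Rmin e0 (PI / 4)). assert (E1 : (0 < e)%R) by (apply Rmin_glb_lt; lra).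
    assert (E2 : (e <= PI / 4)%R) by apply Rmin_r. assert (E3 : (e <= e0)%R) by apply Rmin_l.
    set (F := within (sector e0 (RtoC (Qc2R q))) (locally (T := C_UniformSpace) (RtoC (Qc2R q)))).
    change (F (fun tau => (Cmod (Theta nu f M tau - l) < eps)%R)).
    assert (FF : Filter F) by (apply within_filter, locally_filter).
    assert (Hsec : forall tau, sector e0 (RtoC (Qc2R q)) tau ->
      (0 < Im (tau - RtoC (Qc2R q)))%R /\ (sin e * Cmod (tau - RtoC (Qc2R q)) <= Im (tau - RtoC (Qc2R q)))%R).
    { intros tau [r [t [Hr [Ht E]]]]. rewrite E. rewrite Cmod_mult, Cmod_Cexp_Ci, Cmod_Rpos, Cexp_Ci by lra.
      replace (Im (RtoC r * (cos t, sin t))) with (r * sin t)%R by (simpl; ring).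
      assert (S1 := sin_ge_of_sector e t E1 E2 ltac:(lra)).
      assert (S2 : (0 < sin e)%R) by (apply sin_gt_0; lra). nra. }
    apply (Hl C F FF (fun tau => theta_param M (tau - RtoC (Qc2R q))) (Theta nu f M) (sin e)).
    - apply sin_gt_0; lra.
    - assert (A : Ctends F (fun tau => tau) (RtoC (Qc2R q))).
      { apply (Ctends_filterlim F). intros P HPl. unfold F, within, filtermap. revert HPl. apply filter_imp. auto. }
      unfold theta_param. replace (RtoC 0) with (- Ci * RtoC (PI / IZR M) * (RtoC (Qc2R q) - RtoC (Qc2R q))) by ring.
      apply (Ctends_mult F); [apply (Ctends_const F)|]. apply (Ctends_minus F); [exact A|apply (Ctends_const F)].
    - unfold F, within. apply filter_forall. intros tau Ht. rewrite Re_theta_param.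
      apply Rmult_lt_0_compat; [apply Rdiv_lt_0_compat; lra|]. now apply Hsec.
    - unfold F, within. apply filter_forall. intros tau Ht. rewrite Re_theta_param. unfold theta_param.
      assert (Pm : (0 < PI / IZR M)%R) by (apply Rdiv_lt_0_compat; lra).
      rewrite !Cmod_mult, Cmod_opp, Cmod_Ci, Cmod_Rpos by lra.
      destruct (Hsec tau Ht) as [_ B]. nra.
    - unfold F, within. apply filter_forall. intros tau Ht. apply (Theta_twist_Csums nu f M (Qc2R q) tau b HM); [|exact Hb].
      destruct (Hsec tau Ht) as [B _]. destruct tau as [x y]. simpl in *. lra.
    - exact He. }
  replace (Theta_nt nu f M (Some q)) with l; [exact L|].
  symmetry. unfold Theta_nt, Clim.
  apply (iota_filterlim_locally (K := C_AbsRing) (V := C_CompleteNormedModule) (F := nontangential (RtoC (Qc2R q)))).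
  now apply (Ctends_filterlim (nontangential (RtoC (Qc2R q)))).
Qed.

(** Such a path stays within [pi / 4] of the vertical direction, so the sector for [eps = pi / 4]
    contains it; polar coordinates are recovered from the arctangent of the slope. *)
Lemma nontangential_path {T : Type} (F : (T -> Prop) -> Prop) {FF : Filter F} (h : T -> C) (a : R) :
  Ctends F h (RtoC a) -> F (fun t => (Rabs (Re (h t) - a) < Im (h t))%R) -> filterlim h F (nontangential (RtoC a)).
Proof.
  intros Hh HF P HP. assert (HPI := PI_RGT_0). specialize (HP (PI / 4)%R ltac:(lra)).
  apply (Ctends_filterlim F) in Hh. specialize (Hh _ HP). unfold filtermap in *.
  generalize (filter_and _ _ Hh HF). apply filter_imp. intros t [H1 H2]. apply H1.
  set (u := (Re (h t) - a)%R) in *. set (v := Im (h t)) in *.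
  assert (Hv : (0 < v)%R) by (generalize (Rabs_pos u); lra).
  apply Rabs_lt_between in H2.
  set (w := (u / v)%R).
  assert (Hw : (-1 < w < 1)%R).
  { unfold w. split; apply (Rmult_lt_reg_r v); try exact Hv; unfold Rdiv; rewrite ?Rmult_assoc, ?Rinv_l, ?Rmult_1_r by lra; lra. }
  assert (S0 : (0 < sqrt (1 + Rsqr w))%R) by (apply sqrt_lt_R0; generalize (Rle_0_sqr w); lra).
  exists (v * sqrt (1 + Rsqr w))%R, (PI / 2 - atan w)%R. split; [now apply Rmult_lt_0_compat|]. split.
  - assert (A1 := atan_increasing w 1 (proj2 Hw)). assert (A2 := atan_increasing (-1) w (proj1 Hw)).
    rewrite atan_1 in A1. replace (-1)%R with (- (1))%R in A2 by ring. rewrite atan_opp, atan_1 in A2. lra.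
  - rewrite Cexp_Ci, cos_shift, sin_shift, sin_atan, cos_atan.
    apply C_ext.
    + transitivity u; [unfold u; destruct (h t); simpl; ring|].
      transitivity (v * sqrt (1 + Rsqr w) * (w / sqrt (1 + Rsqr w)))%R; [|simpl; ring]. unfold w. field. split; [lra|].
      fold w. lra.
    + transitivity v; [unfold v; destruct (h t); simpl; ring|].
      transitivity (v * sqrt (1 + Rsqr w) * (1 / sqrt (1 + Rsqr w)))%R; [|simpl; ring]. field. lra.
Qed.

Lemma at_right_Ctends (x c : R) : Ctends (at_right 0) (fun e : R => RtoC x + Ci * RtoC (c * e)) (RtoC x).
Proof.
  intros eps He.
  assert (Hd : (0 < eps / (Rabs c + 1))%R) by (apply Rdiv_lt_0_compat; [exact He|generalize (Rabs_pos c); lra]).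
  exists (mkposreal _ Hd). intros e Hb _. unfold ball in Hb; simpl in Hb.
  unfold AbsRing_ball, abs, minus, plus, opp in Hb; simpl in Hb. rewrite Ropp_0, Rplus_0_r in Hb.
  replace (RtoC x + Ci * RtoC (c * e) - RtoC x) with (Ci * RtoC (c * e)) by ring.
  rewrite Cmod_mult, Cmod_Ci, Rmult_1_l, Cmod_R, Rabs_mult.
  assert (P := Rabs_pos c). assert (Q := Rabs_pos e).
  apply Rle_lt_trans with ((Rabs c + 1) * Rabs e)%R; [nra|].
  replace eps with ((Rabs c + 1) * (eps / (Rabs c + 1)))%R by (field; lra).
  apply Rmult_lt_compat_l; lra.
Qed.

Lemma at_right_pos : at_right 0 (fun e => (0 < e)%R).
Proof. exists (mkposreal 1 Rlt_0_1). intros e _ H. exact H. Qed.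

Lemma Theta_vertical (nu : nat) (f : Z -> C) (M : Z) (q : Qc) (b : R) :
  (0 < M)%Z -> (nu <= 1)%nat -> (forall n, (Cmod (f n) <= b)%R) -> Qbar f M q ->
  Ctends (at_right 0) (fun e => Theta nu f M (RtoC (Qc2R q) + Ci * RtoC (1 * e))) (Theta_nt nu f M (Some q)).
Proof.
  intros HM Hnu Hb Hq.
  apply (Ctends_comp (nontangential (RtoC (Qc2R q))) (at_right 0) _ (Theta nu f M)).
  - apply nontangential_path; [typeclasses eauto|apply at_right_Ctends|].
    generalize at_right_pos. apply filter_imp. intros e He.
    simpl. replace (Qc2R q + (0 * (1 * e) - 1 * 0) - Qc2R q)%R with 0%R by ring. rewrite Rabs_R0. lra.
  - now apply (Theta_nontangential nu f M q b).
Qed.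

Lemma Re_le_Cmod_1 (z w : C) : (Re z <= Cmod w + Cmod (z - w))%R.
Proof.
  eapply Rle_trans; [apply Rle_abs|]. eapply Rle_trans; [apply re_le_Cmod|].
  replace z with (w + (z - w)) at 1 by ring. apply Cmod_triangle.
Qed.

(* For nonzero mean [m], the part [m sum n e^(-kappa n^2)] is unbounded as [kappa -> 0]. *)
Lemma mean_zero_of_vertical_limit (f : Z -> C) (M : Z) (q : Qc) (b : R) (N : nat) (l : C) :
  (0 < M)%Z -> (forall n, (Cmod (f n) <= b)%R) -> (0 < N)%nat ->
  periodic (Z.of_nat N) (twist f (Qc2R q / IZR M)) ->
  Ctends (at_right 0) (fun e => Theta 1 f M (RtoC (Qc2R q) + Ci * RtoC (1 * e))) l -> Qbar f M q.
Proof.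
  intros HM Hb HN Hper HL. assert (PM : (0 < IZR M)%R) by (now apply IZR_lt). assert (HP := PI_RGT_0).
  assert (PN : (0 < INR N)%R) by (now apply lt_0_INR).
  assert (PNC : RtoC (INR N) <> 0) by (intros E; apply RtoC_inj in E; lra).
  apply (Qbar_intro f M q N HN Hper).
  set (v := fun j => twist f (Qc2R q / IZR M) (Z.of_nat (S j))).
  change (csum v N = 0). set (m := csum v N * / RtoC (INR N)).
  assert (Hu : mean_zero_seq N (fun j => v j - m)).
  { split.
    - intros j. f_equal. unfold v. rewrite <- (Hper (Z.of_nat (S j))). f_equal. lia.
    - rewrite csum_minus, csum_const. unfold m. field. exact PNC. }
  destruct (theta_sector_limit N 1 (fun j => v j - m) HN (le_n 1) Hu) as [l' Hl'].
  set (s := fun e : R => RtoC (PI / IZR M * e)).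
  assert (Es : forall e : R, theta_param M (RtoC (Qc2R q) + Ci * RtoC (1 * e) - RtoC (Qc2R q)) = s e).
  { intros e. unfold theta_param, s. apply C_ext; simpl; ring. }
  set (A := fun e => CSeries (fun j => 1 * gpow 1 (s e) (INR (S j)))).
  assert (Pk : (0 < PI / IZR M)%R) by (apply Rdiv_lt_0_compat; lra).
  assert (HA : forall e, (0 < e)%R -> Csums (fun j => 1 * gpow 1 (s e) (INR (S j))) (A e)).
  { intros e He. destruct (gauss_terms_bound 1 (s e)) as [c [Hc B]]; [unfold s; simpl; nra|].
    apply (Csums_exp_dominated _ c). intros n. rewrite Cmult_1_l. apply B, pos_INR. }
  assert (L' : Ctends (at_right 0) (fun e => Theta 1 f M (RtoC (Qc2R q) + Ci * RtoC (1 * e)) - m * A e) l').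
  { apply (Hl' R (at_right 0) _ s _ 1%R Rlt_0_1).
    - intros eps He. destruct (at_right_Ctends 0 (PI / IZR M) eps He) as [d Hd]. exists d. intros e H1 H2.
      specialize (Hd e H1 H2). unfold s.
      replace (RtoC 0 + Ci * RtoC (PI / IZR M * e) - RtoC 0) with (Ci * RtoC (PI / IZR M * e)) in Hd by ring.
      rewrite Cmod_mult, Cmod_Ci, Rmult_1_l in Hd. replace (RtoC (PI / IZR M * e) - 0) with (RtoC (PI / IZR M * e)) by ring. exact Hd.
    - generalize at_right_pos. apply filter_imp. intros e He. unfold s; simpl. nra.
    - generalize at_right_pos. apply filter_imp. intros e He. unfold s. rewrite Rmult_1_l, Cmod_Rpos by nra. simpl. lra.
    - generalize at_right_pos. apply filter_imp. intros e He.
      assert (T := Theta_twist_Csums 1 f M (Qc2R q) (RtoC (Qc2R q) + Ci * RtoC (1 * e)) b HM ltac:(simpl; lra) Hb).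
      rewrite Es in T.
      replace (Theta 1 f M (RtoC (Qc2R q) + Ci * RtoC (1 * e)) - m * A e)
        with (Theta 1 f M (RtoC (Qc2R q) + Ci * RtoC (1 * e)) + (- m) * A e) by ring.
      eapply Csums_ext; [|exact (Csums_plus _ _ _ _ T (Csums_mult_l (- m) _ _ (HA e He)))].
      intros j. cbv beta. fold (v j). ring. }
  assert (LA : Ctends (at_right 0) (fun e => m * A e) (l - l')).
  { apply (Ctends_ext (at_right 0) (fun e => Theta 1 f M (RtoC (Qc2R q) + Ci * RtoC (1 * e)) -
      (Theta 1 f M (RtoC (Qc2R q) + Ci * RtoC (1 * e)) - m * A e))); [intros; ring|].
    now apply (Ctends_minus (at_right 0)). }
  assert (Hm : m = 0).
  { destruct (Ceq_dec m 0) as [H|H]; [exact H|exfalso].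
    assert (Pm := proj1 (Cmod_gt_0 m) H).
    (* With this [K], the first [K] terms of the real series alone exceed, by a third of [K], the
       bound that the assumed limit puts on [A e], with a margin for truncating the series. *)
    destruct (INR_unbounded (3 * (2 + Cmod (l - l') / Cmod m + / Cmod m))) as [K HK].
    assert (PK : (0 < INR K)%R).
    { assert (0 < / Cmod m)%R by now apply Rinv_0_lt_compat.
      assert (0 <= Cmod (l - l') / Cmod m)%R by (apply Rdiv_le_0_compat; [apply Cmod_ge_0|exact Pm]). lra. }
    assert (PK2 : (0 < PI / IZR M * INR K ^ 2)%R) by (apply Rmult_lt_0_compat; [exact Pk|apply pow_lt; exact PK]).
    assert (Esm : at_right 0 (fun e => (e < / (PI / IZR M * INR K ^ 2))%R)).
    { exists (mkposreal _ (Rinv_0_lt_compat _ PK2)). intros e Hb' H0. unfold ball in Hb'; simpl in Hb'.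
      unfold AbsRing_ball, abs, minus, plus, opp in Hb'; simpl in Hb'. rewrite Ropp_0, Rplus_0_r in Hb'.
      rewrite Rabs_pos_eq in Hb' by lra. exact Hb'. }
    destruct (filter_ex (F := at_right 0) _ (filter_and (F := at_right 0) _ _ (LA 1%R Rlt_0_1) (filter_and (F := at_right 0) _ _ Esm at_right_pos)))
      as [e [H1 [H2 H3]]].
    destruct (HA e H3 1%R Rlt_0_1) as [n0 Hn0]. specialize (Hn0 (K + n0)%nat ltac:(lia)).
    assert (R1 : forall n, Re (csum (fun j => 1 * gpow 1 (s e) (INR (S j))) n) =
      rsum (fun j => INR (S j) * exp (- (PI / IZR M * e * INR (S j) ^ 2)))%R n).
    { intros n. rewrite Re_csum. apply rsum_ext. intros j _. unfold gpow, gw, s.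
      rewrite <- RtoC_mult, <- RtoC_opp, Cexp_RtoC, <- !RtoC_mult. unfold RtoC, Re. cbn [fst]. ring. }
    assert (R2 : (INR K * / 3 <= rsum (fun j => INR (S j) * exp (- (PI / IZR M * e * INR (S j) ^ 2)))%R (K + n0))%R).
    { rewrite rsum_add. rewrite <- rsum_const.
      assert (0 <= rsum (fun k => INR (S (K + k)) * exp (- (PI / IZR M * e * INR (S (K + k)) ^ 2)))%R n0)%R.
      { rewrite <- (Rmult_0_r (INR n0)), <- rsum_const. apply rsum_le. intros k _.
        apply Rmult_le_pos; [apply pos_INR|left; apply exp_pos]. }
      assert (rsum (fun _ => / 3) K <= rsum (fun j => INR (S j) * exp (- (PI / IZR M * e * INR (S j) ^ 2))) K)%R; [|lra].
      apply rsum_le. intros j Hj. assert (J1 : (1 <= INR (S j))%R) by (apply (le_INR 1); lia).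
      assert (J2 : (INR (S j) <= INR K)%R) by (apply le_INR; lia).
      assert (J3 : (INR (S j) ^ 2 <= INR K ^ 2)%R) by (apply pow_incr; lra).
      assert (J4 : (PI / IZR M * e * INR (S j) ^ 2 <= 1)%R).
      { apply Rle_trans with (PI / IZR M * e * INR K ^ 2)%R; [apply Rmult_le_compat_l; nra|].
        apply Rmult_lt_compat_r with (r := (PI / IZR M * INR K ^ 2)%R) in H2; [|exact PK2].
        rewrite Rinv_l in H2 by lra. lra. }
      (* For [e] this small every exponent of index at most [K] is within [1], so each of these
         terms is at least [exp (- 1) >= 1 / 3]. *)
      assert (J5 : (/ 3 <= exp (- (1)))%R).
      { rewrite exp_Ropp. apply Rinv_le_contravar; [apply exp_pos|]. apply exp_le_3. }
      assert (J6 : (exp (- (1)) <= exp (- (PI / IZR M * e * INR (S j) ^ 2)))%R) by (apply exp_le; lra). nra. }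
    rewrite <- R1 in R2.
    assert (R3 := Re_le_Cmod_1 (csum (fun j => 1 * gpow 1 (s e) (INR (S j))) (K + n0)) (A e)).
    assert (R4 : (Cmod (A e) <= (Cmod (l - l') + 1) / Cmod m)%R).
    { apply Rmult_le_reg_l with (Cmod m); [exact Pm|]. rewrite <- Cmod_mult.
      replace (Cmod m * ((Cmod (l - l') + 1) / Cmod m))%R with (Cmod (l - l') + 1)%R by (field; lra).
      replace (m * A e) with ((m * A e - (l - l')) + (l - l')) by ring.
      eapply Rle_trans; [apply Cmod_triangle|]. lra. }
    replace ((Cmod (l - l') + 1) / Cmod m)%R with (Cmod (l - l') / Cmod m + / Cmod m)%R in R4 by (field; lra).
    lra. }
  unfold m in Hm. transitivity (csum v N * / RtoC (INR N) * RtoC (INR N)); [field; exact PNC|]. rewrite Hm. ring.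
Qed.

(** * The transformation of boundary values *)

Lemma periodic_Z_bounded (M : Z) (f : Z -> C) : (0 < M)%Z -> periodic M f ->
  exists b : R, forall n, (Cmod (f n) <= b)%R.
Proof.
  intros HM Hf. destruct (periodic_bounded (Z.to_nat M) f) as [b [_ H]]; [lia| |now exists b].
  now rewrite Z2Nat.id by lia.
Qed.

Section Transformation.
Context (M : Z) (f : Z -> C) (nu : nat) (a b c d k : Z).
Context (HM : (0 < M)%Z) (Hf : periodic M f) (f0 : f 0%Z = 0) (Hnu : (nu <= 1)%nat) (Hpar : parity nu f).
Context (Hk : (0 < k)%Z) (Hc : c = (2 * M * k)%Z) (Hdet : (a * d - b * c = 1)%Z).
Context (chi0 : C) (Hchi0 : Cmod chi0 = 1%R).
Context (Hchi : forall m, f (- (a * m))%Z * Cunit (- (IZR (a * b * m ^ 2) / (2 * IZR M))) = chi0 * f m).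

Let N : nat := Z.to_nat (c * M).
Let g : Z -> C := gauss_twist M c d f.
Let PM : (0 < IZR M)%R := IZR_lt 0 M HM.

Let Hc0 : (0 < c)%Z.
Proof. rewrite Hc. nia. Qed.

Let Pc : (0 < IZR c)%R := IZR_lt 0 c Hc0.

Definition transformation_factor : C := RtoC (/ sqrt (IZR (c * M))) * gauss_sum M c d * chi0.

Lemma transformation_N : (0 < N)%nat.
Proof. unfold N. nia. Qed.

Lemma transformation_ZN : Z.of_nat N = (c * M)%Z.
Proof. unfold N. rewrite Z2Nat.id; nia. Qed.

Lemma Cmod_transformation_factor : Cmod transformation_factor = 1%R.
Proof.
  assert (P : (0 < IZR (c * M))%R) by (rewrite mult_IZR; now apply Rmult_lt_0_compat).
  assert (S := sqrt_lt_R0 _ P). unfold transformation_factor.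
  rewrite !Cmod_mult, Hchi0, (Cmod_gauss_sum M a b c d k HM Hk Hc Hdet), Cmod_Rpos by (left; now apply Rinv_0_lt_compat).
  field. lra.
Qed.

Lemma transformation_dft (m : Z) : dft N g m = transformation_factor * (f m * Cunit (IZR (a * m ^ 2) / (2 * IZR (c * M)))).
Proof.
  unfold g, N. rewrite (dft_gauss_twist M a b c d k HM Hk Hc Hdet f Hf m), Hchi. unfold transformation_factor. ring.
Qed.

Lemma transformation_periodic : periodic (Z.of_nat N) g.
Proof. exact (gauss_twist_periodic M a b c d k HM Hk Hc Hdet f Hf). Qed.

Lemma transformation_parity : parity nu g.
Proof.
  intros n. unfold g, gauss_twist. rewrite Hpar. replace ((- n) ^ 2)%Z with (n ^ 2)%Z by ring. ring.
Qed.

Lemma transformation_g0 : g 0%Z = 0.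
Proof. unfold g, gauss_twist. rewrite f0. ring. Qed.

Lemma transformation_dft0 : dft N g 0 = 0.
Proof. rewrite transformation_dft, f0. ring. Qed.

Lemma Theta_shift (tau : C) :
  Theta nu g (Z.of_nat N) (RtoC (IZR c) * tau + RtoC (IZR d)) = Theta nu f M tau.
Proof.
  apply CSeries_ext. intros j. cbv zeta. rewrite transformation_ZN. unfold g, gauss_twist.
  set (n := S j). rewrite <- !Cmult_assoc. f_equal. f_equal.
  unfold Cunit. rewrite <- Cexp_plus. f_equal. rewrite mult_IZR, Z.pow_2_r, !mult_IZR, <- INR_IZR_INZ.
  destruct tau as [x y]. apply C_ext; simpl; field; repeat split; lra.
Qed.

(** [a / c - 1 / (c w)] is [gamma tau] in terms of [w = c tau + d]. The constant [a / c] accounts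
    for the phase in the transform of [g]. *)
Lemma Theta_inversion (w : C) (bd : R) : (forall n, (Cmod (f n) <= bd)%R) -> (0 < Im w)%R ->
  (0 < Im (RtoC (IZR a / IZR c) - / (RtoC (IZR c) * w)))%R ->
  Theta nu (dft N g) (Z.of_nat N) (- / w) =
  transformation_factor * Theta nu f M (RtoC (IZR a / IZR c) - / (RtoC (IZR c) * w)).
Proof.
  intros Hb Hw Hi. rewrite <- (Theta_scal nu transformation_factor f M _ bd HM Hi Hb).
  assert (W0 : w <> 0) by (intros E; rewrite E in Hw; simpl in Hw; lra).
  assert (c0 : RtoC (IZR c) <> 0) by (intros E; apply RtoC_inj in E; lra).
  assert (m0 : RtoC (IZR M) <> 0) by (intros E; apply RtoC_inj in E; lra).
  apply CSeries_ext. intros j. cbv zeta. rewrite transformation_ZN, transformation_dft.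
  set (n := S j). rewrite <- !Cmult_assoc. do 3 f_equal.
  unfold Cunit. rewrite <- Cexp_plus. f_equal. rewrite !mult_IZR, Z.pow_2_r, !mult_IZR, <- INR_IZR_INZ.
  unfold Rdiv. rewrite !RtoC_mult, !RtoC_inv, !RtoC_mult, RtoC_pow by nra. field. auto.
Qed.

(** The image of a vertical line is an arc of a circle that meets the real axis at a right angle:
    horizontal over vertical displacement is [c e / |y|], below one for small [e]. *)
Lemma transformation_path (y : R) : y <> 0%R ->
  filterlim (fun e : R => RtoC (IZR a / IZR c) - / (RtoC (IZR c) * (RtoC y + Ci * RtoC (IZR c * e)))) (at_right 0)
    (nontangential (RtoC (IZR a / IZR c - / (IZR c * y)))).
Proof.
  intros Hy.
  assert (c0 : RtoC (IZR c) <> 0) by (intros E; apply RtoC_inj in E; lra).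
  assert (y0 : RtoC y <> 0) by (intros E; apply RtoC_inj in E; lra).
  apply nontangential_path; [typeclasses eauto| |].
  - rewrite RtoC_minus, RtoC_inv, RtoC_mult by (apply Rmult_integral_contrapositive; lra).
    apply (Ctends_minus (at_right 0)); [apply (Ctends_const (at_right 0))|].
    apply (Ctends_inv (at_right 0)); [now apply Cmult_neq_0|].
    apply (Ctends_mult (at_right 0)); [apply (Ctends_const (at_right 0))|apply at_right_Ctends].
  - assert (He : (0 < Rabs y / IZR c)%R) by (apply Rdiv_lt_0_compat; [now apply Rabs_pos_lt|exact Pc]).
    assert (Esm : at_right 0 (fun e => (e < Rabs y / IZR c)%R)).
    { exists (mkposreal _ He). intros e Hb' H0. unfold ball in Hb'; simpl in Hb'.
      unfold AbsRing_ball, abs, minus, plus, opp in Hb'; simpl in Hb'. rewrite Ropp_0, Rplus_0_r in Hb'.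
      rewrite Rabs_pos_eq in Hb' by lra. exact Hb'. }
    generalize (filter_and _ _ Esm at_right_pos). apply filter_imp. intros e [H1 H2].
    set (cc := IZR c) in *.
    assert (y2 : (0 < y ^ 2)%R) by (apply pow2_gt_0; exact Hy).
    assert (D : (0 < y ^ 2 + cc ^ 2 * e ^ 2)%R).
    { assert (0 <= cc ^ 2 * e ^ 2)%R by (apply Rmult_le_pos; apply pow2_ge_0). lra. }
    assert (E : RtoC (IZR a / cc) - / (RtoC cc * (RtoC y + Ci * RtoC (cc * e))) =
       ((IZR a / cc - y / (cc * (y ^ 2 + cc ^ 2 * e ^ 2)))%R, (e / (y ^ 2 + cc ^ 2 * e ^ 2))%R)).
    { assert (D' : RtoC (y ^ 2 + cc ^ 2 * e ^ 2) <> 0) by (intros X; apply RtoC_inj in X; lra).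
      assert (W0 : RtoC y + Ci * RtoC (cc * e) <> 0).
      { intros X. apply (f_equal Re) in X. simpl in X. apply Hy. lra. }
      assert (EI : / (RtoC cc * (RtoC y + Ci * RtoC (cc * e))) = (RtoC y - Ci * RtoC (cc * e)) / (RtoC cc * RtoC (y ^ 2 + cc ^ 2 * e ^ 2))).
      { assert (EP : RtoC (y ^ 2 + cc ^ 2 * e ^ 2) = (RtoC y - Ci * RtoC (cc * e)) * (RtoC y + Ci * RtoC (cc * e)))
          by (apply C_ext; simpl; ring).
        rewrite EP in D' |- *.
        assert (W1 : RtoC y - Ci * RtoC (cc * e) <> 0) by (intros X; apply D'; rewrite X; ring).
        field. auto. }
      rewrite EI. unfold Cdiv. rewrite <- RtoC_mult, <- RtoC_inv by (apply Rgt_not_eq; nra).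
      apply C_ext; simpl; field; split; nra. }
    rewrite E. cbn [Re Im fst snd].
    replace (IZR a / cc - y / (cc * (y ^ 2 + cc ^ 2 * e ^ 2)) - (IZR a / cc - / (cc * y)))%R
      with (e / (y ^ 2 + cc ^ 2 * e ^ 2) * (cc * e / y))%R by (field; repeat split; lra).
    rewrite Rabs_mult, (Rabs_pos_eq (e / _)) by (apply Rdiv_le_0_compat; lra).
    rewrite <- (Rmult_1_r (e / (y ^ 2 + cc ^ 2 * e ^ 2))) at 2. apply Rmult_lt_compat_l; [apply Rdiv_lt_0_compat; lra|].
    assert (Ya : (0 < Rabs y)%R) by (now apply Rabs_pos_lt).
    rewrite Rabs_div by exact Hy. rewrite Rabs_pos_eq by nra.
    apply Rmult_lt_reg_r with (Rabs y); [exact Ya|]. unfold Rdiv. rewrite Rmult_assoc, Rinv_l, Rmult_1_l, Rmult_1_r by lra.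
    apply Rmult_lt_compat_l with (r := cc) in H1; [|exact Pc].
    replace (cc * (Rabs y / cc))%R with (Rabs y) in H1 by (field; lra). exact H1.
Qed.

(** Only the image [q'] is assumed to lie in the domain. That a limit exists over [q] is part of the
    conclusion, and stability in the even case rests on this. *)
Lemma transformation_limit (q q' : Qc) : let y := (IZR c * Qc2R q + IZR d)%R in
  y <> 0%R -> Qc2R q' = (IZR a / IZR c - / (IZR c * y))%R -> Qbar f M q' ->
  Ctends (at_right 0) (fun e => Theta nu f M (RtoC (Qc2R q) + Ci * RtoC (1 * e)))
    (obstruction N nu g y + theta_multiplier nu * real_cpow y (- (INR nu + / 2)) *
      (transformation_factor * Theta_nt nu f M (Some q'))).
Proof.
  intros y Hy Hq' HQ. destruct (periodic_Z_bounded M f HM Hf) as [bd Hbd].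
  set (h := fun e : R => RtoC y + Ci * RtoC (IZR c * e)).
  apply (Ctends_ext (at_right 0) (fun e => Theta nu g (Z.of_nat N) (h e))).
  { intros e. rewrite <- Theta_shift. f_equal. unfold h, y. rewrite RtoC_plus, !RtoC_mult. ring. }
  assert (HI : at_right 0 (fun e => (0 < Im (h e))%R)).
  { generalize at_right_pos. apply filter_imp. intros e He. unfold h; simpl. nra. }
  apply (theta_limit (at_right 0) N nu transformation_N Hnu g h y).
  - exact transformation_periodic.
  - exact transformation_parity.
  - exact transformation_g0.
  - exact transformation_dft0.
  - exact Hy.
  - apply at_right_Ctends.
  - exact HI.
  - assert (Path := transformation_path y Hy). rewrite <- Hq' in Path. fold (h) in Path.
    assert (L := Theta_nontangential nu f M q' bd HM Hnu Hbd HQ).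
    assert (L' := Ctends_comp _ (at_right 0) _ _ _ Path L).
    apply (Ctends_near (at_right 0) (fun e => transformation_factor *
      Theta nu f M (RtoC (IZR a / IZR c) - / (RtoC (IZR c) * (RtoC y + Ci * RtoC (IZR c * e)))))).
    + generalize at_right_pos. apply filter_imp. intros e He. symmetry.
      apply (Theta_inversion (h e) bd Hbd); [unfold h; simpl; nra|].
      unfold h.
      assert (D : (0 < y ^ 2 + (IZR c * e) ^ 2)%R).
      { assert (0 < y ^ 2)%R by (now apply pow2_gt_0). generalize (pow2_ge_0 (IZR c * e)). lra. }
      replace (Im _) with (e / (y ^ 2 + (IZR c * e) ^ 2))%R; [now apply Rdiv_lt_0_compat|].
      simpl. field. simpl in D. split; [|lra].
      match goal with |- ?x <> 0%R => replace x with (IZR c * (IZR c * (y * (y * 1) + IZR c * e * (IZR c * e * 1))))%R by ring end.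
      apply Rgt_not_eq, Rmult_lt_0_compat; [exact Pc|apply Rmult_lt_0_compat; [exact Pc|exact D]].
    + apply (Ctends_mult (at_right 0)); [apply (Ctends_const (at_right 0))|exact L'].
Qed.

(** At [a / c] the twist of [f] is itself a multiple of the Fourier transform of [g], whose sum over
    a period is [sqrt N g 0 = 0]. *)
Lemma Qbar_cusp (q : Qc) : Qc2R q = (IZR a / IZR c)%R -> Qbar f M q.
Proof.
  intros Hq. assert (HN := transformation_N).
  assert (T0 : transformation_factor <> 0) by (apply Cmod_gt_0; rewrite Cmod_transformation_factor; lra).
  assert (E : forall m, twist f (Qc2R q / IZR M) m = / transformation_factor * dft N g m).
  { intros m. rewrite transformation_dft. unfold twist, Cunit.
    replace (Ci * RtoC (2 * PI * (IZR (a * m ^ 2) / (2 * IZR (c * M))))) with (Ci * RtoC (PI * IZR m ^ 2 * (Qc2R q / IZR M))).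
    - field. exact T0.
    - do 2 f_equal. rewrite Hq, !mult_IZR, Z.pow_2_r, mult_IZR. field. lra. }
  apply (Qbar_intro f M q N HN).
  - intros m. rewrite !E. f_equal. now apply dft_periodic.
  - rewrite (csum_ext _ (fun k => / transformation_factor * dft N g (Z.of_nat (S k)))) by (intros; apply E).
    rewrite csum_mult_l.
    rewrite (csum_ext _ (fun k => dft N g (Z.of_nat k + 1))) by (intros; f_equal; lia).
    rewrite (csum_shift1 N (dft N g)) by (now apply dft_periodic).
    rewrite csum_dft, transformation_g0; [ring|exact HN|exact transformation_periodic].
Qed.

End Transformation.

(** * The congruence subgroups *)

(* All that is used of the three groups: this invariance of [f] makes the Fourier
   transform of [gauss_twist] a unimodular multiple of a twist of [f] itself. *)
Definition compatible (M : Z) (f : Z -> C) (g : SL2Z) : Prop :=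
  (2 * M | gc g)%Z /\
  exists chi0 : C, Cmod chi0 = 1%R /\
    forall m, f (- (ga g * m))%Z * Cunit (- (IZR (ga g * gb g * m ^ 2) / (2 * IZR M))) = chi0 * f m.

Lemma Cunit_twoM (M x y : Z) : (0 < M)%Z -> (2 * M | x - y)%Z ->
  Cunit (- (IZR x / (2 * IZR M))) = Cunit (- (IZR y / (2 * IZR M))).
Proof.
  intros HM H. rewrite !Cunit_opp. f_equal. rewrite <- (mult_IZR 2). now apply Cunit_IZR_div_mod; [lia|].
Qed.

(** With [a = s = 1] or [-1] modulo [2 M], parity disposes of the argument of [f], and on the
    support of [f] the quadratic phase is constant, equal to its value at [n0]. *)
Lemma compatible_of_sign (M : Z) (f : Z -> C) (g : SL2Z) (s n0 : Z) (nu : nat) :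
  (0 < M)%Z -> periodic M f -> parity nu f ->
  (s = 1 \/ s = -1)%Z -> (2 * M | gc g)%Z -> (2 * M | ga g - s)%Z ->
  (forall m, f m <> 0 -> (2 * M | gb g * (m ^ 2 - n0 ^ 2))%Z) -> compatible M f g.
Proof.
  intros HM Hf Hp Hs Hc Ha Hn. split; [exact Hc|].
  assert (Hsgn : exists sg : C, Cmod sg = 1%R /\ forall m, f (- (s * m))%Z = sg * f m).
  { destruct Hs as [-> | ->].
    - exists (- (- (1)) ^ nu). split; [rewrite Cmod_opp, Cmod_pow, Cmod_opp, Cmod_1, pow1; reflexivity|].
      intros m. rewrite <- Hp. f_equal. ring.
    - exists 1. split; [apply Cmod_1|]. intros m. rewrite Cmult_1_l. f_equal. ring. }
  destruct Hsgn as [sg [Hsg1 Hsg]].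
  exists (sg * Cunit (- (IZR (ga g * gb g * n0 ^ 2) / (2 * IZR M)))). split.
  { rewrite Cmod_mult, Hsg1, Cmod_Cunit. ring. }
  intros m. rewrite (periodic_congr M f (- (ga g * m)) (- (s * m)) Hf).
  2:{ destruct Ha as [u Hu]. exists (- (2 * u * m))%Z. replace (ga g) with (s + u * (2 * M))%Z by lia. ring. }
  rewrite Hsg. destruct (Ceq_dec (f m) 0) as [E|E]; [rewrite E; ring|].
  rewrite (Cunit_twoM M (ga g * gb g * m ^ 2) (ga g * gb g * n0 ^ 2) HM); [ring|].
  replace (ga g * gb g * m ^ 2 - ga g * gb g * n0 ^ 2)%Z with (ga g * (gb g * (m ^ 2 - n0 ^ 2)))%Z by ring.
  apply Z.divide_mul_r. now apply Hn.
Qed.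

Lemma Cmod_le_1_of_bounded_pow (z : C) (b : R) : (forall n, (Cmod (z ^ n) <= b)%R) -> (Cmod z <= 1)%R.
Proof.
  intros H. destruct (Rle_dec (Cmod z) 1) as [K|K]; [exact K|]. exfalso.
  destruct (Pow_x_infinity (Cmod z)) with (b := (b + 1)%R) as [n Hn].
  { rewrite Rabs_pos_eq by apply Cmod_ge_0. lra. }
  specialize (Hn n (Nat.le_refl n)). specialize (H n). rewrite Cmod_pow in H.
  rewrite Rabs_pos_eq in Hn by (apply pow_le, Cmod_ge_0). lra.
Qed.

(** Powers of values are again values of the bounded function [f], so no value has modulus above
    one; since [f a] and [f d] have product one, both have modulus one. *)
Lemma dirichlet_Cmod (M : Z) (f : Z -> C) (a d : Z) : (0 < M)%Z -> dirichlet_character M f ->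
  (M | a * d - 1)%Z -> Cmod (f a) = 1%R.
Proof.
  intros HM (Hf & H1 & Hm & _) Had. destruct (periodic_Z_bounded M f HM Hf) as [b Hb].
  assert (Hle : forall x, (Cmod (f x) <= 1)%R).
  { intros x. apply (Cmod_le_1_of_bounded_pow _ b). intros n.
    assert (E : f x ^ n = f (x ^ Z.of_nat n)%Z).
    { induction n as [|n IH]; [now rewrite Z.pow_0_r, H1|].
      rewrite Nat2Z.inj_succ, Z.pow_succ_r, Hm by lia. rewrite <- IH. reflexivity. }
    rewrite E. apply Hb. }
  assert (E : Cmod (f a * f d) = 1%R).
  { rewrite <- Hm, (periodic_congr M f (a * d) 1 Hf Had), H1. apply Cmod_1. }
  rewrite Cmod_mult in E. assert (L1 := Hle a). assert (L2 := Hle d).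
  assert (P1 := Cmod_ge_0 (f a)). assert (P2 := Cmod_ge_0 (f d)). nra.
Qed.

Lemma allowed_compatible (M : Z) (f : Z -> C) (nu : nat) (G : SL2Z -> Prop) (g : SL2Z) :
  (0 < M)%Z -> periodic M f -> parity nu f -> allowed_group M f G ->
  G g \/ G (SL2Z_opp g) -> compatible M f g.
Proof.
  intros HM Hf Hp HG Hg. assert (Hdet := gdet g). destruct HG as [|[n0 Hn0]|HD].
  - assert (E : exists s, (s = 1 \/ s = -1)%Z /\ (2 * M | ga g - s)%Z /\ (2 * M | gb g)%Z /\ (2 * M | gc g)%Z).
    { destruct Hg as [(A & _ & B & C)|(A & _ & B & C)]; unfold congr in *; simpl in *.
      - exists 1%Z. rewrite Z.sub_0_r in B, C. auto.
      - exists (-1)%Z. rewrite Z.sub_0_r in B, C. apply Z.divide_opp_r in B, C. rewrite Z.opp_involutive in B, C.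
        split; [auto|]. split; [|auto]. apply Z.divide_opp_r in A. replace (ga g - -1)%Z with (- (- ga g - 1))%Z by ring. exact A. }
    destruct E as [s (Hs & A & B & C)]. apply (compatible_of_sign M f g s 0 nu); auto.
    intros m _. now apply Z.divide_mul_l.
  - assert (E : exists s, (s = 1 \/ s = -1)%Z /\ (2 * M | ga g - s)%Z /\ (2 * M | gc g)%Z).
    { destruct Hg as [(A & _ & C)|(A & _ & C)]; unfold congr in *; simpl in *.
      - exists 1%Z. rewrite Z.sub_0_r in C. auto.
      - exists (-1)%Z. rewrite Z.sub_0_r in C. apply Z.divide_opp_r in C. rewrite Z.opp_involutive in C.
        split; [auto|]. split; [|auto]. apply Z.divide_opp_r in A. replace (ga g - -1)%Z with (- (- ga g - 1))%Z by ring. exact A. }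
    destruct E as [s (Hs & A & C)]. apply (compatible_of_sign M f g s n0 nu); auto.
    intros m Hm. apply Z.divide_mul_r. now apply Hn0.
  - assert (E : (2 * M | gb g)%Z /\ (2 * M | gc g)%Z).
    { destruct Hg as [(B & C)|(B & C)]; unfold congr in *; simpl in *; rewrite Z.sub_0_r in B, C; auto.
      apply Z.divide_opp_r in B, C. rewrite Z.opp_involutive in B, C. auto. }
    (* Here [2 M] divides [b], so the phase is trivial and multiplicativity alone produces the
       factor. *)
    destruct E as [B C]. split; [exact C|]. exists (f (- ga g)%Z). split.
    + apply (dirichlet_Cmod M f _ (- gd g)); auto.
      destruct B as [u Hu]. exists (2 * u * gc g)%Z.
      transitivity (ga g * gd g - 1)%Z; [ring|]. rewrite <- Hdet, Hu. ring.
    + intros m. rewrite (Cunit_twoM M _ 0 HM).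
      * rewrite Rdiv_0_l, Ropp_0, Cunit_0, Cmult_1_r. destruct HD as (_ & _ & Hm & _). rewrite <- Hm. f_equal. ring.
      * rewrite Z.sub_0_r. apply Z.divide_mul_l, Z.divide_mul_r. exact B.
Qed.

(** * Rational points and the action of SL(2,Z) *)

Lemma Qc2R_Q2Qc (x : Q) : Qc2R (Q2Qc x) = Q2R x.
Proof. apply Qeq_eqR, Qred_correct. Qed.

Lemma Qc2R_Z2Qc (n : Z) : Qc2R (Z2Qc n) = IZR n.
Proof. unfold Z2Qc. rewrite Qc2R_Q2Qc. unfold Q2R. simpl. field. Qed.

Lemma Qc2R_plus (x y : Qc) : Qc2R (x + y)%Qc = (Qc2R x + Qc2R y)%R.
Proof. unfold Qcplus. rewrite Qc2R_Q2Qc. apply Q2R_plus. Qed.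

Lemma Qc2R_mult (x y : Qc) : Qc2R (x * y)%Qc = (Qc2R x * Qc2R y)%R.
Proof. unfold Qcmult. rewrite Qc2R_Q2Qc. apply Q2R_mult. Qed.

Lemma Qc2R_inj (x y : Qc) : Qc2R x = Qc2R y -> x = y.
Proof. intros H. apply Qc_is_canon, eqR_Qeq, H. Qed.

Lemma Qc2R_div (x y : Qc) : Qc2R y <> 0%R -> Qc2R (x / y)%Qc = (Qc2R x / Qc2R y)%R.
Proof.
  intros H. unfold Qcdiv. rewrite Qc2R_mult. unfold Rdiv. f_equal.
  unfold Qcinv. rewrite Qc2R_Q2Qc. apply Q2R_inv. intros E. apply H.
  apply Qeq_eqR in E. unfold Qc2R. rewrite E. unfold Q2R; simpl. ring.
Qed.

Lemma Qc2R_fraction (q : Qc) : exists p r : Z, (0 < r)%Z /\ Qc2R q = (IZR p / IZR r)%R.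
Proof. exists (Qnum (this q)), (Zpos (Qden (this q))). split; [lia|reflexivity]. Qed.

Lemma act_Some (g : SL2Z) (q : Qc) : automorphy g (Qc2R q) <> 0%R ->
  exists q', act g (Some q) = Some q' /\
    Qc2R q' = ((IZR (ga g) * Qc2R q + IZR (gb g)) / automorphy g (Qc2R q))%R.
Proof.
  intros H. unfold act. cbv zeta.
  assert (E : Qc2R (Z2Qc (gc g) * q + Z2Qc (gd g))%Qc = automorphy g (Qc2R q)).
  { unfold automorphy. now rewrite Qc2R_plus, Qc2R_mult, !Qc2R_Z2Qc. }
  destruct (Qc_eq_dec _ _) as [K|K].
  - rewrite K, Qc2R_Z2Qc in E. now elim H.
  - eexists. split; [reflexivity|].
    rewrite Qc2R_div, E, Qc2R_plus, Qc2R_mult, !Qc2R_Z2Qc by now rewrite E. reflexivity.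
Qed.

Lemma translation_act (g : SL2Z) (q : Qc) : gc g = 0%Z -> gd g = 1%Z ->
  exists q', act g (Some q) = Some q' /\ Qc2R q' = (Qc2R q + IZR (gb g))%R.
Proof.
  intros Hc Hd. assert (Ha : ga g = 1%Z) by (generalize (gdet g); rewrite Hc, Hd; lia).
  assert (A : automorphy g (Qc2R q) = 1%R) by (unfold automorphy; rewrite Hc, Hd; ring).
  destruct (act_Some g q) as [q' [H1 H2]]; [lra|]. exists q'. split; [exact H1|]. rewrite H2, A, Ha. field.
Qed.

Lemma act_Some_pole (g : SL2Z) (q : Qc) : automorphy g (Qc2R q) = 0%R -> act g (Some q) = None.
Proof.
  intros H. unfold act. cbv zeta. destruct (Qc_eq_dec _ _) as [K|K]; [reflexivity|].
  elim K. apply Qc2R_inj. rewrite Qc2R_plus, Qc2R_mult, !Qc2R_Z2Qc. exact H.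
Qed.

Lemma act_None (g : SL2Z) : gc g <> 0%Z ->
  exists q', act g None = Some q' /\ Qc2R q' = (IZR (ga g) / IZR (gc g))%R.
Proof.
  intros H. unfold act. destruct (Z.eq_dec _ _) as [K|K]; [now elim H|].
  eexists. split; [reflexivity|]. rewrite Qc2R_div, !Qc2R_Z2Qc; [reflexivity|].
  rewrite Qc2R_Z2Qc. now apply not_0_IZR.
Qed.

Lemma act_None_fixed (g : SL2Z) : gc g = 0%Z -> act g None = None.
Proof. intros H. unfold act. destruct (Z.eq_dec _ _) as [K|K]; [reflexivity|now elim K]. Qed.

Lemma gdet_R (g : SL2Z) : (IZR (ga g) * IZR (gd g) - IZR (gb g) * IZR (gc g) = 1)%R.
Proof. rewrite <- !mult_IZR, <- minus_IZR, gdet. reflexivity. Qed.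

Lemma SL2Z_inv_det (g : SL2Z) : (gd g * ga g - - gb g * - gc g = 1)%Z.
Proof. rewrite <- (gdet g). ring. Qed.

Definition SL2Z_inv (g : SL2Z) : SL2Z := mkSL2Z (gd g) (- gb g) (- gc g) (ga g) (SL2Z_inv_det g).

(** Checked by cases, according to whether the pole or the point at infinity occurs. It lets
    stability be deduced from the closure of the domain under preimages. *)
Lemma act_inv (g : SL2Z) (x : P1Q) : act (SL2Z_inv g) (act g x) = x.
Proof.
  assert (D := gdet_R g). destruct x as [q|].
  - destruct (Req_dec (automorphy g (Qc2R q)) 0) as [E|E].
    + rewrite (act_Some_pole g q E). unfold automorphy in E.
      assert (C0 : IZR (gc g) <> 0%R) by (intros X; rewrite X in D, E; nra).
      destruct (act_None (SL2Z_inv g)) as [q' [-> Hq']]; [simpl; intros X; apply C0; now replace (gc g) with 0%Z by lia|].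
      f_equal. apply Qc2R_inj. rewrite Hq'. simpl. rewrite opp_IZR.
      apply Rmult_eq_reg_l with (IZR (gc g)); [|exact C0].
      transitivity (- IZR (gd g))%R; [field; exact C0|lra].
    + destruct (act_Some g q E) as [q' [-> Hq']].
      assert (A : automorphy (SL2Z_inv g) (Qc2R q') = (/ automorphy g (Qc2R q))%R).
      { rewrite Hq'. unfold automorphy in *. simpl. rewrite opp_IZR.
        apply Rmult_eq_reg_r with (IZR (gc g) * Qc2R q + IZR (gd g))%R; [|exact E].
        rewrite Rinv_l by exact E. rewrite <- D. field. exact E. }
      destruct (act_Some (SL2Z_inv g) q') as [q2 [-> Hq2]]; [rewrite A; now apply Rinv_neq_0_compat|].
      f_equal. apply Qc2R_inj. rewrite Hq2, A, Hq'. simpl. rewrite opp_IZR. unfold automorphy in *.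
      transitivity ((IZR (ga g) * IZR (gd g) - IZR (gb g) * IZR (gc g)) * Qc2R q)%R; [field; exact E|rewrite D; ring].
  - destruct (Z.eq_dec (gc g) 0) as [E|E].
    + rewrite (act_None_fixed g E). apply act_None_fixed. simpl. lia.
    + destruct (act_None g E) as [q' [-> Hq']]. apply act_Some_pole. unfold automorphy. simpl.
      rewrite Hq', opp_IZR. field. now apply not_0_IZR.
Qed.

(** Allows a matrix to be replaced by its opposite whenever the sign of [c] has to be normalised. *)
Lemma act_opp (g : SL2Z) (x : P1Q) : act (SL2Z_opp g) x = act g x.
Proof.
  destruct x as [q|].
  - assert (A : automorphy (SL2Z_opp g) (Qc2R q) = (- automorphy g (Qc2R q))%R).
    { unfold automorphy. simpl. rewrite !opp_IZR. ring. }
    destruct (Req_dec (automorphy g (Qc2R q)) 0) as [E|E].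
    + rewrite (act_Some_pole g q E). apply act_Some_pole. rewrite A, E. ring.
    + destruct (act_Some g q E) as [q' [-> Hq']].
      destruct (act_Some (SL2Z_opp g) q) as [q2 [-> Hq2]]; [rewrite A; lra|].
      f_equal. apply Qc2R_inj. rewrite Hq', Hq2, A. simpl. rewrite !opp_IZR. field. lra.
  - destruct (Z.eq_dec (gc g) 0) as [E|E].
    + rewrite (act_None_fixed g E). apply act_None_fixed. simpl. lia.
    + destruct (act_None g E) as [q' [-> Hq']]. destruct (act_None (SL2Z_opp g)) as [q2 [-> Hq2]]; [simpl; lia|].
      f_equal. apply Qc2R_inj. rewrite Hq', Hq2. simpl. rewrite !opp_IZR. field. now apply not_0_IZR.
Qed.

Definition SL2Z_one : SL2Z := mkSL2Z 1 0 0 1 eq_refl.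

Lemma act_one (x : P1Q) : act SL2Z_one x = x.
Proof.
  destruct x as [q|]; [|reflexivity].
  assert (A : automorphy SL2Z_one (Qc2R q) = 1%R) by (unfold automorphy; simpl; ring).
  destruct (act_Some SL2Z_one q) as [q' [-> Hq']]; [rewrite A; lra|].
  f_equal. apply Qc2R_inj. rewrite Hq', A. simpl. field.
Qed.

Section Allowed.
Context (M : Z) (f : Z -> C) (G : SL2Z -> Prop) (HG : allowed_group M f G).

Lemma allowed_one : G SL2Z_one.
Proof.
  destruct HG; repeat split; simpl; unfold congr; try (exists 0%Z; ring).
Qed.

Lemma congr_opp (n x : Z) : congr n x 0 -> congr n (- x) 0.
Proof. intros [k H]. exists (- k)%Z. lia. Qed.

Lemma allowed_inv (g : SL2Z) : G g -> G (SL2Z_inv g).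
Proof.
  destruct HG; unfold Gamma_principal, Gamma_1, Gamma_0_0; simpl; intuition; now apply congr_opp.
Qed.

Lemma allowed_opp_opp (g : SL2Z) : G g -> G (SL2Z_opp (SL2Z_opp g)).
Proof.
  destruct HG; unfold Gamma_principal, Gamma_1, Gamma_0_0; simpl; rewrite !Z.opp_involutive; trivial.
Qed.

Lemma allowed_inv_opp (g : SL2Z) : G (SL2Z_opp g) -> G (SL2Z_opp (SL2Z_inv g)).
Proof.
  destruct HG; unfold Gamma_principal, Gamma_1, Gamma_0_0; simpl; intuition;
    lazymatch goal with H : congr _ (- ?x) 0 |- congr _ (- - ?x) 0 => now apply congr_opp end.
Qed.

(** For [c > 0], the opposite of the inverse again has lower left entry [c], and it sends infinity
    to the pole [- d / c]. *)
Lemma allowed_opp_inv_opp (g : SL2Z) : G g \/ G (SL2Z_opp g) ->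
  G (SL2Z_opp (SL2Z_inv g)) \/ G (SL2Z_opp (SL2Z_opp (SL2Z_inv g))).
Proof.
  intros [H|H]; [right; now apply allowed_opp_opp, allowed_inv|left; now apply allowed_inv_opp].
Qed.

End Allowed.

(** * Stability and quantum modularity *)

Lemma twist_periodic (M : Z) (f : Z -> C) (q : Qc) : (0 < M)%Z -> periodic M f ->
  exists N : nat, (0 < N)%nat /\ periodic (Z.of_nat N) (twist f (Qc2R q / IZR M)).
Proof.
  intros HM Hf. destruct (Qc2R_fraction q) as (p & r & Hr & E).
  (* For [q = p / r] the half-phase [n^2 p / (2 r M)] changes under this shift by the integer
     [2 n p + 2 M r p]. *)
  exists (Z.to_nat (2 * M * r)). split; [lia|]. rewrite Z2Nat.id by lia.
  assert (PM : (0 < IZR M)%R) by (now apply IZR_lt). assert (Pr : (0 < IZR r)%R) by (now apply IZR_lt).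
  intros n. unfold twist.
  assert (T : forall m : Z, Cexp (Ci * RtoC (PI * IZR m ^ 2 * (Qc2R q / IZR M))) = Cunit (IZR m ^ 2 * (Qc2R q / IZR M) / 2)).
  { intros m. unfold Cunit. do 3 f_equal. field. lra. }
  rewrite !T. f_equal.
  - replace (2 * M * r)%Z with (M * (2 * r))%Z by ring. now apply periodic_mult.
  - apply (Cunit_mod1 _ _ (2 * n * p + 2 * M * r * p)%Z). rewrite E, !plus_IZR, !mult_IZR. field. lra.
Qed.

(** The quadratic phase is even, so the twist is odd and its sum over a period equals its own
    negative. *)
Lemma Qbar_of_odd (M : Z) (f : Z -> C) (q : Qc) : (0 < M)%Z -> periodic M f -> is_odd f -> Qbar f M q.
Proof.
  intros HM Hf Ho. destruct (twist_periodic M f q HM Hf) as [N [HN Hp]].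
  apply (Qbar_intro f M q N HN Hp). set (t := twist f (Qc2R q / IZR M)) in *.
  assert (Ht : forall n, t (- n)%Z = - t n).
  { intros n. unfold t, twist. rewrite Ho, opp_IZR. replace ((- IZR n) ^ 2)%R with (IZR n ^ 2)%R by ring. ring. }
  rewrite (csum_ext _ (fun k => t (Z.of_nat k + 1)%Z)) by (intros; f_equal; lia).
  rewrite (csum_shift1 N t Hp).
  assert (E := csum_negate N t Hp).
  rewrite (csum_ext _ (fun k => - (1) * t (Z.of_nat k))) in E by (intros; rewrite Ht; ring).
  rewrite csum_mult_l in E. set (S := csum _ N) in *.
  replace S with (RtoC (/ 2) * (S - - (1) * S)); [rewrite E; ring|].
  replace (S - - (1) * S) with (RtoC 2 * S) by (apply C_ext; simpl; ring).
  rewrite Cmult_assoc, <- RtoC_mult, Rinv_l by lra. ring.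
Qed.

Section Modularity.
Context (M : Z) (f : Z -> C) (nu : nat) (G : SL2Z -> Prop).
Context (HM : (0 < M)%Z) (Hf : periodic M f) (f0 : f 0%Z = 0) (Hnu : (nu <= 1)%nat) (Hpar : parity nu f).
Context (HG : allowed_group M f G).

Let PM : (0 < IZR M)%R := IZR_lt 0 M HM.

(** [F] is the obstruction pulled back by [x -> c x + d], hence singular at most at [- d / c]; [chi]
    is [theta_multiplier] times the Gauss sum factor. Neither depends on [q]. *)
Lemma boundary_transformation (g : SL2Z) : G g \/ G (SL2Z_opp g) -> (0 < gc g)%Z ->
  exists chi F, Cmod chi = 1%R /\
    real_analytic_on (fun x => x <> (- IZR (gd g) / IZR (gc g))%R) F /\
    forall q q', automorphy g (Qc2R q) <> 0%R -> act g (Some q) = Some q' -> Qbar f M q' ->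
      Ctends (at_right 0) (fun e => Theta nu f M (RtoC (Qc2R q) + Ci * RtoC (1 * e)))
        (F (Qc2R q) + chi * real_cpow (automorphy g (Qc2R q)) (- (INR nu + / 2)) * Theta_nt nu f M (Some q')).
Proof.
  intros Hg Hc. destruct (allowed_compatible M f nu G g HM Hf Hpar HG Hg) as [[k Hk] [chi0 [Hchi0 Hchi]]].
  assert (Hk' : gc g = (2 * M * k)%Z) by lia.
  assert (k0 : (0 < k)%Z) by nia. assert (D := gdet_R g). assert (Pc : (0 < IZR (gc g))%R) by (now apply IZR_lt).
  set (N := Z.to_nat (gc g * M)). set (h := gauss_twist M (gc g) (gd g) f).
  set (T := transformation_factor M (gc g) (gd g) chi0).
  assert (HT : Cmod T = 1%R) by (eapply Cmod_transformation_factor; eauto using gdet).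
  exists (theta_multiplier nu * T), (fun x => obstruction N nu h (IZR (gc g) * x + IZR (gd g))%R).
  split; [rewrite Cmod_mult, HT, Cmod_theta_multiplier; ring|]. split.
  - intros x0 Hx0.
    assert (A : analytic_at (fun x => obstruction N nu h (IZR (gc g) * x + IZR (gd g))%R) x0).
    { apply (analytic_at_affine (obstruction N nu h)). apply obstruction_analytic.
      - unfold N. nia.
      - exact (gauss_twist_periodic M (ga g) (gb g) (gc g) (gd g) k HM k0 Hk' (gdet g) f Hf).
      - intros E. apply Hx0. apply Rmult_eq_reg_r with (IZR (gc g)); [|lra].
        transitivity (- IZR (gd g))%R; [lra|field; lra]. }
    destruct A as [a [r [Hr A]]]. exists a, r. split; [exact Hr|]. intros x Hx. apply Csums_is_pseries. now apply A.
  - intros q q' Hq Hact HQ. destruct (act_Some g q Hq) as [q2 [Hact2 Hq2]].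
    rewrite Hact in Hact2. injection Hact2 as <-.
    assert (Hq' : Qc2R q' = (IZR (ga g) / IZR (gc g) - / (IZR (gc g) * automorphy g (Qc2R q)))%R).
    { rewrite Hq2. unfold automorphy in *.
      apply Rmult_eq_reg_r with (IZR (gc g) * (IZR (gc g) * Qc2R q + IZR (gd g)))%R; [|apply Rmult_integral_contrapositive; lra].
      transitivity (IZR (ga g) * (IZR (gc g) * Qc2R q + IZR (gd g)) - (IZR (ga g) * IZR (gd g) - IZR (gb g) * IZR (gc g)))%R;
        [field; exact Hq|rewrite D; field; lra]. }
    assert (L := transformation_limit M f nu (ga g) (gb g) (gc g) (gd g) k HM Hf f0 Hnu Hpar k0 Hk' (gdet g) chi0 Hchi q q' Hq Hq' HQ).
    replace (theta_multiplier nu * T * real_cpow (automorphy g (Qc2R q)) (- (INR nu + / 2)) * Theta_nt nu f M (Some q'))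
      with (theta_multiplier nu * real_cpow (automorphy g (Qc2R q)) (- (INR nu + / 2)) * (T * Theta_nt nu f M (Some q'))) by ring.
    exact L.
Qed.

Lemma translation_factor (g : SL2Z) : G g \/ G (SL2Z_opp g) -> gc g = 0%Z -> gd g = 1%Z ->
  exists chi, Cmod chi = 1%R /\ forall m, f m * Cunit (IZR (gb g * m ^ 2) / (2 * IZR M)) = chi * f m.
Proof.
  intros Hg Hc Hd. destruct (allowed_compatible M f nu G g HM Hf Hpar HG Hg) as [_ [chi0 [Hchi0 Hchi]]].
  assert (Ha : ga g = 1%Z) by (generalize (gdet g); rewrite Hc, Hd; lia).
  set (sg := - (- (1)) ^ nu : C).
  assert (Hsg : Cmod sg = 1%R) by (unfold sg; rewrite Cmod_opp, Cmod_pow, Cmod_opp, Cmod_1, pow1; reflexivity).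
  assert (n0 : chi0 <> 0) by (apply Cmod_gt_0; lra).
  (* Compatibility at [a = 1] carries the inverse phase and the argument [- m]; solving for the
     phase inverts [chi0] and leaves the parity sign. *)
  exists (sg / chi0). split; [rewrite Cmod_div, Hsg, Hchi0 by exact n0; field|].
  intros m. specialize (Hchi m). rewrite Ha, Cunit_opp in Hchi.
  replace (1 * gb g * m ^ 2)%Z with (gb g * m ^ 2)%Z in Hchi by ring.
  replace (- (1 * m))%Z with (- m)%Z in Hchi by ring. rewrite Hpar in Hchi. fold sg in Hchi.
  assert (U := Cunit_neq_0 (IZR (gb g * m ^ 2) / (2 * IZR M))). set (V := Cunit _) in *.
  transitivity (/ chi0 * (chi0 * f m) * V); [field; exact n0|]. rewrite <- Hchi. field. auto.
Qed.

Lemma Qbar_translation (q q' : Qc) (b : Z) (chi : C) : Cmod chi = 1%R ->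
  (forall m, f m * Cunit (IZR (b * m ^ 2) / (2 * IZR M)) = chi * f m) ->
  Qc2R q' = (Qc2R q + IZR b)%R -> Qbar f M q' -> Qbar f M q.
Proof.
  intros Hchi H Hq HQ. assert (n0 : chi <> 0) by (apply Cmod_gt_0; lra).
  assert (E : forall m, twist f (Qc2R q / IZR M) m = / chi * twist f (Qc2R q' / IZR M) m).
  { intros m. unfold twist.
    replace (Ci * RtoC (PI * IZR m ^ 2 * (Qc2R q' / IZR M))) with
      (Ci * RtoC (2 * PI * (IZR (b * m ^ 2) / (2 * IZR M))) + Ci * RtoC (PI * IZR m ^ 2 * (Qc2R q / IZR M))).
    - rewrite Cexp_plus. fold (Cunit (IZR (b * m ^ 2) / (2 * IZR M))).
      set (E := Cexp _). transitivity (/ chi * (chi * f m) * E); [field; exact n0|rewrite <- H; ring].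
    - rewrite Hq, mult_IZR, Z.pow_2_r, mult_IZR. apply C_ext; simpl; field; lra. }
  destruct (Qbar_inv f M q' HQ) as [N [HN [Hp HS]]]. apply (Qbar_intro f M q N HN).
  - intros n. rewrite !E. f_equal. apply Hp.
  - rewrite (csum_ext _ (fun k => / chi * twist f (Qc2R q' / IZR M) (Z.of_nat (S k)))) by (intros; apply E).
    rewrite csum_mult_l, HS. ring.
Qed.

Lemma Theta_translation (q q' : Qc) (b : Z) (chi : C) :
  (forall m, f m * Cunit (IZR (b * m ^ 2) / (2 * IZR M)) = chi * f m) ->
  Qc2R q' = (Qc2R q + IZR b)%R -> Qbar f M q -> Qbar f M q' ->
  Theta_nt nu f M (Some q') = chi * Theta_nt nu f M (Some q).
Proof.
  intros H Hq HQ HQ'. destruct (periodic_Z_bounded M f HM Hf) as [bd Hbd].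
  assert (L := Theta_vertical nu f M q bd HM Hnu Hbd HQ).
  assert (L' := Theta_vertical nu f M q' bd HM Hnu Hbd HQ').
  apply (Ctends_unique (at_right 0) _ _ _ L').
  apply (Ctends_near (at_right 0) (fun e => chi * Theta nu f M (RtoC (Qc2R q) + Ci * RtoC (1 * e)))).
  2:{ apply (Ctends_mult (at_right 0)); [apply (Ctends_const (at_right 0))|exact L]. }
  generalize at_right_pos. apply filter_imp. intros e He.
  rewrite <- (Theta_scal nu chi f M _ bd HM) by (simpl; auto; lra).
  apply CSeries_ext. intros j. cbv zeta. rewrite <- H. set (n := S j).
  rewrite <- !Cmult_assoc. f_equal. f_equal. unfold Cunit. rewrite <- Cexp_plus. f_equal.
  rewrite Hq, mult_IZR, Z.pow_2_r, mult_IZR, <- INR_IZR_INZ. apply C_ext; simpl; field; repeat split; lra.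
Qed.

(** Once both points are in the domain, the boundary value at [q] and the right-hand side of
    [boundary_transformation] are limits along one vertical line, hence equal. *)
Lemma Theta_nt_quantum_modular : stable G (Theta_nt_domain f M) ->
  quantum_modular_form G (INR nu + / 2)%R (Theta_nt_domain f M) (Theta_nt nu f M).
Proof.
  intros Hst. destruct (periodic_Z_bounded M f HM Hf) as [bd Hbd].
  assert (Hst' : forall g x, G g \/ G (SL2Z_opp g) -> Theta_nt_domain f M x -> Theta_nt_domain f M (act g x)).
  { intros g x [H|H] Hx; [now apply Hst|]. rewrite <- act_opp. now apply Hst. }
  split; [|split; [exact Hst|]].
  { exists (2 * Z.of_nat nu + 1)%Z. rewrite plus_IZR, mult_IZR, <- INR_IZR_INZ. field. }
  intros g Hg [Hc|[Hc Hd]].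
  - destruct (boundary_transformation g Hg Hc) as (chi & F & Hchi & HF & HT).
    exists chi. split; [exact Hchi|]. split; [|intros; lia]. intros _. exists F. split; [exact HF|].
    intros q HQ Hq. unfold modular_defect. destruct (act_Some g q Hq) as [q' [Hact _]].
    assert (HQ' := Hst' g _ Hg HQ). rewrite Hact in *.
    rewrite (Ctends_unique (at_right 0) _ _ _ (Theta_vertical nu f M q bd HM Hnu Hbd HQ) (HT q q' Hq Hact HQ')). ring.
  - destruct (translation_factor g Hg Hc Hd) as [chi [Hchi H]]. assert (n0 : chi <> 0) by (apply Cmod_gt_0; lra).
    (* [chi] carries the value at [q] to the value at the image, while [modular_defect] puts its
       multiplier on the image. *)
    exists (/ chi). split; [rewrite Cmod_inv, Hchi by exact n0; apply Rinv_1|]. split; [intros; lia|]. intros _ q HQ Hq.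
    unfold modular_defect. destruct (translation_act g q Hc Hd) as [q' [Hact Hq']].
    assert (HQ' := Hst' g _ Hg HQ). rewrite Hact in *.
    rewrite (Theta_translation q q' _ chi H Hq' HQ HQ').
    replace (automorphy g (Qc2R q)) with 1%R by (unfold automorphy; rewrite Hc, Hd; ring).
    unfold real_cpow. destruct (Rlt_dec 1 0) as [K|K]; [lra|].
    rewrite Rabs_R1, Rmult_0_r. unfold Rpower. rewrite ln_1, Rmult_0_r, exp_0, Cmult_0_r, Cexp_0. field. exact n0.
Qed.

End Modularity.

Section Even.
Context (M : Z) (f : Z -> C) (G : SL2Z -> Prop).
Context (HM : (0 < M)%Z) (Hf : periodic M f) (f0 : f 0%Z = 0) (Heven : is_even f).
Context (HG : allowed_group M f G).

Let Hpar : parity 1 f.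
Proof. intros n. rewrite Heven. ring. Qed.

Lemma Qbar_of_pole (g : SL2Z) (q : Qc) : G g \/ G (SL2Z_opp g) -> (0 < gc g)%Z ->
  Qc2R q = (IZR (ga g) / IZR (gc g))%R -> Qbar f M q.
Proof.
  intros Hg Hc Hq. destruct (allowed_compatible M f 1 G g HM Hf Hpar HG Hg) as [[k Hk] [chi0 [Hchi0 Hchi]]].
  assert (Hk' : gc g = (2 * M * k)%Z) by lia. assert (k0 : (0 < k)%Z) by nia.
  eapply Qbar_cusp; eauto using gdet.
Qed.

(** Away from the pole, the limit over [q] supplied by the image forces the mean of the twist at [q]
    to vanish, as otherwise the theta series would be unbounded there. *)
Lemma domain_of_act (g : SL2Z) (x : P1Q) : G g \/ G (SL2Z_opp g) -> (0 < gc g)%Z \/ (gc g = 0%Z /\ gd g = 1%Z) ->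
  Theta_nt_domain f M (act g x) -> Theta_nt_domain f M x.
Proof.
  intros Hg Hn. destruct x as [q|]; [|easy]. intros H. destruct Hn as [Hc|[Hc Hd]].
  - assert (Pc : (0 < IZR (gc g))%R) by (now apply IZR_lt).
    destruct (Req_dec (automorphy g (Qc2R q)) 0) as [E|E].
    + apply (Qbar_of_pole (SL2Z_opp (SL2Z_inv g))); [now apply (allowed_opp_inv_opp M f G HG)|simpl; lia|].
      simpl. rewrite Z.opp_involutive, opp_IZR. unfold automorphy in E.
      apply Rmult_eq_reg_r with (IZR (gc g)); [|lra]. transitivity (- IZR (gd g))%R; [lra|field; lra].
    + destruct (boundary_transformation M f 1 G HM Hf f0 (le_n 1) Hpar HG g Hg Hc) as (chi & F & _ & _ & HT).
      destruct (act_Some g q E) as [q' [Hact _]]. rewrite Hact in H. specialize (HT q q' E Hact H).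
      destruct (periodic_Z_bounded M f HM Hf) as [bd Hbd]. destruct (twist_periodic M f q HM Hf) as [N [HN Hp]].
      exact (mean_zero_of_vertical_limit f M q bd N _ HM Hbd HN Hp HT).
  - destruct (translation_factor M f 1 G HM Hf (le_n 1) Hpar HG g Hg Hc Hd) as [chi [Hchi HE]].
    destruct (translation_act g q Hc Hd) as [q' [Hact Hq']]. rewrite Hact in H.
    exact (Qbar_translation M f HM q q' (gb g) chi Hchi HE Hq' H).
Qed.

(** The inverse [h] sends [g x] back to [x], so [domain_of_act] for [h] at the point [g x] gives the
    claim; only the sign of [h] has to be normalised, with diagonal entries [1] or [-1] when
    [c = 0]. *)
Lemma domain_stable : stable G (Theta_nt_domain f M).
Proof.
  intros g x Hg Hx. set (h := SL2Z_inv g).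
  assert (Hh : G h) by (now apply (allowed_inv M f G HG)).
  assert (Hx' : Theta_nt_domain f M (act h (act g x))) by (unfold h; now rewrite act_inv).
  assert (Hh' : G (SL2Z_opp (SL2Z_opp h))) by (now apply (allowed_opp_opp M f G HG)).
  destruct (Z_lt_le_dec 0 (gc h)) as [Hc|Hc]; [apply (domain_of_act h); auto|].
  assert (Hc' : (gc h < 0 \/ gc h = 0)%Z) by lia. destruct Hc' as [Hc'|Hc'].
  - apply (domain_of_act (SL2Z_opp h)); [auto|left; change (0 < - gc h)%Z; lia|now rewrite act_opp].
  - assert (Hd : (gd h = 1 \/ gd h = -1)%Z).
    { generalize (gdet h). rewrite Hc'. intros E. destruct (Z.mul_eq_1 (gd h) (ga h)); auto; lia. }
    destruct Hd as [Hd|Hd].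
    + apply (domain_of_act h); auto.
    + apply (domain_of_act (SL2Z_opp h)); [auto|right; change (- gc h = 0 /\ - gd h = 1)%Z; lia|now rewrite act_opp].
Qed.

End Even.

Lemma union_of_cusps_of_stable (G : SL2Z -> Prop) (D : P1Q -> Prop) : G SL2Z_one -> stable G D -> union_of_cusps G D.
Proof.
  intros H1 HD. exists (fun o => is_cusp G o /\ forall x, o x -> D x). split; [now intros o [H _]|].
  intros x. split; [|now intros [o [[_ H] Hx]]; apply H].
  intros Hx. exists (orbit G x). split; [|exists SL2Z_one; split; [exact H1|apply act_one]].
  split; [now exists x|]. intros y [g [Hg <-]]. now apply HD.
Qed.

Lemma Qbar_zero (f : Z -> C) (M : Z) : is_mean f 0 -> Qbar f M (Z2Qc 0).
Proof.
  assert (E : forall n, twist f (Qc2R (Z2Qc 0) / IZR M) n = f n).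
  { intros n. unfold twist. rewrite Qc2R_Z2Qc, Rdiv_0_l, Rmult_0_r, Cmult_0_r, Cexp_0. ring. }
  intros [N [HN [Hp H0]]]. exists N. split; [exact HN|]. split; [intros n; rewrite !E; apply Hp|].
  rewrite H0 at 1. f_equal. apply sum_n_m_ext. intros n. now rewrite E.
Qed.

Theorem theorem7 (M : Z) (f : Z -> C) (nu : nat) (Gamma : SL2Z -> Prop)
    (hM : (0 < M)%Z) (hMeven : Z.Even M)
    (hper : periodic M f) (hf0 : f 0%Z = RtoC 0)
    (hpar : (nu = 0%nat /\ is_odd f) \/ (nu = 1%nat /\ is_even f))
    (hGamma : allowed_group M f Gamma) :
  (is_even f ->
     stable Gamma (Theta_nt_domain f M) /\
     union_of_cusps Gamma (Theta_nt_domain f M) /\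
     (forall x : P1Q, orbit Gamma None x -> Theta_nt_domain f M x) /\
     (is_mean f (RtoC 0) ->
      forall x : P1Q, orbit Gamma (Some (Z2Qc 0)) x ->
                      Theta_nt_domain f M x)) /\
  (is_odd f -> forall alpha : Qc, Qbar f M alpha) /\
  (nu = 0%nat /\ is_odd f ->
     quantum_modular_form Gamma (1 / 2)%R
       (Theta_nt_domain f M) (Theta_nt nu f M)) /\
  (nu = 1%nat /\ is_even f ->
     quantum_modular_form Gamma (3 / 2)%R
       (Theta_nt_domain f M) (Theta_nt nu f M)).
Proof.
  (* For odd [f] the domain contains every rational number as well as infinity, so stability is
     immediate. *)
  assert (Hst : stable Gamma (Theta_nt_domain f M)).
  { destruct hpar as [[_ Hodd]|[_ Heven]].
    - intros g [q|] _ _; [destruct (act g _); [now apply Qbar_of_odd|exact I]|].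
      destruct (act g None); [now apply Qbar_of_odd|exact I].
    - exact (domain_stable M f Gamma hM hper hf0 Heven hGamma). }
  split; [|split; [|split]].
  - intros Heven.
    assert (Hst' := domain_stable M f Gamma hM hper hf0 Heven hGamma).
    split; [exact Hst'|]. split; [|split].
    + exact (union_of_cusps_of_stable Gamma _ (allowed_one M f Gamma hGamma) Hst').
    + intros x [g [Hg <-]]. now apply Hst'.
    + intros Hmean x [g [Hg <-]]. apply Hst'; [exact Hg|]. now apply Qbar_zero.
  - intros Hodd alpha. now apply Qbar_of_odd.
  - intros [-> Hodd]. replace (1 / 2)%R with (INR 0 + / 2)%R by (simpl; field).
    apply Theta_nt_quantum_modular; auto. intros n. rewrite Hodd. ring.
  - intros [-> Heven]. replace (3 / 2)%R with (INR 1 + / 2)%R by (simpl; field).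
    apply Theta_nt_quantum_modular; auto. intros n. rewrite Heven. ring.
Qed.
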